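(* Let $X=B(0,r)\subset\mathbb C^n$ be an open ball centered at the origin, let $H=\{x_1\cdots x_s=0\}$ be a union of coordinate hyperplanes, let $X_0=X-H$, and let $\rho:\pi_1(X_0,x_0)=\mathbb Z^s\to\mathrm{Aut}(\mathbb D)$ be a non-trivial representation. Let $f$ be a $\rho$-equivariant multivalued holomorphic map on $X_0$ taking values in $\mathbb D$. If $f$ is non-constant, then $\rho$ is not of hyperbolic type. Moreover, the following hold. (1) If $\rho$ is of parabolic type (with $h$ as in the definition of this type), then there exist a holomorphic function $g$ on $X=B(0,r)$ and $s$ non-negative real numbers $\lambda_1,\dots,\lambda_s$ such that, in Poincaré's upper half-plane model, $$h\circ f=\frac{1}{2i\pi}\sum_{i=1}^s\lambda_i\log x_i+g .$$ (2) If $\rho$ is of elliptic type (with $h$ as in the definition of this type), then there exist a holomorphic function $u:X\to\mathbb C$ and $s$ real numbers $\nu_1,\dots,\nu_s\in[0,1)$ such that $$h\circ f=u\prod_{i=1}^s x_i^{\nu_i}.$$ In particular, the foliation $\mathcal F$ on $X_0$ defined by the level sets of (non-constant) $f$ extends to a foliation on $X$, and the transverse hyperbolic structure without poles on $X_0$ defined by $f$ extends to a transverse hyperbolic structure (perhaps with poles) for this foliation on $X$.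
   Context: $\mathbb D$ is the unit disc, $\mathbb H$ the upper half-plane, both seen in $\mathbb P^1$. A $\rho$-equivariant multivalued holomorphic map $f$ on $X_0$ with values in $\mathbb D$ means a holomorphic map $\mathcal D:\widetilde{X_0}\to\mathbb D$ on the universal cover with $\mathcal D\circ\gamma=\rho(\gamma)\circ\mathcal D$ for $\gamma\in\pi_1(X_0)$, composed with a local (multivalued) inverse of the covering map. Types of a non-trivial $\rho$ (non-trivial $\rho$ has exactly one type): Elliptic: there is $h\in\mathrm{Aut}(\mathbb D)$ such that for every $\gamma$, $h\circ\rho(\gamma)\circ h^{-1}(z)=a_\gamma z$ with $a_\gamma\in\mathbb S^1$. Parabolic: there is $h\in\mathrm{Aut}(\mathbb P^1)$ with $h(\mathbb D)=\mathbb H$ such that for every $\gamma$, $h\circ\rho(\gamma)\circ h^{-1}(z)=z+a_\gamma$ with $a_\gamma\in\mathbb R$. Hyperbolic: there is $h\in\mathrm{Aut}(\mathbb P^1)$ with $h(\mathbb D)=\mathbb H$ such that for every $\gamma$, $h\circ\rho(\gamma)\circ h^{-1}(z)=a_\gamma z$ with $a_\gamma\in(0,\infty)$ (not all equal to $1$). A transverse projective structure for a codimension one foliation $\mathcal F$ on a complex manifold is a triple $(E,\nabla,\sigma)$: a rank $2$ vector bundle $E$, a flat meromorphic connection $\nabla$ on $E$, and a meromorphic section $\sigma$ of $\mathbb P(E)$ with $\mathcal F=\sigma^*\mathcal R$, where $\mathcal R$ is the Riccati foliation on $\mathbb P(E)$ whose general leaves are projectivized flat sections of $\nabla$. Outside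 the polar hypersurface of $\nabla$, trivializing $\mathbb P(E)$ locally by flat sections turns $\sigma$ into local first integrals, whose analytic continuation gives a developing map on the universal cover, equivariant with respect to a monodromy representation. The structure is hyperbolic if some developing map takes values in $\mathbb D$ and its monodromy takes values in $\mathrm{Aut}(\mathbb D)$. It is without poles if $\mathcal R$ is everywhere transverse to the fibration $\mathbb P(E)\to X$; a transverse hyperbolic structure without poles on $X_0$ amounts to a non-constant holomorphic map $\mathcal D:\widetilde{X_0}\to\mathbb D$ on the universal cover of $X_0$ with $\mathcal D\circ\gamma=\rho(\gamma)\circ\mathcal D$ for all $\gamma\in\pi_1(X_0)$, where $\rho:\pi_1(X_0)\to\mathrm{Aut}(\mathbb D)$ is the monodromy representation. *)

(* Defs.v *)
From HB Require Import structures.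
From mathcomp Require Import all_boot all_order all_algebra.
From mathcomp Require Import complex.
From mathcomp Require Import all_classical all_reals all_analysis.
Set Implicit Arguments.
Unset Strict Implicit.
Unset Printing Implicit Defensive.
Import Order.TTheory GRing.Theory Num.Theory.
Import numFieldNormedType.Exports.
Local Open Scope classical_set_scope.
Local Open Scope ring_scope.

(* Packing R[i] as a numClosedFieldType is what gives access to the topology
   and to the normed modules over it. *)
Definition Cplx (R : realType) : numClosedFieldType := R[i].

Section SeveralVariables.
Variable R : realType.
Local Notation C := (Cplx R).

(* [differentiable] is C-differentiability; only used for open [U]. *)
Definition holomorphic (V W : normedModType C) (U : set V) (f : V -> W) :=
  forall x, U x -> differentiable f x.

Definition cexp (z : C) : C :=
  real_complex R (expR (complex.Re z)) *
  (cos (complex.Im z) +i* sin (complex.Im z))%C.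

Definition two_i_pi : C := 'i * real_complex R (pi *+ 2).

Definition disc : set C := [set z | `|z| < 1].

Definition upper_half_plane : set C := [set z | 0 < complex.Im z].

Definition eball n (r : R) : set 'rV[C]_n :=
  [set x | \sum_j `|x 0 j| ^+ 2 < real_complex R (r ^+ 2)].

Variable n : nat.
Local Notation Cn := 'rV[C]_n.

Definition partial (W : normedModType C) (k : 'I_n) (f : Cn -> W) (x : Cn) : W :=
  'D_(delta_mx 0 k) f x.

(* A 1-form sum_k w_k dx_k is the row vector of its coefficients. *)
Definition differential (f : Cn -> C) (x : Cn) : Cn := \row_k partial k f x.

Definition wedge_eq0 (a b : Cn) := forall k l, a 0 k * b 0 l = a 0 l * b 0 k.

(* w /\ dw = 0 *)
Definition integrable_form (U : set Cn) (w : Cn -> Cn) :=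
  let dw a b x := partial a (fun y => w y 0 b) x - partial b (fun y => w y 0 a) x in
  forall x, U x -> forall a b c,
    w x 0 a * dw b c x + w x 0 b * dw c a x + w x 0 c * dw a b x = 0.

Definition somewhere_in_every_open (U : set Cn) (P : Cn -> Prop) :=
  forall W, open W -> W !=set0 -> W `<=` U -> exists2 x, W x & P x.

(* A meromorphic function is represented by a total function, whose values on
   the zero set of a denominator are irrelevant. *)
Definition meromorphic (U : set Cn) (f : Cn -> C) :=
  forall p, U p -> exists V (P Q : Cn -> C),
    [/\ open V, V p, holomorphic V P, holomorphic V Q &
        somewhere_in_every_open V (fun x => Q x != 0)
        /\ forall x, V x -> Q x != 0 -> f x = P x / Q x].

End SeveralVariables.

Arguments disc R : clear implicits.
Arguments upper_half_plane R : clear implicits.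
Arguments eball {R} n r.

Section Coverings.
Variables (R : realType) (Z S : topologicalType).
Local Notation I := (`[0, 1]%classic : set R).

(* The total space of a covering is an open subset [Y] of an ambient space
   [Z]; the values of the maps outside [Y] are irrelevant. *)
Definition path_in (Y : set Z) (g : R -> Z) :=
  {within I, continuous g} /\ (forall t, I t -> Y (g t)).

Definition simply_connected (Y : set Z) :=
  [/\ Y !=set0,
      forall x y, Y x -> Y y -> exists g, [/\ path_in Y g, g 0 = x & g 1 = y] &
      forall g, path_in Y g -> g 0 = g 1 -> exists H : R * R -> Z,
        [/\ {within I `*` I, continuous H},
            forall u t, I u -> I t -> Y (H (u, t)),
            forall t, I t -> H (0, t) = g t,
            forall t, I t -> H (1, t) = g 0 &
            forall u, I u -> H (u, 0) = g 0 /\ H (u, 1) = g 0]].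

Definition covering_map (Y : set Z) (p : Z -> S) (B : set S) :=
  [/\ open Y, forall y, Y y -> {for y, continuous p} & forall y, Y y -> B (p y)]
  /\ forall b, B b -> exists V (J : Type) (W : J -> set Z) (sec : J -> S -> Z),
    [/\ [/\ open V, V b & V `<=` B],
        (forall j, open (W j)),
        Y `&` p @^-1` V = \bigcup_j W j,
        (forall j j' y, W j y -> W j' y -> j = j') &
        forall j, [/\ forall x, V x -> {for x, continuous (sec j)},
                      forall x, V x -> W j (sec j x) /\ p (sec j x) = x &
                      forall y, W j y -> sec j (p y) = y]].

Definition universal_cover (Y : set Z) (p : Z -> S) (B : set S) :=
  covering_map Y p B /\ simply_connected Y.

Definition deck_transformation (Y : set Z) (p : Z -> S) (c : Z -> Z) :=
  [/\ forall y, Y y -> {for y, continuous c},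
      set_bij Y Y c &
      forall y, Y y -> p (c y) = p y].

(* [phi] is a branch on [V] of the multivalued map [d o p^-1]. *)
Definition branch (T : Type) (Y : set Z) (p : Z -> S) (d : Z -> T)
    (V : set S) (phi : S -> T) :=
  exists sec : S -> Z, forall x, V x ->
    [/\ {for x, continuous sec}, Y (sec x), p (sec x) = x & phi x = d (sec x)].

End Coverings.

Section Representations.
Variable R : realType.
Local Notation C := (Cplx R).
Local Notation D := (disc R).
Local Notation HH := (upper_half_plane R).

(* Functions are only considered on the disc. *)
Definition aut_disc (a : C -> C) :=
  holomorphic D a /\ exists b : C -> C,
    [/\ holomorphic D b,
        forall z, D z -> D (a z) /\ D (b z) &
        forall z, D z -> b (a z) = z /\ a (b z) = z].

(* Aut(P^1) = PGL_2(C); a point sent to infinity gets the value 0, which does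
   not belong to the upper half-plane. *)
Definition mobius (M : 'M[C]_2) (z : C) : C :=
  (M 0 0 * z + M 0 1) / (M 1 0 * z + M 1 1).

Definition aut_P1_disc_to_half_plane (h : C -> C) :=
  exists2 M : 'M[C]_2, M \in unitmx & h = mobius M /\ h @` D = HH.

Variable s : nat.
Implicit Types rho : 'rV[int]_s -> C -> C.

Definition representation rho :=
  [/\ forall c, aut_disc (rho c),
      forall z, D z -> rho 0 z = z &
      forall c c' z, D z -> rho (c + c') z = rho c (rho c' z)].

Definition nontrivial rho := exists c, exists2 z, D z & rho c z <> z.

(* In the three types, the equation on [h o rho(c) o h^-1] at the point [h z]. *)
Definition elliptic_via rho (h : C -> C) :=
  aut_disc h /\ forall c, exists2 a : C, `|a| = 1 &
    forall z, D z -> h (rho c z) = a * h z.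

Definition parabolic_via rho (h : C -> C) :=
  aut_P1_disc_to_half_plane h /\ forall c, exists a : R,
    forall z, D z -> h (rho c z) = h z + real_complex R a.

Definition hyperbolic_via rho (h : C -> C) :=
  aut_P1_disc_to_half_plane h /\ exists a : 'rV[int]_s -> R,
    [/\ forall c, 0 < a c, exists c, a c <> 1 &
        forall c z, D z -> h (rho c z) = real_complex R (a c) * h z].

Definition hyperbolic_type rho := exists h, hyperbolic_via rho h.

End Representations.

Section Complement.
Variables (R : realType) (s m : nat) (r : R).
Local Notation C := (Cplx R).
Local Notation Cn := 'rV[C]_(s + m).

Definition hyperplanes : set Cn := [set x | \prod_(i < s) x 0 (lshift m i) = 0].

Definition ball_compl : set Cn := eball (s + m) r `\` hyperplanes.

(* The universal cover of [ball_compl] is the convex open set [ucover] of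
   logarithmic coordinates: the i-th coordinate of a point is log x_i for
   i < s, and x_i otherwise. *)
Definition uproj (w : Cn) : Cn := row_mx (map_mx (@cexp R) (lsubmx w)) (rsubmx w).

Definition ucover : set Cn := uproj @^-1` eball (s + m) r.

(* pi_1 = Z^s acts by log x_i |-> log x_i + 2 i pi c_i. *)
Definition udeck (c : 'rV[int]_s) (w : Cn) : Cn :=
  w + row_mx (\row_i (two_i_pi R *~ c 0 i)) 0.

Definition equivariant_multivalued_map (rho : 'rV[int]_s -> C -> C) (f : Cn -> C) :=
  [/\ holomorphic ucover f,
      forall w, ucover w -> disc R (f w) &
      forall c w, ucover w -> f (udeck c w) = rho c (f w)].

Definition nonconstant (f : Cn -> C) :=
  exists w w', [/\ ucover w, ucover w' & f w <> f w'].

End Complement.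

Arguments hyperplanes {R} s m.
Arguments ball_compl {R} s m r.
Arguments ucover {R} s m r.
Arguments uproj {R} s m w.

Section Foliations.
Variables (R : realType) (n : nat).
Local Notation C := (Cplx R).
Local Notation Cn := 'rV[C]_n.

(* A (singular) foliation on the open set [X] is given by its conormal sheaf
   [N], the subsheaf of Omega^1 of the forms vanishing on the leaves: it is
   saturated, coherent of rank one and integrable, i.e. locally of the form
   {w | w /\ eta = 0} for an integrable [eta] that is not identically zero. *)
Definition foliation (X : set Cn) (N : set Cn -> (Cn -> Cn) -> Prop) :=
  (forall U w, open U -> U `<=` X ->
     (N U w <-> forall p, U p -> exists V, [/\ open V, V p, V `<=` U & N V w]))
  /\ forall p, X p -> exists V (eta : Cn -> Cn),
    [/\ open V, V p, V `<=` X, holomorphic V eta /\ integrable_form V eta &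
        somewhere_in_every_open V (fun x => eta x <> 0)
        /\ forall U w, open U -> U `<=` V ->
             (N U w <-> holomorphic U w /\ forall x, U x -> wedge_eq0 (w x) (eta x))].

(* On the open set [B], [N] is the foliation by the level sets of the
   multivalued function [d o p^-1]. *)
Definition level_set_foliation (Z : topologicalType) (Y : set Z) (p : Z -> Cn)
    (d : Z -> C) (B : set Cn) (N : set Cn -> (Cn -> Cn) -> Prop) :=
  forall U w, open U -> U `<=` B ->
    (N U w <-> holomorphic U w /\
       forall V phi, open V -> branch Y p d V phi ->
         forall x, U x -> V x -> wedge_eq0 (w x) (differential phi x)).

End Foliations.

Section Projective.
Variables (R : realType) (n : nat).
Local Notation C := (Cplx R).
Local Notation Cn := 'rV[C]_n.
Variable X : set Cn.

(* A section is a family of C^2-valued maps y_i with y_i = g_ij y_j. *)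
Record bundle2 := Bundle2 {
  chart : Type;
  dom : chart -> set Cn;
  trans : chart -> chart -> Cn -> 'M[C]_2;
  dom_open : forall i, open (dom i);
  dom_cover : \bigcup_i dom i = X;
  trans_holo : forall i j, holomorphic (dom i `&` dom j) (trans i j);
  trans_unit : forall i j x, dom i x -> dom j x -> trans i j x \in unitmx;
  trans_refl : forall i x, dom i x -> trans i i x = 1%:M;
  trans_cocycle : forall i j k x, dom i x -> dom j x -> dom k x ->
    trans i j x *m trans j k x = trans i k x }.

Definition regular_matrix (U : set Cn) (A : 'I_n -> Cn -> 'M[C]_2) (x : Cn) :=
  exists V, [/\ open V, V x, V `<=` U & forall k, holomorphic V (A k)].

(* nabla y = dy + A_i y in the chart i, with A_i = sum_k A_ik dx_k;
   [conn_compat] is nabla (g_ij y) = g_ij (nabla y), and [conn_flat] is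
   dA_i + A_i /\ A_i = 0. *)
Record flat_connection (E : bundle2) := FlatConnection {
  conn : chart E -> 'I_n -> Cn -> 'M[C]_2;
  conn_mero : forall i k a b, meromorphic (dom i) (fun x => conn i k x a b);
  conn_compat : forall i j k x,
    regular_matrix (dom i) (conn i) x -> regular_matrix (dom j) (conn j) x ->
    partial k (trans i j) x + conn i k x *m trans i j x = trans i j x *m conn j k x;
  conn_flat : forall i k l x, regular_matrix (dom i) (conn i) x ->
    partial k (conn i l) x - partial l (conn i k) x
    + conn i k x *m conn i l x - conn i l x *m conn i k x = 0 }.

Definition wedge2 (u v : 'cV[C]_2) : C := u 0 0 * v 1 0 - u 1 0 * v 0 0.

(* A meromorphic section of P(E) is given, on each (small enough) chart, by
   homogeneous coordinates [y_1 : y_2] that are holomorphic and not both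
   identically zero. *)
Record proj_section (E : bundle2) := ProjSection {
  psec : chart E -> Cn -> 'cV[C]_2;
  psec_holo : forall i, holomorphic (dom i) (psec i);
  psec_neq0 : forall i, somewhere_in_every_open (dom i) (fun x => psec i x <> 0);
  psec_compat : forall i j x, dom i x -> dom j x ->
    wedge2 (psec i x) (trans i j x *m psec j x) = 0 }.

Record proj_structure := ProjStructure {
  bundle :> bundle2;
  connection : flat_connection bundle;
  section : proj_section bundle }.

Variable T : proj_structure.

Definition regular_at (i : chart T) (x : Cn) :=
  regular_matrix (dom i) (conn (connection T) i) x.

Definition poles : set Cn := X `\` [set x | exists i, regular_at i x].

(* With z = y_1 / y_2, the Riccati foliation of P(E) is defined by the form
   dz + b + (a - d) z - c z^2 if A_i = [a, b; c, d]; up to the factor y_2^2 (and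
   the sign), its pull-back by the section y is y /\ nabla y. *)
Definition riccati_form (i : chart T) (x : Cn) : Cn :=
  let y := psec (section T) i in
  \row_k wedge2 (y x) (partial k y x + conn (connection T) i k x *m y x).

(* The foliation [N] is the pull-back of the Riccati foliation. *)
Definition transverse_structure_for (N : set Cn -> (Cn -> Cn) -> Prop) :=
  (forall i, somewhere_in_every_open (dom i)
     (fun x => regular_at i x /\ riccati_form i x <> 0))
  /\ forall U w, open U -> U `<=` X ->
    (N U w <-> holomorphic U w /\
       forall i x, U x -> regular_at i x -> wedge_eq0 (w x) (riccati_form i x)).

(* The Riccati foliation is transverse to the fibre over [x] when b, a - d and
   c are holomorphic at [x]: A_i is holomorphic there up to scalar matrices. *)
Definition without_poles_over (B : set Cn) :=
  forall x, B x -> exists (i : chart T) V (A : 'I_n -> Cn -> 'M[C]_2)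
      (theta : 'I_n -> Cn -> C),
    [/\ open V, V x, V `<=` dom i, forall k, holomorphic V (A k) &
        forall y k, V y -> regular_at i y ->
          conn (connection T) i k y = A k y + (theta k y)%:M].

(* [phi] is obtained by writing the section of P(E) as [phi : 1] in local
   projective frames given by flat sections (the columns of [F]). *)
Definition local_developing (V : set Cn) (phi : Cn -> C) :=
  holomorphic V phi /\
  forall i x, V x -> regular_at i x -> exists W (F : Cn -> 'M[C]_2),
    [/\ open W, W x, W `<=` V `&` dom i, holomorphic W F &
        forall y, W y ->
          [/\ F y \in unitmx,
              forall k, partial k F y + conn (connection T) i k y *m F y = 0 &
              wedge2 (psec (section T) i y)
                (F y *m (\col_(a < 2) (if a == 0 then phi y else 1))) = 0]].

(* The multivalued map [d o p^-1] is a developing map over [B]. *)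
Definition developing_map (Z : topologicalType) (Y : set Z) (p : Z -> Cn)
    (d : Z -> C) (B : set Cn) :=
  forall V phi, open V -> V `<=` B -> branch Y p d V phi -> local_developing V phi.

Definition hyperbolic_structure :=
  exists (Z : topologicalType) (Y : set Z) (p : Z -> Cn) (d : Z -> C),
    [/\ universal_cover R Y p (X `\` poles),
        developing_map Y p d (X `\` poles),
        forall y, Y y -> disc R (d y) &
        forall c, deck_transformation Y p c ->
          exists2 a, aut_disc a & forall y, Y y -> d (c y) = a (d y)].

End Projective.

(* Main.v *)
Require Import Defs.
From mathcomp Require Import all_boot all_order all_algebra.
From mathcomp Require Import complex.
From mathcomp Require Import all_classical all_reals all_analysis.
From mathcomp Require Import ring lra zify.
Set Implicit Arguments.
Unset Strict Implicit.
Unset Printing Implicit Defensive.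
Import Order.TTheory GRing.Theory Num.Theory.
Import numFieldNormedType.Exports.
Local Open Scope classical_set_scope.
Local Open Scope ring_scope.

(** In the coordinates [w_i = log x_i] the map [f] lives on a convex domain, on
    which the generators of [pi_1] act by [w_i |-> w_i + 2 i pi].  These
    translations have bounded length, while the domain contains discs of
    arbitrarily large radius in the directions [Re w_i -> -oo]; by the
    Schwarz-Pick lemma they cannot act on the image as a homothety of the
    half-plane, which excludes the hyperbolic type.  For the parabolic (elliptic)
    type, subtracting the linear part [sum_i lambda_i w_i / (2 i pi)] (dividing
    by [exp (sum_i nu_i w_i)]) gives a function that descends to [X - H].  By
    Schwarz-Pick along a segment joining a point near [H] to a base point (by
    boundedness), this function multiplied by [x_1 ... x_s] tends to 0 at [H], so
    that it extends to [X]; the numbers [lambda_i] are non-negative because the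
    imaginary part of [h o f] stays positive when [Re w_i -> -oo].

    An automorphism of the disc fixes a point of the closed disc, and elements
    commuting with it fix the same point; hence [rho] is always elliptic or
    parabolic via some Moebius map [M], and
    [M f = exp (alpha . w) g + beta . w] with [g] holomorphic on [X] and
    [alpha = 0] or [beta = 0].  The foliation is then defined by
    [x_1 ... x_s (dg + sum_i (alpha_i g + beta_i) dx_i / x_i)], and it is
    transversely projective for the logarithmic connection with matrix
    [[alpha, beta; 0, 0]] in [dx_i / x_i] and the section [[g : 1]].

    Cauchy's formula is deduced from Goursat's theorem on rectangles in the plane
    of the logarithm, and the theory of several variables from Osgood's lemma. *)

(** Three points that the overview only names. An automorphism with two fixed points on the circle
    is neither elliptic nor parabolic, and it is [f] that excludes it: with one fixed point sent to
    infinity the action is [A z + B], and if [A] were not 1, moving the other fixed point to 0 would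
    turn [f] into a map with a multiplier, against Schwarz-Pick.

    Near H the growth of [h o f] must be controlled uniformly, also where several coordinates vanish
    at once, although Schwarz-Pick sees one disc at a time. The complex line through a nearby point
    (parameter 1) and a fixed base point (parameter 0), in logarithmic coordinates, stays in the
    domain over the disc of centre 1 and radius 1 + 1/(1 + D), with D the distance of the real
    parts. The margin 1/(1 + D) beyond the base point gives a bound linear in D, hence logarithmic
    in the |x_i|, which every positive power of |x_i| absorbs.

    The relation [alpha k * beta l = 0] lets one formula serve both types: it makes the connection
    flat and its flat sections explicit. *)

Notation rc := (real_complex _).
Notation ReC := (@complex.Re _).
Notation ImC := (@complex.Im _).

(* The norm of a normed module over [C] is [C]-valued. *)
Definition nrm (R : realType) (V : normedZmodType (Cplx R)) (x : V) : R := ReC `|x|.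

(** * Real-valued norms, continuity and differentiability in epsilon-delta form *)

Section Norm.
Variable R : realType.
Local Notation C := (Cplx R).

Section NormedZmod.
Variable V : normedZmodType C.
Implicit Types x y : V.

Lemma nrmE x : `|x| = rc (nrm x).
Proof. by rewrite /nrm RRe_real // normr_real. Qed.

Lemma nrm_ge0 x : 0 <= nrm x.
Proof. by have := normr_ge0 x; rewrite nrmE lecR. Qed.

Lemma nrm0 : nrm (0 : V) = 0.
Proof. by rewrite /nrm normr0. Qed.

Lemma nrm_eq0 x : (nrm x == 0) = (x == 0).
Proof. by rewrite -(normr_eq0 x) nrmE; apply/eqP/eqP => [->//|[]]. Qed.

Lemma nrm_gt0 x : (0 < nrm x) = (x != 0).
Proof. by rewrite lt0r nrm_ge0 andbT nrm_eq0. Qed.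

Lemma ler_nrmD x y : nrm (x + y) <= nrm x + nrm y.
Proof. by have := ler_normD x y; rewrite !nrmE -rmorphD lecR. Qed.

Lemma nrmN x : nrm (- x) = nrm x.
Proof. by rewrite /nrm normrN. Qed.

Lemma nrmB x y : nrm (x - y) = nrm (y - x).
Proof. by rewrite -opprB nrmN. Qed.

Lemma ler_nrmB x y : nrm (x - y) <= nrm x + nrm y.
Proof. by rewrite -(nrmN y) ler_nrmD. Qed.

Lemma ler_nrmBD x y z : nrm (x - z) <= nrm (x - y) + nrm (y - z).
Proof. by rewrite -{1}(subrKA y x) ler_nrmD. Qed.

Lemma lerB_nrm x y : nrm x - nrm y <= nrm (x - y).
Proof. by rewrite lerBlDr; have := ler_nrmD (x - y) y; rewrite subrK. Qed.

Lemma ler_nrm_sum (I : Type) (r : seq I) (P : pred I) (F : I -> V) :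
  nrm (\sum_(i <- r | P i) F i) <= \sum_(i <- r | P i) nrm (F i).
Proof.
elim/big_ind2: _ => [|a b c d ab cd|//]; first by rewrite nrm0.
by rewrite (le_trans (ler_nrmD _ _)) ?lerD.
Qed.

End NormedZmod.

Lemma nrmM (x y : C) : nrm (x * y) = nrm x * nrm y.
Proof. by apply: complexI; rewrite rmorphM /= -!nrmE normrM. Qed.

Lemma nrmZ (V : normedModType C) (k : C) (x : V) : nrm (k *: x) = nrm k * nrm x.
Proof. by apply: complexI; rewrite rmorphM /= -!nrmE normrZ. Qed.

Lemma nrm1 : nrm (1 : C) = 1.
Proof. by rewrite /nrm normr1. Qed.

Lemma nrmX (x : C) n : nrm (x ^+ n) = nrm x ^+ n.
Proof. by apply: complexI; rewrite rmorphXn /= -!nrmE normrX. Qed.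

Lemma nrmV (x : C) : nrm x^-1 = (nrm x)^-1.
Proof. by apply: complexI; rewrite fmorphV /= -!nrmE normfV. Qed.

Lemma nrm_rc (x : R) : nrm (rc x : C) = `|x|.
Proof.
have [x0|x0] := leP 0 x.
  by rewrite /nrm ger0_norm ?ler0c // ger0_norm.
rewrite -(opprK x) rmorphN nrmN /nrm ger0_norm ?ler0c ?oppr_ge0 ?ltW //=.
by rewrite normrN gtr0_norm // oppr_gt0.
Qed.

Lemma nrm_i : nrm ('i : C) = 1.
Proof. by rewrite /nrm normCi. Qed.

Lemma nrm_prod (I : Type) (r : seq I) (P : pred I) (F : I -> C) :
  nrm (\prod_(i <- r | P i) F i) = \prod_(i <- r | P i) nrm (F i).
Proof. by elim/big_ind2: _ => [|? ? ? ? <- <-|//]; rewrite ?nrm1 ?nrmM. Qed.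

Lemma nrm_sqr (z : C) : nrm z ^+ 2 = ReC z ^+ 2 + ImC z ^+ 2.
Proof. by apply: complexI; rewrite rmorphXn /= -nrmE add_Re2_Im2. Qed.

Lemma Re_le_nrm (z : C) : `|ReC z| <= nrm z.
Proof. by rewrite -ler_sqr ?nnegrE ?nrm_ge0 // nrm_sqr real_normK ?num_real // lerDl sqr_ge0. Qed.

Lemma Im_le_nrm (z : C) : `|ImC z| <= nrm z.
Proof. by rewrite -ler_sqr ?nnegrE ?nrm_ge0 // nrm_sqr real_normK ?num_real // lerDr sqr_ge0. Qed.

Lemma nrm_le_ReIm (z : C) : nrm z <= `|ReC z| + `|ImC z|.
Proof.
rewrite -ler_sqr ?nnegrE ?nrm_ge0 ?addr_ge0 // nrm_sqr sqrrD !real_normK ?num_real //.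
by rewrite -addrA [X in _ <= _ + X]addrC addrA lerDl mulrn_wge0 // mulr_ge0.
Qed.

Lemma cReD (x y : C) : ReC (x + y) = ReC x + ReC y. Proof. by case: x y => [? ?] [? ?]. Qed.
Lemma cImD (x y : C) : ImC (x + y) = ImC x + ImC y. Proof. by case: x y => [? ?] [? ?]. Qed.
Lemma cReN (x : C) : ReC (- x) = - ReC x. Proof. by case: x. Qed.
Lemma cImN (x : C) : ImC (- x) = - ImC x. Proof. by case: x. Qed.
Lemma cReB (x y : C) : ReC (x - y) = ReC x - ReC y. Proof. by rewrite cReD cReN. Qed.
Lemma cImB (x y : C) : ImC (x - y) = ImC x - ImC y. Proof. by rewrite cImD cImN. Qed.
Lemma cReM (x y : C) : ReC (x * y) = ReC x * ReC y - ImC x * ImC y.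
Proof. by case: x y => [? ?] [? ?]. Qed.
Lemma cImM (x y : C) : ImC (x * y) = ReC x * ImC y + ImC x * ReC y.
Proof. by case: x y => [? ?] [? ?]. Qed.
Lemma Rei : ReC ('i : C) = 0. Proof. by rewrite -complexiE. Qed.
Lemma Imi : ImC ('i : C) = 1. Proof. by rewrite -complexiE. Qed.
Lemma ReRc (x : R) : ReC (rc x) = x. Proof. by []. Qed.
Lemma ImRc (x : R) : ImC (rc x) = 0. Proof. by []. Qed.
Definition ReImE := (cReB, cImB, cReD, cImD, cReN, cImN, cReM, cImM, Rei, Imi, ReRc, ImRc).

Lemma CE (z : C) : z = rc (ReC z) + 'i * rc (ImC z).
Proof. by rewrite -complexiE -complexE. Qed.

Lemma C_eq (x y : C) : ReC x = ReC y -> ImC x = ImC y -> x = y.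
Proof. by case: x y => [? ?] [? ?] /= -> ->. Qed.

Section Nbhs.
Variable V : normedModType C.

Lemma nbhs_nrmP (x : V) (U : set V) :
  nbhs x U <-> exists2 e : R, 0 < e & forall y, nrm (y - x) < e -> U y.
Proof.
rewrite -nbhs_ballE; split=> [[e /= e0 sub]|[e e0 sub]].
  have eE : e = rc (ReC e) by rewrite RRe_real // gtr0_real.
  exists (ReC e) => [|y yx]; first by move: e0; rewrite eE ltcR.
  by apply: sub; rewrite -ball_normE /= distrC nrmE eE ltcR.
exists (rc e) => /=; first by rewrite ltcR.
move=> y; rewrite -ball_normE /= distrC nrmE ltcR; exact: sub.
Qed.

Lemma open_nrmP (U : set V) :
  open U <-> forall x, U x -> exists2 e : R, 0 < e & forall y, nrm (y - x) < e -> U y.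
Proof.
rewrite openE; split=> H x /H; first by move/nbhs_nrmP.
by move=> Ux; apply/nbhs_nrmP.
Qed.

End Nbhs.

Lemma cvg_nrmP (T : Type) (V : normedModType C) (F : set_system T) {FF : Filter F}
  (f : T -> V) (l : V) :
  f @ F --> l <-> forall e : R, 0 < e -> \forall t \near F, nrm (f t - l) < e.
Proof.
split=> [fl e e0|H].
  have : nbhs l [set y | nrm (y - l) < e] by apply/nbhs_nrmP; exists e.
  exact: fl.
by move=> A /nbhs_nrmP[e /H h sub]; apply: filterS h => t /sub.
Qed.

Lemma continuous_nrmP (V W : normedModType C) (f : V -> W) (x : V) :
  {for x, continuous f} <->
  forall e : R, 0 < e -> exists2 d : R, 0 < d &
    forall y, nrm (y - x) < d -> nrm (f y - f x) < e.
Proof.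
split=> [/cvg_nrmP H e /H /nbhs_nrmP //|H].
by apply/cvg_nrmP => e /H h; apply/nbhs_nrmP.
Qed.

Lemma continuousR_nrmP (W : normedModType C) (f : R -> W) (x : R) :
  {for x, continuous f} <->
  forall e : R, 0 < e -> exists2 d : R, 0 < d &
    forall y, `|y - x| < d -> nrm (f y - f x) < e.
Proof.
split=> [/cvg_nrmP H e /H /nbhs_ballP[d /= d0 sub]|H].
  by exists d => // y yx; apply: sub; rewrite /ball /= distrC.
apply/cvg_nrmP => e /H [d d0 h]; apply/nbhs_ballP; exists d => // y.
by rewrite /ball /= distrC => /h.
Qed.

Lemma continuous_toR_nrmP (V : normedModType C) (f : V -> R) (x : V) :
  {for x, continuous f} <->
  forall e : R, 0 < e -> exists2 d : R, 0 < d &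
    forall y, nrm (y - x) < d -> `|f y - f x| < e.
Proof.
split=> [H e e0|H].
  have /H : nbhs (f x) [set z | `|z - f x| < e].
    by apply/nbhs_ballP; exists e => // z; rewrite /ball /= distrC.
  by move/nbhs_nrmP.
move=> A /nbhs_ballP[e /= /H [d d0 h] sub]; apply/nbhs_nrmP; exists d => // y /h.
by move=> ?; apply: sub; rewrite /ball /= distrC.
Qed.

Lemma continuous_Re : continuous (ReC : C -> R).
Proof.
move=> x; apply/continuous_toR_nrmP => e e0; exists e => // y.
by apply: le_lt_trans; rewrite -cReB Re_le_nrm.
Qed.

Lemma continuous_Im : continuous (ImC : C -> R).
Proof.
move=> x; apply/continuous_toR_nrmP => e e0; exists e => // y.
by apply: le_lt_trans; rewrite -cImB Im_le_nrm.
Qed.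

Lemma continuous_rc : continuous (real_complex R : R -> C).
Proof.
move=> x; apply/continuousR_nrmP => e e0; exists e => // y.
by rewrite -rmorphB /= nrm_rc.
Qed.

Lemma continuous_nrm (V : normedModType C) : continuous (@nrm R V).
Proof.
move=> x; apply/continuous_toR_nrmP => e e0; exists e => // y.
apply: le_lt_trans; rewrite ler_norml; apply/andP; split.
  by rewrite lerNl opprB nrmB lerB_nrm.
exact: lerB_nrm.
Qed.

(** With the converse that follows, this trades the little-o of [differentiable] for an estimate in
    the real norm [nrm], the form used whenever a derivative is produced by hand. *)
Lemma differentiable_expand (V W : normedModType C) (f : V -> W) (x : V) :
  differentiable f x ->
  forall e : R, 0 < e -> exists2 d : R, 0 < d & forall h, nrm h < d ->
    nrm (f (x + h) - f x - 'd f x h) <= e * nrm h.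
Proof.
move=> df e e0.
have /eqaddoP /(_ (rc e)) := diff_locally df.
rewrite ltcR => /(_ e0) /nbhs_nrmP [d d0 H]; exists d => // h hd.
have /= := H h; rewrite subr0 => /(_ hd).
rewrite !fctE /= !nrmE -rmorphM /= lecR.
by rewrite /shift /= [h + x]addrC opprD addrA.
Qed.

Lemma expand_differentiable (V W : normedModType C) (f : V -> W) (x : V)
  (L : {linear V -> W}) : continuous L ->
  (forall e : R, 0 < e -> exists2 d : R, 0 < d & forall h, nrm h < d ->
    nrm (f (x + h) - f x - L h) <= e * nrm h) ->
  differentiable f x /\ 'd f x = L :> (V -> W).
Proof.
move=> cL H.
have E : f \o shift x = cst (f x) + L +o_ (0 : V) id.
  apply/eqaddoP => e e0.
  have eE : e = rc (ReC e) by rewrite RRe_real // gtr0_real.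
  move: e0; rewrite eE ltcR => e0; have [d d0 h] := H _ e0.
  apply/nbhs_nrmP; exists d => // y; rewrite subr0 => /h.
  rewrite !fctE /= !nrmE -rmorphM /= lecR.
  by rewrite /shift /= [y + x]addrC opprD addrA.
have dE := diff_unique cL E.
split=> //; apply/diff_locallyP; rewrite dE; split => //.
Qed.

Section Continuity.
Variables (T : topologicalType) (V : normedModType C).
Implicit Types (f g : T -> V) (p q : T -> C).

Lemma cts_cst (k : V) x : {for x, continuous (fun _ : T => k)}.
Proof. exact: cvg_cst. Qed.

Lemma ctsD f g x : {for x, continuous f} -> {for x, continuous g} ->
  {for x, continuous (fun t => f t + g t)}.
Proof. exact: cvgD. Qed.

Lemma ctsB f g x : {for x, continuous f} -> {for x, continuous g} ->
  {for x, continuous (fun t => f t - g t)}.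
Proof. exact: cvgB. Qed.

Lemma ctsM p q x : {for x, continuous p} -> {for x, continuous q} ->
  {for x, continuous (fun t => p t * q t)}.
Proof. exact: cvgM. Qed.

Lemma ctsV p x : p x != 0 -> {for x, continuous p} -> {for x, continuous (fun t => (p t)^-1)}.
Proof. exact: cvgV. Qed.

Lemma cts_comp (S U : topologicalType) (h : S -> T) (f : T -> U) x :
  {for x, continuous h} -> {for h x, continuous f} -> {for x, continuous (fun t => f (h t))}.
Proof. exact: continuous_comp. Qed.

End Continuity.

Lemma cts_id (T : topologicalType) (x : T) : {for x, continuous (fun t : T => t)}.
Proof. exact: cvg_id. Qed.

Lemma differentiable_cts (V W : normedModType C) (f : V -> W) x :
  differentiable f x -> {for x, continuous f}.
Proof. exact: differentiable_continuous. Qed.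

Section OneVariable.
Variable V : normedModType C.
Implicit Types f : C -> V.

Lemma differentiable1_expand f z : differentiable f z ->
  forall e : R, 0 < e -> exists2 d : R, 0 < d & forall h, nrm h < d ->
    nrm (f (z + h) - f z - h *: 'D_1 f z) <= e * nrm h.
Proof.
move=> df e /(differentiable_expand df) [d d0 h]; exists d => // k /h.
have E : k *: (1 : C) = k := mulr1 k.
by rewrite deriveE //; have <- : 'd f z k = k *: 'd f z 1 by rewrite -{1}E linearZ.
Qed.

Lemma expand1_differentiable f z (D : V) :
  (forall e : R, 0 < e -> exists2 d : R, 0 < d & forall h, nrm h < d ->
    nrm (f (z + h) - f z - h *: D) <= e * nrm h) ->
  differentiable f z /\ 'D_1 f z = D.
Proof.
move=> H.
have cv : (fun h => h^-1 *: ((f \o shift z) (h *: 1) - f z)) @ 0^' --> D.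
  apply/cvg_nrmP => e e0; have [d d0 h] := H (e / 2) (divr_gt0 e0 (ltr0Sn _ 1)).
  rewrite near_withinE; apply/nbhs_nrmP; exists d => // k; rewrite subr0 => kd k0.
  have E : k *: (1 : C) = k := mulr1 k.
  rewrite /= /shift /= E [k + z]addrC.
  have kp : 0 < nrm k by rewrite nrm_gt0.
  have -> : D = k^-1 *: (k *: D) by rewrite scalerA mulVf // scale1r.
  rewrite -scalerBr nrmZ nrmV mulrC ltr_pdivrMr //.
  by apply: (le_lt_trans (h k kd)); rewrite ltr_pM2r //; lra.
have dv : derivable f z 1 by apply/cvg_ex; exists D.
by split; [exact/derivable1_diffP|exact: cvg_lim cv].
Qed.

End OneVariable.

End Norm.

(** * Cauchy theory in one variable *)

Section ComplexIntegral.
Variable R : realType.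
Local Notation C := (Cplx R).
Local Notation mu := (@lebesgue_measure R).

Definition cint (f : R -> C) (a b : R) : C :=
  rc (\int[mu]_(t in `[a, b]) ReC (f t))%R +
  'i * rc (\int[mu]_(t in `[a, b]) ImC (f t))%R.

Definition continuous_on (a b : R) (f : R -> C) :=
  forall t, a <= t <= b -> {for t, continuous f}.

Lemma within_itv_continuous (a b : R) (f : R -> R) :
  (forall t, a <= t <= b -> {for t, continuous f}) -> {within `[a, b], continuous f}.
Proof.
move=> cf; apply: continuous_in_subspaceT => x; rewrite inE /= in_itv /=.
exact: cf.
Qed.

Lemma continuous_onRe a b f : continuous_on a b f ->
  {within `[a, b], continuous (fun t => ReC (f t))}.
Proof.
move=> cf; apply: within_itv_continuous => t /cf ct.
by apply: (@continuous_comp _ _ _ f (@complex.Re R : C -> R)) => //; apply: continuous_Re.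
Qed.

Lemma continuous_onIm a b f : continuous_on a b f ->
  {within `[a, b], continuous (fun t => ImC (f t))}.
Proof.
move=> cf; apply: within_itv_continuous => t /cf ct.
by apply: (@continuous_comp _ _ _ f (@complex.Im R : C -> R)) => //; apply: continuous_Im.
Qed.

Lemma itv_integrable a b (f : R -> R) : {within `[a, b], continuous f} ->
  mu.-integrable `[a, b] (EFin \o f).
Proof. by move=> cf; apply: continuous_compact_integrable => //; apply: segment_compact. Qed.

Lemma eq_cint a b f g : (forall t, a <= t <= b -> f t = g t) -> cint f a b = cint g a b.
Proof.
move=> fg; rewrite /cint; congr (rc _ + 'i * rc _); apply: eq_Rintegral => t;
  by rewrite inE /= in_itv /= => /fg ->.
Qed.

Lemma cintD a b f g : continuous_on a b f -> continuous_on a b g ->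
  cint (fun t => f t + g t) a b = cint f a b + cint g a b.
Proof.
move=> cf cg; rewrite /cint.
have := (itv_integrable (continuous_onRe cf), itv_integrable (continuous_onIm cf),
         itv_integrable (continuous_onRe cg), itv_integrable (continuous_onIm cg)).
move=> [[[h1 h2] h3] h4].
under eq_Rintegral do rewrite cReD.
under [X in _ + 'i * rc X]eq_Rintegral do rewrite cImD.
by rewrite !RintegralD //= !rmorphD /=; ring.
Qed.

Lemma continuous_on_scale a b (k : C) f : continuous_on a b f ->
  continuous_on a b (fun t => k * f t).
Proof. move=> cf t /cf ct; apply: cvgM; [exact: cvg_cst|exact: ct]. Qed.

Lemma continuous_on_cst a b k : continuous_on a b (fun=> k).
Proof. by move=> t _; apply: cvg_cst. Qed.

Lemma continuous_on_rc a b : continuous_on a b rc.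
Proof. by move=> t _; apply: continuous_rc. Qed.

Lemma cintZ a b (k : C) f : continuous_on a b f ->
  cint (fun t => k * f t) a b = k * cint f a b.
Proof.
move=> cf; rewrite /cint.
have h1 := itv_integrable (continuous_onRe cf).
have h2 := itv_integrable (continuous_onIm cf).
have z (r : R) (g : R -> R) : mu.-integrable `[a, b] (EFin \o g) ->
    mu.-integrable `[a, b] (EFin \o (fun t => r * g t)).
  move=> ig; have -> : EFin \o (fun t => r * g t) = (fun t => r%:E * (EFin \o g) t)%E.
    by apply/funext => t /=; rewrite EFinM.
  exact: integrableZl.
under eq_Rintegral do rewrite cReM.
under [X in _ + 'i * rc X]eq_Rintegral do rewrite cImM.
rewrite RintegralB ?RintegralD ?RintegralZl //=; try exact: z.
apply: C_eq; rewrite !ReImE; ring.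
Qed.

Lemma cintB a b f g : continuous_on a b f -> continuous_on a b g ->
  cint (fun t => f t - g t) a b = cint f a b - cint g a b.
Proof.
move=> cf cg; have cg' := continuous_on_scale (k := -1) cg.
rewrite -mulN1r -(cintZ _ cg) -(cintD cf cg').
by apply: eq_cint => t _; rewrite mulN1r.
Qed.

Lemma cint_cst a b (k : C) : a <= b -> cint (fun=> k) a b = rc (b - a) * k.
Proof.
move=> ab; rewrite /cint !Rintegral_cst //= lebesgue_measure_itv /= lte_fin.
case: ltP => [_|ba]; first by apply: C_eq; rewrite !ReImE /=; ring.
have -> : b = a by apply/le_anti; rewrite ab ba.
by apply: C_eq; rewrite !ReImE /=; ring.
Qed.

Lemma cint_id a b : a <= b -> cint rc a b = rc ((b ^+ 2 - a ^+ 2) / 2).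
Proof.
rewrite le_eqVlt => /predU1P[->|ab].
  by rewrite /cint set_itv1 !Rintegral_set1 subrr mul0r mulr0 addr0.
rewrite /cint /=; have -> : (\int[mu]_(t in `[a, b]) t)%R = (b ^+ 2 - a ^+ 2) / 2.
  have dF (x : R) : is_derive x 1 (fun t => t ^+ 2 / 2 : R) x.
    have -> : (fun t : R => t ^+ 2 / 2) = (fun t : R => 2^-1 *: t ^+ 2).
      by apply/funext => t; rewrite /GRing.scale /= mulrC.
    apply: is_derive_eq; rewrite /GRing.scale /=; lra.
  rewrite /Rintegral (@continuous_FTC2 _ id (fun t => t ^+ 2 / 2)) //=; first lra.
  - by apply: within_itv_continuous => t _; apply: cvg_id.
  - have cF (x : R) : {for x, continuous (fun t : R => t ^+ 2 / 2)}.
      by apply: differentiable_continuous; apply/derivable1_diffP; case: (dF x).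
    split => [x _| |]; first by case: (dF x).
      by apply: cvg_at_right_filter; apply: cF.
    by apply: cvg_at_left_filter; apply: cF.
  - by move=> x _; rewrite derive1E derive_val.
by rewrite Rintegral_cst //= mul0r mulr0 addr0.
Qed.

Lemma cint_split a b c f : a <= c -> c <= b -> continuous_on a b f ->
  cint f a b = cint f a c + cint f c b.
Proof.
move=> ac cb cf.
have h1 := itv_integrable (continuous_onRe cf).
have h2 := itv_integrable (continuous_onIm cf).
have sp (g : R -> R) : mu.-integrable `[a, b] (EFin \o g) ->
    (\int[mu]_(t in `[a, b]) g t = \int[mu]_(t in `[a, c]) g t + \int[mu]_(t in `[c, b]) g t)%R.
  move=> ig; apply/eqP; rewrite addrC -subr_eq; apply/eqP.
  rewrite (@Rintegral_itvB _ _ _ _ c) ?bnd_simp //.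
  apply: Rintegral_itv_obnd_cbnd; apply: integrableS ig => //.
  by apply: subset_itvr; rewrite bnd_simp.
by rewrite /cint (sp _ h1) (sp _ h2) !rmorphD /=; ring.
Qed.

(** The constant 2 comes from bounding the real and imaginary parts separately. Where a sharp
    constant matters, [max_principle] removes it by passing to powers. *)
Lemma cint_bound a b f (M : R) : a <= b -> continuous_on a b f ->
  (forall t, a <= t <= b -> nrm (f t) <= M) -> nrm (cint f a b) <= 2 * M * (b - a).
Proof.
move=> ab cf fM.
have h1 := itv_integrable (continuous_onRe cf).
have h2 := itv_integrable (continuous_onIm cf).
have bd (g : R -> R) : mu.-integrable `[a, b] (EFin \o g) ->
    (forall t, a <= t <= b -> `|g t| <= M) ->
    `|\int[mu]_(t in `[a, b]) g t|%R <= M * (b - a).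
  move=> ig gM; apply: (le_trans (le_normr_Rintegral _ _)) => //.
  apply: (@le_trans _ _ (\int[mu]_(t in `[a, b]) M)%R).
    apply: le_Rintegral => //.
    + exact: integrable_norm.
    + apply: itv_integrable; apply: within_itv_continuous => t _; exact: cvg_cst.
  rewrite Rintegral_cst //= lebesgue_measure_itv /= lte_fin.
  case: ltP => //= ba; have -> : b = a by apply/le_anti; rewrite ab ba.
  by rewrite subrr.
apply: (le_trans (ler_nrmD _ _)); rewrite nrmM nrm_i mul1r !nrm_rc.
apply: (@le_trans _ _ (M * (b - a) + M * (b - a))); last by rewrite -mulrA mulr2n mulrDl !mul1r.
apply: lerD; apply: bd => // t /fM; apply: le_trans; [exact: Re_le_nrm|exact: Im_le_nrm].
Qed.

(* [(x, y)] is the lower left corner, [w] the width and [h] the height. *)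
Definition rectint (f : C -> C) (x y w h : R) : C :=
  cint (fun t => f (t +i* y)%C) x (x + w) - cint (fun t => f (t +i* (y + h))%C) x (x + w)
  + 'i * (cint (fun t => f ((x + w) +i* t)%C) y (y + h) - cint (fun t => f (x +i* t)%C) y (y + h)).

Definition rect (x y w h : R) : set C :=
  [set z | x <= ReC z <= x + w /\ y <= ImC z <= y + h].

Lemma rectS (x y w h x' y' w' h' : R) : x <= x' -> x' + w' <= x + w -> y <= y' -> y' + h' <= y + h ->
  rect x' y' w' h' `<=` rect x y w h.
Proof. by move=> h1 h2 h3 h4 z [/andP[? ?] /andP[? ?]]; split; apply/andP; split; lra. Qed.

Lemma continuous_horizontal (f : C -> C) (y t : R) :
  {for (t +i* y)%C, continuous f} -> {for t, continuous (fun t => f (t +i* y)%C)}.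
Proof.
move=> cf; apply: (@continuous_comp _ _ _ (fun t => (t +i* y)%C : C) f); last exact: cf.
apply/continuousR_nrmP => e e0; exists e => // u ut.
apply: le_lt_trans ut.
have -> : ((u +i* y)%C - (t +i* y)%C : C) = rc (u - t) by apply: C_eq; rewrite !ReImE //= subrr.
by rewrite nrm_rc.
Qed.

Lemma continuous_vertical (f : C -> C) (x t : R) :
  {for (x +i* t)%C, continuous f} -> {for t, continuous (fun t => f (x +i* t)%C)}.
Proof.
move=> cf; apply: (@continuous_comp _ _ _ (fun t => (x +i* t)%C : C) f); last exact: cf.
apply/continuousR_nrmP => e e0; exists e => // u ut.
apply: le_lt_trans ut.
have -> : ((x +i* u)%C - (x +i* t)%C : C) = 'i * rc (u - t).
  by apply: C_eq; rewrite !ReImE //= ?subrr; ring.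
by rewrite nrmM nrm_i mul1r nrm_rc.
Qed.

(** Continuity along the four sides only, so that the notion still applies to a function that is
    singular inside the rectangle, as in [goursat_punctured]. *)
Definition cont_bd (f : C -> C) (x y w h : R) :=
  [/\ continuous_on x (x + w) (fun t => f (t +i* y)%C),
      continuous_on x (x + w) (fun t => f (t +i* (y + h))%C),
      continuous_on y (y + h) (fun t => f ((x + w) +i* t)%C) &
      continuous_on y (y + h) (fun t => f (x +i* t)%C)].

Lemma cont_bd_rect (f : C -> C) (x y w h : R) : 0 <= w -> 0 <= h ->
  (forall z, rect x y w h z -> {for z, continuous f}) -> cont_bd f x y w h.
Proof.
move=> w0 h0 cf; split => t /andP[t1 t2]; (apply: continuous_horizontal || apply: continuous_vertical);
  by apply: cf; split; rewrite /=; apply/andP; split; lra.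
Qed.

Lemma eq_rectint (f g : C -> C) (x y w h : R) : (forall z, rect x y w h z -> f z = g z) -> 0 <= w -> 0 <= h ->
  rectint f x y w h = rectint g x y w h.
Proof.
move=> fg w0 h0; rewrite /rectint; congr (_ - _ + 'i * (_ - _)); apply: eq_cint => t /andP[t1 t2];
  by apply: fg; split; rewrite /=; apply/andP; split; lra.
Qed.

Lemma rectintD (f g : C -> C) (x y w h : R) : cont_bd f x y w h -> cont_bd g x y w h ->
  rectint (fun z => f z + g z) x y w h = rectint f x y w h + rectint g x y w h.
Proof.
case=> f1 f2 f3 f4 [g1 g2 g3 g4]; rewrite /rectint.
by rewrite (cintD f1 g1) (cintD f2 g2) (cintD f3 g3) (cintD f4 g4); ring.
Qed.

Lemma rectint_bound (f : C -> C) (x y w h M : R) : 0 <= w -> 0 <= h -> cont_bd f x y w h ->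
  (forall z, rect x y w h z ->
    [\/ ReC z = x, ReC z = x + w, ImC z = y | ImC z = y + h] -> nrm (f z) <= M) ->
  nrm (rectint f x y w h) <= 4 * M * (w + h).
Proof.
move=> w0 h0 [f1 f2 f3 f4] fM.
have b1 : nrm (cint (fun t => f (t +i* y)%C) x (x + w)) <= 2 * M * (x + w - x).
  apply: cint_bound f1 _; first lra.
  by move=> t /andP[t1 t2]; apply: fM; [split; rewrite /=; apply/andP; split; lra|exact: Or43].
have b2 : nrm (cint (fun t => f (t +i* (y + h))%C) x (x + w)) <= 2 * M * (x + w - x).
  apply: cint_bound f2 _; first lra.
  by move=> t /andP[t1 t2]; apply: fM; [split; rewrite /=; apply/andP; split; lra|exact: Or44].
have b3 : nrm (cint (fun t => f ((x + w) +i* t)%C) y (y + h)) <= 2 * M * (y + h - y).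
  apply: cint_bound f3 _; first lra.
  by move=> t /andP[t1 t2]; apply: fM; [split; rewrite /=; apply/andP; split; lra|exact: Or42].
have b4 : nrm (cint (fun t => f (x +i* t)%C) y (y + h)) <= 2 * M * (y + h - y).
  apply: cint_bound f4 _; first lra.
  by move=> t /andP[t1 t2]; apply: fM; [split; rewrite /=; apply/andP; split; lra|exact: Or41].
rewrite /rectint; apply: (le_trans (ler_nrmD _ _)); rewrite nrmM nrm_i mul1r.
have := ler_nrmB (cint (fun t => f (t +i* y)%C) x (x + w)) (cint (fun t => f (t +i* (y + h))%C) x (x + w)).
have := ler_nrmB (cint (fun t => f ((x + w) +i* t)%C) y (y + h)) (cint (fun t => f (x +i* t)%C) y (y + h)).
lra.
Qed.

Lemma rectint_splitx (f : C -> C) (x y w1 w2 h : R) : 0 <= w1 -> 0 <= w2 -> 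
  continuous_on x (x + (w1 + w2)) (fun t => f (t +i* y)%C) ->
  continuous_on x (x + (w1 + w2)) (fun t => f (t +i* (y + h))%C) ->
  rectint f x y (w1 + w2) h = rectint f x y w1 h + rectint f (x + w1) y w2 h.
Proof.
move=> h1 h2 c1 c2; rewrite /rectint.
rewrite (@cint_split x _ (x + w1) _ _ _ c1); [|lra|lra].
rewrite (@cint_split x _ (x + w1) _ _ _ c2); [|lra|lra].
by rewrite -(addrA x w1 w2); ring.
Qed.

Lemma rectint_splity (f : C -> C) (x y w h1 h2 : R) : 0 <= h1 -> 0 <= h2 -> 
  continuous_on y (y + (h1 + h2)) (fun t => f ((x + w) +i* t)%C) ->
  continuous_on y (y + (h1 + h2)) (fun t => f (x +i* t)%C) ->
  rectint f x y w (h1 + h2) = rectint f x y w h1 + rectint f x (y + h1) w h2.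
Proof.
move=> k1 k2 c1 c2; rewrite /rectint.
rewrite (@cint_split y _ (y + h1) _ _ _ c1); [|lra|lra].
rewrite (@cint_split y _ (y + h1) _ _ _ c2); [|lra|lra].
by rewrite -(addrA y h1 h2); ring.
Qed.

(** In [goursat_local] this removes the first-order part of the integrand, whose contribution must
    vanish exactly. *)
Lemma rectint_affine (A B : C) (x y w h : R) : 0 <= w -> 0 <= h ->
  rectint (fun z => A + B * z) x y w h = 0.
Proof.
move=> w0 h0; rewrite /rectint.
have H (a b k : R) : a <= b -> cint (fun t => A + B * (t +i* k)%C) a b =
    rc (b - a) * (A + B * ('i * rc k)) + B * rc ((b ^+ 2 - a ^+ 2) / 2).
  move=> ab.
  under [LHS](@eq_cint _ _ _ (fun t => (A + B * ('i * rc k)) + B * rc t)) => t _.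
    by rewrite -addrA -mulrDr; congr (_ + _ * _); apply: C_eq; rewrite !ReImE /=; ring.
  rewrite (cintD (@continuous_on_cst a b _) (continuous_on_scale (@continuous_on_rc a b))).
  by rewrite (cintZ _ (@continuous_on_rc a b)) (cint_cst _ ab) (cint_id ab).
have V (a b k : R) : a <= b -> cint (fun t => A + B * (k +i* t)%C) a b =
    rc (b - a) * (A + B * rc k) + B * 'i * rc ((b ^+ 2 - a ^+ 2) / 2).
  move=> ab.
  under [LHS](@eq_cint _ _ _ (fun t => (A + B * rc k) + B * 'i * rc t)) => t _.
    by rewrite -addrA -mulrA -mulrDr; congr (_ + _ * _); apply: C_eq; rewrite !ReImE /=; ring.
  rewrite (cintD (@continuous_on_cst a b _) (continuous_on_scale (@continuous_on_rc a b))).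
  by rewrite (cintZ _ (@continuous_on_rc a b)) (cint_cst _ ab) (cint_id ab).
have xw : x <= x + w by lra.
have yh : y <= y + h by lra.
rewrite !(H _ _ _ xw) !(V _ _ _ yh).
case: A B {H V} => [a1 a2] [b1 b2].
by apply: C_eq; rewrite !ReImE /=; field.
Qed.

End ComplexIntegral.

(** * Goursat's theorem on rectangles, also with a bounded singularity inside *)

Section Goursat.
Variable R : realType.
Local Notation C := (Cplx R).

(** After subtraction of the tangent affine map at [z0], whose integral is 0, the integrand is at
    most [e * (w + h)] on the boundary; the second factor [w + h] is the perimeter. *)
Lemma goursat_local (f : C -> C) (z0 : C) (e : R) : 0 < e -> differentiable f z0 ->
  exists2 d : R, 0 < d & forall x y w h : R, 0 <= w -> 0 <= h -> w + h < d ->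
    rect x y w h z0 -> (forall z, rect x y w h z -> differentiable f z) ->
    nrm (rectint f x y w h) <= 4 * e * (w + h) ^+ 2.
Proof.
move=> e0 dz; have [d d0 H] := differentiable1_expand dz e0; set D := 'D_1 f z0 in H.
exists d => // x y w h w0 h0 whd rz0 df.
pose aff (z : C) : C := (f z0 - z0 * D) + D * z.
pose r (z : C) : C := f z - aff z.
have caff (z : C) : {for z, continuous aff}.
  by apply: ctsD; [exact: cts_cst|apply: ctsM; [exact: cts_cst|exact: cts_id]].
have cr (z : C) : rect x y w h z -> {for z, continuous r}.
  move=> /df dz1; apply: ctsB; last exact: caff.
  exact: differentiable_cts dz1.
have -> : rectint f x y w h = rectint r x y w h + rectint aff x y w h.
  rewrite -(rectintD (cont_bd_rect w0 h0 cr) (cont_bd_rect w0 h0 (fun z _ => caff z))).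
  by apply: eq_rectint => // z _; rewrite /r subrK.
rewrite rectint_affine // addr0.
have close z : rect x y w h z -> nrm (z - z0) <= w + h.
  move=> [/andP[z1 z2] /andP[z3 z4]]; apply: (le_trans (nrm_le_ReIm _)).
  move: rz0 => [/andP[z5 z6] /andP[z7 z8]].
  by rewrite cReB cImB; apply: lerD; rewrite ler_norml; apply/andP; split; lra.
apply: (le_trans (@rectint_bound _ r x y w h (e * (w + h)) w0 h0 _ _)).
- exact: cont_bd_rect.
- move=> z rz _; have zz := close z rz; have := H (z - z0) (le_lt_trans zz whd).
  rewrite subrKC => /le_trans/(_ (ler_wpM2l (ltW e0) zz)); apply: le_trans.
  rewrite le_eqVlt; apply/orP; left; apply/eqP; congr nrm.
  by rewrite /r /aff /GRing.scale /=; ring.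
- by rewrite le_eqVlt; apply/orP; left; apply/eqP; ring.
Qed.

Lemma exp2_gt (x : R) : exists n, x < 2 ^+ n.
Proof.
exists (Num.bound x); apply: (le_lt_trans (ler_norm x)).
apply: (lt_trans (archi_boundP (normr_ge0 x))).
have -> : Num.bound `|x| = Num.bound x by rewrite /Num.bound normr_id.
by rewrite -natrX ltr_nat ltn_expl.
Qed.

Lemma rectint_quarter (f : C -> C) (a b W Q : R) : 0 <= W -> 0 <= Q ->
  (forall z, rect a b (W + W) (Q + Q) z -> {for z, continuous f}) ->
  rectint f a b (W + W) (Q + Q) =
      rectint f a b W Q + rectint f a (b + Q) W Q +
      (rectint f (a + W) b W Q + rectint f (a + W) (b + Q) W Q).
Proof.
move=> w1 h1 dr.
have ch c : b <= c <= b + (Q + Q) -> continuous_on a (a + (W + W)) (fun t => f (t +i* c)%C).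
  move=> /andP[c1 c2] t /andP[t1 t2]; apply: continuous_horizontal.
  by apply: dr; split; rewrite /=; apply/andP; split; lra.
have cv c : a <= c <= a + (W + W) -> continuous_on b (b + (Q + Q)) (fun t => f (c +i* t)%C).
  move=> /andP[c1 c2] t /andP[t1 t2]; apply: continuous_vertical.
  by apply: dr; split; rewrite /=; apply/andP; split; lra.
rewrite (@rectint_splitx _ f a b W W (Q + Q) w1 w1); [|apply: ch; lra|apply: ch; lra].
rewrite (@rectint_splity _ f a b W Q Q h1 h1); [|apply: cv; lra|apply: cv; lra].
by rewrite (@rectint_splity _ f (a + W) b W Q Q h1 h1) //; apply: cv; lra.
Qed.

(** The integral is the sum of those over the four quarters, so by the triangle inequality one
    quarter keeps at least a fourth of it. *)
Lemma rectint_quarter_large (f : C -> C) (a b W Q K : R) : 0 <= W -> 0 <= Q ->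
  (forall z, rect a b (W + W) (Q + Q) z -> {for z, continuous f}) ->
  ~ nrm (rectint f a b (W + W) (Q + Q)) <= 4 * K ->
  exists a' b', [/\ a <= a', a' + W <= a + (W + W), b <= b', b' + Q <= b + (Q + Q) &
    ~ nrm (rectint f a' b' W Q) <= K].
Proof.
move=> w1 h1 dr nP; apply: contrapT => nq; apply: nP; rewrite rectint_quarter //.
have q (a' b' : R) : a <= a' -> a' + W <= a + (W + W) -> b <= b' -> b' + Q <= b + (Q + Q) ->
      nrm (rectint f a' b' W Q) <= K.
  by move=> k1 k2 k3 k4; apply: contrapT => k; apply: nq; exists a', b'.
have [i1 i2 i3 i4] : [/\ a <= a + W, a + W <= a + (W + W), a + W + W <= a + (W + W) & a <= a].
  by split; lra.
have [j1 j2 j3 j4] : [/\ b <= b + Q, b + Q <= b + (Q + Q), b + Q + Q <= b + (Q + Q) & b <= b].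
  by split; lra.
have q1 := q a b i4 i2 j4 j2; have q2 := q a (b + Q) i4 i2 j1 j3.
have q3 := q (a + W) b i1 i3 j4 j2; have q4 := q (a + W) (b + Q) i1 i3 j1 j3.
have -> : 4 * K = K + K + (K + K) by ring.
by apply: (le_trans (ler_nrmD _ _)); apply: lerD; apply: (le_trans (ler_nrmD _ _)); apply: lerD.
Qed.

Lemma goursat (f : C -> C) (x y w h : R) : 0 <= w -> 0 <= h ->
  (forall z, rect x y w h z -> differentiable f z) -> rectint f x y w h = 0.
Proof.
move=> w0 h0 df.
pose s n : R := 2 ^- n.
have s0 n : 0 < s n by rewrite invr_gt0 exprn_gt0.
have sS n : s n = s n.+1 + s n.+1 by rewrite /s exprS invfM; lra.
have ws n : 0 <= w * s n by rewrite mulr_ge0 // ltW.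
have hs n : 0 <= h * s n by rewrite mulr_ge0 // ltW.
suff P (e : R) : 0 < e -> nrm (rectint f x y w h) <= 4 * e * (w + h) ^+ 2.
  apply/eqP; rewrite -nrm_eq0 eq_le nrm_ge0 andbT; apply/ler_addgt0Pr => e e0.
  rewrite add0r; set c := 4 * (w + h) ^+ 2.
  have c0 : 0 <= c by rewrite mulr_ge0 // sqr_ge0.
  have := P (e / (c + 1)) (divr_gt0 e0 (ltr_wpDl c0 ltr01)); move/le_trans; apply.
  have -> : 4 * (e / (c + 1)) * (w + h) ^+ 2 = e * (c / (c + 1)).
    by rewrite /c; field; rewrite -/c; lra.
  rewrite ler_piMr ?(ltW e0) // ler_pdivrMr; lra.
move=> e0; apply: contrapT => nP.
(* Halving the sides divides the bound of [goursat_local] by 4, and so, at worst, the integral over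
   a suitable quarter: the failure of that bound is passed from a rectangle to one of its
   quarters. *)
pose good n (p : R * R) := [/\ x <= p.1, p.1 + w * s n <= x + w, y <= p.2, p.2 + h * s n <= y + h
   & ~ nrm (rectint f p.1 p.2 (w * s n) (h * s n)) <= 4 * e * (w * s n + h * s n) ^+ 2].
pose nxt n (p q : R * R) := [/\ good n.+1 q, p.1 <= q.1, q.1 + w * s n.+1 <= p.1 + w * s n,
   p.2 <= q.2 & q.2 + h * s n.+1 <= p.2 + h * s n].
have step n p : good n p -> exists q, nxt n p q.
  case: p => a b [/= a1 a2 b1 b2 nPn].
  have wE : w * s n = w * s n.+1 + w * s n.+1 by rewrite (sS n) mulrDr.
  have hE : h * s n = h * s n.+1 + h * s n.+1 by rewrite (sS n) mulrDr.
  have [|nP'|a' [b' [k1 k2 k3 k4 k5]]] := @rectint_quarter_large f a b (w * s n.+1) (h * s n.+1)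
      (4 * e * (w * s n.+1 + h * s n.+1) ^+ 2) (ws _) (hs _).
  - move=> z rz; apply: differentiable_cts; apply: df; move: rz; rewrite -wE -hE; exact: rectS.
  - apply: nPn; rewrite wE hE; apply: (le_trans nP'); rewrite le_eqVlt; apply/orP; left; apply/eqP.
    by ring.
  exists (a', b'); rewrite -wE -hE in k2 k4.
  split => //; split => //=; [exact: le_trans k1|exact: le_trans a2|exact: le_trans k3|exact: le_trans b2].
(* A choice of the next corner; the default [np.2] is never reached from a [good] rectangle. *)
pose g (np : nat * (R * R)) : R * R :=
  if pselect (exists q, nxt np.1 np.2 q) is left ex then projT1 (cid ex) else np.2.
have hg np : good np.1 np.2 -> nxt np.1 np.2 (g np).
  by move=> /step ex; rewrite /g; case: pselect => // ex'; exact: (projT2 (cid ex')).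
pose p_ := fix p_ n := if n is n'.+1 then g (n', p_ n') else (x, y).
have gp n : good n (p_ n).
  elim: n => [|n IH] /=; last by case: (hg (n, p_ n) IH).
  by rewrite /good /= /s expr0 invr1 !mulr1; split.
have nx n : nxt n (p_ n) (p_ n.+1) by apply: (hg (n, p_ n)).
have mono1 n k : (p_ n).1 <= (p_ (n + k)%N).1 /\ (p_ (n + k)%N).1 + w * s (n + k)%N <= (p_ n).1 + w * s n.
  elim: k => [|k [I1 I2]]; first by rewrite addn0.
  by rewrite addnS; case: (nx (n + k)%N) => _ j1 j2 _ _; split; lra.
have mono2 n k : (p_ n).2 <= (p_ (n + k)%N).2 /\ (p_ (n + k)%N).2 + h * s (n + k)%N <= (p_ n).2 + h * s n.
  elim: k => [|k [I1 I2]]; first by rewrite addn0.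
  by rewrite addnS; case: (nx (n + k)%N) => _ _ _ j1 j2; split; lra.
have up1 n m : (p_ n).1 <= (p_ m).1 + w * s m.
  have [nm|/ltnW mn] := leqP n m.
    by have := mono1 n (m - n)%N; rewrite subnKC // => -[j _]; have := ws m; lra.
  by have := mono1 m (n - m)%N; rewrite subnKC // => -[_ j]; have := ws n; lra.
have up2 n m : (p_ n).2 <= (p_ m).2 + h * s m.
  have [nm|/ltnW mn] := leqP n m.
    by have := mono2 n (m - n)%N; rewrite subnKC // => -[j _]; have := hs m; lra.
  by have := mono2 m (n - m)%N; rewrite subnKC // => -[_ j]; have := hs n; lra.
(* The rectangles are nested, so every lower left corner lies below every upper right one, and the
   suprema give a point common to all of them. There [goursat_local] contradicts [good]. *)
pose X := sup (range (fun n => (p_ n).1)); pose Y := sup (range (fun n => (p_ n).2)).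
have XP n : (p_ n).1 <= X <= (p_ n).1 + w * s n.
  apply/andP; split.
    apply: ub_le_sup; last by exists n.
    by exists ((p_ 0).1 + w * s 0) => _ [m _ <-]; apply: up1.
  apply: ge_sup; first by exists (p_ 0).1, 0.
  by move=> _ [m _ <-]; apply: up1.
have YP n : (p_ n).2 <= Y <= (p_ n).2 + h * s n.
  apply/andP; split.
    apply: ub_le_sup; last by exists n.
    by exists ((p_ 0).2 + h * s 0) => _ [m _ <-]; apply: up2.
  apply: ge_sup; first by exists (p_ 0).2, 0.
  by move=> _ [m _ <-]; apply: up2.
have rn n : rect (p_ n).1 (p_ n).2 (w * s n) (h * s n) (X +i* Y)%C by split; [exact: XP|exact: YP].
have sub n : rect (p_ n).1 (p_ n).2 (w * s n) (h * s n) `<=` rect x y w h.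
  by apply: rectS; case: (gp n).
have [d d0 H] := goursat_local e0 (df _ (sub 0 _ (rn 0))).
have [n Hn] := exp2_gt ((w + h) / d).
case: (gp n) => _ _ _ _; apply; apply: H => //; first last.
  by move=> z /sub; apply: df.
by rewrite -mulrDl /s ltr_pdivrMr ?exprn_gt0 // mulrC -ltr_pdivrMr.
Qed.

(** The parts of the rectangle to the left and to the right of the vertical strip of width 2 t
    around [a] avoid the singular point, so their integrals vanish by [goursat]. *)
Lemma goursat_shrink_x (f : C -> C) (a b x y w h t : R) :
  0 < t -> x < a - t -> a + t < x + w -> y < b < y + h ->
  (forall z, rect x y w h z -> z != (a +i* b)%C -> differentiable f z) ->
  rectint f x y w h = rectint f (a - t) y (t + t) h.
Proof.
move=> t0 t1 t2 /andP[yb b_y] df.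
have hc c (u v : R) : x <= u -> v <= x + w -> y <= c <= y + h -> c != b ->
    continuous_on u v (fun s => f (s +i* c)%C).
  move=> xu vx cy cb s /andP[us sv]; apply: continuous_horizontal; apply: differentiable_continuous; apply: df.
    by split => //=; rewrite (le_trans xu us) (le_trans sv vx).
  by rewrite eq_complex /= negb_and cb orbT.
have sidex (u v : R) : x <= u -> 0 <= v -> u + v <= x + w -> u + v < a \/ a < u -> rectint f u y v h = 0.
  move=> k1 k2 k3 k4; apply: goursat; [lra|lra|] => z [/andP[z1 z2] zy]; apply: df.
    by split=> //; rewrite (le_trans k1 z1) (le_trans z2 k3).
  by apply/eqP => zE; rewrite zE /= in z1 z2; lra.
have ny1 : y != b by rewrite lt_eqF.
have ny2 : y + h != b by rewrite gt_eqF.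
have h0 : y <= y + h by lra.
have sx (u w1 w2 : R) : x <= u -> 0 <= w1 -> 0 <= w2 -> u + (w1 + w2) <= x + w ->
    rectint f u y (w1 + w2) h = rectint f u y w1 h + rectint f (u + w1) y w2 h.
  by move=> k1 k2 k3 k4; apply: rectint_splitx => //; apply: hc => //; rewrite lexx h0.
have a1 : 0 <= a - t - x by lra.
have a2 : 0 <= x + w - (a + t) by lra.
have a3 : 0 <= t + t by lra.
have -> : w = (a - t - x) + ((t + t) + (x + w - (a + t))) by ring.
clear hc df; rewrite (sx x); [|lra|lra|lra|lra].
rewrite (sidex x); [|lra|lra|lra|left; lra].
rewrite (_ : x + (a - t - x) = a - t); last ring.
rewrite (sx (a - t) (t + t) (x + w - (a + t))); [|lra|lra|lra|lra].
by rewrite (sidex (a - t + (t + t))) ?addr0 ?add0r //; lra.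
Qed.

Lemma goursat_shrink_y (f : C -> C) (a b x y w h t : R) :
  0 < t -> y < b - t -> b + t < y + h -> x < a < x + w ->
  (forall z, rect x y w h z -> z != (a +i* b)%C -> differentiable f z) ->
  rectint f x y w h = rectint f x (b - t) w (t + t).
Proof.
move=> t0 t1 t2 /andP[xa a_x] df.
have vc c (u v : R) : y <= u -> v <= y + h -> x <= c <= x + w -> c != a ->
    continuous_on u v (fun s => f (c +i* s)%C).
  move=> xu vx cy cb s /andP[us sv]; apply: continuous_vertical; apply: differentiable_continuous; apply: df.
    by split => //=; rewrite (le_trans xu us) (le_trans sv vx).
  by rewrite eq_complex /= negb_and cb.
have sidey (u v : R) : y <= u -> 0 <= v -> u + v <= y + h -> u + v < b \/ b < u -> rectint f x u w v = 0.
  move=> k1 k2 k3 k4; apply: goursat; [lra|lra|] => z [zx /andP[z1 z2]]; apply: df.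
    by split=> //; rewrite (le_trans k1 z1) (le_trans z2 k3).
  by apply/eqP => zE; rewrite zE /= in z1 z2; lra.
have nx1 : x != a by rewrite lt_eqF.
have nx2 : x + w != a by rewrite gt_eqF.
have w0 : x <= x + w by lra.
have sy (u h1 h2 : R) : y <= u -> 0 <= h1 -> 0 <= h2 -> u + (h1 + h2) <= y + h ->
    rectint f x u w (h1 + h2) = rectint f x u w h1 + rectint f x (u + h1) w h2.
  by move=> k1 k2 k3 k4; apply: rectint_splity => //; apply: vc => //; rewrite lexx w0.
have b1 : 0 <= b - t - y by lra.
have b2 : 0 <= y + h - (b + t) by lra.
have b3 : 0 <= t + t by lra.
have -> : h = (b - t - y) + ((t + t) + (y + h - (b + t))) by ring.
clear vc df; rewrite (sy y); [|lra|lra|lra|lra].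
rewrite (sidey y); [|lra|lra|lra|left; lra].
rewrite (_ : y + (b - t - y) = b - t); last ring.
rewrite (sy (b - t) (t + t) (y + h - (b + t))); [|lra|lra|lra|lra].
by rewrite (sidey (b - t + (t + t))) ?addr0 ?add0r //; lra.
Qed.

(** Shrinking in both directions leaves a square of side 2 t around [z0]; the integrand is bounded
    there and the perimeter tends to 0. *)
Lemma goursat_punctured (f : C -> C) (z0 : C) (x y w h : R) (M d : R) :
  x < ReC z0 < x + w -> y < ImC z0 < y + h ->
  (forall z, rect x y w h z -> z != z0 -> differentiable f z) ->
  0 < d -> (forall z, z != z0 -> nrm (z - z0) < d -> nrm (f z) <= M) ->
  rectint f x y w h = 0.
Proof.
case: z0 => a b /= /andP[xa ax] /andP[yb b_y] df d0 fM.
have M0 : 0 <= M.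
  apply: (le_trans (nrm_ge0 (f ((a + d / 2) +i* b)%C))); apply: fM.
    by rewrite eq_complex /= negb_and; apply/orP; left; apply/eqP; lra.
  have -> : ((a + d / 2) +i* b)%C - (a +i* b)%C = rc (d / 2) :> C.
    by apply: C_eq; rewrite !ReImE; [change (a + d / 2 - a = d / 2)|change (b - b = 0)]; ring.
  by rewrite nrm_rc gtr0_norm; lra.
(* The constant 16 is 4 (2 + 2), from [rectint_bound] on a square of side 2 t. The condition
   [t < d / 2] keeps the square within distance [d] of [z0], as |Re| + |Im| is at most 2 t there. *)
suff P (t : R) : 0 < t -> t < a - x -> t < x + w - a -> t < b - y -> t < y + h - b -> t < d / 2 ->
    nrm (rectint f x y w h) <= 16 * M * t.
  pose m := Num.min (Num.min (Num.min (a - x) (x + w - a)) (Num.min (b - y) (y + h - b))) (d / 2).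
  have m0 : 0 < m by rewrite !lt_min; apply/andP; split; [apply/andP; split; apply/andP; split|]; lra.
  have Pm t : 0 < t -> t < m -> nrm (rectint f x y w h) <= 16 * M * t.
    by move=> t0; rewrite !lt_min => /andP[/andP[/andP[? ?] /andP[? ?]] ?]; apply: P.
  apply/eqP; rewrite -nrm_eq0 eq_le nrm_ge0 andbT; apply/ler_addgt0Pr => e e0; rewrite add0r.
  set c := 16 * M in Pm *; have c0 : 0 <= c by rewrite mulr_ge0.
  pose t := Num.min (m / 2) (e / (c + 1)).
  have e1 : 0 < e / (c + 1) by rewrite divr_gt0 //; lra.
  have t0 : 0 < t by rewrite lt_min e1 andbT; lra.
  have tm : t < m by rewrite gt_min; apply/orP; left; lra.
  apply: (le_trans (Pm t t0 tm)); apply: (@le_trans _ _ (c * (e / (c + 1)))).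
    by rewrite ler_wpM2l // ge_min lexx orbT.
  rewrite mulrCA ler_piMr ?(ltW e0) // ler_pdivrMr; lra.
move=> t0 t1 t2 t3 t4 td.
have EX : rectint f x y w h = rectint f (a - t) y (t + t) h.
  by apply: (@goursat_shrink_x f a b) => //; [lra|lra|rewrite yb].
have sub z : rect (a - t) y (t + t) h z -> rect x y w h z.
  by move=> [/andP[z1 z2] z3]; split=> //; apply/andP; split; lra.
have EY : rectint f (a - t) y (t + t) h = rectint f (a - t) (b - t) (t + t) (t + t).
  apply: (@goursat_shrink_y f a b) => //; [lra|lra|by apply/andP; split; lra|].
  by move=> z /sub; apply: df.
have cf z : rect (a - t) (b - t) (t + t) (t + t) z -> z != (a +i* b)%C -> {for z, continuous f}.
  move=> [z1 /andP[z3 z4]] zn; apply: differentiable_continuous; apply: df; last exact: zn.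
  by apply: sub; split=> //; apply/andP; split; lra.
rewrite EX EY; clear EX EY sub df t1 t2 t3 t4 xa ax yb b_y.
have n1 (c : R) : c - t != c by rewrite lt_eqF //; lra.
have n2 (c : R) : c - t + (t + t) != c by rewrite gt_eqF //; lra.
have l1 (c : R) : c - t <= c - t + (t + t) by lra.
have cb : cont_bd f (a - t) (b - t) (t + t) (t + t).
  split=> s /andP[s1 s2].
  - by apply: continuous_horizontal; apply: cf; [split; rewrite /= ?s1 ?s2 ?lexx ?l1|rewrite eq_complex /= negb_and n1 orbT].
  - by apply: continuous_horizontal; apply: cf; [split; rewrite /= ?s1 ?s2 ?lexx ?l1|rewrite eq_complex /= negb_and n2 orbT].
  - by apply: continuous_vertical; apply: cf; [split; rewrite /= ?s1 ?s2 ?lexx ?l1|rewrite eq_complex /= negb_and n2].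
  - by apply: continuous_vertical; apply: cf; [split; rewrite /= ?s1 ?s2 ?lexx ?l1|rewrite eq_complex /= negb_and n1].
apply: (le_trans (@rectint_bound _ f (a - t) (b - t) (t + t) (t + t) M _ _ cb _)); [lra|lra| |lra].
move=> z [/= /andP[z1 z2] /andP[z3 z4]] side; apply: fM.
  by apply/eqP => zE; case: side; rewrite zE /= => -[] e; move: (n1 a) (n2 a) (n1 b) (n2 b); rewrite -e eqxx.
apply: (le_lt_trans (nrm_le_ReIm _)); rewrite cReB cImB /=.
have : `|ReC z - a| <= t by rewrite ler_norml; apply/andP; split; lra.
have : `|ImC z - b| <= t by rewrite ler_norml; apply/andP; split; lra.
move: td; clear; lra.
Qed.

End Goursat.

(** * The complex exponential and its logarithms *)

Section ComplexExponential.
Variable R : realType.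
Local Notation C := (Cplx R).
Local Notation cexp := (@cexp R).

Lemma cexpE (z : C) : cexp z = rc (expR (ReC z)) * (cos (ImC z) +i* sin (ImC z))%C.
Proof. by []. Qed.

Lemma Re_cexp (z : C) : ReC (cexp z) = expR (ReC z) * cos (ImC z).
Proof. by rewrite cexpE !ReImE /= mul0r subr0. Qed.

Lemma Im_cexp (z : C) : ImC (cexp z) = expR (ReC z) * sin (ImC z).
Proof. by rewrite cexpE !ReImE /= mul0r addr0. Qed.

Lemma cexpD (z w : C) : cexp (z + w) = cexp z * cexp w.
Proof.
apply: C_eq; first by rewrite cReM !Re_cexp !Im_cexp cReD cImD expRD cosD; ring.
by rewrite cImM !Re_cexp !Im_cexp cReD cImD expRD sinD; ring.
Qed.

Lemma cexp0 : cexp 0 = 1.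
Proof. by apply: C_eq; rewrite ?Re_cexp ?Im_cexp expR0 ?cos0 ?sin0 ?mul1r. Qed.

Lemma nrm_cexp (z : C) : nrm (cexp z) = expR (ReC z).
Proof.
apply/eqP; rewrite -(@eqrXn2 _ 2) ?nrm_ge0 ?expR_ge0 // nrm_sqr Re_cexp Im_cexp.
by rewrite !exprMn -mulrDr cos2Dsin2 mulr1.
Qed.

Lemma cexp_neq0 (z : C) : cexp z != 0.
Proof. by rewrite -nrm_gt0 nrm_cexp expR_gt0. Qed.

Lemma cexpN (z : C) : cexp (- z) = (cexp z)^-1.
Proof. by apply: (mulfI (cexp_neq0 z)); rewrite mulfV ?cexp_neq0 // -cexpD subrr cexp0. Qed.

Lemma cexpMn (z : C) n : cexp (n%:R * z) = cexp z ^+ n.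
Proof. by elim: n => [|n IH]; rewrite ?mul0r ?cexp0 // exprS -IH -cexpD mulrS mulrDl mul1r. Qed.

Lemma cexp_sum (I : Type) (r : seq I) (P : pred I) (F : I -> C) :
  cexp (\sum_(i <- r | P i) F i) = \prod_(i <- r | P i) cexp (F i).
Proof. by elim/big_rec2: _ => [|i x y _ <-]; rewrite ?cexp0 // cexpD. Qed.

Lemma is_derive_expand (f : R -> R) (x D : R) : is_derive x 1 f D ->
  forall e : R, 0 < e -> exists2 d : R, 0 < d & forall h, `|h| < d ->
    `|f (x + h) - f x - h * D| <= e * `|h|.
Proof.
move=> [df dE] e e0.
have /eqaddoP /(_ e e0) := diff_locally ((derivable1_diffP f x).1 df).
move/nbhs_ballP => [d /= d0 H]; exists d => // h hd.
have /= := H h; rewrite /ball /= sub0r normrN => /(_ hd).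
rewrite !fctE /= /shift /= [h + x]addrC opprD addrA.
have E : h *: (1 : R) = h := mulr1 h.
have -> // : 'd f x h = h * D.
by rewrite -dE (deriveE _ ((derivable1_diffP f x).1 df)) -{1}E linearZ.
Qed.

Lemma cexp_expand0 (e : R) : 0 < e -> exists2 d : R, 0 < d &
  forall h : C, nrm h < d -> nrm (cexp h - 1 - h) <= e * nrm h.
Proof.
(* With tolerance [t] on exp, cos and sin the real part costs 3 t |h| and the imaginary part 5 t
   |h|, whence [e / 8]; the bound [t <= 1] absorbs the products of errors. *)
move=> e0; have [t [t0 t1 te]] : exists t, [/\ 0 < t, t <= 1 & t <= e / 8].
  by exists (Num.min (e / 8) 1); rewrite lt_min ltr01 andbT divr_gt0 // !ge_min !lexx orbT.
have [d1 d10 H1] := is_derive_expand (is_derive_expR (0 : R)) t0.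
have [d2 d20 H2] := is_derive_expand (is_derive_cos (0 : R)) t0.
have [d3 d30 H3] := is_derive_expand (is_derive_sin (0 : R)) t0.
exists (Num.min (Num.min d1 d2) (Num.min d3 t)).
  by rewrite !lt_min d10 d20 d30 t0.
move=> h; rewrite !lt_min => /andP[/andP[h1 h2] /andP[h3 ht]].
set a := ReC h; set b := ImC h.
have na := Re_le_nrm h; have nb := Im_le_nrm h; rewrite -/a -/b in na nb.
have := H1 a (le_lt_trans na h1); rewrite add0r expR0 mulr1 => A.
have := H2 b (le_lt_trans nb h2); rewrite add0r cos0 sin0 oppr0 mulr0 subr0 => B.
have := H3 b (le_lt_trans nb h3); rewrite add0r cos0 sin0 subr0 mulr1 => D.
have n0 := nrm_ge0 h; set N := nrm h in na nb n0 ht *.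
have tN : 0 <= t * N by rewrite mulr_ge0 // ltW.
have A' : `|expR a - 1 - a| <= t * N by rewrite (le_trans A) // ler_wpM2l // ltW.
have B' : `|cos b - 1| <= t * N by rewrite (le_trans B) // ler_wpM2l // ltW.
have D' : `|sin b - b| <= t * N by rewrite (le_trans D) // ler_wpM2l // ltW.
have tNN : t * N <= N by rewrite ler_piMl.
apply: (le_trans (nrm_le_ReIm _)); rewrite !cReB !cImB Re_cexp Im_cexp -/a -/b /= subr0.
have re : `|expR a * cos b - 1 - a| <= 3 * (t * N).
  have -> : expR a * cos b - 1 - a = (expR a - 1 - a) * cos b + (1 + a) * (cos b - 1) by ring.
  apply: (le_trans (ler_normD _ _)); rewrite !normrM.
  have p1 : `|expR a - 1 - a| * `|cos b| <= t * N * 1 by apply: ler_pM => //; exact: cos_max.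
  have p2 : `|1 + a| * `|cos b - 1| <= 2 * (t * N).
    apply: ler_pM => //; apply: (le_trans (ler_normD _ _)); rewrite normr1; lra.
  lra.
have im : `|expR a * sin b - b| <= 5 * (t * N).
  have -> : expR a * sin b - b = (expR a - 1) * sin b + (sin b - b) by ring.
  apply: (le_trans (ler_normD _ _)); rewrite !normrM.
  have p1 : `|expR a - 1| * `|sin b| <= (2 * t) * (2 * N).
    apply: ler_pM => //.
      have -> : expR a - 1 = (expR a - 1 - a) + a by ring.
      apply: (le_trans (ler_normD _ _)); lra.
    have -> : sin b = (sin b - b) + b by ring.
    apply: (le_trans (ler_normD _ _)); lra.
  lra.
have : 8 * (t * N) <= e * N.
  by rewrite mulrA ler_wpM2r //; lra.
lra.
Qed.

Lemma differentiable_cexp (z : C) : differentiable cexp z /\ 'D_1 cexp z = cexp z.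
Proof.
apply: expand1_differentiable => e e0.
have z0 : 0 < nrm (cexp z) by rewrite nrm_gt0 cexp_neq0.
have [d d0 H] := cexp_expand0 (divr_gt0 e0 z0); exists d => // h /H Hh.
have -> : cexp (z + h) - cexp z - h *: cexp z = cexp z * (cexp h - 1 - h).
  by rewrite cexpD /GRing.scale /=; ring.
rewrite nrmM; apply: (le_trans (ler_wpM2l (ltW z0) Hh)).
by rewrite mulrA mulrCA divff ?mulr1 // gt_eqF.
Qed.

Lemma cts_cexp (z : C) : {for z, continuous cexp}.
Proof. by apply: differentiable_cts; case: (differentiable_cexp z). Qed.

Lemma cos_period (v : R) (k : int) : cos (v + (pi *+ 2) *~ k) = cos v.
Proof.
have cn n : forall u : R, cos (u + (pi *+ 2) *+ n) = cos u.
  elim: n => [|n IH] u; first by rewrite addr0.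
  by rewrite mulrSr addrA (cosD2pi _) IH.
case: k => n; first exact: cn.
by rewrite NegzE mulrNz -[RHS](cn n.+1) -(cn n.+1 (v + _)) subrK cn.
Qed.

(** Modulo 2 pi the argument is some u in [0, 2 pi), and either u or 2 pi - u lies in [0, pi], where
    cos is injective. *)
Lemma cos_eq1 (t : R) : cos t = 1 -> exists k : int, t = (pi *+ 2) *~ k.
Proof.
have pi0 : (0 : R) < pi *+ 2 by rewrite mulrn_wgt0 ?pi_gt0.
pose k := Num.floor (t / (pi *+ 2)); pose u := t - (pi *+ 2) *~ k.
have [u0 u1] : 0 <= u /\ u < pi *+ 2.
  have /andP[k1 k2] := floor_itv (t / (pi *+ 2)).
  rewrite ler_pdivlMr // in k1; rewrite ltr_pdivrMr // in k2.
  rewrite /u -mulrzl; split; first by rewrite subr_ge0.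
  by rewrite ltrBlDr -[X in X + _]mul1r -mulrDl addrC -intrD1.
have cu : cos u = cos t by rewrite -(cos_period u k) subrK.
move=> ct; exists k; apply/eqP; rewrite -subr_eq0 -/u; apply/eqP.
rewrite ct in cu.
have inj (v : R) : 0 <= v <= pi -> cos v = 1 -> v = 0.
  move=> v0 cv; apply: cos_inj; rewrite ?in_itv //= ?lexx ?pi_ge0 //.
  by rewrite cv cos0.
have [up|pu] := leP u pi; first by apply: inj => //; rewrite u0.
have : pi *+ 2 - u = 0.
  apply: inj.
    by rewrite mulr2n in u1 *; apply/andP; split; lra.
  by rewrite addrC (cosD2pi _) cosN.
by move=> E; rewrite mulr2n in u1 E; lra.
Qed.

Lemma cexp_eq1 (z : C) : cexp z = 1 -> exists k : int, z = two_i_pi R *~ k.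
Proof.
move=> E.
have rz : ReC z = 0.
  by apply: expR_inj; rewrite expR0 -nrm_cexp E nrm1.
have : cos (ImC z) = 1 by have := Re_cexp z; rewrite E rz expR0 mul1r => /= <-.
move=> /cos_eq1 [k kE]; exists k; rewrite /two_i_pi -mulrzAr.
have -> : rc (pi *+ 2) *~ k = rc (pi *+ 2 *~ k) :> C by rewrite rmorphMz.
by rewrite -kE; apply: C_eq; rewrite !ReImE ?rz; ring.
Qed.

Lemma cexp_two_i_pi (k : int) : cexp (two_i_pi R *~ k) = 1.
Proof.
have e1 : cexp (two_i_pi R) = 1.
  have re : ReC (two_i_pi R) = 0 by rewrite /two_i_pi !ReImE; ring.
  have im : ImC (two_i_pi R) = pi *+ 2 by rewrite /two_i_pi !ReImE; ring.
  by apply: C_eq; rewrite ?Re_cexp ?Im_cexp re im expR0 mul1r ?cos2pi ?sin2pi.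
have e2 n : cexp (two_i_pi R *+ n) = 1 by rewrite -mulr_natl cexpMn e1 expr1n.
case: k => n; first exact: e2.
by rewrite NegzE mulrNz cexpN e2 invr1.
Qed.

Lemma cexp_period (z : C) (k : int) : cexp (z + two_i_pi R *~ k) = cexp z.
Proof. by rewrite cexpD cexp_two_i_pi mulr1. Qed.

Lemma cexp_inj_mod (z w : C) : cexp z = cexp w -> exists k : int, z = w + two_i_pi R *~ k.
Proof.
move=> E; have [|k kE] := @cexp_eq1 (z - w); first by rewrite cexpD cexpN E mulfV ?cexp_neq0.
by exists k; rewrite -kE subrKC.
Qed.

(** The last clause says that only the negative real axis has its logarithm on the edge of the
    strip; [cauchy_formula] reaches that axis by continuity. *)
Lemma cexp_surj (z : C) : z != 0 ->
  exists2 w, cexp w = z & (- pi < ImC w <= pi) /\ (ImC w = pi -> ImC z = 0 /\ ReC z < 0).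
Proof.
rewrite -nrm_gt0 => z0; set N := nrm z in z0.
pose u := ReC z / N; pose v := ImC z / N.
have uv : u ^+ 2 + v ^+ 2 = 1.
  by rewrite !expr_div_n -mulrDl -nrm_sqr divff // expf_neq0 // gt_eqF.
have u1 : -1 <= u <= 1.
  have : `|u| ^+ 2 <= 1 by rewrite real_normK ?num_real // -uv lerDl sqr_ge0.
  by rewrite expr_le1 // ler_norml.
have s2 : Num.sqrt (1 - u ^+ 2) = `|v| by rewrite -uv addrAC subrr add0r sqrtr_sqr.
pose th := if 0 <= v then acos u else - acos u.
have cth : cos th = u by rewrite /th; case: ifP => _; rewrite ?cosN acosK.
have sth : sin th = v.
  rewrite /th; case: (leP 0 v) => v0; rewrite ?sinN sin_acos // s2.
    by rewrite ger0_norm.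
  by rewrite ltr0_norm // opprK.
have a0 := acos_ge0 u1; have a1 := acos_lepi u1.
have expN : expR (ln N) = N by rewrite lnK.
exists ((ln N) +i* th)%C.
  apply: C_eq; rewrite ?Re_cexp ?Im_cexp /= expN ?cth ?sth /u /v mulrC divfK // gt_eqF //.
have vpi : v < 0 -> acos u < pi.
  move=> v0; apply: acos_ltpi; have [? ?] := andP u1; apply/andP; split => //.
  rewrite lt_neqAle; apply/andP; split => //; apply/eqP => u1'.
  have : v ^+ 2 = 0 by move: uv; rewrite -u1'; lra.
  by move/eqP; rewrite sqrf_eq0 => /eqP v0'; rewrite v0' ltxx in v0.
have p0 := @pi_gt0 R.
rewrite /= /th; case: (leP 0 v) => v0; split.
- by apply/andP; split; lra.
- move=> E; have cu : u = -1 by rewrite -cth /th v0 E cospi.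
  have v2 : v = 0.
    have : v ^+ 2 = 0 by move: uv; rewrite cu; lra.
    by move/eqP; rewrite sqrf_eq0 => /eqP.
  have uN : ReC z = u * N by rewrite /u divfK // gt_eqF.
  have vN : ImC z = v * N by rewrite /v divfK // gt_eqF.
  by rewrite uN vN cu v2 mul0r mulN1r oppr_lt0.
- by have := vpi v0; move=> ?; apply/andP; split; lra.
- by have := vpi v0; lra.
Qed.

(* A logarithm only where [0 < Re z]. *)
Definition clog (z : C) : C := (ln (nrm z) +i* asin (ImC z / nrm z))%C.

Lemma nrm_Re_gt0 (z : C) : 0 < ReC z -> 0 < nrm z.
Proof. by move=> z0; apply: (lt_le_trans z0); apply: (le_trans (ler_norm _)); apply: Re_le_nrm. Qed.

Lemma Im_div_nrm (z : C) : 0 < ReC z -> -1 < ImC z / nrm z < 1.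
Proof.
move=> z0; have n0 := nrm_Re_gt0 z0.
rewrite -ltr_norml normrM normfV (gtr0_norm n0) ltr_pdivrMr // mul1r.
rewrite -ltr_sqr ?nnegrE ?nrm_ge0 // nrm_sqr real_normK ?num_real // ltrDr.
by rewrite exprn_gt0.
Qed.

Lemma clogK (z : C) : 0 < ReC z -> cexp (clog z) = z.
Proof.
move=> z0; have n0 := nrm_Re_gt0 z0; have /andP[v1 v2] := Im_div_nrm z0.
have v12 : -1 <= ImC z / nrm z <= 1 by rewrite !ltW.
have expN : expR (ln (nrm z)) = nrm z by rewrite lnK.
apply: C_eq; rewrite ?Re_cexp ?Im_cexp /= expN.
  rewrite cos_asin //.
  have -> : 1 - (ImC z / nrm z) ^+ 2 = (ReC z / nrm z) ^+ 2.
    rewrite !expr_div_n -[1](@divff _ (nrm z ^+ 2)) ?expf_neq0 ?gt_eqF //.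
    by rewrite -mulrBl nrm_sqr addrK.
  by rewrite sqrtr_sqr ger0_norm ?divr_ge0 ?ltW // mulrC divfK // gt_eqF.
by rewrite asinK ?in_itv //= mulrC divfK // gt_eqF.
Qed.

Lemma Im_clog (z : C) : 0 < ReC z -> - (pi / 2) < ImC (clog z) < pi / 2.
Proof.
move=> z0; have /andP[v1 v2] := Im_div_nrm z0; rewrite /=; apply/andP; split.
  by apply: asin_gtNpi2; rewrite v1 ltW.
by apply: asin_ltpi2; rewrite v2 ltW.
Qed.

Lemma cts_pair (T : topologicalType) (f g : T -> R) (x : T) :
  {for x, continuous f} -> {for x, continuous g} ->
  {for x, continuous (fun t => (f t +i* g t)%C : C)}.
Proof.
move=> cf cg; have -> : (fun t => (f t +i* g t)%C : C) = (fun t => rc (f t) + 'i * rc (g t)).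
  by apply/funext => t; apply: C_eq; rewrite !ReImE /=; ring.
apply: ctsD; last (apply: ctsM; first exact: cts_cst);
  by apply: (@cts_comp _ _ _ _ (real_complex R : R -> C)) => //; apply: continuous_rc.
Qed.

Lemma cts_clog (z : C) : 0 < ReC z -> {for z, continuous clog}.
Proof.
move=> z0; have n0 := nrm_Re_gt0 z0; apply: cts_pair.
  apply: (@cts_comp _ _ _ (@nrm R C) (@ln R)); first exact: continuous_nrm.
  exact: continuous_ln.
apply: (@cts_comp _ _ _ (fun t : C => ImC t / nrm t) (@asin R)).
  have c1 : {for z, continuous (@complex.Im R : C -> R)} by apply: continuous_Im.
  have c2 : {for z, continuous (fun t : C => (nrm t)^-1)}.
    have n1 : nrm z != 0 by rewrite gt_eqF.
    have c0 : {for z, continuous (fun t : C => nrm t)} by apply: continuous_nrm.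
    exact: (cvgV n1 c0).
  exact: (cvgM c1 c2).
exact: continuous_asin (Im_div_nrm z0).
Qed.

End ComplexExponential.

Section DifferentiableRules.
Variables (R : realType) (V : normedModType (Cplx R)).
Local Notation C := (Cplx R).
Implicit Types (f g : V -> C).

Lemma holD f g x : differentiable f x -> differentiable g x ->
  differentiable (fun t => f t + g t) x.
Proof. exact: differentiableD. Qed.

Lemma holB f g x : differentiable f x -> differentiable g x ->
  differentiable (fun t => f t - g t) x.
Proof. exact: differentiableB. Qed.

Lemma holN f x : differentiable f x -> differentiable (fun t => - f t) x.
Proof. exact: differentiableN. Qed.

Lemma holM f g x : differentiable f x -> differentiable g x ->
  differentiable (fun t => f t * g t) x.
Proof. exact: differentiableM. Qed.

Lemma holV f x : f x != 0 -> differentiable f x -> differentiable (fun t => (f t)^-1) x.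
Proof. by move=> fx df; apply: differentiableV. Qed.

Lemma hol_div f g x : g x != 0 -> differentiable f x -> differentiable g x ->
  differentiable (fun t => f t / g t) x.
Proof. by move=> gx df dg; apply: holM => //; apply: holV. Qed.

Lemma hol_cst (k : C) x : differentiable (fun _ : V => k) x.
Proof. exact: differentiable_cst. Qed.

Lemma holX f n x : differentiable f x -> differentiable (fun t => f t ^+ n) x.
Proof.
move=> df; elim: n => [|n IH]; first exact: differentiable_cst.
have -> : (fun t => f t ^+ n.+1) = (fun t => f t * f t ^+ n) by apply/funext => t; rewrite exprS.
exact: holM.
Qed.

Lemma hol_sum (I : Type) (r : seq I) (P : pred I) (F : I -> V -> C) x :
  (forall i, P i -> differentiable (F i) x) -> differentiable (fun t => \sum_(i <- r | P i) F i t) x.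
Proof.
move=> dF; elim: r => [|i r IH].
  have -> : (fun t => \sum_(i <- [::] | P i) F i t) = (fun=> 0) by apply/funext => t; rewrite big_nil.
  exact: hol_cst.
case Pi : (P i).
  have -> : (fun t => \sum_(i <- i :: r | P i) F i t) = (fun t => F i t + \sum_(i <- r | P i) F i t).
    by apply/funext => t; rewrite big_cons Pi.
  by apply: holD => //; apply: dF.
have -> // : (fun t => \sum_(i <- i :: r | P i) F i t) = (fun t => \sum_(i <- r | P i) F i t).
by apply/funext => t; rewrite big_cons Pi.
Qed.

Lemma hol_prod (I : Type) (r : seq I) (P : pred I) (F : I -> V -> C) x :
  (forall i, P i -> differentiable (F i) x) -> differentiable (fun t => \prod_(i <- r | P i) F i t) x.
Proof.
move=> dF; elim: r => [|i r IH].
  have -> : (fun t => \prod_(i <- [::] | P i) F i t) = (fun=> 1) by apply/funext => t; rewrite big_nil.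
  exact: hol_cst.
case Pi : (P i).
  have -> : (fun t => \prod_(i <- i :: r | P i) F i t) = (fun t => F i t * \prod_(i <- r | P i) F i t).
    by apply/funext => t; rewrite big_cons Pi.
  by apply: holM => //; apply: dF.
have -> // : (fun t => \prod_(i <- i :: r | P i) F i t) = (fun t => \prod_(i <- r | P i) F i t).
by apply/funext => t; rewrite big_cons Pi.
Qed.

Lemma hol_id (W : normedModType C) (x : W) : differentiable (fun t : W => t) x.
Proof. exact: ex_diff. Qed.

Lemma hol_comp (U W : normedModType C) (g : U -> V) (h : V -> W) x :
  differentiable g x -> differentiable h (g x) -> differentiable (fun t => h (g t)) x.
Proof. exact: differentiable_comp. Qed.

Lemma hol_near (W : normedModType C) (f g : V -> W) x : (\forall t \near x, f t = g t) ->
  differentiable f x -> differentiable g x.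
Proof.
move=> fg df; have [] // := @expand_differentiable _ _ _ g x ('d f x) _ _.
  exact: diff_continuous.
move=> e e0; have [d1 d10 H1] := differentiable_expand df e0.
have /nbhs_nrmP [d2 d20 H2] := fg.
exists (Num.min d1 d2); first by rewrite lt_min d10.
move=> h; rewrite lt_min => /andP[h1 h2]; have := H1 h h1.
by rewrite (nbhs_singleton fg) H2 // addrAC subrr add0r.
Qed.

End DifferentiableRules.

Section PowerBound.
Variable R : realType.

(** If a > b > 0, then (a / b)^n exceeds n (a / b - 1) and is unbounded. This is the device that
    removes the constant [K] from estimates valid for all powers of a function. *)
Lemma pow_bound_le (a b K : R) : 0 <= a -> 0 <= b ->
  (forall n, a ^+ n <= K * b ^+ n) -> a <= b.
Proof.
move=> a0; rewrite le_eqVlt => /predU1P[<-|b0] H.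
  by have := H 1; rewrite !expr1 mulr0.
rewrite leNgt; apply/negP => ab.
have q1 : 0 < a / b - 1 by rewrite subr_gt0 ltr_pdivlMr // mul1r.
have q n : n%:R * (a / b - 1) <= K.
  have : (a / b) ^+ n <= K by rewrite expr_div_n ler_pdivrMr ?exprn_gt0.
  apply: le_trans; elim: n => [|n IH]; first by rewrite mul0r.
  rewrite exprS -natr1 mulrDl mul1r; set x := a / b in q1 IH *.
  have : n%:R * (x - 1) <= x * x ^+ n - x ^+ n + (x ^+ n - (x - 1)) - 0.
    have : 1 <= x ^+ n by rewrite exprn_ege1 //; lra.
    have : 0 <= (x - 1) * (x ^+ n - 1).
      by rewrite mulr_ge0 ?subr_ge0 ?exprn_ege1 //; lra.
    lra.
  by rewrite subr0; lra.
have : K < (Num.bound (K / (a / b - 1)))%:R * (a / b - 1).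
  rewrite -ltr_pdivrMr //; apply: (le_lt_trans (ler_norm _)).
  by have := archi_boundP (normr_ge0 (K / (a / b - 1))); rewrite /Num.bound normr_id.
by rewrite ltNge q.
Qed.

End PowerBound.

(** * Cauchy's formula on circles around the origin *)

Section CauchyFormula.
Variable R : realType.
Local Notation C := (Cplx R).
Local Notation cexp := (@cexp R).
Local Notation pi := (@pi R).

(** The exponential wraps the rectangle onto an annulus: the horizontal sides cancel by periodicity,
    and the vertical sides are the two boundary circles. *)
Lemma log_rect (F : C -> C) (a1 a2 : R) : a1 <= a2 ->
  (forall t : R, F (t +i* pi)%C = F (t +i* - pi)%C) ->
  rectint F a1 (- pi) (a2 - a1) (pi + pi) = 0 ->
  cint (fun t => F (a2 +i* t)%C) (- pi) pi = cint (fun t => F (a1 +i* t)%C) (- pi) pi.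
Proof.
move=> a12 per; rewrite /rectint.
have -> : - pi + (pi + pi) = pi by ring.
have -> : a1 + (a2 - a1) = a2 by ring.
rewrite (@eq_cint _ a1 a2 (fun t => F (t +i* pi)%C) (fun t => F (t +i* - pi)%C)) // subrr add0r.
move/eqP; rewrite mulf_eq0 -nrm_eq0 nrm_i oner_eq0 /= subr_eq0 => /eqP.
by [].
Qed.

Definition circle (r t : R) : C := cexp (ln r +i* t)%C.

Lemma nrm_circle (r t : R) : 0 < r -> nrm (circle r t) = r.
Proof. by move=> r0; rewrite nrm_cexp /= lnK. Qed.

Lemma cts_circle (r t : R) : {for t, continuous (circle r)}.
Proof.
apply: (@cts_comp _ _ _ (fun t => (ln r +i* t)%C : C) cexp); last exact: cts_cexp.
by apply: cts_pair; [exact: cvg_cst|exact: cvg_id].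
Qed.

Lemma circle_period (x : R) : cexp (x +i* pi)%C = cexp (x +i* - pi)%C.
Proof. by apply: C_eq; rewrite ?Re_cexp ?Im_cexp /= ?cosN ?sinN ?cospi ?sinpi ?oppr0. Qed.

Lemma sub_neq0_nrm (x z : C) : nrm z < nrm x -> x - z != 0.
Proof. by move=> zx; rewrite subr_eq0; apply: contraTneq zx => ->; rewrite ltxx. Qed.

Lemma pi2_gt0 : 0 < pi + pi. Proof. by have := @pi_gt0 R; lra. Qed.

Lemma Npi_le_pi : - pi <= pi. Proof. by have := @pi_gt0 R; lra. Qed.

Lemma eq0_eps (V : normedZmodType C) (x : V) : (forall e : R, 0 < e -> nrm x <= e) -> x = 0.
Proof.
move=> H; apply/eqP; rewrite -nrm_eq0 eq_le nrm_ge0 andbT.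
by apply/ler_addgt0Pr => e e0; rewrite add0r; apply: H.
Qed.

(** The integral does not depend on the radius as long as the circle encloses [z], and it tends to 0
    as the radius grows. *)
Lemma cint_kernel0 (z : C) (r : R) : 0 < r -> nrm z < r ->
  cint (fun t => z / (circle r t - z)) (- pi) pi = 0.
Proof.
move=> r0 zr; apply: eq0_eps => e e0.
pose K (w : C) : C := z / (cexp w - z).
have [A [Ar A1]] : exists A, r <= A /\ 2 * (nrm z / (A - nrm z)) * (pi + pi) <= e.
  have p2 := pi2_gt0; have z0 := nrm_ge0 z.
  pose q := 2 * nrm z * (pi + pi) / e.
  have q0 : 0 <= q by rewrite divr_ge0 ?mulr_ge0 //; lra.
  exists (r + nrm z + q); split; first lra.
  have -> : 2 * (nrm z / (r + nrm z + q - nrm z)) * (pi + pi) = q * e / (r + q).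
    have qe : q * e = 2 * nrm z * (pi + pi) by rewrite /q divfK // gt_eqF.
    by rewrite qe; field; rewrite gt_eqF //; lra.
  rewrite ler_pdivrMr; last lra.
  by rewrite mulrC ler_wpM2l ?(ltW e0) //; lra.
have A0 : 0 < A by lra.
have rA : ln r <= ln A by rewrite ler_ln.
have E : cint (fun t => K (ln A +i* t)%C) (- pi) pi = cint (fun t => K (ln r +i* t)%C) (- pi) pi.
  apply: log_rect => //; first by move=> t; rewrite /K circle_period.
  apply: goursat; [lra|have := pi2_gt0; lra|] => w [/andP[w1 _] _].
  have n : cexp w - z != 0.
    apply: sub_neq0_nrm; rewrite nrm_cexp; apply: (lt_le_trans zr).
    by rewrite -[r]lnK // ler_expR.
  have dz : differentiable (fun _ : C => z) w := hol_cst z w.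
  by apply: (hol_div _ dz (holB (differentiable_cexp w).1 dz)); exact: n.
have -> : cint (fun t => z / (circle r t - z)) (- pi) pi = cint (fun t => K (ln A +i* t)%C) (- pi) pi.
  exact: (esym E).
have zA : nrm z < A := lt_le_trans zr Ar.
have zA' : 0 < A - nrm z by rewrite subr_gt0.
rewrite /K; clear E rA K.
have n t : circle A t - z != 0 by apply: sub_neq0_nrm; rewrite (nrm_circle _ A0).
have B : nrm (cint (fun t => z / (circle A t - z)) (- pi) pi) <= 2 * (nrm z / (A - nrm z)) * (pi - - pi).
  apply: (cint_bound Npi_le_pi) => t _.
  - apply: ctsM; first exact: cts_cst.
    by apply: ctsV; [exact: n|apply: ctsB; [exact: cts_circle|exact: cts_cst]].
  - rewrite nrmM nrmV; apply: ler_wpM2l; first exact: nrm_ge0.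
    rewrite lef_pV2 ?posrE ?nrm_gt0 ?n //.
    by apply: le_trans (lerB_nrm _ _); rewrite (nrm_circle _ A0).
by rewrite opprK in B; exact: le_trans B A1.
Qed.

Lemma cint_kernel (z : C) (r : R) : 0 < r -> nrm z < r ->
  cint (fun t => circle r t / (circle r t - z)) (- pi) pi = rc (pi + pi).
Proof.
move=> r0 zr.
have n t : circle r t - z != 0 by apply: sub_neq0_nrm; rewrite nrm_circle.
rewrite (@eq_cint _ _ _ _ (fun t => 1 + z / (circle r t - z))); last first.
  by move=> t _; rewrite -{1}(subrK z (circle r t)) mulrDl divff.
have ck : continuous_on (- pi) pi (fun t => z / (circle r t - z)).
  move=> t _; apply: ctsM; first exact: cts_cst.
  by apply: ctsV; [exact: n|apply: ctsB; [exact: cts_circle|exact: cts_cst]].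
rewrite (cintD (@continuous_on_cst _ _ _ 1) ck) (cint_kernel0 r0 zr) cint_cst ?Npi_le_pi //.
by rewrite addr0 mulr1 opprK.
Qed.

Section Disc.
Variables (u : C -> C) (r0 : R).
Hypothesis u_cts : forall z : C, nrm z < r0 -> {for z, continuous u}.
Hypothesis u_hol : forall z : C, nrm z < r0 -> z != 0 -> differentiable u z.

Lemma cts_u_circle (r t : R) : 0 < r -> r < r0 -> {for t, continuous (fun t => u (circle r t))}.
Proof.
by move=> rp rr; apply: (cts_comp (@cts_circle r t)); apply: u_cts; rewrite nrm_circle.
Qed.

Lemma cts_slope (s : R) (z : C) (t : R) : 0 < s -> s < r0 -> s < nrm z ->
  {for t, continuous (fun t => (u (circle s t) - u z) * circle s t / (circle s t - z))}.
Proof.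
move=> s0 sr sz; apply: ctsM.
  by apply: ctsM; [apply: ctsB; [exact: cts_u_circle|exact: cts_cst]|exact: cts_circle].
apply: ctsV; last by apply: ctsB; [exact: cts_circle|exact: cts_cst].
by rewrite -opprB oppr_eq0; apply: sub_neq0_nrm; rewrite nrm_circle.
Qed.

(** Pulled back by [cexp], the integrand is bounded near its only singularity [ze], so its integral
    over vertical segments does not depend on the abscissa; far to the left the circle shrinks to 0
    and the integral with it. As [cexp] omits 0, continuity of [u] at 0 and holomorphy elsewhere
    suffice, which makes [removable0] a corollary. *)
Lemma cauchy_slit0 (r : R) (z ze : C) : 0 < r -> r < r0 -> nrm z < r -> cexp ze = z -> - pi < ImC ze < pi ->
  cint (fun t => (u (circle r t) - u z) * circle r t / (circle r t - z)) (- pi) pi = 0.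
Proof.
move=> rp rr zr zez /andP[ze1 ze2].
have z0 : z != 0 by rewrite -zez cexp_neq0.
have nz0 : 0 < nrm z by rewrite nrm_gt0.
have zr0 : nrm z < r0 by lra.
pose Phi (w : C) : C := (u (cexp w) - u z) * cexp w / (cexp w - z).
have Rze : ReC ze = ln (nrm z) by rewrite -zez nrm_cexp expRK.
have p0 := @pi_gt0 R.
have dPhi (w : C) : ReC w <= ln r -> cexp w != z -> differentiable Phi w.
  move=> wr wz; have dc := (differentiable_cexp w).1.
  have du : differentiable u (cexp w).
    apply: u_hol; last exact: cexp_neq0.
    by rewrite nrm_cexp; apply: le_lt_trans rr; rewrite -[r]lnK // ler_expR.
  have dz (k : C) : differentiable (fun=> k) w := hol_cst k w.
  have d1 := holM (holB (hol_comp dc du) (dz (u z))) dc.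
  apply: (hol_div _ d1 (holB dc (dz z))); by rewrite subr_eq0.
(* Two logarithms of [z] differ by 2 pi k in imaginary part; [ze] is strictly inside the strip, so
   |k| < 1 even for [w] on its edge. *)
have uniq (w : C) : - pi <= ImC w <= pi -> cexp w = z -> w = ze.
  move=> /andP[w1 w2]; rewrite -zez => /cexp_inj_mod [k kE].
  have : ImC w = ImC ze + (pi + pi) * k%:~R.
    rewrite kE cImD; congr (_ + _); rewrite /two_i_pi -mulrzAr.
    have -> : rc (pi *+ 2) *~ k = rc (pi *+ 2 *~ k) :> C by rewrite rmorphMz.
    by rewrite !ReImE -mulrzr mulr2n; ring.
  move=> E; suff k0 : k = 0 by rewrite kE k0 mulr0z addr0.
  have k1 : (k%:~R : R) < 1 by rewrite -(ltr_pM2l pi2_gt0); lra.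
  have k2 : (-1 : R) < k%:~R by rewrite -(ltr_pM2l pi2_gt0); lra.
  have k1' : k < 1 by move: k1; rewrite -[1]/(1%:~R) ltr_int.
  have k2' : -1 < k by move: k2; rewrite -[-1]/((-1)%:~R) ltr_int.
  by move: k1' k2'; case: (k) => [[|n]|[|n]].
(* Near [ze] the integrand is a difference quotient of [u] at [z] times [cexp w]; where the
   denominator vanishes, the convention on inverses makes it 0. *)
have [d [M [d0 HM]]] : exists d M, 0 < d /\ forall w : C, w != ze -> nrm (w - ze) < d -> nrm (Phi w) <= M.
  have [d1 d10 H1] := differentiable1_expand (u_hol zr0 z0) ltr01.
  have /continuous_nrmP /(_ (Num.min d1 1)) [|d d0 Hd] := @cts_cexp R ze.
    by rewrite lt_min d10 ltr01.
  exists d, ((1 + nrm ('D_1 u z)) * (nrm z + 1)); split => // w wn wd.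
  have := Hd w wd; rewrite zez lt_min => /andP[w1 w2].
  have := H1 (cexp w - z) w1; rewrite subrKC mul1r /GRing.scale /= => B.
  have [zz|nz] := eqVneq (cexp w - z) 0.
    by rewrite /Phi zz invr0 mulr0 nrm0 mulr_ge0 ?addr_ge0 ?nrm_ge0.
  rewrite /Phi (nrmM (_ * _)) (nrmM (_ - _)) nrmV ler_pdivrMr ?nrm_gt0 //.
  have : nrm (u (cexp w) - u z) <= (1 + nrm ('D_1 u z)) * nrm (cexp w - z).
    have := ler_nrmD (u (cexp w) - u z - (cexp w - z) * 'D_1 u z) ((cexp w - z) * 'D_1 u z).
    rewrite subrK nrmM; lra.
  have : nrm (cexp w) <= nrm z + 1.
    by have := lerB_nrm (cexp w) z; lra.
  move=> C1 C2; have := ler_pM (nrm_ge0 _) (nrm_ge0 _) C2 C1.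
  by rewrite mulrAC.
have E (a : R) : a < ln (nrm z) -> cint (fun t => Phi (ln r +i* t)%C) (- pi) pi = cint (fun t => Phi (a +i* t)%C) (- pi) pi.
  move=> az; have zr' : ln (nrm z) < ln r by rewrite ltr_ln.
  apply: log_rect; [lra|by move=> t; rewrite /Phi circle_period|].
  apply: (goursat_punctured _ _ _ d0 HM).
  - by rewrite Rze; apply/andP; split; lra.
  - by apply/andP; split; lra.
  - move=> w [/andP[w1 w2] w34] wn; apply: dPhi; first lra.
    have piE : - pi + (pi + pi) = pi by ring.
    by rewrite piE in w34; apply: contra_neq wn; apply: uniq.
have -> : cint (fun t => (u (circle r t) - u z) * circle r t / (circle r t - z)) (- pi) pi =
   cint (fun t => Phi (ln r +i* t)%C) (- pi) pi by [].
apply: eq0_eps => e e0.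
have r00 : 0 < r0 by lra.
have /continuous_nrmP /(_ 1 ltr01) [d1 d10 H1] : {for 0, continuous u} by apply: u_cts; rewrite nrm0.
pose B := 1 + nrm (u 0 - u z); have B0 : 0 < B by rewrite ltr_pwDl ?nrm_ge0.
pose q := nrm z * e / (4 * B * (pi + pi) + e).
have P0 := pi2_gt0.
have dq : 0 < 4 * B * (pi + pi) + e by rewrite addr_gt0 // !mulr_gt0.
have q0 : 0 < q by rewrite divr_gt0 // mulr_gt0.
(* The shrunken radius: below [d1] to bound [u] by continuity at 0, at most |z| / 2 to stay away
   from [z], and at most [q] to make the final bound at most [e]. *)
pose s := Num.min (Num.min (d1 / 2) q) (nrm z / 2).
have s0 : 0 < s by rewrite !lt_min q0 !divr_gt0.
have sd1 : s < d1 by rewrite !gt_min; apply/orP; left; apply/orP; left; lra.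
have sq : s <= q by rewrite !ge_min lexx orbT.
have sz : s <= nrm z / 2 by rewrite ge_min lexx orbT.
have ls : ln s < ln (nrm z) by rewrite ltr_ln ?posrE //; lra.
rewrite (E _ ls).
apply: (le_trans (@cint_bound _ _ _ _ (B * s / (nrm z - s)) Npi_le_pi _ _)).
- move=> t _; apply: cts_slope => //; lra.
- move=> t _; rewrite /Phi -/(circle s t) (nrmM (_ * _)) (nrmM (_ - _)) nrmV nrm_circle //.
  have n : circle s t - z != 0 by rewrite -opprB oppr_eq0; apply: sub_neq0_nrm; rewrite nrm_circle //; lra.
  have n1 : nrm z - s <= nrm (circle s t - z) by rewrite nrmB (le_trans _ (lerB_nrm _ _)) // nrm_circle.
  have zs : 0 < nrm z - s by lra.
  have uB : nrm (u (circle s t) - u z) <= B.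
    have := ler_nrmBD (u (circle s t)) (u 0) (u z).
    have := H1 (circle s t); rewrite subr0 nrm_circle // => /(_ sd1); rewrite /B; lra.
  apply: ler_pM; rewrite ?mulr_ge0 ?invr_ge0 ?nrm_ge0 //; first lra.
    by apply: ler_pM; rewrite ?nrm_ge0 //; lra.
  by rewrite lef_pV2 ?posrE ?nrm_gt0.
have -> : 2 * (B * s / (nrm z - s)) * (pi - - pi) = s * (2 * B * (pi + pi)) / (nrm z - s).
  by field; rewrite gt_eqF //; lra.
rewrite ler_pdivrMr; last lra.
have qE : q * (4 * B * (pi + pi) + e) = nrm z * e by rewrite /q divfK // gt_eqF.
have : s * (4 * B * (pi + pi) + e) <= nrm z * e by rewrite -qE ler_wpM2r // ltW.
have BP : 0 < s * (B * (pi + pi)) by rewrite !mulr_gt0.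
have es : e * s <= e * (nrm z / 2) by rewrite ler_wpM2l // ltW.
clearbody s B; clear -BP es; lra.
Qed.

Lemma circle_bound (r : R) : 0 < r -> r < r0 ->
  exists M, forall t, - pi <= t <= pi -> nrm (u (circle r t)) <= M.
Proof.
move=> rp rr.
have c : {within `[- pi, pi], continuous (fun t => nrm (u (circle r t)))}.
  apply: within_itv_continuous => t _.
  apply: (@cts_comp _ _ _ (fun t => u (circle r t)) (@nrm R C)); last exact: continuous_nrm.
  exact: cts_u_circle.
have [m _ Hm] := EVT_max Npi_le_pi c.
by exists (nrm (u (circle r m))) => t tI; apply: Hm; rewrite in_itv.
Qed.

Definition cauchy_transform (r : R) (z : C) : C :=
  cint (fun t => u (circle r t) * circle r t / (circle r t - z)) (- pi) pi.

Lemma cts_num (r : R) (t : R) : 0 < r -> r < r0 ->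
  {for t, continuous (fun t => u (circle r t) * circle r t)}.
Proof. by move=> rp rr; apply: ctsM; [exact: cts_u_circle|exact: cts_circle]. Qed.

Lemma circle_sub_neq0 (r t : R) (z : C) : 0 < r -> nrm z < r -> circle r t - z != 0.
Proof. by move=> rp zr; apply: sub_neq0_nrm; rewrite nrm_circle. Qed.

Lemma cts_cauchy (r : R) (z : C) (t : R) : 0 < r -> r < r0 -> nrm z < r ->
  {for t, continuous (fun t => u (circle r t) * circle r t / (circle r t - z))}.
Proof.
move=> rp rr zr; apply: ctsM; first exact: cts_num.
by apply: ctsV; [exact: circle_sub_neq0|apply: ctsB; [exact: cts_circle|exact: cts_cst]].
Qed.

Lemma cauchy_slit (r : R) (z ze : C) : 0 < r -> r < r0 -> nrm z < r -> cexp ze = z -> - pi < ImC ze < pi ->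
  cauchy_transform r z = rc (pi + pi) * u z.
Proof.
move=> rp rr zr zez ze1; have H := cauchy_slit0 rp rr zr zez ze1.
have c1 (t : R) : {for t, continuous (fun t => circle r t / (circle r t - z))}.
  apply: ctsM; first exact: cts_circle.
  by apply: ctsV; [exact: circle_sub_neq0|apply: ctsB; [exact: cts_circle|exact: cts_cst]].
rewrite -(cint_kernel rp zr) mulrC -cintZ; last by move=> t _; apply: c1.
have cA : continuous_on (- pi) pi (fun t => u (circle r t) * circle r t / (circle r t - z)).
  by move=> t _; apply: cts_cauchy.
have cB : continuous_on (- pi) pi (fun t => u z * (circle r t / (circle r t - z))).
  by apply: continuous_on_scale => t _; apply: c1.
apply/eqP; rewrite -subr_eq0 -(cintB cA cB) -H; apply/eqP; apply: eq_cint => t _.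
by rewrite !mulrBl -!mulrA.
Qed.

Lemma expand_sq_differentiable (V : normedModType C) (f : C -> V) (z : C) (D : V) (K d : R) : 0 < d ->
  (forall h, nrm h < d -> nrm (f (z + h) - f z - h *: D) <= K * nrm h ^+ 2) ->
  differentiable f z /\ 'D_1 f z = D.
Proof.
move=> d0 H; apply: expand1_differentiable => e e0.
have k0 : 0 < `|K| + 1 by rewrite ltr_wpDl.
exists (Num.min d (e / (`|K| + 1))); first by rewrite lt_min d0 divr_gt0.
move=> h; rewrite lt_min => /andP[h1]; rewrite ltr_pdivlMr // => h2.
apply: (le_trans (H h h1)); rewrite expr2 mulrA ler_wpM2r ?nrm_ge0 //.
apply: le_trans (ltW h2); rewrite mulrC ler_wpM2l ?nrm_ge0 //.
by apply: (le_trans (ler_norm K)); rewrite lerDl.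
Qed.

(** No differentiation under the integral sign: by partial fractions the remainder is exactly h^2
    times the integral of a kernel that stays bounded while |h| < [p / 2]. *)
Lemma differentiable_cauchy_transform (r : R) (z : C) : 0 < r -> r < r0 -> nrm z < r ->
  differentiable (cauchy_transform r) z.
Proof.
move=> rp rr zr; have [M HM] := circle_bound rp rr.
pose D : C := cint (fun t => u (circle r t) * circle r t / ((circle r t - z) * (circle r t - z))) (- pi) pi.
pose p := r - nrm z; have p0 : 0 < p by rewrite subr_gt0.
have d0 : 0 < p / 2 by rewrite divr_gt0.
suff [] : differentiable (cauchy_transform r) z /\ 'D_1 (cauchy_transform r) z = D by [].
apply: (expand_sq_differentiable (K := 2 * (M * r / (p * p * (p / 2))) * (pi + pi)) d0) => h hd.
have M0 : 0 <= M by apply: le_trans (nrm_ge0 _) (HM 0 _); have := @pi_gt0 R; move=> ?; apply/andP; split; lra.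
have zh : nrm (z + h) < r by apply: (le_lt_trans (ler_nrmD _ _)); rewrite /p in hd; lra.
have n1 (t : R) : circle r t - z != 0 by apply: circle_sub_neq0.
have n2 (t : R) : circle r t - (z + h) != 0 by apply: circle_sub_neq0.
have cD (t : R) : {for t, continuous (fun t => u (circle r t) * circle r t / ((circle r t - z) * (circle r t - z)))}.
  apply: ctsM; first exact: cts_num.
  by apply: ctsV; [rewrite mulf_neq0|apply: ctsM; apply: ctsB; (exact: cts_circle || exact: cts_cst)].
have c1 (t : R) := @cts_cauchy r z t rp rr zr; have c2 (t : R) := @cts_cauchy r (z + h) t rp rr zh.
have -> : cauchy_transform r (z + h) - cauchy_transform r z - h *: D =
   cint (fun t => h ^+ 2 * (u (circle r t) * circle r t / ((circle r t - z) * (circle r t - z) * (circle r t - (z + h))))) (- pi) pi.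
  rewrite /cauchy_transform /D /GRing.scale /= -cintB; [|by move=> t _; exact: c2|by move=> t _; exact: c1].
  rewrite -cintZ; last by move=> t _; exact: cD.
  rewrite -cintB; last 2 first.
  - by move=> t _; apply: ctsB; [exact: c2|exact: c1].
  - by move=> t _; apply: ctsM; [exact: cts_cst|exact: cD].
  by apply: eq_cint => t _; field; rewrite n1 n2.
apply: (le_trans (@cint_bound _ _ _ _ (nrm h ^+ 2 * (M * r / (p * p * (p / 2)))) Npi_le_pi _ _)).
- move=> t _; apply: ctsM; first exact: cts_cst.
  apply: ctsM; first exact: cts_num.
  apply: ctsV; first by rewrite !mulf_neq0.
  have k (x : C) : {for t, continuous (fun t => circle r t - x)}.
    by apply: ctsB; [exact: cts_circle|exact: cts_cst].
  exact: (ctsM (ctsM (k z) (k z)) (k (z + h))).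
- move=> t tI; rewrite nrmM nrmX ler_wpM2l ?exprn_ge0 ?nrm_ge0 // nrmM nrmV.
  have q1 : p <= nrm (circle r t - z) by rewrite (le_trans _ (lerB_nrm _ _)) // nrm_circle.
  have q2 : p / 2 <= nrm (circle r t - (z + h)).
    apply: (le_trans _ (lerB_nrm _ _)); rewrite nrm_circle //; have := ler_nrmD z h.
    by rewrite /p in hd *; lra.
  apply: ler_pM; rewrite ?invr_ge0 ?nrm_ge0 //.
    by rewrite nrmM nrm_circle // ler_wpM2r ?HM // ltW.
  rewrite lef_pV2 ?posrE ?nrm_gt0 ?mulf_neq0 ?mulr_gt0 // !nrmM.
  by rewrite !ler_pM // ?mulr_ge0 // ltW.
- by rewrite opprK le_eqVlt; apply/orP; left; apply/eqP; ring.
Qed.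

(** Only 0 and the negative reals lack a logarithm inside the open strip. Both sides are continuous,
    and [z + 'i * rc t] has such a logarithm for small t > 0. *)
Theorem cauchy_formula (r : R) (z : C) : 0 < r -> r < r0 -> nrm z < r ->
  cauchy_transform r z = rc (pi + pi) * u z.
Proof.
move=> rp rr zr.
have [[ze zez ze1]|nze] := pselect (exists2 ze, cexp ze = z & - pi < ImC ze < pi).
  exact: cauchy_slit zez ze1.
have zI : ImC z = 0.
  have [->//|z0] := eqVneq z 0.
  have [w wz [/andP[w1 w2] w3]] := cexp_surj z0.
  have [|wp] := eqVneq (ImC w) pi; first by case/w3.
  by exfalso; apply: nze; exists w => //; rewrite w1 lt_neqAle wp w2.
apply/eqP; rewrite -subr_eq0; apply/eqP; apply: eq0_eps => e e0.
have cG : {for z, continuous (fun z => cauchy_transform r z - rc (pi + pi) * u z)}.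
  apply: ctsB; first by apply: differentiable_cts; apply: differentiable_cauchy_transform.
  by apply: ctsM; [exact: cts_cst|apply: u_cts; lra].
have /continuous_nrmP /(_ e e0) [d d0 H] := cG.
pose t := Num.min (d / 2) ((r - nrm z) / 2).
have t0 : 0 < t by rewrite lt_min !divr_gt0 // subr_gt0.
have td : t < d by rewrite gt_min; apply/orP; left; lra.
have tr : t < r - nrm z by rewrite gt_min; apply/orP; right; lra.
pose w := z + 'i * rc t.
have wz : nrm (w - z) = t by rewrite /w addrC addKr nrmM nrm_i mul1r nrm_rc gtr0_norm.
have := H w; rewrite wz => /(_ td).
have wr : nrm w < r by have := lerB_nrm w z; rewrite wz; lra.
have Iw : ImC w = t by rewrite /w !ReImE zI; ring.
have w0 : w != 0 by apply/eqP => w0; rewrite w0 /= in Iw; rewrite -Iw ltxx in t0.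
have [we wew [/andP[w1 w2] w3]] := cexp_surj w0.
have wep : ImC we != pi by apply/eqP => /w3 [Iw0 _]; rewrite Iw0 in Iw; rewrite -Iw ltxx in t0.
have wI : - pi < ImC we < pi by rewrite w1 lt_neqAle wep w2.
rewrite (cauchy_slit rp rr wr wew wI) subrr sub0r nrmN.
exact: ltW.
Qed.

Lemma removable0 : 0 < r0 -> differentiable u 0.
Proof.
move=> r00; pose r := r0 / 2; have rp : 0 < r by rewrite divr_gt0.
have rr : r < r0 by rewrite /r; lra.
have P0 : rc (pi + pi) != 0 :> C by rewrite -nrm_gt0 nrm_rc gtr0_norm ?pi2_gt0.
apply: (@hol_near _ _ C (fun z => (rc (pi + pi))^-1 * cauchy_transform r z)).
  apply/nbhs_nrmP; exists r => // z; rewrite subr0 => zr.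
  by rewrite cauchy_formula // mulKf.
apply: holM; first exact: hol_cst.
by apply: differentiable_cauchy_transform => //; rewrite nrm0.
Qed.

Lemma maximum_bound (r : R) (z : C) (M : R) : 0 < r -> r < r0 -> nrm z < r ->
  (forall x, nrm x = r -> nrm (u x) <= M) -> nrm (u z) <= 2 * (r / (r - nrm z)) * M.
Proof.
move=> rp rr zr HM; have zr' : 0 < r - nrm z by rewrite subr_gt0.
have := cauchy_formula rp rr zr => /(congr1 (@nrm R C)); rewrite nrmM nrm_rc (gtr0_norm pi2_gt0) => E.
rewrite -(ler_pM2l pi2_gt0) -E.
apply: (le_trans (@cint_bound _ _ _ _ (M * r / (r - nrm z)) Npi_le_pi _ _)).
- by move=> t _; apply: cts_cauchy.
- move=> t _; rewrite (nrmM (u _ * _)) (nrmM (u _)) nrmV nrm_circle //.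
  have uM : nrm (u (circle r t)) <= M by apply: HM; rewrite nrm_circle.
  apply: ler_pM; rewrite ?mulr_ge0 ?invr_ge0 ?nrm_ge0 ?(ltW rp) //.
    by rewrite ler_wpM2r // ltW.
  rewrite lef_pV2 ?posrE ?nrm_gt0 ?circle_sub_neq0 //.
  by rewrite (le_trans _ (lerB_nrm _ _)) // nrm_circle.
- rewrite opprK le_eqVlt; apply/orP; left; apply/eqP; field.
  by rewrite gt_eqF.
Qed.

End Disc.

End CauchyFormula.

(** * Maximum principle, Schwarz lemma, Cauchy estimates and identity theorem in one variable *)

Section OneComplexVariable.
Variable R : realType.
Local Notation C := (Cplx R).

Definition hol_disc (f : C -> C) (c : C) (r : R) :=
  forall z, nrm (z - c) < r -> differentiable f z.

Lemma hol_discS f c r c' r' : nrm (c' - c) + r' <= r -> hol_disc f c r -> hol_disc f c' r'.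
Proof.
move=> cr H z zr; apply: H; apply: lt_le_trans cr.
by apply: (le_lt_trans (ler_nrmBD z c' c)); rewrite addrC ltrD2l.
Qed.

Lemma hol_shift (V : normedModType C) (f : V -> C) (c z : V) :
  differentiable f (c + z) -> differentiable (fun z => f (c + z)) z.
Proof.
move=> df; apply: (@differentiable_comp _ V V C (fun z => c + z) f) => //.
Qed.

Lemma cts_shift (V : normedModType C) (f : V -> C) (c z : V) :
  {for (c + z), continuous f} -> {for z, continuous (fun z => f (c + z))}.
Proof.
move=> cf; apply: (@cts_comp _ _ _ (fun z => c + z) f) => //.
by apply: ctsD; [exact: cts_cst|exact: cts_id].
Qed.

Lemma removable (u : C -> C) (c : C) (r : R) : 0 < r ->
  (forall z, nrm (z - c) < r -> {for z, continuous u}) ->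
  (forall z, nrm (z - c) < r -> z != c -> differentiable u z) -> differentiable u c.
Proof.
move=> r0 cu du.
have cE (z : C) : c + z - c = z by rewrite addrC addKr.
have : differentiable (fun z => u (c + z)) 0.
  apply: (removable0 _ _ r0) => z zr.
    by apply: cts_shift; apply: cu; rewrite cE.
  by move=> z0; apply: hol_shift; apply: du; rewrite ?cE // -subr_eq0 cE.
move=> d; have := @hol_shift _ (fun z => u (c + z)) (- c) c.
have -> : (fun z => u (c + (- c + z))) = u by apply/funext => z; rewrite addNKr.
by apply; rewrite addNr.
Qed.

Lemma circle_surj (r : R) (x : C) : 0 < r -> nrm x = r -> exists2 t : R, - pi <= t <= pi & circle r t = x.
Proof.
move=> r0 xr; have x0 : x != 0 by rewrite -nrm_gt0 xr.
have [w wx [/andP[w1 w2] _]] := cexp_surj x0; exists (ImC w); first by rewrite w2 ltW.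
rewrite /circle -[RHS]wx; congr cexp; apply: C_eq => //=.
by rewrite -xr -wx nrm_cexp expRK.
Qed.

Lemma hol_cts f c r (z : C) : hol_disc f c r -> nrm (z - c) < r -> {for z, continuous f}.
Proof. by move=> H /H /differentiable_cts. Qed.

Lemma sphere_bound (f : C -> C) (c : C) (rho r : R) : 0 < rho -> rho < r -> hol_disc f c r ->
  exists2 M, 0 <= M & forall x, nrm (x - c) = rho -> nrm (f x) <= M.
Proof.
move=> rp rr hf.
have cE (z : C) : c + z - c = z by rewrite addrC addKr.
have cf (z : C) : nrm z < r -> {for z, continuous (fun z => f (c + z))}.
  by move=> zr; apply: cts_shift; apply: (hol_cts hf); rewrite cE.
have [M HM] := circle_bound cf rp rr.
exists M.
  by apply: (le_trans (nrm_ge0 _) (HM 0 _)); have := @pi_gt0 R; move=> ?; apply/andP; split; lra.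
move=> x xr; have [t tI tx] := circle_surj rp xr.
by have := HM t tI; rewrite tx subrKC.
Qed.

(** Cauchy's formula bounds |f(z)| by M up to a factor depending on [z]. The same factor serves for
    every power of f, and [pow_bound_le] removes it. *)
Lemma max_principle (f : C -> C) (c : C) (rho r M : R) : 0 < rho -> rho < r -> hol_disc f c r ->
  (forall x, nrm (x - c) = rho -> nrm (f x) <= M) -> forall z, nrm (z - c) <= rho -> nrm (f z) <= M.
Proof.
move=> rp rr hf HM z; rewrite le_eqVlt => /predU1P[/HM //|zr].
have cE (y : C) : c + y - c = y by rewrite addrC addKr.
apply: (@pow_bound_le _ _ _ (2 * (rho / (rho - nrm (z - c))))); first exact: nrm_ge0.
  apply: (le_trans (nrm_ge0 _)); apply: (HM (c + rc rho)).
  by rewrite cE nrm_rc gtr0_norm.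
move=> n.
have df (x : C) : nrm x < r -> differentiable (fun z => f (c + z) ^+ n) x.
  by move=> xr; apply: holX; apply: hol_shift; apply: hf; rewrite cE.
have := @maximum_bound R (fun z => f (c + z) ^+ n) r _ _ rho (z - c) (M ^+ n) rp rr zr.
rewrite subrKC nrmX; apply.
- by move=> x /df /differentiable_cts.
- by move=> x /df.
- by move=> x xr; rewrite nrmX lerXn2r ?nnegrE ?nrm_ge0 //; [apply: (le_trans (nrm_ge0 _))|];
    apply: (HM (c + x)); rewrite cE.
Qed.

(** The divided difference completed across [c]. It is holomorphic by removability, and it takes the
    place of power series in what follows: one application gives the Schwarz lemma, two give the
    second-order Taylor bound. *)
Definition slope (f : C -> C) (c z : C) : C :=
  if z == c then 'D_1 f c else (f z - f c) / (z - c).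

Lemma slopeE f c z : f z - f c = (z - c) * slope f c z.
Proof.
rewrite /slope; have [->|zc] := eqVneq z c; first by rewrite !subrr mul0r.
by rewrite mulrC divfK // subr_eq0.
Qed.

Lemma slope_cts f (c : C) : differentiable f c -> {for c, continuous (slope f c)}.
Proof.
move=> df; apply/continuous_nrmP => e e0.
have [d d0 H] := differentiable1_expand df (divr_gt0 e0 (ltr0Sn _ 1)).
exists d => // y yd; have [->|yc] := eqVneq y c; first by rewrite subrr nrm0.
have := H (y - c) yd; rewrite subrKC slopeE /GRing.scale /= -mulrBr nrmM.
have -> : slope f c c = 'D_1 f c by rewrite /slope eqxx.
rewrite mulrC ler_pM2r; last by rewrite nrm_gt0 subr_eq0.
by move/le_lt_trans; apply; lra.
Qed.

Lemma slope_hol_off f (c z : C) : z != c -> differentiable f z -> differentiable (slope f c) z.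
Proof.
move=> zc df; apply: (@hol_near _ _ _ (fun z => (f z - f c) / (z - c))).
  apply/nbhs_nrmP; exists (nrm (z - c)); first by rewrite nrm_gt0 subr_eq0.
  move=> y; rewrite /slope; case: eqVneq => // ->; by rewrite nrmB ltxx.
have dz : differentiable (fun z : C => z) z := hol_id z.
have k (a : C) : differentiable (fun _ : C => a) z := hol_cst a z.
by apply: (hol_div _ (holB df (k _)) (holB dz (k _))); rewrite subr_eq0.
Qed.

Lemma slope_hol f (c : C) (r : R) : 0 < r -> hol_disc f c r -> hol_disc (slope f c) c r.
Proof.
move=> r0 hf.
have off (z : C) : nrm (z - c) < r -> z != c -> differentiable (slope f c) z.
  by move=> zr zc; apply: slope_hol_off => //; apply: hf.
have cc : nrm (c - c) < r by rewrite subrr nrm0.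
have dc : differentiable (slope f c) c.
  apply: (removable r0 _ off) => z zr; have [->|zc] := eqVneq z c; first exact: slope_cts (hf c cc).
  exact: differentiable_cts (off z zr zc).
by move=> z zr; have [->|zc] := eqVneq z c; [exact: dc|apply: off].
Qed.

(** On a circle of radius rho < r the divided difference is at most M / rho; the maximum principle
    carries this inside, and rho tends to r. *)
Lemma slope_bound f (c z : C) (r M : R) : hol_disc f c r -> f c = 0 ->
  (forall z, nrm (z - c) < r -> nrm (f z) <= M) -> nrm (z - c) < r -> nrm (slope f c z) * r <= M.
Proof.
move=> hf f0 HM zr; have r0 : 0 < r by apply: le_lt_trans zr; apply: nrm_ge0.
have hs := slope_hol r0 hf.
apply/ler_addgt0Pr => e e0.
set N := nrm (slope f c z); have N0 : 0 <= N := nrm_ge0 _.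
(* Chosen so that replacing [rho] by [r] in [N * rho <= M] costs at most [e]. *)
pose m := Num.max (nrm (z - c)) (r - e / (N + 1)).
have n0 := nrm_ge0 (z - c).
have eN : 0 < e / (N + 1) by rewrite divr_gt0 //; lra.
have mr : m < r by rewrite gt_max zr /=; lra.
pose rho := (m + r) / 2.
have mz : nrm (z - c) <= m by rewrite le_max lexx.
have rp : 0 < rho by rewrite /rho; lra.
have rr : rho < r by rewrite /rho; lra.
have H : N <= M / rho.
  apply: (max_principle rp rr hs) => [x xr|]; last by rewrite /rho; lra.
  have xc : x != c by rewrite -subr_eq0 -nrm_gt0 xr.
  rewrite /slope (negPf xc) f0 subr0 nrmM nrmV xr ler_pM2r ?invr_gt0 //.
  by apply: HM; rewrite xr.
have : N * rho <= M by rewrite -ler_pdivlMr.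
have : N * (r - rho) <= e.
  have h : r - rho <= e / (N + 1).
    have : r - e / (N + 1) <= m by rewrite le_max lexx orbT.
    by rewrite /rho; lra.
  apply: (le_trans (ler_wpM2l N0 h)); rewrite mulrCA ler_piMr ?(ltW e0) //.
  by rewrite ler_pdivrMr ?mul1r; lra.
lra.
Qed.

Lemma schwarz f (c z : C) (r M : R) : hol_disc f c r -> f c = 0 ->
  (forall z, nrm (z - c) < r -> nrm (f z) <= M) -> nrm (z - c) < r ->
  nrm (f z) * r <= M * nrm (z - c).
Proof.
move=> hf f0 HM zr; have := slope_bound hf f0 HM zr.
have := slopeE f c z; rewrite f0 subr0 => ->; rewrite nrmM -mulrA mulrC => H.
by rewrite [leLHS]mulrC; apply: ler_wpM2r H; exact: nrm_ge0.
Qed.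

Lemma hol_disc_subc f c r k : hol_disc f c r -> hol_disc (fun z => f z - k) c r.
Proof. by move=> hf z /hf df; apply: holB => //; apply: hol_cst. Qed.

Lemma lipschitz_hol f (c z : C) (r M : R) : hol_disc f c r ->
  (forall z, nrm (z - c) < r -> nrm (f z) <= M) -> nrm (z - c) < r ->
  nrm (f z - f c) * r <= 2 * M * nrm (z - c).
Proof.
move=> hf HM zr; have r0 : 0 < r by apply: le_lt_trans zr; apply: nrm_ge0.
have := @schwarz (fun z => f z - f c) c z r (2 * M) (@hol_disc_subc _ _ _ _ hf); rewrite subrr.
move/(_ erefl) => H; apply: H => // x xr.
apply: (le_trans (ler_nrmB _ _)); rewrite mulr2n mulrDl mul1r; apply: lerD; apply: HM => //.
by rewrite subrr nrm0.
Qed.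

Lemma slope_subc f (c k : C) z : slope (fun z => f z - k) c z = slope f c z.
Proof.
rewrite /slope; case: eqP => _; last by congr (_ / _); ring.
rewrite /derive; have -> // : (fun h => h^-1 *: (((fun z => f z - k) \o shift c) (h *: (1 : C)) - (f c - k))) =
  (fun h => h^-1 *: ((f \o shift c) (h *: (1 : C)) - f c)).
by apply/funext => h; rewrite /= opprB addrA subrK.
Qed.

Lemma slope_bound2 f (c z : C) (r M : R) : hol_disc f c r ->
  (forall z, nrm (z - c) < r -> nrm (f z) <= M) -> nrm (z - c) < r -> nrm (slope f c z) * r <= 2 * M.
Proof.
move=> hf HM zr; have r0 : 0 < r by apply: le_lt_trans zr; apply: nrm_ge0.
have := @slope_bound (fun z => f z - f c) c z r (2 * M) (@hol_disc_subc _ _ _ _ hf); rewrite subrr slope_subc.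
move/(_ erefl) => H; apply: H => // x xr.
apply: (le_trans (ler_nrmB _ _)); rewrite mulr2n mulrDl mul1r; apply: lerD; apply: HM => //.
by rewrite subrr nrm0.
Qed.

Lemma derive_bound f (c : C) (r M : R) : 0 < r -> hol_disc f c r ->
  (forall z, nrm (z - c) < r -> nrm (f z) <= M) -> nrm ('D_1 f c) * r <= 2 * M.
Proof.
move=> r0 hf HM; have := slope_bound2 (z := c) hf HM.
by rewrite /slope eqxx subrr nrm0; apply.
Qed.

(** The remainder is (z - c) times the increment of [slope f c], itself bounded by [lipschitz_hol]
    for that holomorphic function. *)
Lemma taylor2 f (c z : C) (r M : R) : hol_disc f c r ->
  (forall z, nrm (z - c) < r -> nrm (f z) <= M) -> nrm (z - c) < r ->
  nrm (f z - f c - (z - c) * 'D_1 f c) <= 4 * M / r ^+ 2 * nrm (z - c) ^+ 2.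
Proof.
move=> hf HM zr; have r0 : 0 < r by apply: le_lt_trans zr; apply: nrm_ge0.
have hs := slope_hol r0 hf.
have sb (x : C) : nrm (x - c) < r -> nrm (slope f c x) <= 2 * M / r.
  by move=> xr; rewrite ler_pdivlMr //; apply: slope_bound2.
have := lipschitz_hol hs sb zr; rewrite {2}/slope eqxx -ler_pdivlMr // => H.
rewrite slopeE -mulrBr nrmM expr2 mulrA mulrC ler_wpM2r ?nrm_ge0 //.
apply: (le_trans H); rewrite le_eqVlt; apply/orP; left; apply/eqP; field.
by rewrite gt_eqF.
Qed.

(** Since f vanishes near [c], its quotient by (z - c)^n is holomorphic on the whole disc for every
    n; the maximum principle on a circle of radius rho then gives |f(z)| <= M (|z - c| / rho)^n. *)
Lemma identity_disc f (c z : C) (r e : R) : 0 < e -> hol_disc f c r ->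
  (forall z, nrm (z - c) < e -> f z = 0) -> nrm (z - c) < r -> f z = 0.
Proof.
move=> e0 hf f0 zr; have r0 : 0 < r by apply: le_lt_trans zr; apply: nrm_ge0.
have [ze|ez] := ltP (nrm (z - c)) e; first exact: f0.
have zc : 0 < nrm (z - c) by lra.
pose rho := (nrm (z - c) + r) / 2.
have rp : 0 < rho by rewrite /rho; lra.
have rr : rho < r by rewrite /rho; lra.
have zrho : nrm (z - c) < rho by rewrite /rho; lra.
have [M M0 HM] := sphere_bound rp rr hf.
have hn n : hol_disc (fun z => f z / (z - c) ^+ n) c r.
  move=> x xr; have [->|xc] := eqVneq x c.
    apply: (@hol_near _ _ _ (fun=> 0)); last exact: hol_cst.
    by apply/nbhs_nrmP; exists e => // y ye; rewrite f0 // mul0r.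
  have dx : differentiable (fun z : C => z) x := hol_id x.
  apply: (hol_div _ (hf x xr) (holX n (holB dx (hol_cst c x)))).
  by rewrite expf_neq0 // subr_eq0.
have bn n : nrm (f z) <= M * (nrm (z - c) / rho) ^+ n.
  have : nrm (f z / (z - c) ^+ n) <= M / rho ^+ n.
    apply: (max_principle rp rr (hn n)) => [x xr|]; last exact: ltW.
    by rewrite nrmM nrmV nrmX xr ler_pM2r ?invr_gt0 ?exprn_gt0 //; apply: HM.
  rewrite nrmM nrmV nrmX ler_pdivrMr ?exprn_gt0 // => /le_trans; apply.
  have E (k a b : R) : k / a ^+ n * b ^+ n = k * (b / a) ^+ n by rewrite exprMn exprVn mulrAC -mulrA.
  by rewrite E.
apply/eqP; rewrite -nrm_eq0; apply: contraT => fz.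
have fz0 : 0 < nrm (f z) by rewrite lt0r fz nrm_ge0.
have : 1 <= nrm (z - c) / rho.
  apply: (@pow_bound_le _ _ _ (M / nrm (f z))) => //; first by rewrite divr_ge0 ?ltW.
  by move=> n; rewrite expr1n mulrAC ler_pdivlMr // mul1r.
by rewrite ler_pdivlMr // mul1r leNgt zrho.
Qed.

(** The mean value theorem is one for real functions, so it is applied to the real and the imaginary
    part along the segment. *)
Lemma zero_diff_segment (V : normedModType C) (F : V -> C) (x v : V) :
  (forall t : R, 0 <= t <= 1 -> differentiable F (x + rc t *: v) /\ 'd F (x + rc t *: v) v = 0) ->
  F (x + v) = F x.
Proof.
move=> H.
pose phi (t : R) : C := F (x + rc t *: v).
have small (t : R) : 0 <= t <= 1 -> forall e : R, 0 < e -> exists2 d : R, 0 < d & forall h : R, `|h| < d ->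
    nrm (phi (t + h) - phi t) <= e * `|h|.
  move=> /H [df dv] e e0; have n1 : 0 < nrm v + 1 by rewrite ltr_wpDl ?nrm_ge0.
  have [d d0 Hd] := differentiable_expand df (divr_gt0 e0 n1).
  exists (d / (nrm v + 1)); first by rewrite divr_gt0.
  move=> h; rewrite ltr_pdivlMr // => hd.
  have hv : nrm (rc h *: v) = `|h| * nrm v by rewrite nrmZ nrm_rc.
  have hv' : nrm (rc h *: v) < d.
    by rewrite hv; apply: le_lt_trans hd; rewrite ler_wpM2l // lerDl.
  have := Hd _ hv'; rewrite linearZ /= dv scaler0 subr0 -addrA -scalerDl -rmorphD /= hv.
  move/le_trans; apply; rewrite -mulrA ler_wpM2l ?(ltW e0) // mulrC.
  rewrite ler_pdivrMr // ler_wpM2l // lerDl; exact: ler01.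
have part (g : C -> R) : (forall a b, `|g a - g b| <= nrm (a - b)) -> g (phi 1) = g (phi 0).
  move=> gl.
  have dg (t : R) : 0 <= t <= 1 -> is_derive t 1 (fun t => g (phi t)) 0.
    move=> t01.
    have cv : (fun h : R => h^-1 *: (((fun t => g (phi t)) \o shift t) (h *: (1 : R)) - g (phi t))) @ 0^' --> (0 : R).
      apply/cvgrPdist_lt => e e0; have [d d0 Hd] := small t t01 (e / 2) (divr_gt0 e0 (ltr0Sn _ 1)).
      rewrite near_withinE; apply/nbhs_ballP; exists d => //= h; rewrite /ball /= sub0r normrN => hd h0.
      have E : h *: (1 : R) = h := mulr1 h.
      rewrite sub0r normrN E /shift /= normrZ normfV mulrC ltr_pdivrMr ?normr_gt0 //.
      apply: (le_lt_trans (gl _ _)); rewrite [h + t]addrC; apply: (le_lt_trans (Hd h hd)).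
      by rewrite ltr_pM2r ?normr_gt0 //; lra.
    by split; [apply/cvg_ex; exists 0|exact: cvg_lim cv].
  have [|||c _] := @MVT_segment R (fun t => g (phi t)) (fun=> 0) 0 1.
  - exact: ler01.
  - by move=> t; rewrite in_itv /= => /andP[t0 t1]; apply: dg; rewrite !ltW.
  - apply: within_itv_continuous => t /dg [dt _].
    by apply: differentiable_continuous; apply/derivable1_diffP.
  by rewrite mul0r => /eqP; rewrite subr_eq0 => /eqP.
have := part (@complex.Re R) (fun a b => _); have := part (@complex.Im R) (fun a b => _).
rewrite /phi rmorph1 rmorph0 scale1r scale0r addr0 => HI HR.
by apply: C_eq; [apply: HR => a b; rewrite -cReB Re_le_nrm|apply: HI => a b; rewrite -cImB Im_le_nrm].
Qed.

End OneComplexVariable.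

(** * Several complex variables *)

Section SeveralComplexVariables.
Variable R : realType.
Local Notation C := (Cplx R).

Section Coordinates.
Variable n : nat.
Local Notation Cn := 'rV[C]_n.
Implicit Types x y h : Cn.

Lemma nrm_lt_coord x (e : R) : 0 < e -> nrm x < e <-> forall j, nrm (x 0 j) < e.
Proof.
move=> e0; have e0' : 0 < rc e :> C by rewrite ltcR.
have E : ball (0 : Cn) (rc e) x <-> nrm x < e.
  by rewrite mx_norm_ball /ball_ /= sub0r normrN nrmE ltcR.
have F : ball (0 : Cn) (rc e) x <-> forall j, nrm (x 0 j) < e.
  split=> [[_ H] j|H].
    by have := H 0 j; rewrite mxE /ball /= sub0r normrN nrmE ltcR.
  split=> // i j; rewrite mxE /ball /= sub0r normrN nrmE ltcR ord1; exact: H.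
by rewrite -E F.
Qed.

Lemma nrm_coord x j : nrm (x 0 j) <= nrm x.
Proof.
apply/ler_addgt0Pr => e e0.
have p : 0 < nrm x + e by rewrite ltr_wpDl // nrm_ge0.
by apply: ltW; move: j; apply/(nrm_lt_coord x p); rewrite ltrDl.
Qed.

Lemma nrm_le_coord x (e : R) : 0 <= e -> (forall j, nrm (x 0 j) <= e) -> nrm x <= e.
Proof.
move=> e0 H; apply/ler_addgt0Pr => d d0; apply: ltW.
apply/nrm_lt_coord; first by rewrite ltr_wpDl.
by move=> j; apply: (le_lt_trans (H j)); rewrite ltrDl.
Qed.

Local Notation e_ k := (delta_mx 0 k : Cn).

Lemma nrm_delta k : nrm (e_ k) <= 1.
Proof.
apply: nrm_le_coord => // j; rewrite mxE /=; case: (j == k) => /=; first by rewrite nrm1.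
by rewrite nrm0.
Qed.

Lemma nrm_scale_delta (t : C) k : nrm (t *: e_ k) <= nrm t.
Proof. by rewrite nrmZ ler_piMr ?nrm_ge0 // nrm_delta. Qed.

Lemma hol_coord x j : differentiable (fun y : Cn => y 0 j : C) x.
Proof. exact: differentiable_coord. Qed.

End Coordinates.

Lemma sq_small_differentiable (V W : normedModType C) (f : V -> W) (x : V) (K d : R) : 0 < d ->
  (forall h, nrm h < d -> nrm (f (x + h) - f x) <= K * nrm h ^+ 2) -> differentiable f x.
Proof.
move=> d0 H; have [||//] := @expand_differentiable R V W f x (\0 : {linear V -> W}).
  by move=> y; apply: cvg_cst.
move=> e e0; have k0 : 0 < `|K| + 1 by rewrite ltr_wpDl.
exists (Num.min d (e / (`|K| + 1))); first by rewrite lt_min d0 divr_gt0.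
move=> h; rewrite lt_min => /andP[h1]; rewrite ltr_pdivlMr // => h2.
rewrite subr0; apply: (le_trans (H h h1)); rewrite expr2 mulrA ler_wpM2r ?nrm_ge0 //.
apply: le_trans (ltW h2); rewrite mulrC ler_wpM2l ?nrm_ge0 //.
by apply: (le_trans (ler_norm K)); rewrite lerDl.
Qed.

Lemma line_diff (V W : normedModType C) (f : V -> W) (x v : V) (t : C) :
  differentiable f (x + t *: v) ->
  differentiable (fun t : C => f (x + t *: v)) t /\
  'D_1 (fun t : C => f (x + t *: v)) t = 'd f (x + t *: v) v.
Proof.
move=> df; apply: expand1_differentiable => e e0.
have n1 : 0 < nrm v + 1 by rewrite ltr_wpDl ?nrm_ge0.
have [d d0 Hd] := differentiable_expand df (divr_gt0 e0 n1).
exists (d / (nrm v + 1)); first by rewrite divr_gt0.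
move=> h; rewrite ltr_pdivlMr // => hd.
have hv : nrm (h *: v) < d by rewrite nrmZ; apply: le_lt_trans hd; rewrite ler_wpM2l ?nrm_ge0 // lerDl.
have -> : x + (t + h) *: v = x + t *: v + h *: v by rewrite scalerDl addrA.
have := Hd _ hv; rewrite linearZ /= nrmZ => /le_trans; apply.
rewrite -mulrA ler_wpM2l ?(ltW e0) // mulrC ler_pdivrMr // ler_wpM2l ?nrm_ge0 // lerDl.
exact: ler01.
Qed.

Lemma derive_line (V W : normedModType C) (f : V -> W) (x v : V) (t : C) :
  'D_1 (fun t : C => f (x + t *: v)) t = 'D_v f (x + t *: v).
Proof.
rewrite /derive; apply: (congr1 (fun F => lim (F @ 0^'))); apply/funext => h.
have E : h *: (1 : C) = h := mulr1 h.
by rewrite /= /shift /= E; congr (_ *: (f _ - _)); rewrite scalerDl addrCA.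
Qed.

Lemma D1_sub (f g : C -> C) (x : C) : differentiable f x -> differentiable g x ->
  'D_1 (fun t => f t - g t) x = 'D_1 f x - 'D_1 g x.
Proof. by move=> df dg; apply: deriveB; apply/derivable1_diffP. Qed.

Section Osgood.
Variable n : nat.
Local Notation Cn := 'rV[C]_n.
Local Notation e_ k := (delta_mx 0 k : Cn).

(** The points [x + trunc k h] form the staircase from [x] to [x + h] that moves one coordinate at a
    time. *)
Definition trunc (k : nat) (h : Cn) : Cn := \row_j (if (j < k)%N then h 0 j else 0).

Lemma trunc0 h : trunc 0 h = 0.
Proof. by apply/rowP => j; rewrite !mxE. Qed.

Lemma truncn h : trunc n h = h.
Proof. by apply/rowP => j; rewrite !mxE ltn_ord. Qed.

Lemma truncS (k : 'I_n) h : trunc k.+1 h = trunc k h + h 0 k *: e_ k.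
Proof.
apply/rowP => j; rewrite !mxE eqxx /= ltnS leq_eqVlt.
have [->|jk] := eqVneq j k; first by rewrite eqxx ltnn mulr1 add0r.
by rewrite -val_eqE /= in jk *; rewrite (negPf jk) /= mulr0 addr0.
Qed.

Lemma nrm_trunc k h : nrm (trunc k h) <= nrm h.
Proof.
apply: nrm_le_coord; first exact: nrm_ge0.
by move=> j; rewrite mxE; case: ifP => _; rewrite ?nrm0 ?nrm_ge0 ?nrm_coord.
Qed.

Lemma telescope_trunc (g : Cn -> C) x h :
  g (x + h) - g x = \sum_(k < n) (g (x + trunc k h + h 0 k *: e_ k) - g (x + trunc k h)).
Proof.
transitivity (\sum_(k < n) (g (x + trunc k.+1 h) - g (x + trunc k h))).
  rewrite -(big_mkord xpredT (fun k => g (x + trunc k.+1 h) - g (x + trunc k h))).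
  by rewrite telescope_sumr // trunc0 truncn addr0.
by apply: eq_bigr => k _; rewrite truncS addrA.
Qed.

Variables (g : Cn -> C) (x : Cn) (d M : R).
Hypothesis d0 : 0 < d.
Hypothesis gM : forall y : Cn, nrm (y - x) < d + d -> nrm (g y) <= M.
Hypothesis gline : forall (y : Cn) (k : 'I_n), nrm (y - x) < d + d -> differentiable (fun t : C => g (y + t *: e_ k)) 0.

Lemma osgood_line (y : Cn) (k : 'I_n) : nrm (y - x) < d -> hol_disc (fun t : C => g (y + t *: e_ k)) 0 d.
Proof.
move=> yd t; rewrite subr0 => td.
have := @gline (y + t *: e_ k) k.
have -> : (fun s : C => g (y + t *: e_ k + s *: e_ k)) = (fun s => g (y + (t + s) *: e_ k)).
  by apply/funext => s; rewrite scalerDl addrA.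
move=> H; have : differentiable (fun s => g (y + (t + s) *: e_ k)) 0.
  apply: H; rewrite addrAC; apply: (le_lt_trans (ler_nrmD _ _)).
  by apply: ltrD => //; apply: le_lt_trans td; apply: nrm_scale_delta.
move=> D; have := @hol_shift R C (fun s => g (y + (t + s) *: e_ k)) (- t) t.
have -> : (fun s => g (y + (t + (- t + s)) *: e_ k)) = (fun s => g (y + s *: e_ k)).
  by apply/funext => s; rewrite addNKr.
by apply; rewrite addNr.
Qed.

Lemma osgood_line_bound (y : Cn) (k : 'I_n) (t : C) : nrm (y - x) < d -> nrm (t - 0) < d -> nrm (g (y + t *: e_ k)) <= M.
Proof.
move=> yd; rewrite subr0 => td; apply: gM; rewrite addrAC; apply: (le_lt_trans (ler_nrmD _ _)).
by apply: ltrD => //; apply: le_lt_trans td; apply: nrm_scale_delta.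
Qed.

Lemma osgood_M0 : 0 <= M.
Proof. by apply: (le_trans (nrm_ge0 (g x))); apply: gM; rewrite subrr nrm0 addr_gt0. Qed.

Lemma osgood_lipschitz (y h : Cn) : nrm (y - x) < d / 2 -> nrm h < d / 2 ->
  nrm (g (y + h) - g y) <= n%:R * (2 * M / d) * nrm h.
Proof.
move=> yd hd; have dp := d0; rewrite telescope_trunc.
apply: (le_trans (ler_nrm_sum _ _ _)).
have -> : n%:R * (2 * M / d) * nrm h = \sum_(k < n) (2 * M / d * nrm h).
  by rewrite sumr_const card_ord -[RHS]mulr_natl; ring.
apply: ler_sum => k _.
have yk : nrm (y + trunc k h - x) < d.
  rewrite addrAC; apply: (le_lt_trans (ler_nrmD _ _)).
  have := nrm_trunc k h; lra.
have hk : nrm (h 0 k - 0) < d by rewrite subr0; have := nrm_coord h k; lra.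
have := lipschitz_hol (osgood_line k yk) (fun t => @osgood_line_bound _ k t yk) hk.
rewrite subr0 scale0r addr0 -ler_pdivlMr // => /le_trans; apply.
rewrite mulrAC ler_wpM2l ?nrm_coord //.
by rewrite mulr_ge0 ?invr_ge0 ?mulr_ge0 ?osgood_M0 // ltW.
Qed.

Let D (k : 'I_n) (y : Cn) : C := 'D_1 (fun t : C => g (y + t *: e_ k)) 0.

(** Cauchy's estimate on a disc of radius d / 4, applied to the difference of the two restrictions
    to parallel lines, which is O(|h|) by [osgood_lipschitz]. *)
Lemma osgood_derive_cts (h : Cn) (k : 'I_n) : nrm h < d / 4 ->
  nrm (D k (x + h) - D k x) * (d / 4) <= 2 * (n%:R * (2 * M / d) * nrm h).
Proof.
move=> hd; have dp := d0.
have xd : nrm (x - x) < d by rewrite subrr nrm0.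
have xhd : nrm (x + h - x) < d by rewrite addrC addKr; apply: (lt_trans hd); lra.
have d4 : 0 < d / 4 by rewrite divr_gt0.
have sub4 : nrm ((0 : C) - 0) + d / 4 <= d by rewrite subr0 nrm0; lra.
have c0 : nrm ((0 : C) - 0) < d by rewrite subr0 nrm0.
rewrite -(D1_sub (osgood_line k xhd c0) (osgood_line k xd c0)).
apply: derive_bound => // t td.
  apply: holB; apply: osgood_line => //; rewrite subr0 in td *; lra.
have -> : x + h + t *: e_ k = x + t *: e_ k + h by rewrite addrAC.
rewrite subr0 in td; apply: osgood_lipschitz; last lra.
rewrite addrC addKr; apply: (le_lt_trans (nrm_scale_delta _ _)); lra.
Qed.

(** Along each step of the staircase one compares with the partial derivative at [x]: Taylor's bound
    gives a quadratic error, and moving the derivative from the step back to [x] costs O(|h|) more,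
    multiplied by |h|. *)
Lemma osgood_at : differentiable g x.
Proof.
pose L (y : Cn) : C := \sum_(k < n) y 0 k * D k x.
have dL : differentiable L x.
  apply: hol_sum => k _; apply: holM; [exact: hol_coord|exact: hol_cst].
suff dr : differentiable (fun y => g y - L y) x.
  by have := holD dr dL; under eq_fun do rewrite subrK.
have M0 := osgood_M0; have dp := d0.
(* Per coordinate, the first term comes from [taylor2] and the second from [osgood_derive_cts] after
   division by d / 4. *)
pose K := n%:R * (4 * M / d ^+ 2 + 8 * n%:R * (2 * M / d) / d).
apply: (@sq_small_differentiable _ _ _ _ K (d / 4)); first by rewrite divr_gt0.
move=> h hd.
have -> : g (x + h) - L (x + h) - (g x - L x) =
   \sum_(k < n) (g (x + trunc k h + h 0 k *: e_ k) - g (x + trunc k h) - h 0 k * D k x).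
  rewrite sumrB -telescope_trunc.
  have -> : L (x + h) = L x + \sum_(k < n) h 0 k * D k x.
    by rewrite -big_split /=; apply: eq_bigr => k _; rewrite mxE mulrDl.
  by rewrite opprD opprB addrACA addrA; ring.
apply: (le_trans (ler_nrm_sum _ _ _)).
have -> : K * nrm h ^+ 2 = \sum_(k < n) ((4 * M / d ^+ 2 + 8 * n%:R * (2 * M / d) / d) * nrm h ^+ 2).
  by rewrite sumr_const card_ord -[RHS]mulr_natl /K -[LHS]mulrA.
apply: ler_sum => k _.
have tk : nrm (trunc k h) < d / 4 by apply: le_lt_trans hd; apply: nrm_trunc.
have yk : nrm (x + trunc k h - x) < d by rewrite addrC addKr; lra.
have hk : nrm (h 0 k - 0) < d by rewrite subr0; have := nrm_coord h k; lra.
have := taylor2 (osgood_line k yk) (fun t => @osgood_line_bound _ k t yk) hk.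
rewrite subr0 scale0r addr0 -/(D k (x + trunc k h)) => T.
have := osgood_derive_cts k tk.
set a := D k (x + trunc k h) in T *; set b := D k x.
set G := g _ - g _ in T *.
have -> : G - h 0 k * b = (G - h 0 k * a) + h 0 k * (a - b) by ring.
move=> Q; apply: (le_trans (ler_nrmD _ _)); rewrite mulrDl; apply: lerD.
  apply: (le_trans T); apply: ler_wpM2l.
    by rewrite divr_ge0 ?mulr_ge0 ?exprn_ge0 // ltW.
  by rewrite lerXn2r ?nnegrE ?nrm_ge0 ?nrm_coord.
rewrite nrmM.
have Q' : nrm (a - b) <= 8 * n%:R * (2 * M / d) / d * nrm h.
  have d4 : 0 < d / 4 by rewrite divr_gt0.
  rewrite -(ler_pM2r d4); apply: (le_trans Q).
  have -> : 8 * n%:R * (2 * M / d) / d * nrm h * (d / 4) = 2 * (n%:R * (2 * M / d) * nrm h).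
    by field; rewrite gt_eqF.
  rewrite ler_wpM2l // ler_wpM2l ?nrm_trunc //.
  by rewrite mulr_ge0 // divr_ge0 ?mulr_ge0 // ltW.
rewrite expr2 mulrA mulrC; apply: ler_pM; rewrite ?nrm_ge0 ?nrm_coord //.
Qed.

End Osgood.

(** The usual way below to prove holomorphy of a function defined by cases: only local bounds and
    one-variable statements along coordinate lines remain. *)
Lemma osgood n (U : set 'rV[C]_n) (g : 'rV[C]_n -> C) : open U ->
  (forall x, U x -> exists2 e : R, 0 < e & exists M, forall y, nrm (y - x) < e -> nrm (g y) <= M) ->
  (forall x k, U x -> differentiable (fun t : C => g (x + t *: (delta_mx 0 k : 'rV[C]_n))) 0) ->
  holomorphic U g.
Proof.
move=> /open_nrmP oU gM gd x Ux.
have [e e0 [M HM]] := gM x Ux; have [r r0 Hr] := oU x Ux.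
pose d := Num.min e r / 2.
have m0 : 0 < Num.min e r by rewrite lt_min e0.
have dE : d + d = Num.min e r by rewrite /d; lra.
apply: (@osgood_at n g x d M); first by rewrite divr_gt0.
  by move=> y; rewrite dE lt_min => /andP[ye _]; apply: HM.
by move=> y k; rewrite dE lt_min => /andP[_ /Hr Uy]; apply: gd.
Qed.

End SeveralComplexVariables.

(** * Symmetry of second derivatives, holomorphy of partial derivatives, identity along segments *)

Section MixedDerivatives.
Variable R : realType.
Local Notation C := (Cplx R).

Lemma slope_self (f : C -> C) (c : C) : slope f c c = 'D_1 f c.
Proof. by rewrite /slope eqxx. Qed.

(** The mixed second difference of [phi] restricted to the diagonal. It is symmetric in the two
    variables of [phi], and its t^2 coefficient is the mixed derivative at the origin, so that
    symmetry of second derivatives becomes visible. *)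
Definition diag_diff (phi : C -> C -> C) (t : C) : C :=
  phi t t - phi t 0 - phi 0 t + phi 0 0.

Definition mixed_coef (phi : C -> C -> C) : C := 'D_1 (slope (diag_diff phi) 0) 0.

Lemma mixed_coef_swap phi : mixed_coef (fun s t => phi t s) = mixed_coef phi.
Proof.
rewrite /mixed_coef; have -> // : diag_diff (fun s t => phi t s) = diag_diff phi.
by apply/funext => t; rewrite /diag_diff; ring.
Qed.

Section Bidisc.
Variables (phi : C -> C -> C) (d M : R).
Hypothesis d0 : 0 < d.
Hypothesis phi1 : forall t, nrm t < d -> hol_disc (phi^~ t) 0 d.
Hypothesis phi2 : forall s, nrm s < d -> hol_disc (phi s) 0 d.
Hypothesis phi3 : hol_disc (fun t => phi t t) 0 d.
Hypothesis phiM : forall s t, nrm s < d -> nrm t < d -> nrm (phi s t) <= M.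

Let Delta (s t : C) : C := phi s t - phi s 0 - phi 0 t + phi 0 0.

Lemma nrm00 : nrm (0 : C) < d. Proof. by rewrite nrm0. Qed.

Lemma Delta_hol1 (t : C) : nrm t < d -> hol_disc (Delta^~ t) 0 d.
Proof.
move=> td s sd; have k (a : C) : differentiable (fun _ : C => a) s := hol_cst a s.
exact: (holD (holB (holB (phi1 td sd) (phi1 nrm00 sd)) (k _)) (k _)).
Qed.

Lemma Delta_hol2 (s : C) : nrm s < d -> hol_disc (Delta s) 0 d.
Proof.
move=> sd t td; have k (a : C) : differentiable (fun _ : C => a) t := hol_cst a t.
exact: (holD (holB (holB (phi2 sd td) (k _)) (phi2 nrm00 td)) (k _)).
Qed.

Lemma diag_hol : hol_disc (diag_diff phi) 0 d.
Proof.
move=> t td; have k (a : C) : differentiable (fun _ : C => a) t := hol_cst a t.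
exact: (holD (holB (holB (phi3 td) (phi1 nrm00 td)) (phi2 nrm00 td)) (k _)).
Qed.

Lemma Delta_bound (s t : C) : nrm s < d -> nrm t < d -> nrm (Delta s t) * d <= 4 * M * nrm t.
Proof.
move=> sd td; have := @schwarz R (Delta s) 0 t d (4 * M) (Delta_hol2 sd).
rewrite subr0; apply => //; first by rewrite /Delta; ring.
move=> x; rewrite subr0 => xd; rewrite /Delta.
apply: (le_trans (ler_nrmD _ _)).
have := ler_nrmB (phi s x - phi s 0) (phi 0 x); have := ler_nrmB (phi s x) (phi s 0).
have := phiM sd xd; have := phiM sd nrm00; have := phiM nrm00 xd; have := phiM nrm00 nrm00.
lra.
Qed.

Let B := 4 * M / d / d.

Lemma M_ge0 : 0 <= M.
Proof. exact: le_trans (nrm_ge0 _) (phiM nrm00 nrm00). Qed.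

Lemma B_ge0 : 0 <= B.
Proof. by rewrite /B !divr_ge0 ?(ltW d0) // mulr_ge0 // M_ge0. Qed.

Lemma Delta_bound2 (s t : C) : nrm s < d -> nrm t < d -> nrm (Delta s t) <= 4 * M / d * nrm t.
Proof. by move=> sd td; rewrite mulrAC ler_pdivlMr //; apply: Delta_bound. Qed.

Lemma slope_Delta_bound (s t : C) : nrm s < d -> nrm t < d -> nrm (slope (Delta^~ t) 0 s) <= B * nrm t.
Proof.
move=> sd td; have := @slope_bound R (Delta^~ t) 0 s d (4 * M / d * nrm t) (Delta_hol1 td).
rewrite subr0 -ler_pdivlMr // => H.
have -> : B * nrm t = 4 * M / d * nrm t / d by rewrite /B; ring.
apply: H => //; first by rewrite /Delta; ring.
by move=> x; rewrite subr0 => xd; apply: Delta_bound2.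
Qed.

Lemma Delta_bound3 (s t : C) : nrm s < d -> nrm t < d -> nrm (Delta s t) <= B * nrm t * nrm s.
Proof.
move=> sd td.
have D0 : Delta 0 t = 0 by rewrite /Delta; ring.
have := slopeE (Delta^~ t) 0 s; rewrite /= D0 !subr0 => ->.
by rewrite nrmM mulrC ler_wpM2r ?nrm_ge0 // slope_Delta_bound.
Qed.

(** The mixed difference vanishes on both axes, hence is O(|s| |t|) by two uses of the Schwarz
    lemma; on the diagonal it is quadratic. *)
Lemma slope_diag0 : 'D_1 (diag_diff phi) 0 = 0.
Proof.
have zd : nrm ((0 : C) - 0) < d by rewrite subr0 nrm00.
have dd := diag_hol zd.
have Dg : diag_diff phi 0 = 0 by rewrite /diag_diff; ring.
apply: eq0_eps => e e0.
have [r r0 Hr] := differentiable1_expand dd (divr_gt0 e0 (ltr0Sn R 1)).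
pose t := Num.min (r / 2) (Num.min (d / 2) (e / (2 * (B + 1)))).
have B1 : 0 < B + 1 by rewrite ltr_wpDl ?B_ge0.
have t0 : 0 < t by rewrite !lt_min !divr_gt0 // mulr_gt0.
have tr : t < r by rewrite gt_min; apply/orP; left; have := r0; lra.
have td : t < d by rewrite !gt_min; apply/orP; right; apply/orP; left; have := d0; lra.
have te : t <= e / (2 * (B + 1)) by rewrite !ge_min lexx !orbT.
have nt : nrm (rc t : C) = t by rewrite nrm_rc gtr0_norm.
have := Hr (rc t); rewrite nt => /(_ tr); rewrite add0r Dg subr0 => H.
have b : nrm (diag_diff phi (rc t)) <= B * t * t.
  by have := @Delta_bound3 (rc t) (rc t); rewrite nt; apply.
have : nrm (rc t *: 'D_1 (diag_diff phi) 0) <= e / 2 * t + B * t * t.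
  have -> : rc t *: 'D_1 (diag_diff phi) 0 =
     diag_diff phi (rc t) - (diag_diff phi (rc t) - rc t *: 'D_1 (diag_diff phi) 0) by ring.
  by apply: (le_trans (ler_nrmB _ _)); lra.
rewrite nrmZ nt; have -> : e / 2 * t + B * t * t = t * (e / 2 + B * t) by ring.
rewrite ler_pM2l // => /le_trans; apply.
have : B * t <= e / 2.
  apply: (@le_trans _ _ ((B + 1) * (e / (2 * (B + 1))))).
    by apply: ler_pM; rewrite ?B_ge0 ?(ltW t0) // lerDl.
  rewrite le_eqVlt; apply/orP; left; apply/eqP; field; rewrite gt_eqF //.
lra.
Qed.

(** The increment of the s-derivative from 0 to t is the slope of [Delta^~ t] at s = 0. At s = t
    this slope is the diagonal difference divided by t, and between s = 0 and s = t it varies by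
    O(|t|^2). *)
Lemma mixed_derivative :
  differentiable (fun t => 'D_1 (phi^~ t) 0) 0 /\ 'D_1 (fun t => 'D_1 (phi^~ t) 0) 0 = mixed_coef phi.
Proof.
set L := mixed_coef phi.
have zd : nrm ((0 : C) - 0) < d by rewrite subr0 nrm00.
have Dg : diag_diff phi 0 = 0 by rewrite /diag_diff; ring.
apply: expand1_differentiable => e e0.
have hs1 := slope_hol d0 diag_hol.
have /continuous_nrmP /(_ _ (divr_gt0 e0 (ltr0Sn R 1))) [r r0 Hr] := slope_cts (hs1 0 zd).
have B1 : 0 < B + 1 by rewrite ltr_wpDl ?B_ge0.
have d0' := d0.
pose m := Num.min r (Num.min (d / 2) (e * d / (4 * (B + 1)))).
exists m; first by rewrite !lt_min r0 !divr_gt0 ?mulr_gt0.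
move=> t; rewrite !lt_min => /andP[tr /andP[td te]]; rewrite add0r.
have [->|t0] := eqVneq t 0; first by rewrite subrr scale0r subr0 nrm0 mulr0.
have nt : 0 < nrm t by rewrite nrm_gt0.
have td' : nrm t < d by lra.
have c1 : differentiable (phi^~ t) 0 by apply: (phi1 td'); rewrite subr0 nrm00.
have c2 : differentiable (phi^~ 0) 0 by apply: (phi1 nrm00); rewrite subr0 nrm00.
have ED : 'D_1 (phi^~ t) 0 - 'D_1 (phi^~ 0) 0 = slope (Delta^~ t) 0 0.
  have cd : differentiable (fun s => phi s t - phi s 0) 0 := holB c1 c2.
  have ck : differentiable (fun _ : C => phi 0 t - phi 0 0) 0 := hol_cst _ _.
  rewrite /slope eqxx -(D1_sub c1 c2).
  have -> : Delta^~ t = (fun s => (phi s t - phi s 0) - (phi 0 t - phi 0 0)).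
    by apply/funext => s; rewrite /Delta; ring.
  by rewrite (D1_sub cd ck) derive_cst subr0.
rewrite ED.
have hS := slope_hol d0 (Delta_hol1 td').
have bS (x : C) : nrm (x - 0) < d -> nrm (slope (Delta^~ t) 0 x) <= B * nrm t.
  by rewrite subr0 => xd; apply: slope_Delta_bound.
have tds : nrm (t - 0) < d by rewrite subr0.
have := lipschitz_hol hS bS tds; rewrite subr0 -ler_pdivlMr // => H1.
have D0 : Delta 0 t = 0 by rewrite /Delta; ring.
(* The value at s = t is the first slope of the diagonal; as that slope vanishes at 0, a second
   division by t is possible, and [L] is its value at 0. *)
have E1 : slope (Delta^~ t) 0 t = t * slope (slope (diag_diff phi) 0) 0 t.
  rewrite /slope (negPf t0) eqxx slope_diag0 Dg /= D0 !subr0.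
  by rewrite -/(Delta t t) [t * _]mulrC divfK.
have := Hr t; rewrite subr0 => /(_ tr); rewrite (slope_self (slope (diag_diff phi) 0) 0) -/(mixed_coef phi) -/L => H2.
rewrite /GRing.scale /=.
have -> : slope (Delta^~ t) 0 0 - t * L = t * (slope (slope (diag_diff phi) 0) 0 t - L)
     - (slope (Delta^~ t) 0 t - slope (Delta^~ t) 0 0) by rewrite E1; ring.
apply: (le_trans (ler_nrmB _ _)); rewrite nrmM.
have h1 : nrm t * nrm (slope (slope (diag_diff phi) 0) 0 t - L) <= nrm t * (e / 2).
  by rewrite ler_wpM2l ?nrm_ge0 // ltW.
have h2 : 2 * (B * nrm t) * nrm t / d <= nrm t * (e / 2).
  have -> : 2 * (B * nrm t) * nrm t / d = nrm t * (2 * B * nrm t / d) by ring.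
  rewrite ler_wpM2l ?nrm_ge0 // ler_pdivrMr //.
  have : nrm t * (4 * (B + 1)) <= e * d by rewrite -ler_pdivlMr ?mulr_gt0 // ltW.
  have := mulr_ge0 (nrm_ge0 t) B_ge0; have := nrm_ge0 t; lra.
lra.
Qed.

End Bidisc.
End MixedDerivatives.

Section PartialDerivatives.
Variable R : realType.
Local Notation C := (Cplx R).

Lemma local_bound (V W : normedModType C) (U : set V) (f : V -> W) (x : V) : open U -> U x ->
  {for x, continuous f} ->
  exists2 d : R, 0 < d & forall y, nrm (y - x) < d -> U y /\ nrm (f y) <= nrm (f x) + 1.
Proof.
move=> /open_nrmP oU /oU [d1 d10 H1] /continuous_nrmP /(_ 1 ltr01) [d2 d20 H2].
exists (Num.min d1 d2); first by rewrite lt_min d10.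
move=> y; rewrite lt_min => /andP[/H1 Uy /H2 fy]; split => //.
by have := ler_nrmD (f y - f x) (f x); rewrite subrK; lra.
Qed.

Lemma derive_partial (V : normedModType C) (U : set V) (f : V -> C) (x v w : V) :
  open U -> holomorphic U f -> U x ->
  differentiable (fun t : C => 'D_v f (x + t *: w)) 0 /\
  'D_1 (fun t : C => 'D_v f (x + t *: w)) 0 = mixed_coef (fun s t => f (x + t *: w + s *: v)).
Proof.
move=> oU hf Ux.
have [d d0 Hd] := local_bound oU Ux (differentiable_cts (hf x Ux)).
pose K := nrm v + nrm w + 1.
have v0 := nrm_ge0 v; have w0 := nrm_ge0 w.
have K0 : 0 < K by rewrite /K; lra.
pose r := d / K; have r0 : 0 < r by rewrite divr_gt0.
have inU (s t : C) : nrm s < r -> nrm t < r -> U (x + t *: w + s *: v) /\ nrm (f (x + t *: w + s *: v)) <= nrm (f x) + 1.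
  move=> sr tr; apply: Hd.
  have -> : x + t *: w + s *: v - x = t *: w + s *: v by rewrite -(addrA x) [x + _]addrC addrK.
  apply: (le_lt_trans (ler_nrmD _ _)); rewrite !nrmZ.
  have h1 : nrm s * nrm v <= r * nrm v by rewrite ler_wpM2r // ltW.
  have h2 : nrm t * nrm w <= r * nrm w by rewrite ler_wpM2r // ltW.
  have : r * K = d by rewrite /r divfK // gt_eqF.
  rewrite /K !mulrDr mulr1; lra.
pose phi (s t : C) : C := f (x + t *: w + s *: v).
have p1 (t : C) : nrm t < r -> hol_disc (phi^~ t) 0 r.
  move=> tr s; rewrite subr0 => sr; apply: (line_diff _).1; apply: hf; exact: (inU s t sr tr).1.
have p2 (s : C) : nrm s < r -> hol_disc (phi s) 0 r.
  move=> sr t; rewrite subr0 => tr; rewrite /phi.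
  have -> : (fun t : C => f (x + t *: w + s *: v)) = (fun t : C => f ((x + s *: v) + t *: w)).
    by apply/funext => t'; rewrite addrAC.
  by apply: (line_diff _).1; apply: hf; rewrite addrAC; exact: (inU s t sr tr).1.
have p3 : hol_disc (fun t => phi t t) 0 r.
  move=> t; rewrite subr0 => tr; rewrite /phi.
  have -> : (fun t : C => f (x + t *: w + t *: v)) = (fun t : C => f (x + t *: (w + v))).
    by apply/funext => t'; rewrite scalerDr addrA.
  by apply: (line_diff _).1; apply: hf; rewrite scalerDr addrA; exact: (inU t t tr tr).1.
have H := mixed_derivative r0 p1 p2 p3 (fun s t sr tr => (inU s t sr tr).2).
pose G (t : C) : C := 'D_v f (x + t *: w).
have E : (fun t : C => 'D_1 (phi^~ t) 0) = G.
  by apply/funext => t; have := @derive_line R V C f (x + t *: w) v 0; rewrite scale0r addr0.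
change (differentiable G 0 /\ 'D_1 G 0 = mixed_coef phi).
rewrite -E; exact: H.
Qed.

Lemma derive_comm (V : normedModType C) (U : set V) (f : V -> C) (x v w : V) :
  open U -> holomorphic U f -> U x -> 'D_w ('D_v f) x = 'D_v ('D_w f) x.
Proof.
move=> oU hf Ux.
have A := (derive_partial v w oU hf Ux).2; have B := (derive_partial w v oU hf Ux).2.
have e1 : 'D_1 (fun t : C => 'D_w f (x + t *: v)) 0 = 'D_v ('D_w f) x.
  by have := @derive_line R V C ('D_w f) x v 0; rewrite scale0r addr0.
have e2 : 'D_1 (fun t : C => 'D_v f (x + t *: w)) 0 = 'D_w ('D_v f) x.
  by have := @derive_line R V C ('D_v f) x w 0; rewrite scale0r addr0.
apply: (etrans (etrans (esym e2) A)); apply: etrans (etrans (esym B) e1).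
rewrite -[RHS]mixed_coef_swap; congr mixed_coef.
by apply/funext => s; apply/funext => t; rewrite addrAC.
Qed.

Lemma partial_bound (V : normedModType C) (f : V -> C) (x v : V) (d M : R) : 0 < d -> nrm v <= 1 ->
  (forall y, nrm (y - x) < d + d -> differentiable f y /\ nrm (f y) <= M) ->
  forall y, nrm (y - x) < d -> nrm ('D_v f y) <= 2 * M / d.
Proof.
move=> d0 v1 H y yd.
have near (t : C) : nrm (t - 0) < d -> nrm (y + t *: v - x) < d + d.
  rewrite subr0 => td; rewrite addrAC; apply: (le_lt_trans (ler_nrmD _ _)); apply: ltrD => //.
  by apply: le_lt_trans td; rewrite nrmZ ler_piMr ?nrm_ge0.
rewrite ler_pdivlMr //; have := @derive_bound R (fun t : C => f (y + t *: v)) 0 d M d0.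
rewrite derive_line scale0r addr0; apply => t /near /H [dt bt] //.
exact: (line_diff dt).1.
Qed.

(** Osgood's lemma again: Cauchy's estimate bounds the partial derivative locally, and
    [derive_partial] differentiates it along each coordinate. *)
Lemma holomorphic_partial n (U : set 'rV[C]_n) (f : 'rV[C]_n -> C) (k : 'I_n) :
  open U -> holomorphic U f -> holomorphic U (partial k f).
Proof.
move=> oU hf; apply: osgood => //.
  move=> x Ux; have [d d0 Hd] := local_bound oU Ux (differentiable_cts (hf x Ux)).
  have d2 : 0 < d / 2 by rewrite divr_gt0.
  exists (d / 2) => //; exists (2 * (nrm (f x) + 1) / (d / 2)).
  have P := @partial_bound _ f x (delta_mx 0 k : 'rV[C]_n) (d / 2) (nrm (f x) + 1) d2 (nrm_delta _ k).
  move=> y yd; apply: P => // z; have -> : d / 2 + d / 2 = d by lra.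
  by move=> /Hd [Uy fy]; split => //; apply: hf.
by move=> x j Ux; exact: (derive_partial _ _ oU hf Ux).1.
Qed.

Lemma partialC n (U : set 'rV[C]_n) (f : 'rV[C]_n -> C) (a b : 'I_n) (x : 'rV[C]_n) :
  open U -> holomorphic U f -> U x -> partial a (partial b f) x = partial b (partial a f) x.
Proof. exact: derive_comm. Qed.

(** Continuation along the segment: the parameters near which the restriction vanishes, as a
    function of a complex parameter, cannot have a supremum below 1. *)
Lemma identity_segment (V : normedModType C) (U : set V) (f : V -> C) (x v : V) :
  open U -> holomorphic U f -> (forall t : R, 0 <= t <= 1 -> U (x + rc t *: v)) ->
  (\forall y \near x, f y = 0) -> f (x + v) = 0.
Proof.
move=> oU hf sU fx0.
pose g (z : C) : C := f (x + z *: v).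
have n1 : 0 < nrm v + 1 by rewrite ltr_wpDl ?nrm_ge0.
have disc (t : R) : 0 <= t <= 1 -> exists2 d : R, 0 < d & hol_disc g (rc t) d.
  move=> /sU Ut; have [d d0 Hd] := (open_nrmP U).1 oU _ Ut.
  exists (d / (nrm v + 1)); first by rewrite divr_gt0.
  move=> z; rewrite ltr_pdivlMr // => zd; apply: (line_diff _).1; apply: hf; apply: Hd.
  rewrite opprD addrACA subrr add0r -scalerBl nrmZ; apply: le_lt_trans zd.
  by rewrite ler_wpM2l ?nrm_ge0 // lerDl.
pose vanish (t : R) := exists2 d : R, 0 < d & forall z, nrm (z - rc t) < d -> g z = 0.
have v0 : vanish 0.
  have /nbhs_nrmP [d d0 Hd] := fx0; exists (d / (nrm v + 1)); first by rewrite divr_gt0.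
  move=> z; rewrite rmorph0 subr0 ltr_pdivlMr // => zd; apply: Hd; rewrite addrC addKr nrmZ.
  by apply: le_lt_trans zd; rewrite ler_wpM2l ?nrm_ge0 // lerDl.
pose A := [set t : R | 0 <= t <= 1 /\ vanish t].
have A0 : A 0 by split => //; rewrite lexx ler01.
have ubA : ubound A 1 by move=> t [/andP[]].
have hA : has_sup A by split; [exists 0|exists 1].
pose T := sup A.
have T0 : 0 <= T by apply: ub_le_sup => //; exists 1.
have T1 : T <= 1 by apply: ge_sup => //; exists 0.
have T01 : 0 <= T <= 1 by rewrite T0.
have [d d0 Hd] := disc T T01.
have d3 : 0 < d / 3 by rewrite divr_gt0.
(* A parameter within d / 3 of [T] has its disc of radius 2 d / 3 inside the disc of radius [d]
   around [T], and this smaller disc reaches beyond [T + d / 6]. *)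
have [t [t01 [e e0 He]] tT] := sup_adherent d3 hA.
have tT' : t <= T by apply: ub_le_sup; [exists 1|split => //; exists e].
have nd (a b : R) : nrm (rc a - rc b : C) = `|a - b| by rewrite -rmorphB nrm_rc.
have g0 (z : C) : nrm (z - rc t) < 2 * d / 3 -> g z = 0.
  apply: (identity_disc e0) => //; apply: hol_discS Hd; rewrite nd ler0_norm; last lra.
  by rewrite -/T in tT; lra.
have van (s : R) : `|s - t| < 2 * d / 3 -> vanish s.
  move=> sd; exists (2 * d / 3 - `|s - t|); first lra.
  move=> z zs; apply: g0; apply: (le_lt_trans (ler_nrmBD z (rc s) (rc t))); rewrite nd; lra.
suff : vanish 1 by case=> e1 e10 /(_ 1); rewrite /g rmorph1 subrr nrm0 scale1r; apply.
have [T1'|T1'] := ltP T 1; last first.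
  apply: van; rewrite -/T in tT; have /andP[? ?] := t01; rewrite ger0_norm; lra.
exfalso; pose s := Num.min 1 (T + d / 6).
have sT : T < s by rewrite lt_min T1' /=; lra.
have : s <= T.
  apply: ub_le_sup; first by exists 1.
  split; first by rewrite ge_min lexx andbT; lra.
  apply: van; rewrite ger0_norm; last lra.
  have : s <= T + d / 6 by rewrite ge_min lexx orbT.
  rewrite -/T in tT; lra.
by rewrite leNgt sT.
Qed.

End PartialDerivatives.

(** * Division by a coordinate *)

Section Division.
Variables (R : realType) (n : nat).
Local Notation C := (Cplx R).
Local Notation Cn := 'rV[C]_n.
Local Notation e_ k := (delta_mx 0 k : Cn).

Lemma coord_line (x : Cn) (t : C) (k j : 'I_n) : (x + t *: e_ k) 0 j = x 0 j + t * (j == k)%:R.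
Proof. by rewrite !mxE eqxx. Qed.

Lemma coord_line_neq (x : Cn) (t : C) (k j : 'I_n) : j != k -> (x + t *: e_ k) 0 j = x 0 j.
Proof. by move=> jk; rewrite coord_line (negPf jk) mulr0 addr0. Qed.

Lemma coord_line_eq (x : Cn) (t : C) (k : 'I_n) : (x + t *: e_ k) 0 k = x 0 k + t.
Proof. by rewrite coord_line eqxx mulr1. Qed.

Lemma nrm_line (x : Cn) (t : C) (k : 'I_n) : nrm (x + t *: e_ k - x) <= nrm t.
Proof. by rewrite addrC addKr nrm_scale_delta. Qed.

Lemma near_neq0 (V : normedModType C) (f : V -> C) (x : V) : {for x, continuous f} -> f x != 0 ->
  \forall y \near x, f y != 0.
Proof.
move=> cf fx; have fx0 : 0 < nrm (f x) by rewrite nrm_gt0.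
have /continuous_nrmP /(_ _ fx0) [d d0 H] := cf; apply/nbhs_nrmP; exists d => // y /H.
by apply: contraTneq => ->; rewrite sub0r nrmN ltxx.
Qed.

(** On the line in direction [k] through a point of the hyperplane this is [slope] at 0 of the
    restriction of f, which explains the value on the hyperplane. *)
Definition quotient (k : 'I_n) (f : Cn -> C) (x : Cn) : C :=
  if x 0 k == 0 then partial k f x else f x / x 0 k.

Variables (U : set Cn) (f : Cn -> C) (k : 'I_n).
Hypothesis oU : open U.
Hypothesis hf : holomorphic U f.
Hypothesis f0 : forall x, U x -> x 0 k = 0 -> f x = 0.

Lemma quotientE x : U x -> f x = x 0 k * quotient k f x.
Proof.
move=> Ux; rewrite /quotient; have [x0|x0] := eqVneq (x 0 k) 0; first by rewrite x0 mul0r f0.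
by rewrite mulrC divfK.
Qed.

Lemma quotient_diff x : U x -> x 0 k != 0 -> differentiable (quotient k f) x.
Proof.
move=> Ux x0; have dk : differentiable (fun y : Cn => y 0 k : C) x := hol_coord x k.
apply: (@hol_near _ _ _ (fun y : Cn => f y / y 0 k)).
  apply: filterS (near_neq0 (differentiable_cts dk) x0) => y y0.
  by rewrite /quotient (negPf y0).
by apply: (hol_div _ (hf Ux) dk).
Qed.

Lemma quotient_line (y : Cn) (d : R) (t : C) : y 0 k = 0 -> nrm t < d ->
  (forall t : C, nrm t < d -> U (y + t *: e_ k)) ->
  quotient k f (y + t *: e_ k) = slope (fun t : C => f (y + t *: e_ k)) 0 t.
Proof.
move=> y0 td inU; rewrite /quotient coord_line_eq y0 add0r /slope.
have d0 : 0 < d by apply: le_lt_trans td; apply: nrm_ge0.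
have [->|t0] := eqVneq t 0.
  by rewrite /partial (@derive_line R Cn C f y (e_ k) 0).
rewrite subr0; congr (_ / _); rewrite scale0r addr0 [f y]f0 ?subr0 //.
by have := inU 0; rewrite nrm0 scale0r addr0; apply.
Qed.

(** By Osgood. At a point of the hyperplane the restriction to direction [k] is a slope, and in any
    other direction, which stays in the hyperplane, it is the partial derivative of f. *)
Lemma holomorphic_quotient : holomorphic U (quotient k f).
Proof.
apply: osgood => //.
  move=> x Ux; have [x0|x0] := eqVneq (x 0 k) 0; last first.
    have [d d0 H] := local_bound oU Ux (differentiable_cts (quotient_diff Ux x0)).
    by exists d => //; exists (nrm (quotient k f x) + 1) => y /H [].
  have [d d0 Hd] := local_bound oU Ux (differentiable_cts (hf Ux)).
  have d2 : 0 < d / 2 by rewrite divr_gt0.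
  set M := nrm (f x) + 1 in Hd; exists (d / 2) => //; exists (M / (d / 2)) => y yd.
  (* The foot of [y] on the hyperplane: seen from there the quotient is a slope, which [slope_bound]
     controls uniformly in [y]. *)
  pose y0 : Cn := y + (- y 0 k) *: e_ k.
  have yE : y = y0 + y 0 k *: e_ k by rewrite /y0 scaleNr subrK.
  have y00 : y0 0 k = 0 by rewrite /y0 coord_line_eq subrr.
  have y0x : nrm (y0 - x) < d / 2.
    apply/nrm_lt_coord => // j; have [->|jk] := eqVneq j k.
      by rewrite mxE y00 mxE x0 subr0 nrm0.
    have -> : (y0 - x) 0 j = (y - x) 0 j.
      by rewrite [LHS]mxE /y0 coord_line_neq // [RHS]mxE.
    by apply: le_lt_trans yd; apply: nrm_coord.
  have near (t : C) : nrm t < d / 2 -> U (y0 + t *: e_ k) /\ nrm (f (y0 + t *: e_ k)) <= M.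
    move=> td; apply: Hd; apply: (le_lt_trans (ler_nrmBD _ y0 _)).
    have := nrm_line y0 t k; lra.
  have ykd : nrm (y 0 k) < d / 2.
    have := nrm_coord (y - x) k; rewrite !mxE x0 subr0 => /le_lt_trans; exact.
  rewrite {1}yE (@quotient_line _ (d / 2)) //; last by move=> t /near [].
  rewrite ler_pdivlMr //; apply: slope_bound; rewrite ?subr0 //.
  - by move=> t; rewrite subr0 => /near [Ut _]; apply: (line_diff _).1; apply: hf.
  - by rewrite scale0r addr0 f0 //; have [] := near 0; rewrite ?nrm0 // scale0r addr0.
  - by move=> t; rewrite subr0 => /near [].
move=> x j Ux; have [x0|x0] := eqVneq (x 0 k) 0; last first.
  apply: (line_diff _).1; rewrite scale0r addr0; exact: quotient_diff.
have [->|jk] := eqVneq j k.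
  have [d d0 Hd] := local_bound oU Ux (differentiable_cts (hf Ux)).
  have inU (t : C) : nrm t < d -> U (x + t *: e_ k).
    by move=> td; apply: (Hd _ _).1; apply: le_lt_trans td; apply: nrm_line.
  apply: (@hol_near _ _ _ (slope (fun t : C => f (x + t *: e_ k)) 0)).
    by apply/nbhs_nrmP; exists d => // t; rewrite subr0 => td; rewrite (quotient_line x0 td).
  apply: (slope_hol d0); last by rewrite subr0 nrm0.
  by move=> t; rewrite subr0 => td; apply: (line_diff _).1; apply: hf; apply: inU.
apply: (@hol_near _ _ _ (fun t : C => partial k f (x + t *: e_ j))).
  by apply/nbhs_nrmP; exists 1 => // t _; rewrite /quotient coord_line_neq 1?eq_sym // x0 eqxx.
by apply: (line_diff _).1; apply: (holomorphic_partial k oU hf); rewrite scale0r addr0.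
Qed.

(** Vanishing on the other hyperplanes survives the division, so the coordinates can be divided out
    one after the other. *)
Lemma quotient_vanish (i : 'I_n) : i != k -> (forall x, U x -> x 0 i = 0 -> f x = 0) ->
  forall x, U x -> x 0 i = 0 -> quotient k f x = 0.
Proof.
move=> ik fi x Ux xi; rewrite /quotient; case: ifP => _; last by rewrite fi // mul0r.
have := @derive_line R Cn C f x (e_ k) 0; rewrite scale0r addr0 => E; rewrite /partial -E.
have -> : 'D_1 (fun t : C => f (x + t *: e_ k)) 0 = 'D_1 (fun _ : C => 0 : C) 0.
  apply: near_eq_derive; have [d d0 Hd] := (open_nrmP U).1 oU x Ux.
  apply/nbhs_nrmP; exists d => // t; rewrite subr0 => td; apply: fi.
    by apply: Hd; apply: le_lt_trans td; apply: nrm_line.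
  by rewrite coord_line_neq.
exact: derive_cst.
Qed.

End Division.

(** * Extension across coordinate hyperplanes *)

Section RiemannExtension.
Variables (R : realType) (n : nat).
Local Notation C := (Cplx R).
Local Notation Cn := 'rV[C]_n.
Local Notation e_ k := (delta_mx 0 k : Cn).

Definition coord_prod (I : seq 'I_n) (x : Cn) : C := \prod_(i <- I) x 0 i.

Lemma divide_hyperplanes (U : set Cn) (I : seq 'I_n) (f : Cn -> C) : uniq I -> open U ->
  holomorphic U f -> (forall i x, i \in I -> U x -> x 0 i = 0 -> f x = 0) ->
  exists2 q, holomorphic U q & forall x, U x -> f x = coord_prod I x * q x.
Proof.
move=> + oU; elim: I f => [|k I IH] f.
  by move=> _ hf _; exists f => // x _; rewrite /coord_prod big_nil mul1r.
rewrite /= => /andP[kI uI] hf fI.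
have fk x : U x -> x 0 k = 0 -> f x = 0 by apply: fI; rewrite mem_head.
have [i x iI Ux xi|q hq qE] := IH (quotient k f) uI (holomorphic_quotient oU hf fk).
  have ik : i != k by apply: contraNneq kI => <-.
  apply: (quotient_vanish oU ik) => // y Uy; apply: fI => //; by rewrite inE iI orbT.
exists q => // x Ux; rewrite (quotientE fk Ux) (qE x Ux) /coord_prod big_cons mulrA.
by [].
Qed.

Lemma coord_prod_diff (I : seq 'I_n) (x : Cn) : differentiable (coord_prod I) x.
Proof. by apply: hol_prod => i _; apply: hol_coord. Qed.

Lemma coord_prod_eq0 (I : seq 'I_n) (x : Cn) : (coord_prod I x == 0) = has (fun i => x 0 i == 0) I.
Proof. by rewrite /coord_prod prodf_seq_eq0; apply: eq_has => i. Qed.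

(** The product of [g] with the coordinates, set to 0 on the hyperplanes, is continuous and, by
    Osgood, holomorphic; vanishing on each hyperplane it is divisible by the product, and the
    quotient extends [g]. *)
Theorem riemann_extension (U : set Cn) (I : seq 'I_n) (g : Cn -> C) : uniq I -> open U ->
  (forall x, U x -> coord_prod I x != 0 -> differentiable g x) ->
  (forall x, U x -> coord_prod I x = 0 -> forall e : R, 0 < e -> exists2 d : R, 0 < d &
     forall y, nrm (y - x) < d -> coord_prod I y != 0 -> nrm (coord_prod I y * g y) <= e) ->
  exists2 q, holomorphic U q & forall x, U x -> coord_prod I x != 0 -> q x = g x.
Proof.
move=> uI oU dg gH; pose P := coord_prod I.
pose f (x : Cn) : C := if P x == 0 then 0 else P x * g x.
have df x : U x -> P x != 0 -> differentiable f x.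
  move=> Ux Px; have dP := coord_prod_diff I x.
  apply: (@hol_near _ _ _ (fun y => P y * g y)); last exact: (holM dP (dg x Ux Px)).
  by apply: filterS (near_neq0 (differentiable_cts dP) Px) => y Py; rewrite /f (negPf Py).
have cf x : U x -> {for x, continuous f}.
  move=> Ux; have [Px|Px] := eqVneq (P x) 0; last exact: differentiable_cts (df x Ux Px).
  apply/continuous_nrmP => e e0; have [d d0 H] := gH x Ux Px (e / 2) (divr_gt0 e0 (ltr0Sn _ 1)).
  exists d => // y /H h; rewrite /f Px eqxx subr0; case: eqVneq => [_|Py]; first by rewrite nrm0.
  by apply: (le_lt_trans (h Py)); lra.
have hf : holomorphic U f.
  apply: osgood => //.
    move=> x Ux; have [d d0 H] := local_bound oU Ux (cf x Ux).
    by exists d => //; exists (nrm (f x) + 1) => y /H [].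
  move=> x j Ux; have [Px|Px] := eqVneq (P x) 0; last first.
    by apply: (line_diff _).1; rewrite scale0r addr0; apply: df.
  (* A coordinate line through a point of the hyperplanes either stays in one of them, where the
     function is 0, or meets them only at that point, a removable singularity in one variable. *)
  have [[i [iI ij xi]]|no] := pselect (exists i, [/\ i \in I, i != j & x 0 i = 0]).
    apply: (@hol_near _ _ _ (fun=> 0)); last exact: hol_cst.
    apply/nbhs_nrmP; exists 1 => // t _; rewrite /f; case: ifP => // /negP []; rewrite coord_prod_eq0.
    by apply/hasP; exists i => //; rewrite coord_line_neq // xi.
  have Pt (t : C) : t != 0 -> P (x + t *: e_ j) != 0.
    move=> t0; rewrite coord_prod_eq0; apply/hasPn => i iI.
    have [->|ij] := eqVneq i j; last first.
      by rewrite coord_line_neq //; apply/eqP => xi; apply: no; exists i.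
    have xj : x 0 j = 0.
      have : P x == 0 by rewrite Px.
      rewrite coord_prod_eq0 => /hasP [l lI /eqP xl].
      by have [<-//|lj] := eqVneq l j; exfalso; apply: no; exists l.
    by rewrite coord_line_eq xj add0r.
  have [d d0 Hd] := (open_nrmP U).1 oU x Ux.
  have inU (t : C) : nrm (t - 0) < d -> U (x + t *: e_ j).
    by rewrite subr0 => td; apply: Hd; apply: le_lt_trans td; apply: nrm_line.
  apply: (removable d0) => t /inU Ut.
    apply: (@cts_comp _ _ _ (fun t : C => x + t *: e_ j) f); last exact: cf.
    by apply: differentiable_cts; exact: (@line_diff R Cn Cn id x (e_ j) t (hol_id _)).1.
  by move=> t0; apply: (line_diff _).1; apply: df => //; apply: Pt.
have [|q hq qE] := divide_hyperplanes uI oU hf.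
  move=> i x iI Ux xi; rewrite /f; case: ifP => // /negP []; rewrite coord_prod_eq0.
  by apply/hasP; exists i => //; rewrite xi.
exists q => // x Ux Px; have := qE x Ux; rewrite /f (negPf Px) => /(mulfI Px).
by [].
Qed.

End RiemannExtension.

Section Calculus.
Variable R : realType.
Local Notation C := (Cplx R).

Lemma differentiable_row (V : normedModType C) n (f : V -> 'rV[C]_n) (x : V) :
  (forall j, differentiable (fun y => f y 0 j : C) x) -> differentiable f x.
Proof.
move=> df; have -> : f = \sum_(j < n) (fun y => f y 0 j *: (delta_mx 0 j : 'rV[C]_n)).
  by apply/funext => y; rewrite fct_sumE; exact: row_sum_delta.
by apply: differentiable_sum => j; apply: differentiableZl.
Qed.

Lemma cts_row (T : topologicalType) n (f : T -> 'rV[C]_n) (x : T) :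
  (forall j, {for x, continuous (fun y => f y 0 j : C)}) -> {for x, continuous f}.
Proof.
move=> cf; apply/cvg_nrmP => e e0.
have H : \forall y \near x, forall j, nrm (f y 0 j - f x 0 j) < e.
  have := @filter_forall T 'I_n (fun j y => nrm (f y 0 j - f x 0 j) < e) (nbhs x) _.
  by apply => j; have /cvg_nrmP := cf j; apply.
apply: filterS H => y yH; apply/nrm_lt_coord => // j; rewrite !mxE; exact: yH.
Qed.

Lemma derive_comp1 (V : normedModType C) (h : C -> C) (l : V -> C) (x v : V) :
  differentiable l x -> differentiable h (l x) ->
  'D_v (fun y => h (l y)) x = 'D_1 h (l x) * 'D_v l x.
Proof.
move=> dl dh; have dc : differentiable (h \o l) x by apply: differentiable_comp.
have E := (congr1 (fun F : V -> C => F v) (diff_comp dl dh)).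
rewrite /= in E.
rewrite [LHS](deriveE _ dc) E (deriveE _ dh) (deriveE _ dl).
have e k : k *: (1 : C) = k := mulr1 k.
by rewrite -{1}(e ('d l x v)) linearZ /= mulrC.
Qed.

Lemma derive_coord n (x v : 'rV[C]_n) (j : 'I_n) : 'D_v (fun y : 'rV[C]_n => y 0 j : C) x = v 0 j.
Proof.
rewrite /derive; apply: cvg_lim => //.
apply: cvg_near_cst; apply/nbhs_nrmP; exists 1 => // t _ /= t0.
by rewrite !mxE addrK scalerA mulVf // scale1r.
Qed.

(** At a zero of [p] the differential of the product is [k x] times that of [p]: the variation of
    [k] only contributes o(1) times O(|h|). *)
Lemma differentiable_mul_cts (V : normedModType C) (p k : V -> C) (x : V) :
  differentiable p x -> p x = 0 -> {for x, continuous k} -> differentiable (fun y => p y * k y) x.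
Proof.
move=> dp p0 ck.
have E : (fun y => p y * k y) = (fun y => p y * k x + p y * (k y - k x)).
  by apply/funext => y; ring.
rewrite E; apply: holD; first by apply: holM => //; apply: hol_cst.
have [||//] := @expand_differentiable R V C (fun y => p y * (k y - k x)) x (\0 : {linear V -> C}).
  by move=> y; apply: cvg_cst.
move=> e e0.
have [d1 d10 H1] := differentiable_expand dp ltr01.
have [K K0 HK] : exists2 K : R, 0 < K & forall h, nrm ('d p x h) <= K * nrm h.
  have /linear_lipschitz [k0 k00 Hk] := diff_continuous dp.
  have kE : k0 = rc (ReC k0) by rewrite RRe_real // gtr0_real.
  exists (ReC k0); first by move: k00; rewrite kE ltcR.
  by move=> h; have := Hk h; rewrite !nrmE kE -rmorphM lecR.
have K1 : 0 < K + 1 by lra.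
have /continuous_nrmP /(_ _ (divr_gt0 e0 K1)) [d2 d20 H2] := ck.
exists (Num.min d1 d2); first by rewrite lt_min d10.
move=> h; rewrite lt_min => /andP[h1 h2]; rewrite p0 mul0r !subr0.
have ph : nrm (p (x + h)) <= (K + 1) * nrm h.
  have := H1 h h1; rewrite p0 subr0 => H.
  have := ler_nrmD (p (x + h) - 'd p x h) ('d p x h); rewrite subrK; have := HK h; lra.
have := H2 (x + h); rewrite addrC addKr => /(_ h2) kh.
rewrite nrmM; apply: (le_trans (ler_pM (nrm_ge0 _) (nrm_ge0 _) ph (ltW kh))).
by rewrite le_eqVlt; apply/orP; left; apply/eqP; field; rewrite gt_eqF.
Qed.

(** The increment of [l] is that of [p] divided by the slope of the exponential, which is continuous
    and nonzero; so a merely continuous logarithm is already holomorphic. *)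
Lemma log_branch (V : normedModType C) (l p : V -> C) (x : V) :
  {for x, continuous l} -> differentiable p x -> (\forall y \near x, cexp (l y) = p y) ->
  differentiable l x /\ forall v, 'D_v l x = 'D_v p x / p x.
Proof.
move=> cl dp lp; have lpx := nbhs_singleton lp.
have [dc Dc] := differentiable_cexp (l x).
pose S y := slope (@cexp R) (l x) (l y).
have cS : {for x, continuous S} by apply: (cts_comp cl); apply: slope_cts.
have Sx : S x = cexp (l x) by rewrite /S slope_self Dc.
have Sx0 : S x != 0 by rewrite Sx cexp_neq0.
have dl : differentiable l x.
  apply: (@hol_near _ _ _ (fun y => l x + (p y - p x) * (S y)^-1)).
    have n0 := near_neq0 cS Sx0.
    apply: filterS (filterI lp n0) => y [ly Sy].
    have := slopeE (@cexp R) (l x) (l y); rewrite ly lpx -/(S y) => ->.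
    by rewrite mulfK // subrKC.
  apply: holD; first exact: hol_cst.
  apply: differentiable_mul_cts; [|by rewrite subrr|exact: ctsV].
  by apply: holB => //; apply: hol_cst.
split=> // v.
have := derive_comp1 v dl dc; rewrite Dc lpx.
rewrite (near_eq_derive _ lp) => ->.
have px0 : p x != 0 by rewrite -lpx cexp_neq0.
by rewrite mulrAC divff ?mul1r.
Qed.

End Calculus.

(** * Logarithmic coordinates *)

Section LogCoordinates.
Variables (R : realType) (s m : nat).
Local Notation C := (Cplx R).
Local Notation Cn := 'rV[C]_(s + m).
Implicit Types (w x : Cn) (r : R).

Definition sqnorm n (x : 'rV[C]_n) : R := \sum_j nrm (x 0 j) ^+ 2.

Lemma eballE n (r : R) (x : 'rV[C]_n) : eball n r x <-> sqnorm x < r ^+ 2.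
Proof.
rewrite /eball /= /sqnorm; have -> : \sum_j `|x 0 j| ^+ 2 = rc (\sum_j nrm (x 0 j) ^+ 2) :> C.
  by rewrite rmorph_sum; apply: eq_bigr => j _; rewrite rmorphXn /= nrmE.
by rewrite ltcR.
Qed.

Lemma cts_sumR (T : topologicalType) (I : Type) (l : seq I) (F : I -> T -> R) (x : T) :
  (forall i, {for x, continuous (F i)}) -> {for x, continuous (fun y => \sum_(i <- l) F i y)}.
Proof.
move=> cF; elim: l => [|i l IH].
  have -> : (fun y => \sum_(i <- [::]) F i y) = (fun=> 0) by apply/funext => y; rewrite big_nil.
  exact: cvg_cst.
have -> : (fun y => \sum_(j <- i :: l) F j y) = (fun y => F i y + \sum_(j <- l) F j y).
  by apply/funext => y; rewrite big_cons.
exact: (cvgD (cF i) IH).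
Qed.

Lemma cts_sqnorm n (x : 'rV[C]_n) : {for x, continuous (@sqnorm n)}.
Proof.
apply: cts_sumR => j.
have c1 : {for x, continuous (fun y : 'rV[C]_n => nrm (y 0 j : C))}.
  apply: (@cts_comp _ _ _ (fun y : 'rV[C]_n => y 0 j : C) (@nrm R C)).
    exact: differentiable_cts (hol_coord x j).
  exact: continuous_nrm.
have -> : (fun y : 'rV[C]_n => nrm (y 0 j) ^+ 2) = (fun y => nrm (y 0 j) * nrm (y 0 j)).
  by apply/funext => y; rewrite expr2.
exact: (cvgM c1 c1).
Qed.

Lemma open_lt_cts (T : topologicalType) (f : T -> R) (a : R) :
  (forall y : T, {for y, continuous f}) -> open [set y : T | f y < a].
Proof.
move=> cf; have -> : [set y : T | f y < a] = f @^-1` [set t | t < a] by [].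
by apply: open_comp => [x _|]; [exact: cf|exact: open_lt].
Qed.

Lemma open_eball n (r : R) : open (@eball R n r).
Proof.
have -> : eball n r = [set x : 'rV[C]_n | sqnorm x < r ^+ 2] by apply/seteqP; split=> x /eballE.
by apply: open_lt_cts => x; apply: cts_sqnorm.
Qed.

Lemma uprojL w i : uproj s m w 0 (lshift m i) = cexp (w 0 (lshift m i)).
Proof. by rewrite /uproj row_mxEl !mxE. Qed.

Lemma uprojR w j : uproj s m w 0 (rshift s j) = w 0 (rshift s j).
Proof. by rewrite /uproj row_mxEr !mxE. Qed.

Lemma row_split_eq (x y : Cn) : (forall i, x 0 (lshift m i) = y 0 (lshift m i)) ->
  (forall j, x 0 (rshift s j) = y 0 (rshift s j)) -> x = y.
Proof.
move=> hl hr; apply/rowP => k; case: (split_ordP k) => i ->; [exact: hl|exact: hr].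
Qed.

Lemma differentiable_uproj w : differentiable (uproj s m) w.
Proof.
apply: differentiable_row => k; case: (split_ordP k) => i ->.
  have -> : (fun y => uproj s m y 0 (lshift m i) : C) = (fun y => cexp (y 0 (lshift m i))).
    by apply/funext => y; rewrite uprojL.
  apply: (@hol_comp _ _ _ _ (fun y : Cn => y 0 (lshift m i) : C)); first exact: hol_coord.
  exact: (differentiable_cexp _).1.
have -> : (fun y => uproj s m y 0 (rshift s i) : C) = (fun y => y 0 (rshift s i)).
  by apply/funext => y; rewrite uprojR.
exact: hol_coord.
Qed.

Lemma open_ucover r : open (ucover s m r).
Proof.
apply: open_comp; last exact: open_eball.
by move=> w _; apply: differentiable_cts; apply: differentiable_uproj.
Qed.

Definition hyps : seq 'I_(s + m) := [seq lshift m i | i <- enum 'I_s].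

Lemma uniq_hyps : uniq hyps.
Proof. by rewrite map_inj_uniq ?enum_uniq //; apply: lshift_inj. Qed.

Lemma coord_prod_hyps x : coord_prod hyps x = \prod_(i < s) x 0 (lshift m i).
Proof. by rewrite /coord_prod big_map big_enum. Qed.

Lemma ball_complE r x : ball_compl s m r x <-> eball (s + m) r x /\ coord_prod hyps x != 0.
Proof.
rewrite /ball_compl /hyperplanes coord_prod_hyps; split=> -[Bx Hx]; split=> //=.
  by apply/eqP.
by apply/eqP.
Qed.

Lemma ball_compl_neq0 r x : ball_compl s m r x -> forall i, x 0 (lshift m i) != 0.
Proof.
move=> /ball_complE [_]; rewrite coord_prod_hyps => H i.
by apply: contraNneq H => xi; rewrite (bigD1 i) //= xi mul0r.
Qed.

Lemma neq0_ball_compl r x : eball (s + m) r x -> (forall i, x 0 (lshift m i) != 0) -> ball_compl s m r x.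
Proof.
move=> Bx H; apply/ball_complE; split=> //; rewrite coord_prod_hyps.
by apply/prodf_neq0 => i _.
Qed.

Lemma open_ball_compl r : open (ball_compl s m r).
Proof.
have -> : ball_compl s m r = eball (s + m) r `&` [set x | coord_prod hyps x != 0].
  by apply/seteqP; split=> x /ball_complE.
apply: openI; first exact: open_eball.
apply/open_nrmP => x x0; apply/nbhs_nrmP.
exact: near_neq0 (differentiable_cts (coord_prod_diff hyps x)) x0.
Qed.

Lemma ucover_proj r w : ucover s m r w -> ball_compl s m r (uproj s m w).
Proof. by move=> Uw; apply: neq0_ball_compl => // i; rewrite uprojL cexp_neq0. Qed.

Lemma uproj_surj r x : ball_compl s m r x -> exists2 w, ucover s m r w & uproj s m w = x.
Proof.
move=> Bx; have x0 := ball_compl_neq0 Bx.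
have [l Hl] : exists l : 'I_s -> C, forall i, cexp (l i) = x 0 (lshift m i).
  apply: (@fin_all_exists _ (fun=> C) (fun i z => cexp z = x 0 (lshift m i))) => i.
  by have [z zE _] := cexp_surj (x0 i); exists z.
have pE : uproj s m (row_mx (\row_i l i) (rsubmx x)) = x.
  apply: row_split_eq => i; first by rewrite uprojL row_mxEl mxE Hl.
  by rewrite uprojR row_mxEr mxE.
by exists (row_mx (\row_i l i) (rsubmx x)) => //; rewrite /ucover /= pE; case: Bx.
Qed.

Lemma udeckL c w i : udeck c w 0 (lshift m i) = w 0 (lshift m i) + two_i_pi R *~ c 0 i.
Proof. by rewrite /udeck mxE row_mxEl mxE. Qed.

Lemma udeckR c w j : udeck c w 0 (rshift s j) = w 0 (rshift s j).
Proof. by rewrite /udeck mxE row_mxEr mxE addr0. Qed.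

Lemma uproj_udeck c w : uproj s m (udeck c w) = uproj s m w.
Proof.
by apply: row_split_eq => i; rewrite ?uprojL ?uprojR ?udeckL ?udeckR ?cexp_period.
Qed.

Lemma ucover_udeck r c w : ucover s m r w -> ucover s m r (udeck c w).
Proof. by rewrite /ucover /= uproj_udeck. Qed.

Lemma uproj_fiber w w' : uproj s m w = uproj s m w' -> exists c, w = udeck c w'.
Proof.
move=> E.
have [c Hc] : exists c : 'I_s -> int, forall i, w 0 (lshift m i) = w' 0 (lshift m i) + two_i_pi R *~ c i.
  apply: (@fin_all_exists _ (fun=> int) (fun i k => _ = _ + _ *~ k)) => i.
  by apply: cexp_inj_mod; rewrite -!uprojL E.
exists (\row_i c i); apply: row_split_eq => i; first by rewrite udeckL mxE Hc.
by rewrite udeckR -(uprojR w) -(uprojR w') E.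
Qed.

(* The branch of the inverse of [uproj] through [w0]. *)
Definition usection w0 x : Cn :=
  row_mx (\row_i (w0 0 (lshift m i) + clog (x 0 (lshift m i) / uproj s m w0 0 (lshift m i)))) (rsubmx x).

Definition usection_dom w0 : set Cn :=
  [set x | forall i, 0 < ReC (x 0 (lshift m i) / uproj s m w0 0 (lshift m i))].

Lemma usectionL w0 x i : usection w0 x 0 (lshift m i) =
  w0 0 (lshift m i) + clog (x 0 (lshift m i) / uproj s m w0 0 (lshift m i)).
Proof. by rewrite row_mxEl mxE. Qed.

Lemma usectionR w0 x j : usection w0 x 0 (rshift s j) = x 0 (rshift s j).
Proof. by rewrite row_mxEr mxE. Qed.

Lemma uproj_usection w0 x : usection_dom w0 x -> uproj s m (usection w0 x) = x.
Proof.
move=> Dx; apply: row_split_eq => i; last by rewrite uprojR usectionR.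
rewrite uprojL usectionL cexpD clogK; last exact: Dx.
by rewrite uprojL mulrC divfK // cexp_neq0.
Qed.

Lemma cts_usection w0 x : usection_dom w0 x -> {for x, continuous (usection w0)}.
Proof.
move=> Dx; apply: cts_row => k; case: (split_ordP k) => i ->.
  have -> : (fun y => usection w0 y 0 (lshift m i) : C) = (fun y => w0 0 (lshift m i) +
      clog (y 0 (lshift m i) / uproj s m w0 0 (lshift m i))).
    by apply/funext => y; rewrite usectionL.
  apply: ctsD; first exact: cts_cst.
  apply: (@cts_comp _ _ _ (fun y : Cn => y 0 (lshift m i) / uproj s m w0 0 (lshift m i) : C)).
    by apply: ctsM; [exact: differentiable_cts (hol_coord x _)|exact: cts_cst].
  by apply: cts_clog; apply: Dx.
have -> : (fun y => usection w0 y 0 (rshift s i) : C) = (fun y => y 0 (rshift s i)).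
  by apply/funext => y; rewrite usectionR.
exact: differentiable_cts (hol_coord x _).
Qed.

Lemma open_usection_dom w0 : open (usection_dom w0).
Proof.
rewrite openE => x Dx.
apply: (@filter_forall Cn 'I_s (fun i y => 0 < ReC (y 0 (lshift m i) / uproj s m w0 0 (lshift m i))) (nbhs x) _ _) => i.
have o : open [set x : Cn | - ReC (x 0 (lshift m i) / uproj s m w0 0 (lshift m i)) < 0]; last first.
  have nb : nbhs x [set x : Cn | - ReC (x 0 (lshift m i) / uproj s m w0 0 (lshift m i)) < 0].
    by apply: open_nbhs_nbhs; split=> //=; rewrite oppr_lt0; apply: Dx.
  by apply: filterS nb => y /=; rewrite oppr_lt0.
apply: open_lt_cts => y.
have c : {for y, continuous (fun y : Cn => ReC (y 0 (lshift m i) / uproj s m w0 0 (lshift m i) : C))}.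
  apply: (@cts_comp _ _ _ (fun y : Cn => y 0 (lshift m i) / uproj s m w0 0 (lshift m i) : C) (@complex.Re R : C -> R)).
    by apply: ctsM; [exact: differentiable_cts (hol_coord y _)|exact: cts_cst].
  exact: continuous_Re.
exact: (cvgN c).
Qed.

Lemma usection_dom_self w0 : usection_dom w0 (uproj s m w0).
Proof. by move=> i; rewrite divff ?uprojL ?cexp_neq0 //; apply: ltr01. Qed.

Lemma usection_self w0 : usection w0 (uproj s m w0) = w0.
Proof.
have l1 : @clog R 1 = 0.
  by apply: C_eq; rewrite /clog /= nrm1 ?ln1 // mul0r -[in LHS]sin0 sinK // in_itv /=; have := @pi_gt0 R; lra.
apply: row_split_eq => i; last by rewrite usectionR uprojR.
by rewrite usectionL divff ?l1 ?addr0 // uprojL cexp_neq0.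
Qed.

(** Stated for every continuous section, since a [branch] provides nothing more. The formula is d
    log x_i = dx_i / x_i. *)
Lemma section_diff (sec : Cn -> Cn) (x : Cn) : {for x, continuous sec} ->
  (\forall y \near x, uproj s m (sec y) = y) ->
  differentiable sec x /\
  forall k i, partial k (fun y => sec y 0 (lshift m i) : C) x = (k == lshift m i)%:R / x 0 (lshift m i).
Proof.
move=> cs ps.
have dL i : differentiable (fun y => sec y 0 (lshift m i) : C) x /\
    forall v, 'D_v (fun y => sec y 0 (lshift m i) : C) x = 'D_v (fun y : Cn => y 0 (lshift m i) : C) x / x 0 (lshift m i).
  apply: log_branch; last by apply: filterS ps => y yE; rewrite -uprojL yE.
    apply: (@cts_comp _ _ _ sec (fun y : Cn => y 0 (lshift m i) : C)) => //.
    exact: differentiable_cts (hol_coord _ _).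
  exact: hol_coord.
split.
  apply: differentiable_row => k; case: (split_ordP k) => i ->; first exact: (dL i).1.
  apply: (@hol_near _ _ _ (fun y : Cn => y 0 (rshift s i) : C)); last exact: hol_coord.
  by apply: filterS ps => y yE; rewrite -(uprojR (sec y)) yE.
by move=> k i; rewrite /partial (dL i).2 derive_coord mxE eqxx /= eq_sym.
Qed.

Lemma expR_convex (a b t : R) : 0 <= t <= 1 ->
  expR (a + t * (b - a)) <= (1 - t) * expR a + t * expR b.
Proof.
move=> /andP[t0 t1]; set c := a + t * (b - a).
have key (z : R) : expR c * (1 + (z - c)) <= expR z.
  have -> : expR z = expR c * expR (z - c) by rewrite -expRD subrKC.
  by rewrite ler_pM2l ?expR_gt0 // expR_ge1Dx.
have Ha : (1 - t) * (expR c * (1 + (a - c))) <= (1 - t) * expR a.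
  by apply: ler_wpM2l => //; rewrite subr_ge0.
have Hb := ler_wpM2l t0 (key b).
have E : expR c = (1 - t) * (expR c * (1 + (a - c))) + t * (expR c * (1 + (b - c))).
  by rewrite /c; ring.
by rewrite E; apply: lerD.
Qed.

Lemma sqr_convex (a b t : R) : 0 <= t <= 1 ->
  (a + t * (b - a)) ^+ 2 <= (1 - t) * a ^+ 2 + t * b ^+ 2.
Proof.
move=> /andP[t0 t1]; rewrite -subr_ge0.
have -> : (1 - t) * a ^+ 2 + t * b ^+ 2 - (a + t * (b - a)) ^+ 2 = t * (1 - t) * (b - a) ^+ 2 by ring.
by rewrite mulr_ge0 ?sqr_ge0 // mulr_ge0 // subr_ge0.
Qed.

(** |x_k|^2 is exp(2 Re w_k) or |w_k|^2, convex in both cases; this makes [ucover] convex, hence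
    simply connected and accessible along segments. *)
Lemma nrm_uproj_convex (w w' : Cn) (t : R) (k : 'I_(s + m)) : 0 <= t <= 1 ->
  nrm (uproj s m (w + rc t *: (w' - w)) 0 k) ^+ 2 <=
  (1 - t) * nrm (uproj s m w 0 k) ^+ 2 + t * nrm (uproj s m w' 0 k) ^+ 2.
Proof.
move=> t01; case: (split_ordP k) => i ->.
  rewrite !uprojL !nrm_cexp.
  have sq (z : R) : expR z ^+ 2 = expR (z + z) by rewrite expr2 -expRD.
  rewrite !sq !mxE !ReImE mul0r subr0.
  apply: le_trans (expR_convex _ _ t01); rewrite le_eqVlt; apply/orP; left; apply/eqP.
  by congr expR; ring.
rewrite !uprojR !nrm_sqr !mxE !ReImE !mul0r subr0 addr0.
have A := sqr_convex (ReC (w 0 (rshift s i))) (ReC (w' 0 (rshift s i))) t01.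
have B := sqr_convex (ImC (w 0 (rshift s i))) (ImC (w' 0 (rshift s i))) t01.
apply: (le_trans (lerD A B)); rewrite le_eqVlt; apply/orP; left; apply/eqP; ring.
Qed.

Lemma ucover_convex r w w' (t : R) : ucover s m r w -> ucover s m r w' -> 0 <= t <= 1 ->
  ucover s m r (w + rc t *: (w' - w)).
Proof.
move=> Uw Uw' t01; have /eballE A := Uw; have /eballE B := Uw'; apply/eballE.
have H : sqnorm (uproj s m (w + rc t *: (w' - w))) <=
    (1 - t) * sqnorm (uproj s m w) + t * sqnorm (uproj s m w').
  rewrite /sqnorm !mulr_sumr -big_split; apply: ler_sum => k _.
  exact: nrm_uproj_convex.
apply: (le_lt_trans H); case/andP: t01 => t0 t1.
have [->|tn] := eqVneq t 0; first by rewrite subr0 mul1r mul0r addr0.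
have tp : 0 < t by rewrite lt_def tn.
have E : r ^+ 2 = (1 - t) * r ^+ 2 + t * r ^+ 2 by ring.
rewrite E; apply: ler_ltD; last by rewrite ltr_pM2l.
by apply: ler_wpM2l; [rewrite subr_ge0|exact: ltW].
Qed.

Lemma ucover_usection r w x : ball_compl s m r x -> usection_dom w x -> ucover s m r (usection w x).
Proof. by move=> [Bx _] Dx; rewrite /ucover /= uproj_usection. Qed.

Lemma usection_near w x : usection_dom w x -> \forall y \near x, usection_dom w y.
Proof. by move=> Dx; apply: open_nbhs_nbhs; split=> //; apply: open_usection_dom. Qed.

Lemma usection_diff w x : usection_dom w x -> differentiable (usection w) x.
Proof.
move=> Dx; apply: (section_diff (cts_usection Dx) _).1.
by apply: filterS (usection_near Dx) => y; apply: uproj_usection.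
Qed.

(** The value is read at an arbitrary preimage picked by [xget]; invariance allows it to be read on
    a local section instead, which gives holomorphy. *)
Lemma descent r (G : Cn -> C) : holomorphic (ucover s m r) G ->
  (forall c w, ucover s m r w -> G (udeck c w) = G w) ->
  exists2 g, holomorphic (ball_compl s m r) g & forall w, ucover s m r w -> g (uproj s m w) = G w.
Proof.
move=> hG Ginv.
pose g (x : Cn) : C := G (xget 0 [set w | ucover s m r w /\ uproj s m w = x]).
have gE w : ucover s m r w -> g (uproj s m w) = G w.
  move=> Uw; rewrite /g; case: xgetP => [w1 _ [U1 /uproj_fiber [c ->]]|/(_ w)]; first exact: Ginv.
  by case.
exists g => // x Bx; have [w Uw wx] := uproj_surj Bx.
have Dx : usection_dom w x by rewrite -wx; apply: usection_dom_self.
apply: (@hol_near _ _ _ (fun y => G (usection w y))).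
  have nB : nbhs x (ball_compl s m r) by apply: open_nbhs_nbhs; split=> //; apply: open_ball_compl.
  apply: filterS (filterI nB (usection_near Dx)) => y [By Dy].
  by rewrite -gE ?uproj_usection //; apply: ucover_usection.
apply: differentiable_comp; first exact: usection_diff.
by apply: hG; apply: ucover_usection.
Qed.

End LogCoordinates.

(** * Equivariant maps to the half-plane and to the disc *)

Section SchwarzPick.
Variable R : realType.
Local Notation C := (Cplx R).

Definition cj (z : C) : C := (ReC z +i* - ImC z)%C.

Lemma Re_cj z : ReC (cj z) = ReC z. Proof. by []. Qed.
Lemma Im_cj z : ImC (cj z) = - ImC z. Proof. by []. Qed.

Lemma nrm_sub_cj (z p : C) : nrm (z - cj p) ^+ 2 = nrm (z - p) ^+ 2 + 4 * ImC z * ImC p.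
Proof. by rewrite !nrm_sqr !ReImE /cj /=; ring. Qed.

Lemma nrm_cj (z : C) : nrm (cj z) = nrm z.
Proof.
by apply/eqP; rewrite -(@eqrXn2 _ 2) ?nrm_ge0 // !nrm_sqr /= sqrrN.
Qed.

Lemma ler_sqr2 (x y : R) : 0 <= y -> x ^+ 2 <= y ^+ 2 -> x <= y.
Proof.
move=> y0 H; have [x0|x0] := leP 0 x; first by rewrite -(@ler_pXn2r _ 2) // nnegrE.
exact: le_trans (ltW x0) y0.
Qed.

(** The Schwarz lemma for (F - F(c)) / (F - conj F(c)), which takes values in the closed unit disc
    and vanishes at [c]. *)
Lemma schwarz_pick_half (F : C -> C) (c z : C) (r : R) : hol_disc F c r ->
  (forall z, nrm (z - c) < r -> 0 < ImC (F z)) -> nrm (z - c) < r ->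
  nrm (F z - F c) * r <= nrm (z - c) * nrm (F z - cj (F c)).
Proof.
move=> hF pF zr; have r0 : 0 < r by apply: le_lt_trans (nrm_ge0 _) zr.
have cr : nrm (c - c) < r by rewrite subrr nrm0.
have den (y : C) : nrm (y - c) < r -> 0 < nrm (F y - cj (F c)).
  move=> yr; rewrite nrm_gt0; apply/eqP => /(congr1 (fun z : C => ImC z)).
  rewrite cImB Im_cj /= => E; have := pF _ yr; have := pF _ cr; move: E; rewrite opprK; lra.
pose G (y : C) : C := (F y - F c) / (F y - cj (F c)).
have hG : hol_disc G c r.
  move=> y yr; apply: hol_div.
  - by rewrite -nrm_gt0 den.
  - by apply: holB; [exact: hF|exact: hol_cst].
  - by apply: holB; [exact: hF|exact: hol_cst].
have Gb y : nrm (y - c) < r -> nrm (G y) <= 1.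
  move=> yr; rewrite /G (nrmM (F y - F c)) nrmV ler_pdivrMr ?den // mul1r.
  apply: ler_sqr2; first exact: nrm_ge0.
  by rewrite nrm_sub_cj lerDl mulr_ge0 // ?mulr_ge0 // ltW // pF.
have Gc : G c = 0 by rewrite /G subrr mul0r.
have := schwarz hG Gc Gb zr; rewrite mul1r /G (nrmM (F z - F c)) nrmV mulrAC ler_pdivrMr ?den //.
Qed.

(** The conjugate is eliminated by |F(z) - conj F(c)| <= |F(z) - F(c)| + 2 Im F(z). What remains
    bounds F at the centre by data at [z]; [upper_growth] takes for [z] the base point and for the
    centre the moving point. *)
Lemma half_plane_growth (F : C -> C) (c z : C) (r : R) : hol_disc F c r ->
  (forall z, nrm (z - c) < r -> 0 < ImC (F z)) -> nrm (z - c) < r ->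
  nrm (F z - F c) * (r - nrm (z - c)) <= 2 * nrm (z - c) * ImC (F z).
Proof.
move=> hF pF zr; have H := schwarz_pick_half hF pF zr.
have H2 : nrm (F z - cj (F c)) <= nrm (F z - F c) + 2 * ImC (F z).
  have cr : nrm (c - c) < r by rewrite subrr nrm0; apply: le_lt_trans (nrm_ge0 _) zr.
  have pz := pF _ zr; have pc := pF _ cr.
  apply: ler_sqr2; first by rewrite addr_ge0 ?nrm_ge0 // mulr_ge0 // ltW.
  rewrite nrm_sub_cj.
  have E : (nrm (F z - F c) + 2 * ImC (F z)) ^+ 2 - (nrm (F z - F c) ^+ 2 + 4 * ImC (F z) * ImC (F c))
     = 4 * ImC (F z) * (nrm (F z - F c) + (ImC (F z) - ImC (F c))) by ring.
  rewrite -subr_ge0 E mulr_ge0 //; first by rewrite mulr_ge0 // ltW.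
  have := Im_le_nrm (F z - F c); rewrite cImB ler_norml => /andP[]; lra.
have := ler_wpM2l (nrm_ge0 (z - c)) H2; lra.
Qed.

End SchwarzPick.

Section IntRow.

Lemma int_row_ind s (P : 'rV[int]_s -> Prop) : P 0 -> (forall c c', P c -> P c' -> P (c + c')) ->
  (forall c, P c -> P (- c)) -> (forall i, P (delta_mx 0 i)) -> forall c, P c.
Proof.
move=> P0 PD PN Pe c.
have Pn (n : nat) i : P ((n : int) *: delta_mx 0 i).
  elim: n => [|n IH]; first by rewrite scale0r.
  by rewrite intS scalerDl scale1r; apply: PD.
rewrite (row_sum_delta c).
apply: (big_ind P) => // i _; case: (c 0 i) => n.
  exact: Pn.
by rewrite NegzE scaleNr; apply: PN; apply: Pn.
Qed.

End IntRow.

(** * Extension to the ball of functions invariant under the deck group *)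

Section Extension.
Variables (R : realType) (s m : nat) (r : R).
Local Notation C := (Cplx R).
Local Notation Cn := 'rV[C]_(s + m).

Lemma udeckD (c c' : 'rV[int]_s) (w : Cn) : udeck (c + c') w = udeck c (udeck c' w).
Proof.
apply: row_split_eq => i; last by rewrite !udeckR.
by rewrite !udeckL mxE mulrzDr addrAC addrA.
Qed.

Lemma udeck0 (w : Cn) : udeck 0 w = w.
Proof. by apply: row_split_eq => i; rewrite ?udeckR // udeckL mxE mulr0z addr0. Qed.

Lemma udeckNK (c : 'rV[int]_s) (w : Cn) : udeck c (udeck (- c) w) = w.
Proof. by rewrite -udeckD subrr udeck0. Qed.

Lemma invariant_generators (G : Cn -> C) :
  (forall i w, ucover s m r w -> G (udeck (delta_mx 0 i) w) = G w) ->
  forall c w, ucover s m r w -> G (udeck c w) = G w.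
Proof.
move=> Gi; apply: int_row_ind => //.
- by move=> w _; rewrite udeck0.
- by move=> c c' H H' w Uw; rewrite udeckD H ?H' //; apply: ucover_udeck.
- by move=> c H w Uw; rewrite -(H (udeck (- c) w)) ?udeckNK //; apply: ucover_udeck.
Qed.

Lemma ucover_lt (w w' : Cn) : ucover s m r w ->
  (forall k, nrm (uproj s m w' 0 k) <= nrm (uproj s m w 0 k)) -> ucover s m r w'.
Proof.
move=> /eballE Uw H; apply/eballE; apply: le_lt_trans Uw; apply: ler_sum => k _.
by rewrite ler_pXn2r ?nnegrE ?nrm_ge0.
Qed.

(* The growth condition says that [|G| * \prod_i |x_i|^(1 - theta_i)] is locally
   bounded, since [|x_i| = exp (Re w_i)]. *)
Lemma extension (G : Cn -> C) (theta : 'I_s -> R) : holomorphic (ucover s m r) G ->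
  (forall i w, ucover s m r w -> G (udeck (delta_mx 0 i) w) = G w) ->
  (forall i, 0 < theta i) ->
  (forall p, eball (s + m) r p -> exists K : R, \forall x \near p, ball_compl s m r x ->
     exists w, [/\ ucover s m r w, uproj s m w = x &
       nrm (G w) * \prod_i expR ((1 - theta i) * ReC (w 0 (lshift m i))) <= K]) ->
  exists2 g, holomorphic (eball (s + m) r) g & forall w, ucover s m r w -> G w = g (uproj s m w).
Proof.
move=> hG Gi th growth.
have [g hg gE] := descent hG (invariant_generators Gi).
have [||q hq qE] := @riemann_extension R (s + m) (eball (s + m) r) (hyps s m) g (uniq_hyps s m) (@open_eball R _ r).
- by move=> x Bx Hx; apply: hg; apply/ball_complE.
- move=> p Bp Hp e e0; have [K HK] := growth p Bp.
  have [k pk] : exists k : 'I_s, p 0 (lshift m k) = 0.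
    have := eqxx (coord_prod (hyps s m) p); rewrite {2}Hp coord_prod_hyps prodf_seq_eq0.
    by move=> /hasP [k _ /andP[_ /eqP pk]]; exists k.
  pose K' : R := `|K| + 1; have K'0 : 0 < K' by rewrite ltr_wpDl.
  pose B : R := nrm p + 1; have B0 : 0 < B by rewrite ltr_wpDl // nrm_ge0.
  pose Q : R := \prod_(i | i != k) expR (theta i * ln B).
  have Q0 : 0 < Q by apply: prodr_gt0 => i _; apply: expR_gt0.
  (* |y_k| <= [d1] means |y_k|^theta_k <= e / (Q K'); [Q] bounds the factors |y_i|^theta_i of the
     other coordinates near [p], [K'] comes from the growth condition. *)
  pose d1 : R := expR (ln (e / (Q * K')) / theta k).
  have /nbhs_nrmP [d2 d20 H2] := HK.
  have [d0 d00 H0] := (open_nrmP _).1 (@open_eball R _ r) p Bp.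
  exists (Num.min (Num.min d2 d0) (Num.min d1 1)).
    by rewrite !lt_min d20 d00 expR_gt0 ltr01.
  move=> y; rewrite !lt_min => /andP[/andP[yd2 yd0] /andP[yd1 y1]] Hy.
  have By : ball_compl s m r y by apply/ball_complE; split=> //; apply: H0.
  have [w [Uw wy Gw]] := H2 y yd2 By.
  have yw i : nrm (y 0 (lshift m i)) = expR (ReC (w 0 (lshift m i))) by rewrite -wy uprojL nrm_cexp.
  have wB i : ReC (w 0 (lshift m i)) <= ln B.
    rewrite -ler_expR lnK ?posrE // -yw; apply: (le_trans (nrm_coord _ _)).
    have := ler_nrmD (y - p) p; rewrite subrK /B; have := ltW y1; lra.
  have wk : expR (theta k * ReC (w 0 (lshift m k))) <= e / (Q * K').
    have q0 : 0 < e / (Q * K') by rewrite divr_gt0 // mulr_gt0.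
    rewrite -[leRHS]lnK ?posrE // ler_expR mulrC -ler_pdivlMr ?th // -ler_expR -yw.
    have := nrm_coord (y - p) (lshift m k); rewrite !mxE pk subr0 => H.
    exact: le_trans H (ltW yd1).
  rewrite -{2}wy gE // (nrmM (coord_prod _ _)) coord_prod_hyps nrm_prod.
  (* Each |y_i| is split into |y_i|^(1 - theta_i), used up by the growth of [G], and |y_i|^theta_i,
     which provides the convergence to 0. *)
  have -> : \prod_i nrm (y 0 (lshift m i)) = \prod_i expR ((1 - theta i) * ReC (w 0 (lshift m i)))
      * \prod_i expR (theta i * ReC (w 0 (lshift m i))).
    rewrite -big_split; apply: eq_bigr => i _; rewrite yw /= -expRD; congr expR; ring.
  rewrite mulrC mulrA.
  have T0 : 0 <= \prod_i expR (theta i * ReC (w 0 (lshift m i))) by apply: prodr_ge0 => i _; apply: expR_ge0.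
  have GK : nrm (G w) * \prod_i expR ((1 - theta i) * ReC (w 0 (lshift m i))) <= K'.
    by apply: (le_trans Gw); rewrite /K'; have := ler_norm K; lra.
  apply: (le_trans (ler_wpM2r T0 GK)).
  have TQ : \prod_i expR (theta i * ReC (w 0 (lshift m i))) <= e / (Q * K') * Q.
    rewrite (bigD1 k) //=; apply: ler_pM; [exact: expR_ge0| |exact: wk|].
      by apply: prodr_ge0 => i _; apply: expR_ge0.
    apply: ler_prod => i _; rewrite expR_ge0 ler_expR /=; apply: ler_wpM2l => //; exact: ltW (th i).
  apply: (le_trans (ler_wpM2l (ltW K'0) TQ)); rewrite le_eqVlt; apply/orP; left; apply/eqP.
  by field; rewrite !gt_eqF.
exists q => // w Uw; have /ball_complE [Bw Hw] := ucover_proj Uw.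
by rewrite qE // gE.
Qed.

End Extension.

(** * Growth near the hyperplanes and the expansions of both types *)

Section Bounds.
Variables (R : realType) (s m : nat) (r : R).
Hypothesis r0 : 0 < r.
Local Notation C := (Cplx R).
Local Notation Cn := 'rV[C]_(s + m).
Local Notation e_ i := (delta_mx 0 (lshift m i) : Cn).

Lemma ucover_nonempty : exists w, ucover s m r w.
Proof.
pose N : R := (s + m)%:R.
have N0 : 0 <= N by apply: ler0n.
pose e : R := r / (N + 1).
have e0 : 0 < e by rewrite divr_gt0 // ltr_wpDl.
have [|w Uw _] := @uproj_surj R s m r (const_mx (rc e)); last by exists w.
apply: neq0_ball_compl; last by move=> i; rewrite mxE fmorph_eq0 gt_eqF.
apply/eballE; rewrite /sqnorm (eq_bigr (fun=> e ^+ 2)); last first.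
  by move=> i _; rewrite mxE nrm_rc gtr0_norm.
rewrite sumr_const card_ord -[ltLHS]mulr_natl -/N.
have -> : r = e * (N + 1) by rewrite /e divfK // gt_eqF // ltr_wpDl.
rewrite -subr_gt0.
have -> : (e * (N + 1)) ^+ 2 - N * e ^+ 2 = e ^+ 2 * (N ^+ 2 + (N + 1)) by ring.
by rewrite mulr_gt0 ?exprn_gt0 // ltr_wpDl ?sqr_ge0 // ltr_wpDl.
Qed.

Lemma udeck_delta i (w : Cn) : udeck (delta_mx 0 i) w = w + two_i_pi R *: e_ i.
Proof.
apply: row_split_eq => j.
  rewrite udeckL !mxE eqxx /= (inj_eq (@lshift_inj _ _)).
  by case: (j == i); rewrite ?mulr1 ?mulr0 ?mulr1z ?mulr0z.
by rewrite udeckR !mxE eq_sym eq_lrshift mulr0 addr0.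
Qed.

Lemma nrm_two_i_pi : nrm (two_i_pi R) = pi *+ 2.
Proof. by rewrite /two_i_pi (nrmM 'i) nrm_i mul1r nrm_rc ger0_norm // mulrn_wge0 // pi_ge0. Qed.

Lemma hol_line (F : Cn -> C) (w v : Cn) (t : C) : holomorphic (ucover s m r) F ->
  ucover s m r (w + t *: v) -> differentiable (fun t : C => F (w + t *: v)) t.
Proof. by move=> hF Ut; exact: (line_diff (hF _ Ut)).1. Qed.

Lemma ucover_shift (w : Cn) i (t : C) : ucover s m r w -> ReC t <= 0 -> ucover s m r (w + t *: e_ i).
Proof.
move=> Uw t0; apply: (ucover_lt Uw) => k; case: (split_ordP k) => j ->.
  rewrite !uprojL !nrm_cexp ler_expR coord_line cReD cReM.
  by case: (_ == _); rewrite /= ?mulr1 ?mulr0 ?subr0; lra.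
by rewrite !uprojR coord_line eq_rlshift mulr0 addr0.
Qed.

(** Multiplication by [a] moves every point of the half-plane by the same hyperbolic distance |ln
    a|, whereas the translation by 2 i pi has hyperbolic length tending to 0 in discs of growing
    radius. *)
Lemma no_multiplier (F : Cn -> C) i (a : R) : holomorphic (ucover s m r) F ->
  (forall w, ucover s m r w -> 0 < ImC (F w)) -> 0 < a ->
  (forall w, ucover s m r w -> F (udeck (delta_mx 0 i) w) = rc a * F w) -> a = 1.
Proof.
move=> hF pF a0 Fa; apply/eqP; apply/negPn; apply/negP => a1.
have [w0 Uw0] := ucover_nonempty.
have n0 : 0 < `|a - 1| by rewrite normr_gt0 subr_eq0.
have p0 := @pi_gt0 R.
(* Schwarz-Pick on a disc of radius [T] will give |a - 1| T <= 2 pi (a + 1): the first summand makes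
   this an equality, the others break it and put 2 i pi inside the disc. *)
pose T : R := pi *+ 2 * (a + 1) / `|a - 1| + pi *+ 2 + 1.
have q0 : 0 < pi *+ 2 * (a + 1) / `|a - 1|.
  have p20 : 0 < (pi *+ 2 : R) by rewrite mulr2n addr_gt0.
  by rewrite divr_gt0 // mulr_gt0 // addr_gt0.
have T2 : pi *+ 2 < T by rewrite /T; lra.
pose w := w0 - rc T *: e_ i.
have Ut (t : C) : nrm (t - 0) < T -> ucover s m r (w + t *: e_ i).
  rewrite subr0 => tT; rewrite /w -addrA -scaleNr -scalerDl; apply: ucover_shift => //.
  by rewrite cReD cReN /=; have := Re_le_nrm t; rewrite ler_norml => /andP[]; lra.
pose phi (t : C) : C := F (w + t *: e_ i).
have zT : nrm (two_i_pi R - 0) < T by rewrite subr0 nrm_two_i_pi.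
have T0 : 0 < T by lra.
have cT : nrm ((0 : C) - 0) < T by rewrite subr0 nrm0.
have := @schwarz_pick_half R phi 0 (two_i_pi R) T _ _ zT.
have phiT : phi (two_i_pi R) = rc a * F w.
  by rewrite /phi -udeck_delta Fa //; have := Ut 0 cT; rewrite scale0r addr0.
rewrite subr0 nrm_two_i_pi phiT.
have -> : phi 0 = F w by rewrite /phi scale0r addr0.
have pw : 0 < ImC (F w) by apply: pF; have := Ut 0 cT; rewrite scale0r addr0.
have nFw : 0 < nrm (F w) by rewrite nrm_gt0; apply: contraTneq pw => ->; rewrite ltxx.
move=> /(_ (fun t tT => hol_line hF (Ut t tT)) (fun t tT => pF _ (Ut t tT))).
have -> : rc a * F w - F w = rc (a - 1) * F w by rewrite rmorphB rmorph1; ring.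
rewrite (nrmM (rc (a - 1))) nrm_rc => H.
have H2 : nrm (rc a * F w - cj (F w)) <= (a + 1) * nrm (F w).
  apply: (le_trans (ler_nrmB _ _)); rewrite (nrmM (rc a)) nrm_rc nrm_cj gtr0_norm //.
  by rewrite mulrDl mul1r.
have p2 : 0 <= (pi *+ 2 : R) by rewrite mulrn_wge0 // ltW.
have := le_trans H (ler_wpM2l p2 H2).
have -> : `|a - 1| * nrm (F w) * T = (`|a - 1| * T) * nrm (F w) by ring.
rewrite (mulrA (pi *+ 2)) ler_pM2r // => H3.
have : `|a - 1| * T = pi *+ 2 * (a + 1) + `|a - 1| * (pi *+ 2 + 1).
  by rewrite /T; field; rewrite gt_eqF.
have : 0 < `|a - 1| * (pi *+ 2 + 1) by rewrite mulr_gt0 // ltr_wpDl.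
move: H3; lra.
Qed.

(** Unlike [clog], a logarithm at every nonzero point, with bounded imaginary part but without
    continuity. *)
Definition Log (z : C) : C := xget 0 [set w | cexp w = z /\ - pi < ImC w <= pi].

Lemma LogK (z : C) : z != 0 -> cexp (Log z) = z.
Proof.
by move=> z0; rewrite /Log; case: xgetP => [w _ []//|H]; have [w wz [wI _]] := cexp_surj z0; case: (H w).
Qed.

Lemma Im_Log (z : C) : `|ImC (Log z)| <= pi.
Proof.
rewrite /Log; case: xgetP => [w _ [_ /andP[w1 w2]]|_]; last by rewrite normr0 pi_ge0.
by rewrite ler_norml (ltW w1) w2.
Qed.

Lemma nrm_sub_coord_lt n (x p : 'rV[C]_n) (e : R) : 0 < e ->
  (forall k, nrm (x 0 k - p 0 k) < e) -> nrm (x - p) < e.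
Proof. by move=> e0 H; apply/nrm_lt_coord => // k; rewrite !mxE. Qed.

Lemma clog1 : @clog R 1 = 0.
Proof.
apply: C_eq; rewrite /clog /= nrm1 ?ln1 // mul0r -[in LHS]sin0 sinK // in_itv /=.
have := @pi_gt0 R; lra.
Qed.

(** The bound 3 on the parameter is the one that occurs in [log_segment], where |t - 1| < 2. *)
Lemma near_clog (e : R) (x : Cn) k : 0 < e -> x 0 k != 0 ->
  \forall y \near x, 0 < ReC ((y : Cn) 0 k / x 0 k) /\
    forall t : C, nrm t < 3 -> nrm (x 0 k * cexp (t * clog (y 0 k / x 0 k)) - x 0 k) < e.
Proof.
move=> e0 xk.
have cq : {for x, continuous (fun y : Cn => y 0 k / x 0 k : C)}.
  by apply: ctsM; [exact: differentiable_cts (hol_coord x k)|exact: cts_cst].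
have x1 : x 0 k / x 0 k = 1 by rewrite divff.
have H1 : \forall y \near x, 0 < ReC ((y : Cn) 0 k / x 0 k).
  have cR : {for x, continuous (fun y : Cn => ReC (y 0 k / x 0 k : C))}.
    by apply: (@cts_comp _ _ _ (fun y : Cn => y 0 k / x 0 k : C) (@complex.Re R : C -> R)) => //; apply: continuous_Re.
  have := cR; move=> /continuous_toR_nrmP /(_ 1 ltr01) [d d0 H]; apply/nbhs_nrmP; exists d => // y /H.
  by rewrite x1 /= ltr_norml => /andP[]; lra.
have ce : {for (0 : C), continuous (fun z : C => x 0 k * cexp z)}.
  by apply: ctsM; [exact: cts_cst|exact: cts_cexp].
have /continuous_nrmP /(_ e e0) [d d0 Hd] := ce.
have cl : {for x, continuous (fun y : Cn => clog (y 0 k / x 0 k))}.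
  apply: (@cts_comp _ _ _ (fun y : Cn => y 0 k / x 0 k : C) (@clog R)); first exact: cq.
  by apply: cts_clog; rewrite x1; apply: ltr01.
have /continuous_nrmP /(_ (d / 3) (divr_gt0 d0 (ltr0Sn _ 2))) [d' d'0 Hl] := cl.
have H2 : \forall y \near x, nrm (clog ((y : Cn) 0 k / x 0 k)) < d / 3.
  apply/nbhs_nrmP; exists d' => // y /Hl; by rewrite x1 clog1 subr0.
apply: filterS (filterI H1 H2) => y [y1 y2]; split=> // t t3.
have := Hd (t * clog (y 0 k / x 0 k)); rewrite subr0 cexp0 mulr1; apply.
rewrite (nrmM t); have -> : d = 3 * (d / 3) by field.
by apply: ltr_pM => //; apply: nrm_ge0.
Qed.

Section LogSegment.
Variable p : Cn.
Hypothesis Bp : eball (s + m) r p.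
Variable E : R.

(* The segment joining the base point over [p] to a point of the fibre of a
   nearby [x], in logarithmic coordinates; the base point of the coordinates
   vanishing at [p] is [E]. *)
Definition log_base : Cn := row_mx (\row_i (if p 0 (lshift m i) == 0 then rc E
   else Log (p 0 (lshift m i)))) (rsubmx p).

Definition log_point (x : Cn) : Cn := row_mx (\row_i (if p 0 (lshift m i) == 0 then Log (x 0 (lshift m i))
   else Log (p 0 (lshift m i)) + clog (x 0 (lshift m i) / p 0 (lshift m i)))) (rsubmx x).

Definition log_dist (x : Cn) : R :=
  \sum_i `|ReC (log_point x 0 (lshift m i)) - ReC (log_base 0 (lshift m i))|.

(** At a coordinate vanishing at [p], Re t > -1/(1 + D) lets the real part exceed [E] by at most 1,
    and Im t multiplied by an imaginary part of modulus at most pi adds at most 2 pi; the value of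
    [E] keeps the sum below [ln d]. The other coordinates stay near those of [p] by continuity. *)
Lemma log_segment (d : R) : 0 < d -> E = ln d - 2 - pi *+ 2 ->
  (forall y, nrm (y - p) < d -> eball (s + m) r y) ->
  \forall x \near p, ball_compl s m r x ->
   [/\ uproj s m (log_point x) = x, forall i, `|ImC (log_point x 0 (lshift m i))| <= pi *+ 2 &
    forall t : C, nrm (t - 1) < 1 + (1 + log_dist x)^-1 ->
      ucover s m r (log_base + t *: (log_point x - log_base))].
Proof.
move=> d0 EE Hd.
have pi0 := @pi_gt0 R.
have N1 : \forall x \near p, forall i, p 0 (lshift m i) != 0 ->
    0 < ReC ((x : Cn) 0 (lshift m i) / p 0 (lshift m i)) /\
    forall t : C, nrm t < 3 -> nrm (p 0 (lshift m i) * cexp (t * clog (x 0 (lshift m i) / p 0 (lshift m i))) - p 0 (lshift m i)) < d.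
  apply: (@filter_forall Cn 'I_s (fun i x => p 0 (lshift m i) != 0 -> _ /\ _) (nbhs p) _ _) => i.
  have [pi1|pi1] := eqVneq (p 0 (lshift m i)) 0; first by apply/nbhs_nrmP; exists 1 => // t _; rewrite pi1 eqxx.
  by have := near_clog d0 pi1; apply: filterS => x Hx _.
have eE : 0 < Num.min (d / 3) (expR E) by rewrite lt_min expR_gt0 divr_gt0.
have N2 : \forall x \near p, nrm (x - p) < Num.min (d / 3) (expR E).
  by apply/nbhs_nrmP; exists (Num.min (d / 3) (expR E)).
apply: filterS (filterI N1 N2) => x [H1]; rewrite lt_min => /andP[x3 xE] Bx.
have x0 := ball_compl_neq0 Bx.
have pointL i : log_point x 0 (lshift m i) = (if p 0 (lshift m i) == 0 then Log (x 0 (lshift m i))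
   else Log (p 0 (lshift m i)) + clog (x 0 (lshift m i) / p 0 (lshift m i))) by rewrite row_mxEl mxE.
have baseL i : log_base 0 (lshift m i) = (if p 0 (lshift m i) == 0 then rc E
   else Log (p 0 (lshift m i))) by rewrite row_mxEl mxE.
have pointR j : log_point x 0 (rshift s j) = x 0 (rshift s j) by rewrite row_mxEr mxE.
have baseR j : log_base 0 (rshift s j) = p 0 (rshift s j) by rewrite row_mxEr mxE.
split.
- apply: row_split_eq => i; last by rewrite uprojR pointR.
  rewrite uprojL pointL; case: eqVneq => [pi1|pi1]; first by rewrite LogK.
  by rewrite cexpD clogK ?(H1 i pi1).1 // LogK // mulrC divfK.
- move=> i; rewrite pointL; case: eqVneq => [pi1|pi1].
    by apply: (le_trans (Im_Log _)); rewrite mulr2n; lra.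
  rewrite cImD; apply: (le_trans (ler_normD _ _)); have := Im_Log (p 0 (lshift m i)).
  have /andP[c1 c2] := Im_clog (H1 i pi1).1.
  have : `|ImC (clog (x 0 (lshift m i) / p 0 (lshift m i)))| <= pi.
    by rewrite ler_norml; apply/andP; split; lra.
  by rewrite mulr2n; lra.
move=> t tT; pose D := log_dist x.
have D0 : 0 <= D by apply: sumr_ge0 => i _; apply: normr_ge0.
have D1 : 0 < 1 + D by lra.
have DV : 0 < (1 + D)^-1 by rewrite invr_gt0.
have DV1 : (1 + D)^-1 <= 1 by rewrite invf_le1 //; lra.
have t3 : nrm t < 3.
  have := ler_nrmD (t - 1) 1; rewrite subrK nrm1 => H; apply: (le_lt_trans H).
  move: tT; rewrite -/D; lra.
have tRe : - (1 + D)^-1 < ReC t.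
  have := Re_le_nrm (t - 1); rewrite cReB /= ler_norml => /andP[h _]; move: tT h; rewrite -/D; lra.
have tIm : `|ImC t| <= 2.
  have := Im_le_nrm (t - 1); rewrite cImB /= subr0 => h; apply: (le_trans h).
  move: tT; rewrite -/D; lra.
have segE k : (log_base + t *: (log_point x - log_base)) 0 k =
    log_base 0 k + t * (log_point x 0 k - log_base 0 k) by rewrite !mxE.
apply: Hd; apply: nrm_sub_coord_lt => // k; case: (split_ordP k) => i ->; last first.
  rewrite uprojR segE pointR baseR.
  have -> : p 0 (rshift s i) + t * (x 0 (rshift s i) - p 0 (rshift s i)) - p 0 (rshift s i) =
     t * (x - p) 0 (rshift s i) by rewrite !mxE; ring.
  rewrite (nrmM t); have -> : d = 3 * (d / 3) by field.
  apply: ltr_pM => //; try exact: nrm_ge0.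
  by apply: le_lt_trans x3; apply: nrm_coord.
rewrite uprojL segE pointL baseL; have xi := pointL i; have bi := baseL i.
case: eqVneq xi bi => [pi1|pi1] xi bi; last first.
  have -> : Log (p 0 (lshift m i)) + t * (Log (p 0 (lshift m i)) + clog (x 0 (lshift m i) / p 0 (lshift m i)) - Log (p 0 (lshift m i)))
    = Log (p 0 (lshift m i)) + t * clog (x 0 (lshift m i) / p 0 (lshift m i)) by ring.
  by rewrite cexpD LogK //; apply: (H1 i pi1).2.
rewrite pi1 subr0 nrm_cexp; set z := Log _.
have zE : ReC z < E.
  rewrite -ltr_expR -nrm_cexp LogK //; apply: le_lt_trans xE.
  by have := nrm_coord (x - p) (lshift m i); rewrite !mxE pi1 subr0.
have dD : E - ReC z <= D.
  rewrite /D /log_dist (bigD1 i) //= xi bi /= -/z.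
  have h : 0 <= \sum_(i0 < s | i0 != i) `|ReC (log_point x 0 (lshift m i0)) - ReC (log_base 0 (lshift m i0))|.
    by apply: sumr_ge0 => j _; apply: normr_ge0.
  have := ler_norm (- (ReC z - E)); rewrite normrN; lra.
rewrite -[ltRHS]lnK ?posrE // ltr_expR !ReImE subr0.
have Imz := Im_Log (x 0 (lshift m i)); rewrite -/z in Imz.
have A1 : - ((E - ReC z) * ReC t) <= 1.
  have h : (E - ReC z) * - ReC t <= (E - ReC z) * (1 + D)^-1.
    by apply: ler_wpM2l; lra.
  have h2 : (E - ReC z) * (1 + D)^-1 <= 1 by rewrite ler_pdivrMr // mul1r; lra.
  by move: h h2; rewrite mulrN; lra.
have A2 : - (ImC t * ImC z) <= pi *+ 2.
  apply: (le_trans (ler_norm _)); rewrite normrN normrM -[leRHS]mulr_natl.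
  by apply: ler_pM.
have -> : E + (ReC t * (ReC z - E) - ImC t * ImC z) = E - (E - ReC z) * ReC t - ImC t * ImC z by ring.
rewrite EE; move: A1 A2; rewrite EE; lra.
Qed.

End LogSegment.

(** [half_plane_growth] on the disc of [log_segment]: the margin 1/(1 + D) beyond the base point
    turns the imaginary part of F there into a bound linear in D, hence in the |Re w_i|. *)
Lemma upper_growth (F : Cn -> C) (p : Cn) : holomorphic (ucover s m r) F ->
  (forall w, ucover s m r w -> 0 < ImC (F w)) -> eball (s + m) r p ->
  exists A K : R, 0 <= K /\ \forall x \near p, ball_compl s m r x ->
    exists w, [/\ ucover s m r w, uproj s m w = x,
      forall i, `|ImC (w 0 (lshift m i))| <= A &
      nrm (F w) <= K * (1 + \sum_i `|ReC (w 0 (lshift m i))|)].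
Proof.
move=> hF pF Bp; have [d d0 Hd] := (open_nrmP _).1 (@open_eball R _ r) p Bp.
pose E : R := ln d - 2 - pi *+ 2.
have H := log_segment d0 (erefl E) Hd.
have r1 (x : Cn) : 0 < (1 + log_dist p E x)^-1.
  have h : 0 <= log_dist p E x by apply: sumr_ge0 => i _; apply: normr_ge0.
  by rewrite invr_gt0; lra.
(* If the base point is outside the domain, [log_segment] at t = 0 shows that no nearby [x] is off
   the hyperplanes, and any constants do. *)
have [Ub|nUb] := pselect (ucover s m r (log_base p E)); last first.
  exists 0, 0; split=> //; apply: filterS H => x Hx Bx; exfalso; apply: nUb.
  have [_ _ /(_ 0)] := Hx Bx; rewrite scale0r addr0 sub0r nrmN nrm1; apply.
  by have := r1 x; lra.
pose I0 := ImC (F (log_base p E)).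
have I00 : 0 < I0 by apply: pF.
pose S0 := \sum_i `|ReC (log_base p E 0 (lshift m i))|.
have S00 : 0 <= S0 by apply: sumr_ge0 => i _; apply: normr_ge0.
exists (pi *+ 2), (nrm (F (log_base p E)) + 2 * I0 * (1 + S0)); split.
  apply: addr_ge0; first exact: nrm_ge0.
  by rewrite mulr_ge0 ?mulr_ge0 ?(ltW I00) //; lra.
apply: filterS H => x Hx Bx; have [px Imx Ut] := Hx Bx.
set b := log_base p E in I0 I00 S0 S00 Ub Ut *; set w := log_point p x in px Imx Ut *.
pose D := log_dist p E x; have rD := r1 x; rewrite -/D in rD Ut.
have Uw : ucover s m r w.
  have := Ut 1; rewrite subrr nrm0 scale1r subrKC; apply; lra.
exists w; split=> //.
pose phi (t : C) : C := F (b + t *: (w - b)).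
have z1 : nrm ((0 : C) - 1) < 1 + (1 + D)^-1 by rewrite sub0r nrmN nrm1; lra.
have := half_plane_growth (fun t tT => hol_line hF (Ut t tT)) (fun t tT => pF _ (Ut t tT)) z1.
rewrite scale0r addr0 scale1r subrKC sub0r nrmN nrm1 (addrC 1) addrK mulr1 -/I0.
have D0 : 0 <= D by apply: sumr_ge0 => i _; apply: normr_ge0.
rewrite ler_pdivrMr; last by lra.
move=> H1.
have DS : D <= S0 + \sum_i `|ReC (w 0 (lshift m i))|.
  rewrite /D /log_dist /S0 -big_split; apply: ler_sum => i _ /=.
  by rewrite (le_trans (ler_normB _ _)) // addrC.
pose S1 := \sum_i `|ReC (w 0 (lshift m i))|; rewrite -/S1 in DS *.
have S10 : 0 <= S1 by apply: sumr_ge0 => i _; apply: normr_ge0.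
have H2 : nrm (F w) <= nrm (F b) + 2 * I0 * (1 + D).
  have := ler_nrmBD (F w) (F b) 0; rewrite !subr0 (nrmB (F w)) => h; apply: (le_trans h).
  by rewrite addrC lerD2l.
apply: (le_trans H2); rewrite [leRHS]mulrDl; apply: lerD.
  by rewrite ler_peMr ?nrm_ge0 //; lra.
rewrite -[leRHS]mulrA; apply: ler_wpM2l; first by rewrite mulr_ge0 // ltW.
by have := mulr_ge0 S00 S10; rewrite mulrDl mul1r mulrDr mulr1; lra.
Qed.

(** Distributes the linear growth over the coordinates, to match the product in the growth condition
    of [extension]. *)
Lemma sum_le_prod n (u : 'I_n -> R) : (forall i, 0 <= u i) -> 1 + \sum_i u i <= \prod_i (1 + u i).
Proof.
elim: n u => [|n IH] u u0; first by rewrite !big_ord0 addr0.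
rewrite !big_ord_recl; have H := IH (fun i => u (lift ord0 i)) (fun i => u0 _).
have S0 : 0 <= \sum_(i < n) u (lift ord0 i) by apply: sumr_ge0.
have u1 : 0 <= 1 + u ord0 by have := u0 ord0; lra.
apply: le_trans (ler_wpM2l u1 H); rewrite mulrDl mul1r mulrDr mulr1.
have := mulr_ge0 (u0 ord0) S0; lra.
Qed.

(** For u >= 0 both factors are at most [B]; for u < 0 the second is at most 2 exp(- u / 2), which
    gives the summand 2. *)
Lemma exp_half_bound (u B : R) : 1 <= B -> u <= ln B -> expR (u / 2) * (1 + `|u|) <= B ^+ 2 + 2.
Proof.
move=> B1 uB; have B0 : 0 < B by lra.
have [u0|u0] := leP 0 u.
  rewrite ger0_norm //; have h1 : expR (u / 2) <= B.
    by rewrite -[leRHS]lnK ?posrE // ler_expR; have := ln_ge0 B1; lra.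
  have h2 : 1 + u <= B.
    rewrite -[leRHS]lnK ?posrE //; apply: (le_trans (expR_ge1Dx _)); by rewrite ler_expR.
  have h3 : expR (u / 2) * (1 + u) <= B * B by apply: ler_pM => //; rewrite ?expR_ge0 // addr_ge0.
  by rewrite expr2; lra.
rewrite ltr0_norm //; have h1 := expR_ge1Dx (- u / 2).
have h2 : expR (u / 2) * (1 + - u) <= expR (u / 2) * (2 * expR (- u / 2)).
  by apply: ler_wpM2l; [exact: expR_ge0|lra].
have h3 : expR (u / 2) * (2 * expR (- u / 2)) = 2.
  by rewrite mulrCA -expRD mulNr subrr expR0 mulr1.
have := exprn_ge0 2 (ltW B0); lra.
Qed.

Lemma differentiable_bounded (g : Cn -> C) (p : Cn) : differentiable g p ->
  exists2 d : R, 0 < d & forall x, nrm (x - p) < d -> nrm (g x) <= nrm (g p) + 1.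
Proof.
move=> dg; have /continuous_nrmP /(_ 1 ltr01) [d d0 H] := differentiable_cts dg.
exists d => // x /H h; have := ler_nrmD (g x - g p) (g p); rewrite subrK; have := ltW h; lra.
Qed.

Lemma two_i_pi_neq0 : two_i_pi R != 0.
Proof. by rewrite -nrm_gt0 nrm_two_i_pi mulr2n addr_gt0 ?pi_gt0. Qed.

Lemma Im_div_two_i_pi (z : C) : ImC ((two_i_pi R)^-1 * z) = - ReC z / (pi *+ 2).
Proof.
have p0 : (pi *+ 2 : R) != 0 by rewrite gt_eqF // mulr2n addr_gt0 ?pi_gt0.
have -> : (two_i_pi R)^-1 = - 'i * rc (pi *+ 2)^-1.
  apply: (mulfI two_i_pi_neq0); rewrite divff ?two_i_pi_neq0 // /two_i_pi.
  by rewrite mulrACA -rmorphM divff // rmorph1 mulr1 mulrN -expr2 sqrCi opprK.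
by rewrite !ReImE; set q := (_ *+ 2)^-1; ring.
Qed.

(** The linear term is the one whose increment under the i-th generator is [lambda i], so the
    difference is invariant and extends to the ball. *)
Lemma parabolic_expansion (F : Cn -> C) (lambda : 'I_s -> R) : holomorphic (ucover s m r) F ->
  (forall w, ucover s m r w -> 0 < ImC (F w)) ->
  (forall i w, ucover s m r w -> F (udeck (delta_mx 0 i) w) = F w + rc (lambda i)) ->
  exists g, [/\ holomorphic (eball (s + m) r) g, forall i, 0 <= lambda i &
    forall w, ucover s m r w -> F w =
      (two_i_pi R)^-1 * (\sum_i rc (lambda i) * w 0 (lshift m i)) + g (uproj s m w)].
Proof.
move=> hF pF Fl; pose L (w : Cn) : C := \sum_i rc (lambda i) * w 0 (lshift m i).
pose G (w : Cn) : C := F w - (two_i_pi R)^-1 * L w.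
have hL (w : Cn) : differentiable L w.
  apply: hol_sum => i _; apply: holM; [exact: hol_cst|exact: hol_coord].
have hG : holomorphic (ucover s m r) G.
  move=> w Uw; apply: holB; first exact: hF.
  by apply: holM; [exact: hol_cst|exact: hL].
have LD i (w : Cn) : L (udeck (delta_mx 0 i) w) = L w + two_i_pi R * rc (lambda i).
  rewrite udeck_delta /L (bigD1 i) //= [in RHS](bigD1 i) //= coord_line_eq.
  have -> : \sum_(j | j != i) rc (lambda j) * (w + two_i_pi R *: e_ i) 0 (lshift m j) =
     \sum_(j | j != i) rc (lambda j) * w 0 (lshift m j).
    by apply: eq_bigr => j ji; rewrite coord_line_neq // (inj_eq (@lshift_inj _ _)).
  ring.
have Ginv i w : ucover s m r w -> G (udeck (delta_mx 0 i) w) = G w.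
  move=> Uw; rewrite /G Fl // LD mulrDr mulKf ?two_i_pi_neq0 //; ring.
(* The growth is logarithmic in the |x_i|, so half a power of each of them absorbs it and the other
   half tends to 0. *)
have [|p Bp|g hg gE] := extension hG Ginv (theta := fun=> 2^-1).
- by move=> i; rewrite invr_gt0.
- have [A [K [K0 HK]]] := upper_growth hF pF Bp.
  pose Lam : R := \sum_i `|lambda i|; pose A' := `|A|.
  have Lam0 : 0 <= Lam by apply: sumr_ge0 => i _; apply: normr_ge0.
  have A'0 : 0 <= A' by apply: normr_ge0.
  pose B := nrm p + 1; have B1 : 1 <= B by rewrite /B; have := nrm_ge0 p; lra.
  pose q := nrm (two_i_pi R)^-1; have q0 : 0 <= q by apply: nrm_ge0.
  pose K1 := K + q * (Lam * (1 + A')).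
  have K10 : 0 <= K1 by rewrite addr_ge0 // !mulr_ge0 // addr_ge0.
  exists (K1 * \prod_(i < s) (B ^+ 2 + 2)).
  have N1 : \forall x \near p, nrm (x - p) < 1 by apply/nbhs_nrmP; exists 1.
  apply: filterS (filterI HK N1) => x [Hx x1] Bx; have [w [Uw wx Aw Fw]] := Hx Bx.
  exists w; split=> //.
  pose S := \sum_i `|ReC (w 0 (lshift m i))|; rewrite -/S in Fw.
  have S0 : 0 <= S by apply: sumr_ge0 => i _; apply: normr_ge0.
  have wS i : nrm (w 0 (lshift m i)) <= (1 + A') * (1 + S).
    apply: (le_trans (nrm_le_ReIm _)).
    have h1 : `|ReC (w 0 (lshift m i))| <= S.
      rewrite /S (bigD1 i) //= lerDl; apply: sumr_ge0 => j _; apply: normr_ge0.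
    have h2 : `|ImC (w 0 (lshift m i))| <= A' by apply: (le_trans (Aw i)); apply: ler_norm.
    by have := mulr_ge0 A'0 S0; rewrite mulrDl mul1r mulrDr mulr1; lra.
  have nL : nrm (L w) <= Lam * ((1 + A') * (1 + S)).
    apply: (le_trans (ler_nrm_sum _ _ _)); rewrite /Lam mulr_suml; apply: ler_sum => i _.
    by rewrite (nrmM (rc _)) nrm_rc; apply: ler_wpM2l => //; apply: normr_ge0.
  have nG : nrm (G w) <= K1 * (1 + S).
    apply: (le_trans (ler_nrmB _ _)); rewrite (nrmM (two_i_pi R)^-1) -/q /K1 mulrDl.
    by apply: lerD => //; rewrite -mulrA -(mulrA Lam); apply: ler_wpM2l.
  have P0 : 0 <= \prod_i expR ((1 - 2^-1) * ReC (w 0 (lshift m i))) by apply: prodr_ge0 => i _; apply: expR_ge0.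
  apply: (le_trans (ler_wpM2r P0 nG)); rewrite -mulrA; apply: ler_wpM2l => //.
  have h := sum_le_prod (fun i => normr_ge0 (ReC (w 0 (lshift m i)))).
  apply: (le_trans (ler_wpM2r P0 h)); rewrite -big_split; apply: ler_prod => i _ /=.
  rewrite mulr_ge0 ?expR_ge0 ?addr_ge0 //= mulrC.
  have -> : (1 - 2^-1) * ReC (w 0 (lshift m i)) = ReC (w 0 (lshift m i)) / 2 by field.
  apply: exp_half_bound => //; rewrite -ler_expR lnK ?posrE; last by lra.
  rewrite -nrm_cexp -uprojL wx; apply: (le_trans (nrm_coord _ _)).
  by have := ler_nrmD (x - p) p; rewrite subrK /B; have := ltW x1; lra.
exists g; split=> //; last by move=> w Uw; rewrite -gE // /G subrKC.
(* For a negative coefficient the imaginary part of the linear term tends to minus infinity as Re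
   w_i does, while [g] stays bounded near the limit point [p] on x_i = 0. *)
move=> i; rewrite leNgt; apply/negP => li.
have [w0 Uw0] := ucover_nonempty.
pose p := uproj s m w0 - uproj s m w0 0 (lshift m i) *: e_ i.
have pE k : p 0 k = if k == lshift m i then 0 else uproj s m w0 0 k.
  rewrite /p -scaleNr coord_line; case: eqVneq => [->|]; first by rewrite mulr1 subrr.
  by rewrite mulr0 addr0.
have Bp : eball (s + m) r p.
  have /eballE U := Uw0; apply/eballE; apply: le_lt_trans U; apply: ler_sum => k _; rewrite pE.
  by case: eqP => // _; rewrite nrm0 expr0n /= sqr_ge0.
have [d d0 gb] := differentiable_bounded (hg p Bp).
pose M := nrm (g p) + 1; have M0 : 0 < M by rewrite ltr_wpDl ?nrm_ge0.
pose a := ReC (w0 0 (lshift m i)); pose N := pi *+ 2 * M + `|ReC (L w0)|.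
have pi20 : 0 < (pi *+ 2 : R) by rewrite mulr2n addr_gt0 ?pi_gt0.
have N0 : 0 < N by rewrite ltr_wpDr ?mulr_gt0.
have Nl : 0 < N / - lambda i by rewrite divr_gt0 // oppr_gt0.
(* The last summand brings the imaginary part of the linear term below minus the bound [M] of [g];
   the others make |x_i| = exp(a - t) smaller than [d]. *)
pose t := `|a| + `|ln d| + 1 + N / - lambda i.
have t0 : 0 <= t by rewrite /t; have := normr_ge0 a; have := normr_ge0 (ln d); lra.
have tl : lambda i * t <= - N.
  have : - lambda i * (N / - lambda i) = N by rewrite mulrC divfK // oppr_eq0 lt_eqF.
  have : N / - lambda i <= t by rewrite /t; have := normr_ge0 a; have := normr_ge0 (ln d); lra.
  by rewrite -(ler_pM2l (x := - lambda i)) ?oppr_gt0 // => h1 h2; move: h1; rewrite h2 mulNr; lra.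
pose w := w0 + rc (- t) *: e_ i.
have Uw : ucover s m r w by apply: ucover_shift => //=; rewrite oppr_le0.
have wd : nrm (uproj s m w - p) < d.
  apply: nrm_sub_coord_lt => // k; rewrite pE; case: (split_ordP k) => j ->; last first.
    by rewrite eq_rlshift !uprojR coord_line eq_rlshift mulr0 addr0 subrr nrm0.
  rewrite (inj_eq (@lshift_inj _ _)); case: eqVneq => [->|ji].
    rewrite subr0 uprojL nrm_cexp coord_line_eq -[ltRHS]lnK ?posrE // ltr_expR cReD /= -/a.
    by have := ler_norm a; have := ler_norm (- ln d); rewrite normrN /t; lra.
  by rewrite !uprojL coord_line_neq ?(inj_eq (@lshift_inj _ _)) // subrr nrm0.
have LwE : ReC (L w) = ReC (L w0) - lambda i * t.
  have -> : L w = L w0 + rc (- (lambda i * t)); last by rewrite cReD.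
  rewrite /L (bigD1 i) //= [in RHS](bigD1 i) //= coord_line_eq.
  have -> : \sum_(j | j != i) rc (lambda j) * w 0 (lshift m j) =
     \sum_(j | j != i) rc (lambda j) * w0 0 (lshift m j).
    by apply: eq_bigr => j ji; rewrite coord_line_neq // (inj_eq (@lshift_inj _ _)).
  by rewrite !rmorphN !rmorphM /=; ring.
have := pF _ Uw.
have -> : F w = (two_i_pi R)^-1 * L w + g (uproj s m w) by rewrite -gE // /G subrKC.
rewrite cImD Im_div_two_i_pi LwE => H.
have h1 := le_trans (ler_norm _) (le_trans (Im_le_nrm _) (gb _ wd)).
have h2 : - (ReC (L w0) - lambda i * t) / (pi *+ 2) <= - M.
  rewrite ler_pdivrMr //; move: tl; rewrite /N; have := ler_norm (- ReC (L w0)); rewrite normrN; lra.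
by move: H h1 h2; rewrite /M; lra.
Qed.

(** Division by [E], the branch of the product of the x_i^nu_i, removes the multipliers. As |F| <=
    1, the quotient satisfies the growth condition with theta_i = 1 - nu_i, positive because nu_i <
    1. *)
Lemma elliptic_expansion (F : Cn -> C) (a : 'I_s -> C) : holomorphic (ucover s m r) F ->
  (forall w, ucover s m r w -> nrm (F w) <= 1) -> (forall i, nrm (a i) = 1) ->
  (forall i w, ucover s m r w -> F (udeck (delta_mx 0 i) w) = a i * F w) ->
  exists (u : Cn -> C) (nu : 'I_s -> R), [/\ holomorphic (eball (s + m) r) u, forall i, 0 <= nu i < 1 &
    forall w, ucover s m r w -> F w =
      u (uproj s m w) * \prod_i cexp (rc (nu i) * w 0 (lshift m i))].
Proof.
move=> hF bF a1 Fa.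
have [nu nuP] : exists nu : 'I_s -> R, forall i, 0 <= nu i < 1 /\ cexp (two_i_pi R * rc (nu i)) = a i.
  apply: (@fin_all_exists _ (fun=> R) (fun i t => 0 <= t < 1 /\ cexp (two_i_pi R * rc t) = a i)) => i.
  have ai0 : a i != 0 by rewrite -nrm_gt0 a1.
  have pi0 := @pi_gt0 R.
  have p2 : 0 < (pi *+ 2 : R) by rewrite mulr2n addr_gt0.
  have [w wa [/andP[w1 w2] _]] := cexp_surj ai0.
  have Rw : ReC w = 0 by apply: expR_inj; rewrite expR0 -nrm_cexp wa a1.
  have wE : w = 'i * rc (ImC w) by rewrite {1}(CE w) Rw rmorph0 add0r.
  have tw (t : R) : two_i_pi R * rc (t / (pi *+ 2)) = 'i * rc t.
    rewrite /two_i_pi -mulrA -rmorphM; congr ('i * rc _).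
    by rewrite mulrC divfK // gt_eqF // mulr2n addr_gt0.
  have [w0|w0] := leP 0 (ImC w).
    exists (ImC w / (pi *+ 2)); split; last by rewrite tw -wE.
    rewrite ltr_pdivrMr // mul1r; apply/andP; split; last by lra.
    by apply: divr_ge0; [exact: w0|exact: ltW].
  (* An argument in (-pi, 0) is raised by 2 pi, to have the exponent in [0, 1). *)
  exists ((ImC w + pi *+ 2) / (pi *+ 2)); split; last first.
    rewrite tw rmorphD mulrDr -wE -/(two_i_pi R) -(mulr1z (two_i_pi R)) cexp_period //.
  rewrite ltr_pdivrMr // mul1r; apply/andP; split; last by lra.
  by apply: divr_ge0; [rewrite mulr2n; lra|exact: ltW].
pose E (w : Cn) : C := \prod_i cexp (rc (nu i) * w 0 (lshift m i)).
have E0 w : E w != 0 by apply/prodf_neq0 => i _; apply: cexp_neq0.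
pose G (w : Cn) : C := F w / E w.
have hE (w : Cn) : differentiable E w.
  apply: hol_prod => i _; apply: (@hol_comp _ _ _ _ (fun w : Cn => rc (nu i) * w 0 (lshift m i) : C)).
    by apply: holM; [exact: hol_cst|exact: hol_coord].
  exact: (differentiable_cexp _).1.
have hG : holomorphic (ucover s m r) G by move=> w Uw; apply: hol_div; [exact: E0|exact: hF|exact: hE].
have Ginv i w : ucover s m r w -> G (udeck (delta_mx 0 i) w) = G w.
  move=> Uw; rewrite /G Fa //.
  have -> : E (udeck (delta_mx 0 i) w) = a i * E w.
    rewrite udeck_delta /E (bigD1 i) //= [in RHS](bigD1 i) //= coord_line_eq mulrDr cexpD.
    rewrite [rc (nu i) * two_i_pi R]mulrC (nuP i).2.
    have -> : \prod_(j | j != i) cexp (rc (nu j) * (w + two_i_pi R *: e_ i) 0 (lshift m j)) =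
      \prod_(j | j != i) cexp (rc (nu j) * w 0 (lshift m j)).
      by apply: eq_bigr => j ji; rewrite coord_line_neq // (inj_eq (@lshift_inj _ _)).
    ring.
  by rewrite -mulf_div divff ?mul1r // -nrm_gt0 a1.
have [|p Bp|g hg gE] := extension hG Ginv (theta := fun i => 1 - nu i).
- by move=> i; rewrite subr_gt0; case/andP: (nuP i).1.
- exists 1; apply/nbhs_nrmP; exists 1 => // x _ Bx; have [w Uw wx] := uproj_surj Bx.
  exists w; split=> //.
  have -> : \prod_i expR ((1 - (1 - nu i)) * ReC (w 0 (lshift m i))) = nrm (E w).
    rewrite nrm_prod; apply: eq_bigr => i _; rewrite nrm_cexp cReM /= mul0r subr0; congr expR; ring.
  by rewrite -nrmM /G divfK // bF.
exists g, nu; split=> //; first by move=> i; case: (nuP i).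
by move=> w Uw; rewrite -gE // /G divfK.
Qed.

End Bounds.

(** * Automorphisms of the disc and types of representations *)

Section DiscAutomorphisms.
Variable R : realType.
Local Notation C := (Cplx R).
Local Notation D := (disc R).

Lemma discE (z : C) : D z <-> nrm z < 1.
Proof. by rewrite /disc /= nrmE -(rmorph1 (real_complex R)) ltcR. Qed.

Lemma cjM (x y : C) : cj (x * y) = cj x * cj y.
Proof. by apply: C_eq; rewrite ?cReM ?cImM /= ?cReM ?cImM /=; ring. Qed.
Lemma cjD (x y : C) : cj (x + y) = cj x + cj y.
Proof. by apply: C_eq; rewrite ?cReD ?cImD /= ?cReD ?cImD ?opprD. Qed.
Lemma cjN (x : C) : cj (- x) = - cj x.
Proof. by apply: C_eq; rewrite ?cReN ?cImN /= ?cReN ?cImN. Qed.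
Lemma mul_cj (x : C) : x * cj x = rc (nrm x ^+ 2).
Proof. by apply: C_eq; rewrite !ReImE ?nrm_sqr /cj /=; ring. Qed.

Definition blaschke (q z : C) : C := (z - q) / (1 - cj q * z).

Lemma blaschke_den (q z : C) : nrm q < 1 -> nrm z <= 1 -> 1 - cj q * z != 0.
Proof.
move=> q1 z1; apply/eqP => /subr0_eq /(congr1 (@nrm R C)); rewrite nrm1 (nrmM (cj q)) nrm_cj => E.
have := ler_wpM2l (nrm_ge0 q) z1; rewrite mulr1 -E; lra.
Qed.

Lemma blaschke_sqr (q z : C) :
  nrm (1 - cj q * z) ^+ 2 - nrm (z - q) ^+ 2 = (1 - nrm q ^+ 2) * (1 - nrm z ^+ 2).
Proof. by rewrite !nrm_sqr !ReImE /cj /=; ring. Qed.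

Lemma blaschke_lt1 (q z : C) : nrm q < 1 -> nrm z < 1 -> nrm (blaschke q z) < 1.
Proof.
move=> q1 z1; have d0 := blaschke_den q1 (ltW z1).
rewrite /blaschke (nrmM (z - q)) nrmV ltr_pdivrMr ?nrm_gt0 // mul1r ltNge; apply/negP => H.
have := blaschke_sqr q z.
have h (x : C) : nrm x < 1 -> 0 < 1 - nrm x ^+ 2.
  by move=> x1; rewrite subr_gt0 exprn_ilt1 ?nrm_ge0.
have := mulr_gt0 (h _ q1) (h _ z1).
have : nrm (1 - cj q * z) ^+ 2 <= nrm (z - q) ^+ 2 by rewrite ler_pXn2r ?nnegrE ?nrm_ge0.
lra.
Qed.

Lemma blaschkeK (q z : C) : nrm q < 1 -> nrm z < 1 -> blaschke (- q) (blaschke q z) = z.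
Proof.
move=> q1 z1; have d0 := blaschke_den q1 (ltW z1).
have b1 := blaschke_lt1 q1 z1; have nq : nrm (- q) < 1 by rewrite nrmN.
have := blaschke_den nq (ltW b1); rewrite /blaschke cjN mulNr !opprK => d1.
have e0 : 1 - cj q * q != 0.
  by rewrite mulrC mul_cj -(rmorph1 (real_complex R)) -rmorphB fmorph_eq0 subr_eq0 eq_sym lt_eqF // exprn_ilt1 ?nrm_ge0.
have E1 : 1 + cj q * ((z - q) / (1 - cj q * z)) = (1 - cj q * q) / (1 - cj q * z) by field.
have E2 : (z - q) / (1 - cj q * z) + q = z * (1 - cj q * q) / (1 - cj q * z) by field.
by rewrite E1 E2; field; rewrite e0 d0.
Qed.

Lemma hol_blaschke (q z : C) : nrm q < 1 -> nrm z < 1 -> differentiable (blaschke q) z.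
Proof.
move=> q1 z1; apply: hol_div; first exact: blaschke_den (ltW z1).
  by apply: holB; [exact: hol_id|exact: hol_cst].
by apply: holB; [exact: hol_cst|apply: holM; [exact: hol_cst|exact: hol_id]].
Qed.

(* Letting [e] tend to 0 in the growth estimate of ['i * (1 + e - H)], which
   takes values in the upper half-plane. *)
Lemma modulus1_const (H : C -> C) (c z : C) (r : R) : hol_disc H c r ->
  (forall z, nrm (z - c) < r -> nrm (H z) <= 1) -> H z = 1 -> nrm (z - c) < r -> H c = 1.
Proof.
move=> hH bH Hz zr; apply/eqP; rewrite eq_sym -subr_eq0; apply/eqP/eq0_eps => e e0.
have k0 : 0 < r - nrm (z - c) by rewrite subr_gt0.
pose e' := e * (r - nrm (z - c)) / (2 * nrm (z - c) + 1).
have n1 : 0 < 2 * nrm (z - c) + 1 by rewrite ltr_wpDl // mulr_ge0 // nrm_ge0.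
have e'0 : 0 < e' by rewrite divr_gt0 // mulr_gt0.
pose F (y : C) : C := 'i * (rc (1 + e') - H y).
have ImF y : ImC (F y) = 1 + e' - ReC (H y) by rewrite /F !ReImE; ring.
have hF : hol_disc F c r.
  by move=> y yr; apply: holM; [exact: hol_cst|apply: holB; [exact: hol_cst|exact: hH]].
have pF y : nrm (y - c) < r -> 0 < ImC (F y).
  by move=> yr; rewrite ImF; have := le_trans (ler_norm _) (le_trans (Re_le_nrm _) (bH _ yr)); lra.
have := half_plane_growth hF pF zr.
have -> : F z - F c = - 'i * (H z - H c) by rewrite /F; ring.
rewrite (nrmM (- 'i)) nrmN nrm_i mul1r ImF Hz /= => G.
rewrite -(ler_pM2r k0); apply: (le_trans G).
have -> : 1 + e' - 1 = e' by ring.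
rewrite -[leRHS](divfK (lt0r_neq0 n1)) -/e' mulrC; apply: ler_wpM2l; [exact: ltW|lra].
Qed.

(** The equality case of the Schwarz lemma: [phi] and its left inverse both decrease the modulus, so
    |phi(z)| = |z|, and the slope of [phi] at 0, bounded by 1, reaches its maximum inside and is
    constant. *)
Lemma schwarz_eq (phi psi : C -> C) : hol_disc phi 0 1 -> hol_disc psi 0 1 ->
  (forall z, nrm z < 1 -> nrm (phi z) < 1) -> (forall z, nrm z < 1 -> nrm (psi z) < 1) ->
  phi 0 = 0 -> psi 0 = 0 -> (forall z, nrm z < 1 -> psi (phi z) = z) ->
  exists2 k, nrm k = 1 & forall z, nrm z < 1 -> phi z = k * z.
Proof.
move=> hp hs bp bs p0 s0 sp.
have S (u : C -> C) : hol_disc u 0 1 -> (forall z, nrm z < 1 -> nrm (u z) < 1) -> u 0 = 0 ->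
    forall z, nrm z < 1 -> nrm (u z) <= nrm z.
  move=> hu bu u0 z z1; have zz : nrm (z - 0) < 1 by rewrite subr0.
  have := schwarz hu u0 _ zz (M := 1); rewrite subr0 mulr1 mul1r; apply.
  by move=> y; rewrite subr0 => y1; apply: ltW; apply: bu.
have E z : nrm z < 1 -> nrm (phi z) = nrm z.
  move=> z1; apply/eqP; rewrite eq_le (S phi) //=.
  by rewrite -{1}(sp z z1); apply: (S psi) => //; apply: bp.
(* The constant is read off at 1/2, a point where the slope is an honest quotient. *)
pose k : C := phi (rc 2^-1) * 2.
have h1 : nrm (rc 2^-1 : C) < 1 by rewrite nrm_rc gtr0_norm ?invr_gt0 //; lra.
have k1 : nrm k = 1.
  rewrite /k (nrmM (phi _)) E // nrm_rc gtr0_norm ?invr_gt0 // -(rmorph_nat (real_complex R)) nrm_rc.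
  by rewrite gtr0_norm // mulVf.
have k0 : k != 0 by rewrite -nrm_gt0 k1.
exists k => // z z1.
have hsl := slope_hol ltr01 hp.
pose H (y : C) : C := slope phi 0 y / k.
have slb y : nrm (y - 0) < 1 -> nrm (slope phi 0 y) <= 1.
  move=> y1; rewrite -[leLHS]mulr1; apply: (slope_bound hp p0 _ y1) => x; rewrite subr0 => x1; exact: ltW (bp _ x1).
have hH y : nrm (y - 0) < 1 -> differentiable H y.
  by move=> y1; apply: holM; [exact: hsl|exact: hol_cst].
have bH y : nrm (y - 0) < 1 -> nrm (H y) <= 1.
  by move=> y1; rewrite /H (nrmM (slope _ _ _)) nrmV k1 invr1 mulr1; apply: slb.
have c0 : nrm (rc 2^-1 - 0 : C) < 1 by rewrite subr0.
have Hc : H (rc 2^-1) = 1.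
  have := slopeE phi 0 (rc 2^-1); rewrite p0 !subr0 /H /k => ->.
  have i0 : slope phi 0 (rc 2^-1) != 0.
    apply: contraNneq k0 => s0'; have := slopeE phi 0 (rc 2^-1).
    by rewrite p0 s0' mulr0 subr0 /k => ->; rewrite mul0r.
  have e2 : rc 2^-1 = 2^-1 :> C by rewrite fmorphV rmorph_nat.
  by rewrite mulrAC {2}e2 mulVf ?pnatr_eq0 // mul1r divff.
have Hz : H z = 1.
  (* [modulus1_const] concludes at the centre of a disc; a Blaschke map moves [z] there, and the
     point 1/2 with it. *)
  have nz : nrm (- z) < 1 by rewrite nrmN.
  have b1 (y : C) : nrm (y - 0) < 1 -> nrm (blaschke (- z) y - 0) < 1 by rewrite !subr0 => y1; apply: blaschke_lt1.
  have -> : z = blaschke (- z) 0 by rewrite /blaschke mulr0 subr0 divr1 sub0r opprK.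
  apply: (modulus1_const (H := fun y => H (blaschke (- z) y)) (z := blaschke z (rc 2^-1)) (r := 1)).
  - move=> y y1; apply: hol_comp; last exact: hH (b1 _ y1).
    by apply: hol_blaschke => //; move: y1; rewrite subr0.
  - by move=> y y1; apply: bH; apply: b1.
  - by rewrite blaschkeK.
  - by rewrite subr0; apply: blaschke_lt1.
have := slopeE phi 0 z; rewrite p0 !subr0 => ->.
by move: Hz; rewrite /H => /(canRL (divfK k0)); rewrite mul1r => ->; rewrite mulrC.
Qed.

Lemma aut_disc_form (a : C -> C) : aut_disc a -> exists k q, [/\ nrm k = 1, nrm q < 1 &
  forall z, nrm z < 1 -> a z = blaschke (- q) (k * z)].
Proof.
move=> [ha [b [hb ab abK]]].
have z0 : nrm (0 : C) < 1 by rewrite nrm0.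
have a1 z : nrm z < 1 -> nrm (a z) < 1 by move=> /discE z1; apply/discE; apply: (ab z z1).1.
have b1 z : nrm z < 1 -> nrm (b z) < 1 by move=> /discE z1; apply/discE; apply: (ab z z1).2.
pose q := a 0; have q1 : nrm q < 1 by apply: a1.
have nq1 : nrm (- q) < 1 by rewrite nrmN.
have [|||||||k k1 kE] := schwarz_eq (phi := fun z => blaschke q (a z)) (psi := fun z => b (blaschke (- q) z)).
- move=> z; rewrite subr0 => z1; apply: hol_comp; first by apply: ha; apply/discE.
  by apply: hol_blaschke => //; apply: a1.
- move=> z; rewrite subr0 => z1; apply: hol_comp; first exact: hol_blaschke.
  by apply: hb; apply/discE; apply: blaschke_lt1.
- by move=> z z1; apply: blaschke_lt1 => //; apply: a1.
- by move=> z z1; apply: b1; apply: blaschke_lt1.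
- by rewrite /blaschke subrr mul0r.
- have -> : blaschke (- q) 0 = q by rewrite /blaschke mulr0 subr0 divr1 sub0r opprK.
  by have /discE h := z0; have := (abK 0 h).1.
- move=> z z1; rewrite blaschkeK ?a1 //; have /discE h := z1; exact: (abK z h).1.
exists k, q; split=> // z z1.
by rewrite -kE // blaschkeK ?a1.
Qed.

End DiscAutomorphisms.

Section Mobius.
Variable R : realType.
Local Notation C := (Cplx R).
Local Notation D := (disc R).

Lemma hol_mobius (M : 'M[C]_2) (z : C) : M 1 0 * z + M 1 1 != 0 -> differentiable (mobius M) z.
Proof.
move=> d0; apply: hol_div => //; apply: holD; try exact: hol_cst; apply: holM; try exact: hol_cst; exact: hol_id.
Qed.

(** A pole in the disc would have the conventional value 0, which is not in the upper half-plane; so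
    the denominator does not vanish there. *)
Lemma half_plane_map (h : C -> C) : aut_P1_disc_to_half_plane h ->
  (forall z, D z -> 0 < ImC (h z)) /\ holomorphic D h.
Proof.
move=> [M uM [hM hD]].
have pos z : D z -> 0 < ImC (h z).
  by move=> Dz; have : upper_half_plane R (h z) by rewrite -hD; exists z.
split=> // z Dz; rewrite hM; apply: hol_mobius; apply: contraTneq (pos z Dz) => E.
by rewrite hM /mobius E invr0 mulr0 ltxx.
Qed.

Definition mx2 (a b c d : C) : 'M[C]_2 :=
  \matrix_(i, j) if i == 0 then (if j == 0 then a else b) else (if j == 0 then c else d).

Lemma mx2_unit a b c d : a * d - b * c != 0 -> mx2 a b c d \in unitmx.
Proof. move=> H; rewrite unitmxE unitfE (expand_det_row _ 0) big_ord_recl big_ord1 /cofactor !det_mx11 !mxE /=.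
by rewrite expr0 mul1r expr1 mulN1r mulrN. Qed.

Lemma mobius_mx2 a b c d z : mobius (mx2 a b c d) z = (a * z + b) / (c * z + d).
Proof. by rewrite /mobius !mxE. Qed.

End Mobius.

(** * Fixed points of disc automorphisms, inside and on the circle *)

Section FixedPoints.
Variable R : realType.
Local Notation C := (Cplx R).
Local Notation D := (disc R).

Lemma blaschke_self (q : C) : blaschke q q = 0.
Proof. by rewrite /blaschke subrr mul0r. Qed.

Lemma blaschke0 (q : C) : blaschke (- q) 0 = q.
Proof. by rewrite /blaschke mulr0 subr0 divr1 sub0r opprK. Qed.

(** Conjugation by the Blaschke map that sends [p] to 0 turns [a] and its inverse into self-maps of
    the disc fixing 0, to which [schwarz_eq] applies. *)
Lemma aut_disc_fix (a : C -> C) (p : C) : aut_disc a -> nrm p < 1 -> a p = p ->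
  exists2 k, nrm k = 1 & forall z, nrm z < 1 -> blaschke p (a z) = k * blaschke p z.
Proof.
move=> [ha [b [hb ab abK]]] p1 ap; have np : nrm (- p) < 1 by rewrite nrmN.
have a1 z : nrm z < 1 -> nrm (a z) < 1 by move=> /discE z1; apply/discE; apply: (ab z z1).1.
have b1 z : nrm z < 1 -> nrm (b z) < 1 by move=> /discE z1; apply/discE; apply: (ab z z1).2.
have n1 z : nrm z < 1 -> nrm (blaschke (- p) z) < 1 by apply: blaschke_lt1.
have bp : b p = p by have /discE h := p1; rewrite -{1}ap (abK p h).1.
have K (z : C) : nrm z < 1 -> blaschke p (blaschke (- p) z) = z.
  by move=> z1; rewrite -{1}(opprK p) blaschkeK.
have [|||||||k k1 kE] := schwarz_eq (phi := fun z => blaschke p (a (blaschke (- p) z)))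
    (psi := fun z => blaschke p (b (blaschke (- p) z))).
- move=> z; rewrite subr0 => z1.
  apply: (hol_comp (g := fun z => a (blaschke (- p) z)) (h := blaschke p)); last by apply: hol_blaschke => //; apply: a1; apply: n1.
  by apply: hol_comp; [exact: hol_blaschke|apply: ha; apply/discE; apply: n1].
- move=> z; rewrite subr0 => z1.
  apply: (hol_comp (g := fun z => b (blaschke (- p) z)) (h := blaschke p)); last by apply: hol_blaschke => //; apply: b1; apply: n1.
  by apply: hol_comp; [exact: hol_blaschke|apply: hb; apply/discE; apply: n1].
- by move=> z z1; apply: blaschke_lt1 => //; apply: a1; apply: n1.
- by move=> z z1; apply: blaschke_lt1 => //; apply: b1; apply: n1.
- by rewrite blaschke0 ap blaschke_self.
- by rewrite blaschke0 bp blaschke_self.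
- move=> z z1; rewrite blaschkeK //; last by apply: a1; apply: n1.
  by have /discE h := n1 z z1; rewrite (abK _ h).1 K.
exists k => // z z1; rewrite -kE; last exact: blaschke_lt1.
by rewrite blaschkeK.
Qed.

Lemma blaschke_inj (p z z' : C) : nrm p < 1 -> nrm z < 1 -> nrm z' < 1 ->
  blaschke p z = blaschke p z' -> z = z'.
Proof. by move=> p1 z1 z'1 E; rewrite -(blaschkeK p1 z1) E blaschkeK. Qed.

Lemma aut_disc_fix_unique (a : C -> C) (p p' z : C) : aut_disc a -> nrm p < 1 -> nrm p' < 1 ->
  a p = p -> a p' = p' -> nrm z < 1 -> a z <> z -> p' = p.
Proof.
move=> aa p1 p'1 ap ap' z1 az; apply/eqP/negPn/negP => pp'; apply: az.
have [k _ kE] := aut_disc_fix aa p1 ap.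
have n0 : blaschke p p' != 0.
  apply: contraNneq pp' => E; apply/eqP; apply: (blaschke_inj p1 p'1 p1); by rewrite E blaschke_self.
have k1 : k = 1 by apply: (mulIf n0); rewrite mul1r -kE // ap'.
have a1 : nrm (a z) < 1.
  by have [_ [b [_ ab _]]] := aa; apply/discE; apply: (ab z _).1; apply/discE.
by apply: (blaschke_inj p1 a1 z1); rewrite kE // k1 mul1r.
Qed.

(** The coordinate in the upper half-plane that sends the boundary point [X] to infinity. *)
Definition cayley (X z : C) : C := 'i * (X + z) / (X - z).

Lemma cayley_den (X z : C) : nrm X = 1 -> nrm z < 1 -> X - z != 0.
Proof. by move=> X1 z1; apply/eqP => /subr0_eq E; move: z1; rewrite -E X1 ltxx. Qed.

Lemma cayley_gt0 (X z : C) : nrm X = 1 -> nrm z < 1 -> 0 < ImC (cayley X z).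
Proof.
move=> X1 z1; have d0 := cayley_den X1 z1.
have E : cayley X z * rc (nrm (X - z) ^+ 2) = 'i * ((X + z) * cj (X - z)).
  by rewrite -mul_cj /cayley; field.
have n0 : 0 < nrm (X - z) ^+ 2 by rewrite exprn_gt0 // nrm_gt0.
rewrite -(pmulr_lgt0 _ n0).
have := congr1 (fun z : C => ImC z) E; rewrite cImM /= mulr0 add0r mulrC => ->.
have -> : ImC ('i * ((X + z) * cj (X - z))) = nrm X ^+ 2 - nrm z ^+ 2.
  rewrite !nrm_sqr !ReImE /cj /=; ring.
by rewrite X1 expr1n subr_gt0 exprn_ilt1 ?nrm_ge0.
Qed.

Lemma hol_cayley (X z : C) : nrm X = 1 -> nrm z < 1 -> differentiable (cayley X) z.
Proof.
move=> X1 z1; apply: hol_div; first exact: cayley_den.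
  by apply: holM; [exact: hol_cst|apply: holD; [exact: hol_cst|exact: hol_id]].
by apply: holB; [exact: hol_cst|exact: hol_id].
Qed.

Lemma cayleyDi (X z : C) : nrm X = 1 -> nrm z < 1 -> cayley X z + 'i = 2 * 'i * X / (X - z).
Proof. by move=> X1 z1; have d0 := cayley_den X1 z1; rewrite /cayley; field. Qed.

Lemma cayley_inj (X z z' : C) : nrm X = 1 -> nrm z < 1 -> nrm z' < 1 ->
  cayley X z = cayley X z' -> z = z'.
Proof.
move=> X1 z1 z'1 E; have X0 : X != 0 by rewrite -nrm_gt0 X1.
have := cayleyDi X1 z'1; rewrite -E cayleyDi // => /mulfI H.
have := H _; move=> /(_ _) /invr_inj e; apply: oppr_inj; apply: (addrI X); apply: e.
by rewrite !mulf_neq0 ?neq0Ci ?pnatr_eq0.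
Qed.

(** The last hypothesis says, without denominators, that the automorphism fixes [X]; it therefore
    fixes infinity in the Cayley coordinate and is affine. The identity cayley(z) + i = 2 i X / (X -
    z) reduces the computation to comparing X - a(z) with X - z. *)
Lemma cayley_affine (X k q : C) : nrm X = 1 -> nrm k = 1 -> nrm q < 1 ->
  k * X + q = X * (1 + cj q * k * X) -> exists A B : R, 0 < A /\
    forall z, nrm z < 1 -> cayley X (blaschke (- q) (k * z)) = rc A * cayley X z + rc B.
Proof.
move=> X1 k1 q1 E; pose Q := cj q; pose Y := cj X.
have XY : X * Y = 1 by rewrite mul_cj X1 expr1n rmorph1.
have X0 : X != 0 by rewrite -nrm_gt0 X1.
have k0 : k != 0 by rewrite -nrm_gt0 k1.
have nqn : nrm (- q) < 1 by rewrite nrmN.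
have P0 : 1 - Q * X != 0 by apply: blaschke_den; rewrite // X1.
have PcE : cj (1 - Q * X) = 1 - q * Y.
  by rewrite cjD cjN cjM; congr (_ - _ * _); apply: C_eq; rewrite ?Re_cj ?Im_cj /= ?oppr0 ?opprK.
have Pc0 : 1 - q * Y != 0 by rewrite -PcE -nrm_gt0 nrm_cj nrm_gt0.
have n2 : 0 < nrm (1 - Q * X) ^+ 2 by rewrite exprn_gt0 // nrm_gt0.
have PPc : (1 - Q * X) * (1 - q * Y) = rc (nrm (1 - Q * X) ^+ 2) by rewrite -PcE mul_cj.
pose A : R := (1 - nrm q ^+ 2) / nrm (1 - Q * X) ^+ 2.
pose B : R := 2 * ImC (X * Q) / nrm (1 - Q * X) ^+ 2.
have AE : rc A = (1 - q * Q) / ((1 - Q * X) * (1 - q * Y)).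
  by rewrite /A rmorphM fmorphV PPc rmorphB rmorph1 /Q mul_cj.
have BE : rc B = - 'i * (X * Q - q * Y) / ((1 - Q * X) * (1 - q * Y)).
  rewrite /B rmorphM fmorphV PPc; congr (_ / _).
  have -> : q * Y = cj (X * Q) by rewrite cjM mulrC; congr (_ * _); apply: C_eq; rewrite ?Re_cj ?Im_cj /= ?opprK.
  by case: (X * Q) => x y; apply: C_eq; rewrite !ReImE /=; ring.
exists A, B; split; first by rewrite divr_gt0 // subr_gt0 exprn_ilt1 ?nrm_ge0.
move=> z z1; have d0 := cayley_den X1 z1.
have kz : nrm (k * z) < 1 by rewrite (nrmM k) k1 mul1r.
have b1 := blaschke_lt1 nqn kz.
have D0 := blaschke_den nqn (ltW kz); rewrite cjN mulNr opprK in D0.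
pose N := 1 + Q * k * X.
have NE : k + q * Y = N.
  apply: (mulIf X0); have -> : (k + q * Y) * X = k * X + q * (X * Y) by ring.
  by rewrite XY mulr1 E mulrC.
have kP : k * (1 - Q * X) = 1 - q * Y.
  have -> : k * (1 - Q * X) = k - (N - 1) by rewrite /N; ring.
  by rewrite -NE; ring.
have NP : N * (1 - Q * X) = 1 - q * Q.
  rewrite -NE; have -> : (k + q * Y) * (1 - Q * X) = k * (1 - Q * X) + q * Y - q * Q * (X * Y) by ring.
  by rewrite kP XY; ring.
have num : X - blaschke (- q) (k * z) = k * (X - z) * (1 - Q * X) / (1 + Q * (k * z)).
  rewrite /blaschke cjN mulNr !opprK -/Q; apply: (mulIf D0).
  rewrite mulrBl !divfK //; have -> : X * (1 + Q * (k * z)) - (k * z + q) =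
     k * (X - z) * (1 - Q * X) + (X * (1 + Q * k * X) - (k * X + q)) by ring.
  by rewrite E subrr addr0.
apply: (addIr 'i); rewrite cayleyDi // num.
have -> : rc A * cayley X z + rc B + 'i = rc A * (cayley X z + 'i) + (rc B + 'i * (1 - rc A)) by ring.
rewrite cayleyDi //.
have -> : rc B + 'i * (1 - rc A) = - 2 * 'i * Q * X / (1 - Q * X).
  rewrite AE BE; apply: (mulIf (mulf_neq0 P0 Pc0)); rewrite mulrDl divfK ?mulf_neq0 //.
  have -> : - 2 * 'i * Q * X / (1 - Q * X) * ((1 - Q * X) * (1 - q * Y)) =
    - 2 * 'i * Q * X * (1 - q * Y) by field.
  have -> : 'i * (1 - (1 - q * Q) / ((1 - Q * X) * (1 - q * Y))) * ((1 - Q * X) * (1 - q * Y)) =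
     'i * ((1 - Q * X) * (1 - q * Y) - (1 - q * Q)) by field; rewrite Pc0 P0.
  have -> : (1 - Q * X) * (1 - q * Y) = 1 - Q * X - q * Y + q * Q * (X * Y) by ring.
  have -> : - 2 * 'i * Q * X * (1 - q * Y) = - 2 * 'i * Q * X + 2 * 'i * Q * q * (X * Y) by ring.
  by rewrite XY; ring.
rewrite AE -kP -NP.
have NX : 1 + Q * (k * z) = N - Q * k * (X - z) by rewrite /N; ring.
have D0' : 1 + Q * (k * z) != 0 by [].
rewrite [in LHS]invf_div [in LHS]NX.
by field; rewrite P0 k0 d0.
Qed.

(** The fixed points are the roots of conj(q) k x^2 + (1 - k) x - q, whose product has modulus 1: if
    none is inside the disc, both are on the circle. The equation degenerates for q = 0, where 0 is
    fixed. *)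
Lemma fixed_point_form (k q : C) : nrm k = 1 -> nrm q < 1 ->
  (exists2 p, nrm p < 1 & blaschke (- q) (k * p) = p) \/
  (exists2 X, nrm X = 1 & k * X + q = X * (1 + cj q * k * X)).
Proof.
move=> k1 q1; have nqn : nrm (- q) < 1 by rewrite nrmN.
have inner z : nrm z < 1 -> k * z + q = z * (1 + cj q * k * z) -> blaschke (- q) (k * z) = z.
  move=> z1 E; have kz : nrm (k * z) < 1 by rewrite (nrmM k) k1 mul1r.
  have D0 := blaschke_den nqn (ltW kz); move: D0.
  by rewrite /blaschke cjN mulNr !opprK mulrA E => D0; rewrite mulfK.
have [q0|q0] := eqVneq q 0.
  left; exists 0; first by rewrite nrm0.
  by rewrite q0 oppr0 mulr0 blaschke_self.
have k0 : k != 0 by rewrite -nrm_gt0 k1.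
pose A := cj q * k; have A0 : A != 0 by rewrite mulf_neq0 // -nrm_gt0 nrm_cj nrm_gt0.
pose S := sqrtC ((1 - k) ^+ 2 + 4 * A * q).
have SE : S ^+ 2 = (1 - k) ^+ 2 + 4 * A * q by rewrite sqrtCK.
pose x1 := (k - 1 + S) / (2 * A); pose x2 := (k - 1 - S) / (2 * A).
have A2 : 2 * A != 0 by rewrite mulf_neq0 // pnatr_eq0.
have root (e : C) : e ^+ 2 = 1 -> let x := (k - 1 + e * S) / (2 * A) in k * x + q = x * (1 + A * x).
  move=> e1 /=; set x := _ / _.
  have xE : 2 * A * x = k - 1 + e * S by rewrite /x mulrC divfK.
  have Q2 : (2 * A * x + (1 - k)) ^+ 2 = (1 - k) ^+ 2 + 4 * A * q by rewrite xE -SE -[RHS]mul1r -e1; ring.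
  have A4 : 4 * A != 0 by rewrite mulf_neq0 // pnatr_eq0.
  apply/eqP; rewrite eq_sym -subr_eq0 -(mulrI_eq0 _ (mulfI A4)); apply/eqP.
  have -> : 4 * A * (x * (1 + A * x) - (k * x + q)) = (2 * A * x + (1 - k)) ^+ 2 - ((1 - k) ^+ 2 + 4 * A * q) by ring.
  by rewrite Q2 subrr.
have r1 := root 1 (expr1n _ _); have r2 := root (- 1) (sqrr_sign _ 1).
rewrite mul1r -/x1 in r1; rewrite mulN1r -/x2 in r2.
have x12 : nrm x1 * nrm x2 = 1.
  rewrite -nrmM; have -> : x1 * x2 = - q / A.
    have A4 : 4 * A * A != 0 by rewrite mulf_neq0 // mulf_neq0 // pnatr_eq0.
    apply: (mulfI A4); have -> : 4 * A * A * (x1 * x2) = (2 * A * x1) * (2 * A * x2) by ring.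
    rewrite [2 * A * x1]mulrC [2 * A * x2]mulrC !divfK //.
    have -> : (k - 1 + S) * (k - 1 - S) = (1 - k) ^+ 2 - S ^+ 2 by ring.
    by rewrite SE; field.
  rewrite (nrmM (- q)) nrmV nrmN /A (nrmM (cj q)) nrm_cj k1 mulr1 divff // gt_eqF // nrm_gt0 //.
have [l1|l1] := ltP (nrm x1) 1; first by left; exists x1 => //; apply: inner.
have [l2|l2] := ltP (nrm x2) 1; first by left; exists x2 => //; apply: inner.
right; exists x1 => //; apply/eqP; rewrite eq_le l1 andbT -x12.
by rewrite ler_peMr // nrm_ge0.
Qed.

End FixedPoints.

(** * Representations admitting an equivariant map are elliptic or parabolic *)

Section Types.
Variables (R : realType) (s m : nat) (r : R).
Local Notation C := (Cplx R).
Local Notation D := (disc R).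
Local Notation Cn := 'rV[C]_(s + m).
Variables (rho : 'rV[int]_s -> C -> C) (f : Cn -> C).
Hypotheses (r0 : 0 < r) (rho_rep : representation rho) (f_eq : equivariant_multivalued_map r rho f).

Lemma rho_disc c z : D z -> D (rho c z).
Proof. by move=> Dz; have [/(_ c) [_ [b [_ H _]]] _ _] := rho_rep; apply: (H z Dz).1. Qed.

Lemma rho0 z : D z -> rho 0 z = z.
Proof. by have [_ H _] := rho_rep; apply: H. Qed.

Lemma rhoD c c' z : D z -> rho (c + c') z = rho c (rho c' z).
Proof. by have [_ _ H] := rho_rep; apply: H. Qed.

Lemma rhoNK c z : D z -> rho (- c) (rho c z) = z.
Proof. by move=> Dz; rewrite -rhoD // addNr rho0. Qed.

Lemma rho_comm c c' z : D z -> rho c (rho c' z) = rho c' (rho c z).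
Proof. by move=> Dz; rewrite -!rhoD // addrC. Qed.

Lemma f_disc w : ucover s m r w -> D (f w).
Proof. by have [_ H _] := f_eq; apply: H. Qed.

Lemma f_deck c w : ucover s m r w -> f (udeck c w) = rho c (f w).
Proof. by have [_ _ H] := f_eq; apply: H. Qed.

Lemma hol_f_comp (h : C -> C) : holomorphic D h -> holomorphic (ucover s m r) (fun w => h (f w)).
Proof.
move=> hh w Uw; have [hf _ _] := f_eq; apply: hol_comp; first exact: hf.
by apply: hh; apply: f_disc.
Qed.

Lemma disc0 : D 0.
Proof. by apply/discE; rewrite nrm0. Qed.

(** The multiplier is a homomorphism from Z^s to the positive reals, so it is trivial once it is
    trivial on the generators, where [no_multiplier] applies to [h o f]. *)
Lemma not_hyperbolic : ~ hyperbolic_type rho.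
Proof.
move=> [h [hh [a [a0 [c ac] aE]]]]; have [pos hol] := half_plane_map hh.
have nz z : D z -> h z != 0 by move=> Dz; apply: contraTneq (pos z Dz) => ->; rewrite ltxx.
have aD c1 c2 : a (c1 + c2) = a c1 * a c2.
  have := aE (c1 + c2) 0 disc0; rewrite (rhoD c1 c2 disc0) (aE c1 _ (rho_disc c2 disc0)) (aE c2 0 disc0) mulrA.
  move=> /(mulIf (nz 0 disc0)); rewrite -rmorphM => /(congr1 (fun z : C => ReC z)) /= -> //.
have a1 : a 0 = 1.
  have := aD 0 0; rewrite addr0 => E; have n0 := lt0r_neq0 (a0 0).
  by apply: (mulfI n0); rewrite mulr1.
apply: ac; move: c; apply: int_row_ind => //.
- by move=> c c' H H'; rewrite aD H H' mulr1.
- by move=> c H; have := aD c (- c); rewrite subrr a1 H mul1r.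
move=> i; apply: (@no_multiplier R s m r r0 (fun w => h (f w)) i) => //.
- exact: hol_f_comp.
- by move=> w Uw; apply: pos; apply: f_disc.
- by move=> w Uw; rewrite f_deck // aE //; apply: f_disc.
Qed.

(** Hypotheses on generators and on a holomorphic [h] into the half-plane: this serves both for the
    [h] of the theorem and for the Moebius map of [normal_form]. The same holds for
    [elliptic_case]. *)
Lemma parabolic_case (h : C -> C) : (forall z, D z -> 0 < ImC (h z)) -> holomorphic D h ->
  (forall i, exists a : R, forall z, D z -> h (rho (delta_mx 0 i) z) = h z + rc a) ->
  exists (g : Cn -> C) (lambda : 'I_s -> R), [/\ holomorphic (eball (s + m) r) g,
    forall i, 0 <= lambda i & forall w, ucover s m r w -> h (f w) =
      (two_i_pi R)^-1 * (\sum_i rc (lambda i) * w 0 (lshift m i)) + g (uproj s m w)].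
Proof.
move=> pos hol /(@fin_all_exists _ (fun=> R)) [a aE].
have [|||g [hg l0 gE]] := @parabolic_expansion R s m r r0 (fun w => h (f w)) a.
- exact: hol_f_comp.
- by move=> w Uw; apply: pos; apply: f_disc.
- by move=> i w Uw; rewrite f_deck // aE //; apply: f_disc.
by exists g, a.
Qed.

Lemma elliptic_case (h : C -> C) : (forall z, D z -> D (h z)) -> holomorphic D h ->
  (forall i, exists2 a : C, nrm a = 1 & forall z, D z -> h (rho (delta_mx 0 i) z) = a * h z) ->
  exists (u : Cn -> C) (nu : 'I_s -> R), [/\ holomorphic (eball (s + m) r) u,
    forall i, 0 <= nu i < 1 & forall w, ucover s m r w -> h (f w) =
      u (uproj s m w) * \prod_i cexp (rc (nu i) * w 0 (lshift m i))].
Proof.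
move=> bd hol H; have [a aE] : exists a : 'I_s -> C, forall i, nrm (a i) = 1 /\
    forall z, D z -> h (rho (delta_mx 0 i) z) = a i * h z.
  apply: (@fin_all_exists _ (fun=> C) (fun i (k : C) => nrm k = 1 /\ forall z, D z -> h (rho (delta_mx 0 i) z) = k * h z)) => i.
  by have [k k1 kE] := H i; exists k.
have [||||u [nu [hu nu1 uE]]] := @elliptic_expansion R s m r (fun w => h (f w)) a.
- exact: hol_f_comp.
- by move=> w Uw; apply: ltW; apply/discE; apply: bd; apply: f_disc.
- by move=> i; case: (aE i).
- by move=> i w Uw; rewrite f_deck // (aE i).2 //; apply: f_disc.
by exists u, nu.
Qed.

(** A matrix rather than a map is kept, because its entries appear in the flat frame of the
    transverse structure. *)
Definition mobius_normal_form (M : 'M[C]_2) := [/\ M \in unitmx,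
  forall z, D z -> M 1 0 * z + M 1 1 != 0 &
  ((forall z, D z -> D (mobius M z)) /\ forall i, exists2 a : C, nrm a = 1 &
     forall z, D z -> mobius M (rho (delta_mx 0 i) z) = a * mobius M z) \/
  ((forall z, D z -> 0 < ImC (mobius M z)) /\ forall i, exists a : R,
     forall z, D z -> mobius M (rho (delta_mx 0 i) z) = mobius M z + rc a)].

Lemma moving_generator : nontrivial rho -> exists i, exists2 z, D z & rho (delta_mx 0 i) z <> z.
Proof.
move=> [c [z Dz cz]]; apply: contrapT => H; apply: cz.
have Hi i y : D y -> rho (delta_mx 0 i) y = y.
  by move=> Dy; apply: contrapT => E; apply: H; exists i, y.
move: c z Dz; apply: int_row_ind => //; first exact: rho0.
- move=> c c' H1 H2 z Dz; rewrite rhoD // H2 // H1 //.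
- by move=> c H1 z Dz; rewrite -{1}(H1 z Dz) rhoNK.
Qed.

Lemma rho_aut c : aut_disc (rho c).
Proof. by have [H _ _] := rho_rep; apply: H. Qed.

(** A generator that moves some point has at most one fixed point in the disc; every other generator
    commutes with it, hence fixes [p] too and becomes a rotation once [p] is sent to 0. *)
Lemma elliptic_normal_form i z p : D z -> rho (delta_mx 0 i) z <> z -> D p -> rho (delta_mx 0 i) p = p ->
  exists M, mobius_normal_form M.
Proof.
move=> /discE z1 iz Dp ip; have /discE p1 := Dp.
have hE : mobius (mx2 1 (- p) (- cj p) 1) = blaschke p.
  by apply/funext => y; rewrite mobius_mx2 mul1r mulNr [- _ + 1]addrC.
exists (mx2 1 (- p) (- cj p) 1); rewrite /mobius_normal_form hE; split.
- apply: mx2_unit; rewrite mul1r mulrNN mul_cj -(rmorph1 (real_complex R)) -rmorphB fmorph_eq0.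
  by rewrite subr_eq0 eq_sym lt_eqF // exprn_ilt1 ?nrm_ge0.
- by move=> y /discE y1; rewrite !mxE /= mulNr addrC; apply: blaschke_den => //; apply: ltW.
left; split; first by move=> y /discE y1; apply/discE; apply: blaschke_lt1.
move=> j; have jp : rho (delta_mx 0 j) p = p.
  apply: (aut_disc_fix_unique (rho_aut (delta_mx 0 i)) p1 _ ip _ z1 iz).
    by apply/discE; apply: rho_disc.
  by rewrite rho_comm // ip.
have [k k1 kE] := aut_disc_fix (rho_aut (delta_mx 0 j)) p1 jp.
by exists k => // y /discE y1; apply: kE.
Qed.

(** A generator fixing [X] acts affinely in the Cayley coordinate. A dilation factor different from
    1 would be a second boundary fixed point, which the existence of the equivariant map
    excludes. *)
Lemma translation_part (X k q : C) i : nrm X = 1 -> nrm k = 1 -> nrm q < 1 ->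
  (forall z, nrm z < 1 -> rho (delta_mx 0 i) z = blaschke (- q) (k * z)) ->
  k * X + q = X * (1 + cj q * k * X) ->
  exists B : R, forall z, D z -> cayley X (rho (delta_mx 0 i) z) = cayley X z + rc B.
Proof.
move=> X1 k1 q1 form E; have [A [B [A0 AB]]] := cayley_affine X1 k1 q1 E.
have hc : holomorphic D (cayley X) by move=> z /discE z1; apply: hol_cayley.
have [A1|nA] := eqVneq A 1.
  exists B => z /discE z1; by rewrite form // AB // A1 rmorph1 mul1r.
have A1 : 1 - A != 0 by rewrite subr_eq0 eq_sym.
suff EA : A = 1 by rewrite EA eqxx in nA.
(* Translate the fixed point of [z |-> A z + B] to 0. *)
pose F (w : Cn) : C := cayley X (f w) - rc (B / (1 - A)).
apply: (@no_multiplier R s m r r0 F i).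
- by move=> w Uw; apply: holB; [exact: (hol_f_comp hc Uw)|exact: hol_cst].
- move=> w Uw; rewrite /F cImB /= subr0; apply: cayley_gt0 => //; apply/discE; exact: f_disc.
- exact: A0.
move=> w Uw; have /discE fw := f_disc Uw.
rewrite /F f_deck // form // AB // rmorphM fmorphV rmorphB rmorph1.
have A1' : 1 - rc A != 0 :> C by rewrite -(rmorph1 (real_complex R)) -rmorphB fmorph_eq0.
by field.
Qed.

Lemma cayley_sub (X z : C) (e : R) : nrm X = 1 -> nrm z < 1 -> 0 < e ->
  2 < e * nrm (cayley X z + 'i) -> nrm (X - z) < e.
Proof.
move=> X1 z1 e0; rewrite cayleyDi // (nrmM (2 * 'i * X)) nrmV (nrmM (2 * 'i)) X1 mulr1 (nrmM 2) nrm_i mulr1.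
have -> : nrm (2 : C) = 2 by rewrite -(rmorph_nat (real_complex R)) nrm_rc gtr0_norm.
have n0 : 0 < nrm (X - z) by rewrite nrm_gt0; apply: cayley_den.
by rewrite mulrA ltr_pdivlMr // mulrC ltr_pM2r.
Qed.

(* The iterates of a parabolic element [a] bring every point to its boundary
   fixed point [X], which is therefore fixed by whatever commutes with [a]. *)
Lemma fixes_boundary (X k q : C) (c c' : 'rV[int]_s) (B : R) : nrm X = 1 -> nrm k = 1 -> nrm q < 1 -> B != 0 ->
  (forall z, D z -> cayley X (rho c z) = cayley X z + rc B) ->
  (forall z, nrm z < 1 -> rho c' z = blaschke (- q) (k * z)) ->
  k * X + q = X * (1 + cj q * k * X).
Proof.
move=> X1 k1 q1 B0 cB form; apply/eqP; rewrite -subr_eq0; apply/eqP/eq0_eps => e0 e00.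
(* The three error terms below are at most e, 2 e and e. *)
pose e := e0 / 4; have e4 : 0 < e by rewrite divr_gt0.
have iter n z : D z -> D (rho (c *+ n) z) /\ cayley X (rho (c *+ n) z) = cayley X z + rc (B *+ n).
  move=> Dz; split; first exact: rho_disc.
  elim: n => [|n IH]; first by rewrite !mulr0n rho0 // rmorph0 addr0.
  by rewrite !mulrS rhoD // cB ?IH ?rmorphD; [ring|exact: rho_disc].
have small z : D z -> exists N, forall n, (N <= n)%N -> nrm (X - rho (c *+ n) z) < e.
  move=> Dz; have nB : 0 < `|B| by rewrite normr_gt0.
  have [N HN] : exists N : nat, 2 / e + nrm (cayley X z + 'i) < N%:R * `|B|.
    exists (Num.bound ((2 / e + nrm (cayley X z + 'i)) / `|B|)).
    rewrite -ltr_pdivrMr //; apply: archi_boundP.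
    by apply: divr_ge0; rewrite ?ltW //; apply: ltr_wpDr; rewrite ?nrm_ge0 ?divr_gt0.
  exists N => n Nn; have [Dn cn] := iter n z Dz.
  apply: cayley_sub => //; first by apply/discE.
  rewrite mulrC -ltr_pdivrMr // cn.
  have -> : cayley X z + rc (B *+ n) + 'i = rc (B *+ n) - - (cayley X z + 'i) by ring.
  apply: lt_le_trans (lerB_nrm _ _); rewrite nrmN nrm_rc normrMn ltrBrDr.
  apply: (lt_le_trans HN); rewrite -[leRHS]mulr_natl; apply: ler_wpM2r; first exact: ltW.
  by rewrite ler_nat.
have [N1 H1] := small 0 disc0.
have [N2 H2] := small (rho c' 0) (rho_disc c' disc0).
pose n := maxn N1 N2; pose z := rho (c *+ n) 0; pose w := rho (c *+ n) (rho c' 0).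
have hz : nrm (X - z) < e by apply: H1; apply: leq_maxl.
have hw : nrm (X - w) < e by apply: H2; apply: leq_maxr.
have Dz : D z by apply: rho_disc disc0.
have z1 : nrm z < 1 by apply/discE.
have wz : w = rho c' z by rewrite /w rho_comm //; apply: disc0.
have nqn : nrm (- q) < 1 by rewrite nrmN.
have kz : nrm (k * z) < 1 by rewrite (nrmM k) k1 mul1r.
have D0 := blaschke_den nqn (ltW kz); rewrite cjN mulNr opprK in D0.
have wE : k * z + q = w * (1 + cj q * (k * z)).
  by rewrite wz form // /blaschke cjN mulNr !opprK divfK.
(* The relation between [z] and its image [w] is subtracted from the fixed-point equation at [X];
   both points are within [e] of [X]. *)
have -> : k * X + q - X * (1 + cj q * k * X) = k * (X - z) - (X - w) * (1 + cj q * (k * z))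
    - X * (cj q * k) * (X - z).
  transitivity (k * (X - z) + (k * z + q) - X * (1 + cj q * (k * z)) - X * (cj q * k) * (X - z)); first by ring.
  by rewrite wE; ring.
have b1 : nrm (k * (X - z)) <= e by rewrite (nrmM k) k1 mul1r ltW.
have b2 : nrm ((X - w) * (1 + cj q * (k * z))) <= e * 2.
  rewrite (nrmM (X - w)); apply: ler_pM; rewrite ?nrm_ge0 ?(ltW hw) //.
  apply: (le_trans (ler_nrmD _ _)); rewrite nrm1 (nrmM (cj q)) nrm_cj.
  have : nrm q * nrm (k * z) <= 1 * 1 by apply: ler_pM; rewrite ?nrm_ge0 // ltW.
  lra.
have b3 : nrm (X * (cj q * k) * (X - z)) <= e.
  rewrite (nrmM (X * _)) (nrmM X) (nrmM (cj q)) nrm_cj X1 k1 mul1r mulr1 -[leRHS]mul1r.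
  by apply: ler_pM; rewrite ?nrm_ge0 // ltW.
apply: (le_trans (ler_nrmB _ _)); apply: (le_trans (lerD (ler_nrmB _ _) b3)).
have -> : e0 = e + e * 2 + e by rewrite /e; field.
by rewrite lerD2r lerD.
Qed.

Lemma parabolic_normal_form (X k q z : C) i : nrm X = 1 -> nrm k = 1 -> nrm q < 1 ->
  D z -> rho (delta_mx 0 i) z <> z ->
  (forall z, nrm z < 1 -> rho (delta_mx 0 i) z = blaschke (- q) (k * z)) ->
  k * X + q = X * (1 + cj q * k * X) -> exists M, mobius_normal_form M.
Proof.
move=> X1 k1 q1 Dz iz form E; have X0 : X != 0 by rewrite -nrm_gt0 X1.
have [B HB] := translation_part X1 k1 q1 form E.
have B0 : B != 0.
  apply/eqP => B0; apply: iz; apply: (cayley_inj X1); [exact/discE/rho_disc|exact/discE|].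
  by rewrite HB // B0 rmorph0 addr0.
have hE : mobius (mx2 'i ('i * X) (- 1) X) = cayley X.
  by apply/funext => y; rewrite mobius_mx2 mulN1r [- y + X]addrC -mulrDr [y + X]addrC.
exists (mx2 'i ('i * X) (- 1) X); rewrite /mobius_normal_form hE; split.
- apply: mx2_unit; have -> : 'i * X - 'i * X * -1 = 2 * 'i * X by ring.
  by rewrite !mulf_neq0 ?neq0Ci // pnatr_eq0.
- by move=> y /discE y1; rewrite !mxE /= mulN1r addrC; apply: cayley_den.
right; split; first by move=> y /discE y1; apply: cayley_gt0.
move=> j; have [k' [q' [k'1 q'1 form']]] := aut_disc_form (rho_aut (delta_mx 0 j)).
exact: translation_part X1 k'1 q'1 form' (fixes_boundary X1 k'1 q'1 B0 HB form').
Qed.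

Lemma normal_form : nontrivial rho -> exists M, mobius_normal_form M.
Proof.
move=> /moving_generator [i [z Dz iz]].
have [k [q [k1 q1 form]]] := aut_disc_form (rho_aut (delta_mx 0 i)).
have [[p p1 pE]|[X X1 E]] := fixed_point_form k1 q1.
  by apply: (elliptic_normal_form Dz iz (p := p)); [apply/discE|rewrite form].
exact: parabolic_normal_form X1 k1 q1 Dz iz form E.
Qed.

(* [beta = 0] in the elliptic case, [alpha = 0] in the parabolic case. *)
Lemma developing_normal_form : nontrivial rho ->
  exists (M : 'M[C]_2) (alpha beta : 'I_s -> C) (g : Cn -> C),
  [/\ M \in unitmx, forall z, D z -> M 1 0 * z + M 1 1 != 0,
    forall k l, alpha k * beta l = 0, holomorphic (eball (s + m) r) g &
    forall w, ucover s m r w -> mobius M (f w) =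
      cexp (\sum_i alpha i * w 0 (lshift m i)) * g (uproj s m w)
      + \sum_i beta i * w 0 (lshift m i)].
Proof.
move=> /normal_form [M [uM dM H]].
have hM : holomorphic D (mobius M) by move=> z Dz; apply: hol_mobius; apply: dM.
case: H => -[H1 H2].
  have [u [nu [hu _ uE]]] := elliptic_case H1 hM H2.
  exists M, (fun i => rc (nu i)), (fun=> 0), u; split=> //; first by move=> k l; rewrite mulr0.
  move=> w Uw; rewrite uE // cexp_sum mulrC [X in _ + X]big1 ?addr0 // => i _.
  by rewrite mul0r.
have [g [la [hg _ gE]]] := parabolic_case H1 hM H2.
exists M, (fun=> 0), (fun i => (two_i_pi R)^-1 * rc (la i)), g; split=> //; first by move=> k l; rewrite mul0r.
move=> w Uw; rewrite gE // [in RHS]big1; last by move=> i _; rewrite mul0r.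
rewrite cexp0 mul1r addrC mulr_sumr; congr (_ + _); apply: eq_bigr => i _; by rewrite mulrA.
Qed.

End Types.

(** * The universal covering and its deck transformations *)

Section Covering.
Variables (R : realType) (s m : nat) (r : R).
Hypothesis r0 : 0 < r.
Local Notation C := (Cplx R).
Local Notation Cn := 'rV[C]_(s + m).

Lemma two_i_pi_int (k : int) : nrm (two_i_pi R *~ k) = pi *+ 2 * `|k%:~R|.
Proof. by rewrite -mulrzr (nrmM (two_i_pi R)) nrm_two_i_pi -(rmorph_int (real_complex R)) nrm_rc. Qed.

Lemma udeck_sub (c : 'rV[int]_s) (w : Cn) i : (udeck c w - w) 0 (lshift m i) = two_i_pi R *~ c 0 i.
Proof. by rewrite mxE udeckL mxE addrAC subrr add0r. Qed.

Lemma pi2_gt1 : 1 < pi *+ 2 :> R.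
Proof. by have := @pi_ge2 R; rewrite mulr2n; lra. Qed.

(** Distinct points of a fibre are at distance at least 2 pi > 1, so distance less than 1 identifies
    the sheet in the arguments below. *)
Lemma udeck_close (c : 'rV[int]_s) (w : Cn) : nrm (udeck c w - w) < 1 -> c = 0.
Proof.
move=> H; apply/rowP => i; rewrite mxE; apply/eqP/negPn/negP => ci.
have := le_lt_trans (nrm_coord _ (lshift m i)) H; rewrite udeck_sub two_i_pi_int.
have c1 : 1 <= `|(c 0 i)%:~R| :> R.
  by rewrite -intr_norm ler1z -gtz0_ge1 normr_gt0.
have := pi2_gt1; have := ler_pM ler01 ler01 (ltW pi2_gt1) c1; rewrite mulr1; lra.
Qed.

Lemma udeck_inj (c c' : 'rV[int]_s) (w : Cn) : udeck c w = udeck c' w -> c = c'.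
Proof.
move=> E; apply/eqP; rewrite -subr_eq0; apply/eqP; apply: (@udeck_close _ (udeck c' w)).
by rewrite -udeckD subrK E subrr nrm0 ltr01.
Qed.

Lemma fiber_close (w w' : Cn) : uproj s m w = uproj s m w' -> nrm (w - w') < 1 -> w = w'.
Proof. by move=> /uproj_fiber [c ->] /udeck_close ->; rewrite udeck0. Qed.

Lemma cts_uproj (w : Cn) : {for w, continuous (uproj s m)}.
Proof. exact: differentiable_cts (differentiable_uproj w). Qed.

Lemma cts_addr (T : topologicalType) (F : T -> Cn) (v : Cn) (x : T) :
  {for x, continuous F} -> {for x, continuous (fun y => F y + v)}.
Proof. by move=> cF; exact: (cvgD cF (cvg_cst _)). Qed.

Lemma cts_udeck_comp (T : topologicalType) (F : T -> Cn) c (x : T) :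
  {for x, continuous F} -> {for x, continuous (fun y => udeck c (F y))}.
Proof. exact: cts_addr. Qed.

Lemma cts_usection_uproj (w0 w : Cn) : usection_dom w0 (uproj s m w) ->
  {for w, continuous (fun y => usection w0 (uproj s m y))}.
Proof. by move=> Dw; apply: (cts_comp (@cts_uproj w)); apply: cts_usection. Qed.

Lemma near_close (w : Cn) (F : Cn -> Cn) : {for w, continuous F} -> F w = w ->
  \forall y \near w, nrm (y - F y) < 1.
Proof.
move=> cF Fw; have h2 : 0 < 2^-1 :> R by rewrite invr_gt0.
have /continuous_nrmP /(_ _ h2) [d d0 H] := cF.
apply/nbhs_nrmP; exists (Num.min d 2^-1); first by rewrite lt_min d0.
move=> y; rewrite lt_min => /andP[/H h1 h3]; rewrite Fw in h1.
have := ler_nrmBD y w (F y); rewrite (nrmB w); move: h1 h3; lra.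
Qed.

Lemma usectionK_near (w0 : Cn) : \forall w \near w0, usection w0 (uproj s m w) = w.
Proof.
have D0 := usection_dom_self w0.
have N1 := near_close (cts_usection_uproj D0) (usection_self w0).
have N2 := @cts_uproj w0 _ (usection_near D0).
apply: filterS (filterI N1 N2) => w [w1 Dw]; symmetry; apply: fiber_close => //.
by rewrite uproj_usection.
Qed.

Lemma uproj_covering : covering_map (ucover s m r) (uproj s m) (ball_compl s m r).
Proof.
split; first split.
- exact: open_ucover.
- by move=> w _; apply: cts_uproj.
- by move=> w; apply: ucover_proj.
move=> b Bb; have [w0 Uw0 wb] := uproj_surj Bb.
pose V := ball_compl s m r `&` usection_dom w0.
have oV : open V by apply: openI; [exact: open_ball_compl|exact: open_usection_dom].
(* The sheet is given by an equation instead of as an image of the section; it is open because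
   nearby points of the same fibre coincide. *)
pose W (c : 'rV[int]_s) : set Cn := [set w | V (uproj s m w) /\ w = udeck c (usection w0 (uproj s m w))].
have VU c x : V x -> W c (udeck c (usection w0 x)) /\ uproj s m (udeck c (usection w0 x)) = x.
  move=> [Bx Dx]; have E : uproj s m (udeck c (usection w0 x)) = x by rewrite uproj_udeck uproj_usection.
  by split=> //; split; rewrite E.
exists V, 'rV[int]_s, W, (fun c x => udeck c (usection w0 x)); split.
- split=> //; last by move=> x [].
  by split=> //; rewrite -wb; apply: usection_dom_self.
- move=> c; rewrite openE => w [Vw wE].
  have Dw : usection_dom w0 (uproj s m w) by case: Vw.
  have N1 := near_close (cts_udeck_comp (c := c) (cts_usection_uproj Dw)) (esym wE).
  have nV : nbhs (uproj s m w) V by apply: open_nbhs_nbhs.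
  have N2 := @cts_uproj w _ nV.
  apply: filterS (filterI N1 N2) => y [y1 Vy]; split=> //.
  by apply: fiber_close => //; rewrite uproj_udeck uproj_usection //; case: Vy.
- apply/seteqP; split=> w.
    move=> [Uw [Bw Dw]].
    have [c wE] : exists c, w = udeck c (usection w0 (uproj s m w)).
      by apply: uproj_fiber; rewrite uproj_usection.
    by exists c.
  move=> [c _ [Vw wE]]; split=> //; case: Vw => -[Bw _] _; exact: Bw.
- by move=> c c' w [_ E] [_ E']; apply: (@udeck_inj _ _ (usection w0 (uproj s m w))); rewrite -E -E'.
move=> c; split.
- by move=> x [_ Dx]; apply: cts_udeck_comp; apply: cts_usection.
- exact: VU.
- by move=> w [_ E]; rewrite -E.
Qed.

Lemma cts_segment (x v : Cn) (t : R) : {for t, continuous (fun t : R => x + rc t *: v)}.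
Proof.
apply/continuousR_nrmP => e e0; have n1 : 0 < nrm v + 1 by rewrite ltr_wpDl ?nrm_ge0.
exists (e / (nrm v + 1)); first by rewrite divr_gt0.
move=> y yt; have -> : x + rc y *: v - (x + rc t *: v) = rc (y - t) *: v.
  by rewrite opprD addrACA subrr add0r -scalerBl rmorphB.
rewrite nrmZ nrm_rc; move: yt; rewrite ltr_pdivlMr //; apply: le_lt_trans.
by rewrite ler_wpM2l // lerDl.
Qed.

(** By convexity, segments join points and the straight-line homotopy contracts a loop to its base
    point. *)
Lemma ucover_simply_connected : simply_connected R (ucover s m r).
Proof.
split; first exact: ucover_nonempty.
  move=> x y Ux Uy; exists (fun t : R => x + rc t *: (y - x)); split.
  - split; last by move=> t; rewrite /= in_itv /= => t01; apply: ucover_convex.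
    apply/subspace_continuousP => t _; apply: cvg_within_filter; exact: cts_segment.
  - by rewrite rmorph0 scale0r addr0.
  - by rewrite rmorph1 scale1r subrKC.
move=> g [cg Ug] g01; exists (fun ut : R * R => g ut.2 + rc ut.1 *: (g 0 - g ut.2)).
have I0 : (`[0, 1]%classic : set R) 0 by rewrite /= in_itv /= lexx ler01.
split.
- apply/subspace_continuousP => -[u t] [/= Iu It]; apply/cvg_nrmP => e e0.
  have /cvg_nrmP H := (subspace_continuousP _ _).1 cg t It.
  have h := H (e / 2) (divr_gt0 e0 (ltr0Sn _ 1)).
  have n1 : 0 < 2 * (nrm (g 0 - g t) + 1) by rewrite mulr_gt0 // ltr_wpDl ?nrm_ge0.
  pose e' := e / (2 * (nrm (g 0 - g t) + 1)); have e'0 : 0 < e' by rewrite divr_gt0.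
  have hu : \forall u' \near u, `|u' - u| < e'.
    by apply/nbhs_ballP; exists e' => //= u'; rewrite /ball /= distrC.
  move: h; rewrite near_withinE => h; rewrite near_withinE.
  have : \forall ut \near (u, t), `|ut.1 - u| < e' /\ ((`[0, 1]%classic : set R) ut.2 -> nrm (g ut.2 - g t) < e / 2).
    exists (([set u' | `|u' - u| < e'] : set R), ([set t' | (`[0, 1]%classic : set R) t' -> nrm (g t' - g t) < e / 2] : set R)).
      by split.
    by move=> [u' t'] [].
  apply: filterS => -[u' t'] /= [u'e t'e] [Iu' It'].
  have -> : g t' + rc u' *: (g 0 - g t') - (g t + rc u *: (g 0 - g t)) =
      rc (1 - u') *: (g t' - g t) + rc (u' - u) *: (g 0 - g t).
    rewrite !rmorphB rmorph1 !scalerBl !scalerBr !scale1r.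
    move: (rc u' *: g 0) (rc u' *: g t') (rc u *: g 0) (rc u *: g t) (rc u' *: g t) => a b c d k.
    by apply/rowP => i; rewrite !mxE; ring.
  apply: (le_lt_trans (ler_nrmD _ _)); rewrite !nrmZ !nrm_rc.
  have A : `|1 - u'| * nrm (g t' - g t) <= nrm (g t' - g t).
    rewrite ler_piMl ?nrm_ge0 //; move: Iu'; rewrite /= in_itv /= => /andP[a b].
    by rewrite ger0_norm; lra.
  have B : `|u' - u| * nrm (g 0 - g t) <= e / 2.
    have -> : e / 2 = e' * (nrm (g 0 - g t) + 1).
      by rewrite /e'; field; rewrite gt_eqF // ltr_wpDl ?nrm_ge0.
    by apply: ler_pM => //; [exact: nrm_ge0|exact: ltW|rewrite lerDl].
  have := t'e It'; lra.
- move=> u t Iu It /=; apply: ucover_convex; [exact: Ug|exact: Ug|by move: Iu; rewrite /= in_itv].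
- by move=> t It /=; rewrite rmorph0 scale0r addr0.
- by move=> t It /=; rewrite rmorph1 scale1r subrKC.
move=> u Iu /=; split; first by rewrite subrr scaler0 addr0.
by rewrite -g01 subrr scaler0 addr0.
Qed.

Lemma uproj_universal_cover : universal_cover R (ucover s m r) (uproj s m) (ball_compl s m r).
Proof. by split; [exact: uproj_covering|exact: ucover_simply_connected]. Qed.

(** Otherwise the intermediate value theorem produces the value [l + 1/2], with [l] the smaller of
    the two integers. *)
Lemma integer_valued_const (u : R -> R) : (forall t, 0 <= t <= 1 -> {for t, continuous u}) ->
  (forall t, 0 <= t <= 1 -> exists k : int, u t = k%:~R) -> u 1 = u 0.
Proof.
move=> cu iu; have l01 : 0 <= (0 : R) <= 1 by rewrite lexx ler01.
have l11 : 0 <= (1 : R) <= 1 by rewrite lexx ler01.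
have [k0 E0] := iu 0 l01; have [k1 E1] := iu 1 l11.
apply/eqP/negPn/negP => ne.
pose l := Order.min k0 k1.
have v : Num.min (u 0) (u 1) <= l%:~R + 2^-1 <= Num.max (u 0) (u 1).
  have key (a b : int) : (a < b)%R -> (a%:~R : R) <= (a%:~R : R) + 2^-1 <= (b%:~R : R).
    rewrite -lezD1 => ab; have h : (a + 1)%:~R <= b%:~R :> R by rewrite ler_int.
    rewrite rmorphD /= in h; have h' : a%:~R + 1 <= b%:~R :> R by [].
    by apply/andP; split; move: h'; set x : R := a%:~R; set y : R := b%:~R; lra.
  rewrite E0 E1 /l; case: (ltgtP k0 k1) => h.
  - by have := key _ _ h; rewrite (min_idPl _) ?ler_int ?(ltW h) // (max_idPr _) ?ler_int ?(ltW h).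
  - by have := key _ _ h; rewrite (min_idPr _) ?ler_int ?(ltW h) // (max_idPl _) ?ler_int ?(ltW h).
  - by move: ne; rewrite E0 E1 h eqxx.
have [|c c01 cE] := IVT (@ler01 R) _ v.
  apply: continuous_in_subspaceT => t; rewrite inE /= in_itv /=; exact: cu.
have [|k kE] := iu c; first by move: c01; rewrite in_itv.
move: cE; rewrite kE => /(congr1 (fun z => z * 2)); rewrite mulrDl mulVf // => h.
have : ((k * 2)%:~R : R) = (l * 2 + 1)%:~R by rewrite intrD !intrM.
move=> /eqP; rewrite eqr_int => /eqP; lia.
Qed.

(** At each point [c] differs from the identity by a lattice vector; along the segment from a base
    point this vector varies continuously, hence is constant. *)
Lemma deck_is_udeck (c : Cn -> Cn) : deck_transformation (ucover s m r) (uproj s m) c ->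
  exists k, forall w, ucover s m r w -> c w = udeck k w.
Proof.
move=> [cc bij pc]; have [w0 Uw0] := ucover_nonempty s m r0.
have fib w : ucover s m r w -> exists k, c w = udeck k w by move=> Uw; apply: uproj_fiber; apply: pc.
have [k kE] := fib w0 Uw0; exists k => w Uw; have [k' k'E] := fib w Uw.
suff -> : k = k' by [].
apply/rowP => i; pose ga (t : R) : Cn := w0 + rc t *: (w - w0).
pose u (t : R) : R := ImC ((c (ga t) - ga t) 0 (lshift m i)) / (pi *+ 2).
have Uga t : 0 <= t <= 1 -> ucover s m r (ga t) by apply: ucover_convex.
have p0 : (pi *+ 2 : R) != 0 by rewrite gt_eqF // (lt_trans ltr01) // pi2_gt1.
have uE t q : c (ga t) = udeck q (ga t) -> u t = (q 0 i)%:~R.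
  move=> E; rewrite /u E udeck_sub -mulrzr -(rmorph_int (real_complex R)) /two_i_pi !ReImE.
  by rewrite /= !mul0r !mulr0 !mul1r ?subr0 ?add0r ?addr0 mulrC mulKf.
have ga0 : ga 0 = w0 by rewrite /ga rmorph0 scale0r addr0.
have ga1 : ga 1 = w by rewrite /ga rmorph1 scale1r subrKC.
have := @integer_valued_const u _ _.
rewrite (uE 0 k) ?ga0 // (uE 1 k') ?ga1 // => H.
have : ((k' 0 i)%:~R : R) = (k 0 i)%:~R.
  apply: H => t t01; last first.
    by have [q qE] := fib _ (Uga t t01); exists (q 0 i); apply: uE.
  apply: cvgM; last exact: cvg_cst.
  apply: (@cts_comp _ _ _ (fun t : R => (c (ga t) - ga t) 0 (lshift m i) : C) (@complex.Im R : C -> R)); last exact: continuous_Im.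
  apply: (@cts_comp _ _ _ (fun t : R => c (ga t) - ga t) (fun y : Cn => y 0 (lshift m i) : C)); last first.
    exact: differentiable_cts (hol_coord _ _).
  have cga : {for t, continuous ga} by apply: cts_segment.
  have cca := @cts_comp _ _ _ ga c t cga (cc _ (Uga t t01)).
  exact: (cvgB cca cga).
by move=> /eqP; rewrite eqr_int => /eqP ->.
Qed.

End Covering.

(** * The foliation and its transverse structure *)

Section Derivations.
Variables (R : realType) (V : normedModType (Cplx R)) (v x : V).
Local Notation C := (Cplx R).

(** Differentiability is carried along with the value of the derivative, so that the product and
    chain rules compose without side conditions. *)
Definition dv (f : V -> C) (d : C) := differentiable f x /\ 'D_v f x = d.

Lemma dv_self f : differentiable f x -> dv f ('D_v f x). Proof. by []. Qed.

Lemma dv_cst (k : C) : dv (fun=> k) 0.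
Proof. by split; [exact: hol_cst|exact: derive_cst]. Qed.

Lemma dvD f g a b : dv f a -> dv g b -> dv (fun y => f y + g y) (a + b).
Proof.
move=> [df <-] [dg <-]; split; first exact: holD.
exact: (deriveD (diff_derivable df) (diff_derivable dg)).
Qed.

Lemma dvN f a : dv f a -> dv (fun y => - f y) (- a).
Proof. by move=> [df <-]; split; [exact: holN|exact: (deriveN (diff_derivable df))]. Qed.

Lemma dvM f g a b : dv f a -> dv g b -> dv (fun y => f y * g y) (a * g x + f x * b).
Proof.
move=> [df <-] [dg <-]; split; first exact: holM.
by rewrite addrC [X in _ + X]mulrC; exact: (deriveM (diff_derivable df) (diff_derivable dg)).
Qed.

Lemma dvZ f (k : C) a : dv f a -> dv (fun y => k * f y) (k * a).
Proof. by move=> df; have := dvM (dv_cst k) df; rewrite mul0r add0r. Qed.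

Lemma dv_sum (I : Type) (l : seq I) (F : I -> V -> C) (a : I -> C) : (forall i, dv (F i) (a i)) ->
  dv (fun y => \sum_(i <- l) F i y) (\sum_(i <- l) a i).
Proof.
move=> dF; elim: l => [|i l IH].
  have -> : (fun y => \sum_(i <- [::]) F i y) = (fun=> 0) by apply/funext => y; rewrite big_nil.
  by rewrite big_nil; exact: dv_cst.
have -> : (fun y => \sum_(j <- i :: l) F j y) = (fun y => F i y + \sum_(j <- l) F j y).
  by apply/funext => y; rewrite big_cons.
by rewrite big_cons; apply: dvD.
Qed.

Lemma dv_cexp f a : dv f a -> dv (fun y => cexp (f y)) (a * cexp (f x)).
Proof.
move=> [df <-]; have [dc Dc] := differentiable_cexp (f x).
split; first exact: hol_comp df dc.
by rewrite derive_comp1 // Dc mulrC.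
Qed.

Lemma dv_near f g a : (\forall y \near x, f y = g y) -> dv f a -> dv g a.
Proof.
move=> E [df <-]; split; first exact: hol_near E df.
by symmetry; apply: near_eq_derive.
Qed.

Lemma dvV f a : f x != 0 -> dv f a -> dv (fun y => (f y)^-1) (- a / f x ^+ 2).
Proof.
move=> fx df; have di := holV fx df.1; split=> //.
have N : \forall y \near x, 1 = f y * (f y)^-1.
  by apply: filterS (near_neq0 (differentiable_cts df.1) fx) => y fy; rewrite divff.
have [_ D1] := dv_near N (dv_cst 1); have [_] := dvM df (dv_self di); rewrite D1 => /esym E.
by apply: (mulfI fx); rewrite (canRL (addKr _) E); field.
Qed.

Lemma dv_uniq f a b : dv f a -> dv f b -> a = b.
Proof. by move=> [_ <-] [_ <-]. Qed.

End Derivations.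

Section Matrices2.
Variables (R : realType) (V : normedModType (Cplx R)).
Local Notation C := (Cplx R).

Lemma differentiable_mx n1 n2 (F : V -> 'M[C]_(n1, n2)) (x : V) :
  (forall i j, differentiable (fun y => F y i j : C) x) -> differentiable F x.
Proof.
move=> dF; have -> : F = \sum_i \sum_j (fun y => F y i j *: (delta_mx i j : 'M[C]_(n1, n2))).
  apply/funext => y; rewrite {1}(matrix_sum_delta (F y)) fct_sumE; apply: eq_bigr => i _.
  by rewrite fct_sumE.
by apply: differentiable_sum => i; apply: differentiable_sum => j; apply: differentiableZl.
Qed.

Lemma derive_mx_entry n1 n2 (F : V -> 'M[C]_(n1, n2)) (x v : V) i j : differentiable F x ->
  ('D_v F x) i j = 'D_v (fun y => F y i j : C) x.
Proof.
move=> dF; symmetry; rewrite [LHS]/derive; apply: cvg_lim => //.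
have cc : {for 'D_v F x, continuous (fun A : 'M[C]_(n1, n2) => A i j : C)}.
  exact: differentiable_cts (differentiable_coord _ i j).
have dd : (fun h : C => h^-1 *: ((F \o shift x) (h *: v) - F x)) @ 0^' --> 'D_v F x := diff_derivable dF.
have := cvg_comp _ _ dd cc; apply: cvg_trans.
have -> // : (fun h : C => h^-1 *: (((fun y => F y i j) \o shift x) (h *: v) - F x i j)) =
  (fun A : 'M[C]_(n1, n2) => A i j) \o (fun h : C => h^-1 *: ((F \o shift x) (h *: v) - F x)).
by apply/funext => h; rewrite /= !mxE.
Qed.

Definition col2 (a b : C) : 'cV[C]_2 := \col_i (if i == 0 then a else b).

Lemma ord2_ind (P : 'I_2 -> Prop) : P 0 -> P 1 -> forall i, P i.
Proof.
move=> P0 P1 [[|[|//]] h].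
  by have -> : Ordinal h = 0 by apply/val_inj.
by have -> : Ordinal h = 1 by apply/val_inj.
Qed.

Lemma mx2_eq (A B : 'M[C]_2) : A 0 0 = B 0 0 -> A 0 1 = B 0 1 -> A 1 0 = B 1 0 -> A 1 1 = B 1 1 -> A = B.
Proof. by move=> *; apply/matrixP; apply: ord2_ind; apply: ord2_ind. Qed.

Lemma mulmx2E (A B : 'M[C]_2) i j : (A *m B) i j = A i 0 * B 0 j + A i 1 * B 1 j.
Proof.
rewrite mxE big_ord_recl big_ord1; have -> : lift ord0 ord0 = 1 :> 'I_2 by apply/val_inj.
by [].
Qed.

Lemma mulmx2_col (A : 'M[C]_2) (u : 'cV[C]_2) i : (A *m u) i 0 = A i 0 * u 0 0 + A i 1 * u 1 0.
Proof.
rewrite mxE big_ord_recl big_ord1; have -> : lift ord0 ord0 = 1 :> 'I_2 by apply/val_inj.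
by [].
Qed.

Variables (x v : V).

Lemma dv_mx2 (a b c d : V -> C) (a' b' c' d' : C) : dv v x a a' -> dv v x b b' -> dv v x c c' -> dv v x d d' ->
  differentiable (fun y => mx2 (a y) (b y) (c y) (d y)) x /\
  'D_v (fun y => mx2 (a y) (b y) (c y) (d y)) x = mx2 a' b' c' d'.
Proof.
move=> [da ea] [db eb] [dc ec] [dd ed].
have E00 : (fun y => mx2 (a y) (b y) (c y) (d y) 0 0) = a by apply/funext => y; rewrite mxE.
have E01 : (fun y => mx2 (a y) (b y) (c y) (d y) 0 1) = b by apply/funext => y; rewrite mxE.
have E10 : (fun y => mx2 (a y) (b y) (c y) (d y) 1 0) = c by apply/funext => y; rewrite mxE.
have E11 : (fun y => mx2 (a y) (b y) (c y) (d y) 1 1) = d by apply/funext => y; rewrite mxE.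
have dm : differentiable (fun y => mx2 (a y) (b y) (c y) (d y)) x.
  by apply: differentiable_mx; apply: ord2_ind; apply: ord2_ind; rewrite ?E00 ?E01 ?E10 ?E11.
split=> //; apply: mx2_eq; rewrite derive_mx_entry // ?E00 ?E01 ?E10 ?E11 !mxE //=.
Qed.

Lemma dv_col2 (a b : V -> C) (a' b' : C) : dv v x a a' -> dv v x b b' ->
  differentiable (fun y => col2 (a y) (b y)) x /\ 'D_v (fun y => col2 (a y) (b y)) x = col2 a' b'.
Proof.
move=> [da ea] [db eb].
have E0 j : (fun y => col2 (a y) (b y) 0 j) = a by apply/funext => y; rewrite mxE.
have E1 j : (fun y => col2 (a y) (b y) 1 j) = b by apply/funext => y; rewrite mxE.
have dm : differentiable (fun y => col2 (a y) (b y)) x.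
  by apply: differentiable_mx; apply: ord2_ind => j; rewrite ?E0 ?E1.
split=> //; apply/matrixP; apply: ord2_ind => j; rewrite derive_mx_entry // ?E0 ?E1 !mxE //=.
Qed.

End Matrices2.

Section Density.
Variables (R : realType) (s m : nat) (r : R).
Local Notation C := (Cplx R).
Local Notation Cn := 'rV[C]_(s + m).

Lemma ball_compl_dense (U : set Cn) x : open U -> U x -> exists2 y : Cn, U y &
  forall i : 'I_s, y 0 (lshift m i) != 0.
Proof.
move=> oU Ux; have [d d0 Hd] := (open_nrmP U).1 oU x Ux.
pose t : R := d / 2; have t0 : 0 < t by rewrite divr_gt0.
pose y : Cn := \row_k (if x 0 k == 0 then rc t else x 0 k).
exists y; last by move=> i; rewrite mxE; case: ifPn => [_|//]; rewrite -nrm_gt0 nrm_rc gtr0_norm.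
apply: Hd; apply: nrm_sub_coord_lt => // k; rewrite mxE; case: eqVneq => [->|_].
  by rewrite subr0 nrm_rc gtr0_norm // /t; lra.
by rewrite subrr nrm0.
Qed.

(** Lets identities between holomorphic forms be checked off H only, where the logarithmic
    coordinates exist. *)
Lemma zero_by_density (U : set Cn) (F : Cn -> C) : open U -> U `<=` eball (s + m) r ->
  (forall x, U x -> {for x, continuous F}) -> (forall x, U x -> ball_compl s m r x -> F x = 0) ->
  forall x, U x -> F x = 0.
Proof.
move=> oU UB cF F0 x Ux; apply/eq0_eps => e e0.
have /continuous_nrmP /(_ e e0) [d d00 Hd] := cF x Ux.
have oW : open (U `&` [set y | nrm (y - x) < d]).
  apply: openI => //; apply/open_nrmP => y yd; exists (d - nrm (y - x)); first by rewrite subr_gt0.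
  by move=> z zy; apply: (le_lt_trans (ler_nrmBD z y x)); move: zy; rewrite /=; lra.
have Wx : (U `&` [set y | nrm (y - x) < d]) x by split=> //=; rewrite subrr nrm0.
have [y [Uy yd] yn] := ball_compl_dense oW Wx.
have := Hd y yd; rewrite F0 //; last by apply: neq0_ball_compl => //; apply: UB.
by rewrite sub0r nrmN => /ltW.
Qed.

End Density.

(** * The extended foliation and its logarithmic connection *)

Section Developing.
Variables (R : realType) (s m : nat) (r : R).
Hypothesis r0 : 0 < r.
Local Notation C := (Cplx R).
Local Notation Cn := 'rV[C]_(s + m).
Local Notation X := (eball (s + m) r).
Local Notation B := (ball_compl s m r).
Local Notation U := (ucover s m r).
Local Notation p := (uproj s m).
Local Notation e_ k := (delta_mx 0 k : Cn).

Variables (f : Cn -> C) (M : 'M[C]_2) (alpha beta : 'I_s -> C) (g : Cn -> C).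
Hypothesis hf : holomorphic U f.
Hypothesis fD : forall w, U w -> disc R (f w).
Hypothesis f_nonconst : nonconstant r f.
Hypothesis uM : M \in unitmx.
Hypothesis dM : forall z, disc R z -> M 1 0 * z + M 1 1 != 0.
Hypothesis ab0 : forall k l, alpha k * beta l = 0.
Hypothesis hg : holomorphic X g.
Hypothesis fE : forall w, U w -> mobius M (f w) =
  cexp (\sum_i alpha i * w 0 (lshift m i)) * g (p w) + \sum_i beta i * w 0 (lshift m i).

(* The coefficient at [dx_k] of the form [sum_i c_i dx_i / x_i]. *)
Definition logform (c : 'I_s -> C) (k : 'I_(s + m)) (x : Cn) : C :=
  \sum_i c i * ((k == lshift m i)%:R / x 0 (lshift m i)).

Definition loglin (c : 'I_s -> C) (w : Cn) : C := \sum_i c i * w 0 (lshift m i).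

Lemma alpha_beta : (forall i, alpha i = 0) \/ (forall i, beta i = 0).
Proof.
have [H|H] := pselect (forall i, alpha i = 0); first by left.
right=> i; have [k ak] : exists k, alpha k <> 0 by apply: contrapT => N; apply: H => k; apply: contrapT => E; apply: N; exists k.
by have /eqP := ab0 k i; rewrite mulf_eq0 => /orP[/eqP|/eqP].
Qed.

Lemma loglin0 c w : (forall i, c i = 0) -> loglin c w = 0.
Proof. by move=> c0; rewrite /loglin big1 // => i _; rewrite c0 mul0r. Qed.

Lemma logform0 c k x : (forall i, c i = 0) -> logform c k x = 0.
Proof. by move=> c0; rewrite /logform big1 // => i _; rewrite c0 mul0r. Qed.

Definition is_section (sec : Cn -> Cn) (x : Cn) :=
  {for x, continuous sec} /\ \forall y \near x, U (sec y) /\ p (sec y) = y.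

Lemma section_loglin sec x : is_section sec x -> differentiable sec x /\
  forall c k, dv (e_ k) x (fun y => loglin c (sec y)) (logform c k x).
Proof.
move=> [cs ns]; have ps : \forall y \near x, p (sec y) = y by apply: filterS ns => y [].
have [ds Ds] := section_diff cs ps; split=> // c k; apply: dv_sum => i; apply: dvZ.
split; last exact: Ds.
exact: (@hol_comp _ _ _ _ sec (fun y : Cn => y 0 (lshift m i) : C) x ds (hol_coord _ _)).
Qed.

(** The differential of the multivalued [psi] without its exponential factor; unlike that
    differential it is single-valued off H. *)
Definition omega (k : 'I_(s + m)) (x : Cn) : C :=
  partial k g x + logform alpha k x * g x + logform beta k x.

Definition psi (sec : Cn -> Cn) (x : Cn) : C := cexp (loglin alpha (sec x)) * g x + loglin beta (sec x).

Lemma psi_dv sec x k : is_section sec x -> X x ->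
  dv (e_ k) x (psi sec) (cexp (loglin alpha (sec x)) * omega k x).
Proof.
move=> Hs Xx; have [_ D] := section_loglin Hs.
have H := dvD (dvM (dv_cexp (D alpha k)) (dv_self (e_ k) (hg Xx))) (D beta k).
case: H => H1 H2; split=> //; rewrite H2 /omega -/(partial k g x).
case: alpha_beta => ab; last by rewrite [logform beta _ _]logform0 // !addr0; ring.
by rewrite [logform alpha _ _]logform0 // loglin0 // cexp0; ring.
Qed.

Lemma det_neq0 : M 0 0 * M 1 1 - M 0 1 * M 1 0 != 0.
Proof.
move: uM; rewrite unitmxE unitfE (expand_det_row _ 0) big_ord_recl big_ord1 /cofactor !det_mx11 !mxE /=.
have -> : lift 0 0 = 1 :> 'I_2 by apply/val_inj.
have -> : lift 1 0 = 0 :> 'I_2 by apply/val_inj.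
by rewrite expr0 mul1r expr1 mulN1r mulrN.
Qed.

(** The relation M f = psi, cross-multiplied so that it can be differentiated without quotients. *)
Lemma f_section_eq sec x : U (sec x) -> p (sec x) = x ->
  M 0 0 * f (sec x) + M 0 1 = (M 1 0 * f (sec x) + M 1 1) * psi sec x.
Proof.
move=> Us ps; have := fE Us; rewrite ps /mobius => E.
have -> : psi sec x = (M 0 0 * f (sec x) + M 0 1) / (M 1 0 * f (sec x) + M 1 1) by rewrite E.
by rewrite [RHS]mulrC divfK //; apply: dM; apply: fD.
Qed.

(** [f] and [psi] differ by a Moebius map, so the differential of a branch is a nonzero multiple of
    that of [psi], hence of [omega]. *)
Lemma branch_dv sec x : is_section sec x -> B x ->
  differentiable (fun y => f (sec y)) x /\
  exists2 c : C, c != 0 & forall k, partial k (fun y => f (sec y)) x = c * omega k x.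
Proof.
move=> Hs Bx; have [cs ns] := Hs; have [Us ps] := nbhs_singleton ns.
have [ds _] := section_loglin Hs.
have dphi : differentiable (fun y => f (sec y)) x.
  exact: (@hol_comp _ _ _ _ sec f x ds (hf Us)).
split=> //; pose d := M 1 0 * f (sec x) + M 1 1.
have d0 : d != 0 by apply: dM; apply: fD.
pose det := M 0 0 * M 1 1 - M 0 1 * M 1 0.
pose e := cexp (loglin alpha (sec x)).
exists (d ^+ 2 * e / det).
  by rewrite mulf_neq0 ?invr_eq0 ?det_neq0 // mulf_neq0 ?cexp_neq0 ?expf_neq0.
move=> k; have Dphi := dv_self (e_ k) dphi.
have L := dvD (dvZ (M 0 0) Dphi) (dv_cst (e_ k) x (M 0 1)).
have Rr := dvM (dvD (dvZ (M 1 0) Dphi) (dv_cst (e_ k) x (M 1 1))) (psi_dv k Hs (proj1 Bx)).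
have E : \forall y \near x, M 0 0 * f (sec y) + M 0 1 = (M 1 0 * f (sec y) + M 1 1) * psi sec y.
  by apply: filterS ns => y [Uy py]; apply: f_section_eq.
have := dv_uniq (dv_near E L) Rr; rewrite !addr0 -/(partial k _ x) -/d -/e.
set P := partial k _ x => H.
(* Implicit differentiation leaves this factor in front of the derivative of the branch; it is the
   determinant divided by [d], hence nonzero. *)
have K : (M 0 0 - M 1 0 * psi sec x) * d = det.
  have Ex := f_section_eq Us ps; rewrite -/d in Ex.
  have -> : (M 0 0 - M 1 0 * psi sec x) * d = M 0 0 * d - M 1 0 * (d * psi sec x) by ring.
  by rewrite -Ex /d /det; ring.
have H2 : (M 0 0 - M 1 0 * psi sec x) * P = d * (e * omega k x) by rewrite mulrBl H; ring.
apply: (mulfI det_neq0); rewrite -/det -{1}K.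
have -> : (M 0 0 - M 1 0 * psi sec x) * d * P = d * ((M 0 0 - M 1 0 * psi sec x) * P) by ring.
by rewrite H2; field; exact: det_neq0.
Qed.

Definition pr (x : Cn) : C := coord_prod (hyps s m) x.

(** x_1 ... x_s times [omega], with the quotients by x_i replaced by products over the other
    indices, so that it is holomorphic across H. *)
Definition eta (x : Cn) : Cn := \row_k (pr x * partial k g x +
  \sum_i (k == lshift m i)%:R * ((alpha i * g x + beta i) * \prod_(j | j != i) x 0 (lshift m j))).

Lemma eta_off x k : B x -> eta x 0 k = pr x * omega k x.
Proof.
move=> Bx; have x0 := ball_compl_neq0 Bx; rewrite mxE /omega -addrA mulrDr; congr (_ + _).
rewrite /logform mulr_suml -big_split mulr_sumr; apply: eq_bigr => i _ /=.
rewrite /pr coord_prod_hyps [in RHS](bigD1 i) //=; field; exact: x0.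
Qed.

Lemma hol_eta_coef k : holomorphic X (fun x => eta x 0 k).
Proof.
move=> x Xx.
have -> : (fun x => eta x 0 k) = (fun x => pr x * partial k g x +
  \sum_i (k == lshift m i)%:R * ((alpha i * g x + beta i) * \prod_(j | j != i) x 0 (lshift m j))).
  by apply/funext => y; rewrite mxE.
have hP : differentiable pr x by apply: coord_prod_diff.
have hk := holomorphic_partial k (@open_eball R _ r) hg Xx.
apply: holD; first exact: holM.
apply: hol_sum => i _; apply: holM; first exact: hol_cst.
apply: holM; last by apply: hol_prod => j _; apply: hol_coord.
by apply: holD; [apply: holM; [exact: hol_cst|exact: hg]|exact: hol_cst].
Qed.

Lemma hol_eta : holomorphic X eta.
Proof. by move=> x Xx; apply: differentiable_row => k; apply: hol_eta_coef. Qed.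

Lemma pr_neq0 x : B x -> pr x != 0.
Proof. by move=> /ball_complE []. Qed.

Lemma usection_is_section w0 x : B x -> usection_dom w0 x -> is_section (usection w0) x.
Proof.
move=> Bx Dx; split; first exact: cts_usection.
have nB : nbhs x B by apply: open_nbhs_nbhs; split=> //; apply: open_ball_compl.
apply: filterS (filterI nB (usection_near Dx)) => y [By Dy].
by split; [apply: ucover_usection|apply: uproj_usection].
Qed.

Lemma integrable_eta : integrable_form X eta.
Proof.
move=> /= x Xx a b c; pose dw a b x := partial a (fun y => eta y 0 b) x - partial b (fun y => eta y 0 a) x.
pose F x := eta x 0 a * dw b c x + eta x 0 b * dw c a x + eta x 0 c * dw a b x.
apply: (@zero_by_density R s m r X F (@open_eball R _ r)) => // {x Xx} x Xx.
  have dc k l : differentiable (partial k (fun y => eta y 0 l)) x.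
    exact: (holomorphic_partial k (@open_eball R _ r) (hol_eta_coef l) Xx).
  have dd k l : differentiable (dw k l) x by apply: holB.
  have de k : differentiable (fun y => eta y 0 k) x by apply: hol_eta_coef.
  by apply: differentiable_cts; apply: holD; [apply: holD|]; apply: holM.
move=> Bx; have [w0 Uw0 wx] := uproj_surj Bx.
pose V := B `&` usection_dom w0; pose sec := usection w0.
have Vx : V x by split=> //; rewrite -wx; apply: usection_dom_self.
have oV : open V by apply: openI; [exact: open_ball_compl|exact: open_usection_dom].
have Vs y : V y -> is_section sec y by move=> [By Dy]; apply: usection_is_section.
have VX y : V y -> X y by move=> [[]].
have hpsi : holomorphic V (psi sec) by move=> y Vy; case: (psi_dv a (Vs y Vy) (VX y Vy)).
pose G y : C := pr y / cexp (loglin alpha (sec y)).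
have dG : differentiable G x.
  apply: hol_div; [exact: cexp_neq0|exact: coord_prod_diff|].
  by have [_ D] := section_loglin (Vs x Vx); have [] := dv_cexp (D alpha a).
have EG k y : V y -> eta y 0 k = G y * partial k (psi sec) y.
  move=> Vy; rewrite /partial (psi_dv k (Vs y Vy) (VX y Vy)).2 eta_off; last by case: Vy.
  by rewrite /G mulrA divfK // cexp_neq0.
have nV : nbhs x V by apply: open_nbhs_nbhs.
(* First and second derivatives are abstracted, keeping only the symmetry of the latter: what is
   left is a polynomial identity. *)
have [Q [P [H [De [Q1 EGx]]]]] : exists (Q : 'I_(s + m) -> 'I_(s + m) -> C) (P H : 'I_(s + m) -> C),
    (forall k l, partial k (fun y => eta y 0 l) x = H k * P l + G x * Q k l) /\
    (forall k l, Q k l = Q l k) /\ forall k, eta x 0 k = G x * P k.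
  exists (fun k l => partial k (partial l (psi sec)) x), (fun k => partial k (psi sec) x), (fun k => partial k G x).
  split; [|split] => [k l|k l|k]; [|exact: (partialC k l oV hpsi Vx)|exact: EG].
  have H := dvM (dv_self (e_ k) dG) (dv_self (e_ k) (holomorphic_partial l oV hpsi Vx)).
  rewrite -[RHS]H.2; apply: near_eq_derive; apply: filterS nV => y; exact: EG.
rewrite /F /dw (De a b) (De b a) (De b c) (De c b) (De a c) (De c a) (Q1 b a) (Q1 c a) (Q1 c b).
rewrite (EGx a) (EGx b) (EGx c); move: (G x) (Q a b) (Q a c) (Q b c) => G0 q1 q2 q3; ring.
Qed.

Lemma branch_section V phi x : open V -> branch U p f V phi -> V x ->
  exists sec, [/\ is_section sec x, B x & \forall y \near x, f (sec y) = phi y].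
Proof.
move=> oV [sec Hs] Vx; exists sec; have [cs Us ps _] := Hs x Vx.
have nV : nbhs x V by apply: open_nbhs_nbhs.
split; last by apply: filterS nV => y /Hs [_ _ _ ->].
  by split=> //; apply: filterS nV => y /Hs [_ ? ? _].
by rewrite -ps; apply: ucover_proj.
Qed.

Lemma wedge_scale (a b : Cn) (c : C) : c != 0 -> wedge_eq0 a (c *: b) <-> wedge_eq0 a b.
Proof.
move=> c0; split=> H k l; last by rewrite !mxE mulrCA H mulrCA.
by apply: (mulfI c0); have := H k l; rewrite !mxE mulrCA [RHS]mulrCA.
Qed.

Lemma branch_differential V phi x : open V -> branch U p f V phi -> V x ->
  differentiable phi x /\ exists2 c : C, c != 0 & differential phi x = c *: eta x.
Proof.
move=> oV bV Vx; have [sec [Hs Bx near_phi]] := branch_section oV bV Vx.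
have [df [c c0 cE]] := branch_dv Hs Bx; split; first exact: hol_near near_phi df.
exists (c / pr x); first by rewrite mulf_neq0 ?invr_eq0 ?pr_neq0.
apply/rowP => k; have -> : ((c / pr x) *: eta x) 0 k = c * omega k x.
  by rewrite [LHS]mxE (eta_off k Bx) mulrA divfK // pr_neq0.
rewrite -cE mxE; symmetry; exact: near_eq_derive near_phi.
Qed.

Lemma usection_branch w0 (V : set Cn) : V `<=` B -> V `<=` usection_dom w0 ->
  branch U p f V (fun x => f (usection w0 x)).
Proof.
move=> VB VD; exists (usection w0) => x Vx; split=> //; first by apply: cts_usection; apply: VD.
  by apply: ucover_usection; [exact: VB|exact: VD].
by apply: uproj_usection; apply: VD.
Qed.

Lemma usection_open w0 x : B x -> p w0 = x ->
  [/\ open (B `&` usection_dom w0), (B `&` usection_dom w0) x &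
     branch U p f (B `&` usection_dom w0) (fun x => f (usection w0 x))].
Proof.
move=> Bx wx; split.
- by apply: openI; [exact: open_ball_compl|exact: open_usection_dom].
- by split=> //; rewrite -wx; apply: usection_dom_self.
by apply: usection_branch => y [].
Qed.

Lemma differential_eq0 (phi : Cn -> C) x v : differentiable phi x -> differential phi x = 0 -> 'd phi x v = 0.
Proof.
move=> dphi D0; rewrite (row_sum_delta v) linear_sum big1 // => k _.
rewrite linearZ /= -deriveE //; have := congr1 (fun u : Cn => u 0 k) D0; rewrite !mxE /partial => ->.
by rewrite scaler0.
Qed.

(** If [eta] vanished on an open set, a branch of [f] would be constant on a ball in it off H; by
    [identity_segment] on the convex cover, [f] would be constant. *)
Lemma eta_nonzero : somewhere_in_every_open X (fun x => eta x <> 0).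
Proof.
move=> W oW [x Wx] WX; apply: contrapT => N.
have W0 z : W z -> eta z = 0 by move=> Wz; apply: contrapT => E; apply: N; exists z.
have [y Wy y0] := ball_compl_dense oW Wx.
have By : B y by apply: neq0_ball_compl => //; apply: WX.
have [w0 Uw0 wy] := uproj_surj By.
have [oV Vy bV] := usection_open By wy; set V := B `&` usection_dom w0 in oV Vy bV.
pose phi x := f (usection w0 x).
have [d d0 Hd] := (open_nrmP _).1 (openI oW oV) y (conj Wy Vy).
have phi_const z : nrm (z - y) < d -> phi z = phi y.
  move=> zd; rewrite -(subrKC y z); apply: zero_diff_segment => t /andP[t0 t1].
  have [|Wz Vz] := Hd (y + rc t *: (z - y)).
    rewrite addrC addKr nrmZ nrm_rc ger0_norm //; apply: le_lt_trans zd.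
    by rewrite ler_piMl ?nrm_ge0.
  have [dphi [c _ cE]] := branch_differential oV bV Vz; split=> //.
  by apply: differential_eq0 => //; rewrite cE W0 // scaler0.
have f_const : \forall w \near w0, f w - f w0 = 0.
  have N1 : \forall w \near w0, nrm (p w - y) < d.
    have /continuous_nrmP /(_ d d0) [d' d'0 H] := @cts_uproj R s m w0.
    by apply/nbhs_nrmP; exists d' => // w /H; rewrite wy.
  apply: filterS (filterI (usectionK_near w0) N1) => w [wE wd].
  by rewrite -{1}wE -[f (usection w0 _)]/(phi (p w)) phi_const // -wy /phi usection_self subrr.
have [w1 [w2 [U1 U2 ne]]] := f_nonconst; apply: ne.
have all_const w : U w -> f w = f w0.
  move=> Uw; apply/eqP; rewrite -subr_eq0; apply/eqP.
  have := @identity_segment R _ U (fun w => f w - f w0) w0 (w - w0) (@open_ucover R s m r).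
  rewrite subrKC; apply; [|by move=> t; apply: ucover_convex|exact: f_const].
  by move=> z Uz; apply: holB; [exact: hf|exact: hol_cst].
by rewrite all_const // [RHS]all_const.
Qed.

Definition level_forms (V : set Cn) (w : Cn -> Cn) :=
  holomorphic V w /\ forall x, V x -> wedge_eq0 (w x) (eta x).

Lemma foliation_level_forms : foliation X level_forms.
Proof.
split.
  move=> V w oV VX; split=> [Vw x Vx|H]; first by exists V; split.
  split=> x Vx; have [V' [_ V'x _ [hw ww]]] := H x Vx; [exact: hw|exact: ww].
move=> x Xx; exists X, eta; split=> //; first exact: open_eball.
  by split; [exact: hol_eta|exact: integrable_eta].
by split; [exact: eta_nonzero|].
Qed.

Lemma level_set_level_forms : level_set_foliation U p f B level_forms.
Proof.
move=> V w oV VB; split=> -[hw H]; split=> //.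
  move=> V' phi oV' bV' x Vx V'x; have [_ [c c0 ->]] := branch_differential oV' bV' V'x.
  by apply/wedge_scale => //; apply: H.
move=> x Vx; have [w0 Uw0 wx] := uproj_surj (VB x Vx).
have [oV' V'x bV'] := usection_open (VB x Vx) wx.
have [_ [c c0 cE]] := branch_differential oV' bV' V'x.
by have := H _ _ oV' bV' x Vx V'x; rewrite cE => /(wedge_scale _ _ c0).
Qed.

Lemma logformD (c c' : 'I_s -> C) k x : logform (fun i => c i + c' i) k x = logform c k x + logform c' k x.
Proof. by rewrite /logform -big_split; apply: eq_bigr => i _; rewrite mulrDl. Qed.

Lemma logform_lshift c i x : logform c (lshift m i) x = c i / x 0 (lshift m i).
Proof.
rewrite /logform (bigD1 i) //= eqxx mul1r big1 ?addr0 // => j ji.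
by rewrite (inj_eq (@lshift_inj _ _)) eq_sym (negPf ji) mul0r mulr0.
Qed.

Lemma logform_rshift c j x : logform c (rshift s j) x = 0.
Proof. by rewrite /logform big1 // => i _; rewrite eq_rlshift mul0r mulr0. Qed.

Definition logform2 (c : 'I_s -> C) (k l : 'I_(s + m)) (x : Cn) : C :=
  \sum_i c i * (- ((k == lshift m i)%:R * (l == lshift m i)%:R) / x 0 (lshift m i) ^+ 2).

Lemma logform2C c k l x : logform2 c k l x = logform2 c l k x.
Proof. by apply: eq_bigr => i _; rewrite [_%:R * _%:R]mulrC. Qed.

Lemma dv_logform c k l x : B x -> dv (e_ l) x (logform c k) (logform2 c k l x).
Proof.
move=> Bx; apply: dv_sum => i; apply: dvZ.
have dc : dv (e_ l) x (fun y : Cn => y 0 (lshift m i) : C) (l == lshift m i)%:R.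
  by split; [exact: hol_coord|rewrite derive_coord mxE eqxx eq_sym].
have := dvZ (k == lshift m i)%:R (dvV (ball_compl_neq0 Bx i) dc).
by rewrite mulrA mulrN.
Qed.

(* The diagonal entries differ from the connection [d + [alpha, beta; 0, 0]] by
   the scalar form [sum_i dx_i / x_i], which makes the polar set exactly [H]. *)
Definition conn_mx (k : 'I_(s + m)) (x : Cn) : 'M[C]_2 :=
  mx2 (logform (fun i => 1 + alpha i) k x) (logform beta k x) 0 (logform (fun=> 1) k x).

Lemma conn_mx_dv k l x : B x -> differentiable (conn_mx k) x /\
  partial l (conn_mx k) x =
  mx2 (logform2 (fun i => 1 + alpha i) k l x) (logform2 beta k l x) 0 (logform2 (fun=> 1) k l x).
Proof.
move=> Bx; apply: dv_mx2; try exact: dv_logform.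
exact: dv_cst.
Qed.

(** The lower right entry in direction i is 1 / x_i whatever [alpha] and [beta] are, so no point of
    H is regular. *)
Lemma conn_mx_regular x : regular_matrix X conn_mx x <-> B x.
Proof.
split=> [[V [oV Vx VX hV]]|Bx]; last first.
  exists B; split=> //; [exact: open_ball_compl|by move=> y []|].
  by move=> k y By; case: (conn_mx_dv k k By).
apply: neq0_ball_compl => [|i]; first exact: VX.
apply/eqP => xi; have dC := hV (lshift m i) x Vx.
have dq : differentiable (fun y : Cn => (y 0 (lshift m i))^-1 : C) x.
  have -> : (fun y : Cn => (y 0 (lshift m i))^-1 : C) = (fun y => conn_mx (lshift m i) y 1 1).
    by apply/funext => y; rewrite mxE /= logform_lshift mul1r.
  exact: (@hol_comp _ _ _ _ (conn_mx (lshift m i)) (fun A : 'M[C]_2 => A 1 1) x dC (differentiable_coord _ _ _)).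
have /continuous_nrmP /(_ 1 ltr01) [d d0 H] := differentiable_cts dq.
(* By convention the entry is 0 at [x], but at parameter [t < 1] along direction i its modulus is 1
   / t > 1, against continuity. *)
pose t : R := Num.min (d / 2) 2^-1.
have t0 : 0 < t by rewrite /t lt_min divr_gt0 //= invr_gt0.
have td : t < d by rewrite /t gt_min; apply/orP; left; lra.
have t1 : t < 1 by rewrite /t gt_min; apply/orP; right; lra.
have hd : nrm (x + rc t *: e_ (lshift m i) - x) < d.
  by rewrite addrC addKr; apply: (le_lt_trans (nrm_scale_delta _ _)); rewrite nrm_rc gtr0_norm.
have := H _ hd; rewrite coord_line_eq xi add0r invr0 subr0 nrmV nrm_rc gtr0_norm //.
by rewrite invf_lt1 // ltNge (ltW t1).
Qed.

Lemma mero_logform c k : meromorphic X (logform c k).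
Proof.
move=> x Xx; case: (split_ordP k) => i ->.
  exists X, (fun=> c i), (fun y : Cn => y 0 (lshift m i) : C).
  split; [exact: open_eball|exact: Xx|by move=> y _; apply: hol_cst|by move=> y _; apply: hol_coord|].
  split; last by move=> y _ _; rewrite logform_lshift.
  move=> W oW [y Wy] _; have [z Wz z0] := ball_compl_dense oW Wy; exists z => //; exact: z0.
exists X, (fun=> 0), (fun=> 1).
split; [exact: open_eball|exact: Xx|by move=> y _; apply: hol_cst|by move=> y _; apply: hol_cst|].
split; last by move=> y _ _; rewrite logform_rshift mul0r.
by move=> W oW [y Wy] _; exists y => //; apply: oner_neq0.
Qed.

Lemma mero_cst (k : C) : meromorphic X (fun=> k).
Proof.
move=> x Xx; exists X, (fun=> k), (fun=> 1).
split; [exact: open_eball|exact: Xx|by move=> y _; apply: hol_cst|by move=> y _; apply: hol_cst|].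
split; last by move=> y _ _; rewrite divr1.
by move=> W oW [y Wy] _; exists y => //; apply: oner_neq0.
Qed.

Definition trivial_bundle : bundle2 X.
Proof.
apply: (@Bundle2 R (s + m) X unit (fun=> X) (fun _ _ _ => 1%:M)).
- by move=> _; apply: open_eball.
- by apply/seteqP; split=> [x [_ _ Xx] //|x Xx]; exists tt.
- by move=> _ _ x _; apply: differentiable_cst.
- by move=> *; apply: unitmx1.
- by [].
- by move=> *; rewrite mulmx1.
Defined.

Lemma conn_mx_mero k a b : meromorphic X (fun x => conn_mx k x a b).
Proof.
move: a b; apply: ord2_ind; apply: ord2_ind.
- have -> : (fun x => conn_mx k x 0 0) = logform (fun i => 1 + alpha i) k by apply/funext => y; rewrite mxE.
  exact: mero_logform.
- have -> : (fun x => conn_mx k x 0 1) = logform beta k by apply/funext => y; rewrite mxE.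
  exact: mero_logform.
- have -> : (fun x => conn_mx k x 1 0) = (fun=> 0) by apply/funext => y; rewrite mxE.
  exact: mero_cst.
have -> : (fun x => conn_mx k x 1 1) = logform (fun=> 1) k by apply/funext => y; rewrite mxE.
exact: mero_logform.
Qed.

Lemma alpha_beta_forms k l x : logform alpha k x * logform beta l x = 0.
Proof.
by case: alpha_beta => H; [rewrite (logform0 k x H) mul0r|rewrite (logform0 l x H) mulr0].
Qed.

(** The entries are closed forms, whose derivatives [logform2] are symmetric, so the derivative
    terms cancel; the only entry of the commutator that survives is the wedge of the alpha and beta
    forms, which is 0 because their products are. *)
Lemma conn_mx_flat k l x : B x ->
  partial k (conn_mx l) x - partial l (conn_mx k) x + conn_mx k x *m conn_mx l x - conn_mx l x *m conn_mx k x = 0.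
Proof.
move=> Bx; rewrite (conn_mx_dv l k Bx).2 (conn_mx_dv k l Bx).2.
rewrite (logform2C _ l k) (logform2C beta l k) (logform2C (fun=> 1) l k) subrr add0r.
have A1 := alpha_beta_forms k l x; have A2 := alpha_beta_forms l k x.
apply/eqP; rewrite subr_eq0; apply/eqP.
apply: mx2_eq; rewrite !mulmx2E !mxE /= ?logformD; try ring.
have -> : (logform (fun=> 1) k x + logform alpha k x) * logform beta l x + logform beta k x * logform (fun=> 1) l x =
   logform (fun=> 1) k x * logform beta l x + logform beta k x * logform (fun=> 1) l x + logform alpha k x * logform beta l x by ring.
have -> : (logform (fun=> 1) l x + logform alpha l x) * logform beta k x + logform beta l x * logform (fun=> 1) k x =
   logform (fun=> 1) k x * logform beta l x + logform beta k x * logform (fun=> 1) l x + logform alpha l x * logform beta k x by ring.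
by rewrite A1 A2.
Qed.

Definition log_connection : flat_connection trivial_bundle.
Proof.
apply: (@FlatConnection R (s + m) X trivial_bundle (fun _ => conn_mx)).
- by move=> [] k a b; apply: conn_mx_mero.
- move=> [] [] k x _ _; rewrite mulmx1 mul1mx /partial [X in X + _](_ : _ = 0) ?add0r //.
  exact: derive_cst.
by move=> [] k l x /conn_mx_regular; apply: conn_mx_flat.
Defined.

Definition graph_section : proj_section trivial_bundle.
Proof.
apply: (@ProjSection R (s + m) X trivial_bundle (fun _ x => col2 (g x) 1)).
- move=> [] x Xx; exact: (dv_col2 (v := 0) (dv_self 0 (hg Xx)) (dv_cst 0 x 1)).1.
- move=> [] W oW [x Wx] _; exists x => // E; have := congr1 (fun u : 'cV[C]_2 => u 1 0) E.
  by rewrite !mxE /=; apply/eqP; apply: oner_neq0.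
by move=> [] [] x _ _; rewrite mul1mx /wedge2 mulrC subrr.
Defined.

Definition log_structure : proj_structure X := ProjStructure log_connection graph_section.

Lemma regular_atP (i : chart log_structure) x : regular_at i x <-> B x.
Proof. by case: i; apply: conn_mx_regular. Qed.

Lemma polesE : X `\` poles log_structure = B.
Proof.
apply/seteqP; split=> x.
  move=> [Xx nP]; apply: contrapT => nB; apply: nP; split=> // -[i /regular_atP //].
by move=> Bx; have [Xx _] := Bx; split=> // -[_]; apply; exists tt; apply/regular_atP.
Qed.

(** The scalar part of the connection drops out of the wedge of the section with its covariant
    derivative. *)
Lemma riccatiE (i : chart log_structure) x k : B x -> riccati_form i x 0 k = - omega k x.
Proof.
move=> Bx; rewrite mxE /=.
have -> : partial k (fun x => col2 (g x) 1) x = col2 (partial k g x) 0.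
  exact: (dv_col2 (dv_self (e_ k) (hg (proj1 Bx))) (dv_cst (e_ k) x 1)).2.
have addE (u v : 'cV[C]_2) j : (u + v) j 0 = u j 0 + v j 0 by rewrite mxE.
rewrite /wedge2 !addE !mulmx2_col !mxE /= logformD /omega; ring.
Qed.

Lemma eta_riccati (i : chart log_structure) x : B x -> eta x = - pr x *: riccati_form i x.
Proof.
by move=> Bx; apply/rowP => k; rewrite [RHS]mxE riccatiE // eta_off // mulrNN.
Qed.

(** Off H the Riccati form is a nonzero multiple of [eta]; a wedge relation known at the regular
    points extends over H by density. *)
Lemma transverse_log_structure : transverse_structure_for log_structure level_forms.
Proof.
split.
  move=> i W oW [x Wx] WX.
  have oWB : open (W `&` B) by apply: openI => //; apply: open_ball_compl.
  have nWB : W `&` B !=set0.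
    have [y Wy y0] := ball_compl_dense oW Wx; exists y; split=> //.
    by apply: neq0_ball_compl => //; apply: WX.
  have [y [Wy By] ey] := eta_nonzero oWB nWB (fun z Wz => WX z Wz.1).
  exists y => //; split; first by apply/regular_atP.
  by move=> E; apply: ey; rewrite (eta_riccati i By) E scaler0.
move=> V w oV VX; split=> -[hw H]; split=> //.
  move=> i x Vx /regular_atP Bx; apply/(@wedge_scale _ _ (- pr x)); first by rewrite oppr_eq0 pr_neq0.
  by rewrite -eta_riccati //; apply: H.
move=> x Vx k l; apply/eqP; rewrite -subr_eq0; apply/eqP.
apply: (@zero_by_density R s m r V (fun x => w x 0 k * eta x 0 l - w x 0 l * eta x 0 k)) => // {x Vx} x Vx.
  have hw' j : differentiable (fun x => w x 0 j : C) x.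
    exact: (@hol_comp _ _ _ _ w (fun A : Cn => A 0 j) x (hw x Vx) (hol_coord _ _)).
  have he j : differentiable (fun x => eta x 0 j : C) x by apply: hol_eta_coef; apply: VX.
  by apply: differentiable_cts; apply: holB; apply: holM.
move=> Bx; apply/eqP; rewrite subr_eq0; apply/eqP.
have rx : regular_at (tt : chart log_structure) x by apply/regular_atP.
have := H tt x Vx rx; rewrite -(@wedge_scale _ _ (- pr x)); last by rewrite oppr_eq0 pr_neq0.
by rewrite -eta_riccati //; apply.
Qed.

Lemma log_structure_without_poles : without_poles_over log_structure B.
Proof.
move=> x Bx; exists tt, B, conn_mx, (fun _ _ => 0); split=> //.
- exact: open_ball_compl.
- by move=> y [].
- by move=> k y By; case: (conn_mx_dv k k By).
by move=> y k _ _; rewrite raddf0 addr0.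
Qed.

(* Flat sections in logarithmic coordinates; for [alpha = beta = 0] the matrix
   is [M / \prod_i x_i]. *)
Definition frame (sec : Cn -> Cn) (y : Cn) : 'M[C]_2 :=
  let t0 := cexp (- (loglin (fun=> 1) (sec y) + loglin alpha (sec y))) in
  let t1 := cexp (- loglin (fun=> 1) (sec y)) in
  let b := loglin beta (sec y) in
  mx2 (t0 * M 0 0 + - (b * t1) * M 1 0) (t0 * M 0 1 + - (b * t1) * M 1 1)
      (t1 * M 1 0) (t1 * M 1 1).

Lemma frame_unit sec y : frame sec y \in unitmx.
Proof.
apply: mx2_unit; set t0 := cexp _; set t1 := cexp _; set b := loglin _ _.
have -> : (t0 * M 0 0 + - (b * t1) * M 1 0) * (t1 * M 1 1) - (t0 * M 0 1 + - (b * t1) * M 1 1) * (t1 * M 1 0) =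
   t0 * t1 * (M 0 0 * M 1 1 - M 0 1 * M 1 0) by ring.
by rewrite mulf_neq0 ?det_neq0 // mulf_neq0 ?cexp_neq0.
Qed.

Lemma frame_diff sec x : is_section sec x -> differentiable (frame sec) x.
Proof.
move=> Hs; have [ds _] := section_loglin Hs.
have hl c : differentiable (fun y => loglin c (sec y)) x.
  apply: hol_sum => i _; apply: holM; first exact: hol_cst.
  exact: (@hol_comp _ _ _ _ sec (fun y : Cn => y 0 (lshift m i) : C) x ds (hol_coord _ _)).
have he (h : Cn -> C) : differentiable h x -> differentiable (fun y => cexp (h y)) x.
  by move=> dh; exact: (hol_comp dh (differentiable_cexp (h x)).1).
have h1 := he _ (holN (hl (fun=> 1))).
have h0 := he _ (holN (holD (hl (fun=> 1)) (hl alpha))).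
have hb := holN (holM (hl beta) h1).
have c0 (z : C) := hol_cst z x.
have S (h : Cn -> C) : differentiable h x -> dv 0 x h ('D_0 h x) by move=> dh; apply: dv_self.
exact: (dv_mx2 (S _ (holD (holM h0 (c0 _)) (holM hb (c0 _)))) (S _ (holD (holM h0 (c0 _)) (holM hb (c0 _))))
  (S _ (holM h1 (c0 _))) (S _ (holM h1 (c0 _)))).1.
Qed.

(** The terms that do not cancel identically are multiples of the alpha form times [loglin beta],
    which vanishes in either type. *)
Lemma frame_flat sec x k : is_section sec x -> partial k (frame sec) x + conn_mx k x *m frame sec x = 0.
Proof.
move=> Hs; have [_ D] := section_loglin Hs.
have D0 := dv_cexp (dvN (dvD (D (fun=> 1) k) (D alpha k))).
have D1 := dv_cexp (dvN (D (fun=> 1) k)).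
have Db := dvN (dvM (D beta k) D1).
have c0 (z : C) := dv_cst (e_ k) x z.
have [_ DF] := dv_mx2 (dvD (dvM D0 (c0 (M 0 0))) (dvM Db (c0 (M 1 0)))) (dvD (dvM D0 (c0 (M 0 1))) (dvM Db (c0 (M 1 1))))
  (dvM D1 (c0 (M 1 0))) (dvM D1 (c0 (M 1 1))).
rewrite [X in X + _]DF.
have ab : logform alpha k x * loglin beta (sec x) = 0.
  by case: alpha_beta => H; [rewrite (logform0 k x H) mul0r|rewrite (loglin0 _ H) mulr0].
have addE (A A' : 'M[C]_2) i j : (A + A') i j = A i j + A' i j by rewrite mxE.
apply: mx2_eq; rewrite addE mulmx2E !mxE /= ?logformD; move: ab;
  move: (cexp (- loglin (fun=> 1) (sec x))) => t1;
  move: (cexp (- (loglin (fun=> 1) (sec x) + loglin alpha (sec x)))) => t0;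
  move: (loglin beta (sec x)) (logform alpha k x) (logform beta k x) (logform (fun=> 1) k x) => b la lb l1 ab; try ring.
- transitivity (- (la * b) * t1 * M 1 0); [ring|by rewrite ab; ring].
- transitivity (- (la * b) * t1 * M 1 1); [ring|by rewrite ab; ring].
Qed.

(** [M] sends (f, 1) to a multiple of (psi, 1), and the triangular factor of [frame] sends this to a
    multiple of (g, 1): it divides by the exponential in the elliptic type and subtracts
    [loglin beta] in the parabolic one. *)
Lemma frame_developing sec x : U (sec x) -> p (sec x) = x ->
  wedge2 (col2 (g x) 1) (frame sec x *m (\col_(a < 2) (if a == 0 then f (sec x) else 1))) = 0.
Proof.
move=> Us ps; have E := f_section_eq Us ps.
rewrite /wedge2 !mulmx2_col !mxE /=.
set t1 := cexp (- loglin (fun=> 1) (sec x)); set t0 := cexp (- (_ + _)); set b := loglin beta _; set d := M 1 0 * f (sec x) + M 1 1 in E.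
rewrite !mulr1.
have -> : g x * (t1 * M 1 0 * f (sec x) + t1 * M 1 1) -
  1 * ((t0 * M 0 0 + - (b * t1) * M 1 0) * f (sec x) + (t0 * M 0 1 + - (b * t1) * M 1 1)) =
  g x * t1 * d - t0 * (M 0 0 * f (sec x) + M 0 1) + b * t1 * d by rewrite /d; ring.
rewrite E /psi -/b.
have tt : t0 * cexp (loglin alpha (sec x)) = t1.
  by rewrite /t0 /t1 -cexpD; congr cexp; ring.
have -> : g x * t1 * d - t0 * (d * (cexp (loglin alpha (sec x)) * g x + b)) + b * t1 * d =
   g x * d * (t1 - t0 * cexp (loglin alpha (sec x))) + d * (b * (t1 - t0)) by ring.
rewrite tt subrr mulr0 add0r; case: alpha_beta => H; last by rewrite /b (loglin0 _ H) mul0r mulr0.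
by rewrite /t0 /t1 (loglin0 _ H) addr0 subrr !mulr0.
Qed.

Lemma developing_log_structure : developing_map log_structure U p f B.
Proof.
move=> V phi oV VB bV; split; first by move=> x Vx; case: (branch_differential oV bV Vx).
have [sec Hs] := bV.
have ss y : V y -> is_section sec y.
  move=> Vy; have [cs _ _ _] := Hs y Vy; split=> //.
  have nV : nbhs y V by apply: open_nbhs_nbhs.
  by apply: filterS nV => z /Hs [_ ? ? _].
move=> [] x Vx _; exists V, (frame sec); split=> //.
- by move=> y Vy; split=> //; have [] := VB y Vy.
- by move=> y Vy; apply: frame_diff; apply: ss.
move=> y Vy; have [_ Us ps ->] := Hs y Vy; split.
- exact: frame_unit.
- by move=> k; apply: frame_flat; apply: ss.
exact: frame_developing.
Qed.

End Developing.

Theorem theorem5p2 (R : realType) (s m : nat) (r : R) (r_gt0 : 0 < r)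
    (rho : 'rV[int]_s -> Cplx R -> Cplx R)
    (rho_rep : representation rho) (rho_nontrivial : nontrivial rho)
    (f : 'rV[Cplx R]_(s + m) -> Cplx R)
    (f_equivariant : equivariant_multivalued_map r rho f) :
  [/\ nonconstant r f -> ~ hyperbolic_type rho,
      forall h, parabolic_via rho h ->
        exists (g : 'rV[Cplx R]_(s + m) -> Cplx R) (lambda : 'I_s -> R),
          [/\ holomorphic (eball (s + m) r) g,
              forall i, 0 <= lambda i &
              forall w, ucover s m r w ->
                h (f w) = (two_i_pi R)^-1
                          * (\sum_(i < s) real_complex R (lambda i) * w 0 (lshift m i))
                          + g (uproj s m w)],
      forall h, elliptic_via rho h ->
        exists (u : 'rV[Cplx R]_(s + m) -> Cplx R) (nu : 'I_s -> R),
          [/\ holomorphic (eball (s + m) r) u,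
              forall i, 0 <= nu i < 1 &
              forall w, ucover s m r w ->
                h (f w) = u (uproj s m w)
                          * \prod_(i < s) cexp (real_complex R (nu i) * w 0 (lshift m i))] &
      nonconstant r f ->
        exists N, [/\ foliation (eball (s + m) r) N,
          level_set_foliation (ucover s m r) (uproj s m) f (ball_compl s m r) N &
          exists T : proj_structure (eball (s + m) r),
            [/\ transverse_structure_for T N,
                hyperbolic_structure T,
                without_poles_over T (ball_compl s m r) &
                developing_map T (ucover s m r) (uproj s m) f (ball_compl s m r)]]].
Proof.
split.
- by move=> _; apply: not_hyperbolic r_gt0 rho_rep f_equivariant.
- move=> h [/half_plane_map [pos hol] H].
  by apply: (parabolic_case r_gt0 f_equivariant pos hol) => i; apply: H.
- move=> h [[hol [b [_ ab _]]] H].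
  apply: (elliptic_case f_equivariant _ hol); first by move=> z /ab [].
  move=> i; have [a a1 aE] := H (delta_mx 0 i); exists a => //.
  by rewrite /nrm a1.
move=> f_nonconst.
(* No normalizing map [h] is available here; it is replaced by the Moebius map built from the fixed
   point of a generator. *)
have [M [alpha [beta [g [uM dM ab0 hg gE]]]]] :=
  developing_normal_form r_gt0 rho_rep f_equivariant rho_nontrivial.
have [hf fD f_deck] := f_equivariant.
exists (level_forms alpha beta g); split.
- exact: (foliation_level_forms hf fD f_nonconst uM dM ab0 hg gE).
- exact: (level_set_level_forms hf fD uM dM ab0 hg gE).
have dev := developing_log_structure hf fD uM dM ab0 hg gE.
exists (log_structure ab0 hg); split.
- exact: (transverse_log_structure hf fD f_nonconst uM dM ab0 hg gE).
(* The polar set is exactly H, so the logarithmic coordinates are the universal cover that is asked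
   for, with [f] itself as developing map. *)
- exists 'rV[Cplx R]_(s + m), (ucover s m r), (uproj s m), f; rewrite polesE; split=> //.
    exact: uproj_universal_cover.
  (* Every deck transformation is a lattice translation [udeck k], so its monodromy is the
     automorphism [rho k]. *)
  move=> c /(deck_is_udeck r_gt0) [k kE]; exists (rho k); first exact: (rho_aut rho_rep).
  by move=> w Uw; rewrite kE // f_deck.
- exact: log_structure_without_poles.
exact: dev.
Qed.
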